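(* Let $\alpha>0$; let $\varphi_1,\dots,\varphi_L\in(0,\pi)$ be distinct numbers and let $\psi_1,\dots,\psi_L\in\mathbb{R}$, $\mathsf b_1,\mathsf b_{-1}\in\mathbb{R}$, $b_1,\dots,b_L\in\mathbb{R}$ be arbitrary. Let $h=\{h(j)\}_{j=0}^\infty$ be a sequence of real numbers such that for all $j\ge 2$ $$h(j)=\mathsf b_1 j^{-1}(\log j)^{-\alpha}+\mathsf g_1(j)+(-1)^j\bigl(\mathsf b_{-1}j^{-1}(\log j)^{-\alpha}+\mathsf g_{-1}(j)\bigr)+2\sum_{\ell=1}^L\bigl(b_\ell j^{-1}(\log j)^{-\alpha}+g_\ell(j)\bigr)\cos(\varphi_\ell j-\psi_\ell),$$ where each of the error sequences $g\in\{\mathsf g_1,\mathsf g_{-1},g_1,\dots,g_L\}$ satisfies $$g^{(m)}(j)=o\bigl(j^{-1-m}(\log j)^{-\alpha}\bigr),\quad j\to\infty,\qquad\text{for all } m=0,1,\dots,M(\alpha).$$ Then the eigenvalues of the Hankel operator $\Gamma(h)$ in $\ell^2(\mathbb{Z}_+)$ satisfy $$\lambda_n^\pm(\Gamma(h))=a^\pm n^{-\alpha}+o(n^{-\alpha}),\quad n\to\infty,$$ where $$a^\pm=\varkappa(\alpha)\Bigl((\mathsf b_{-1})_\pm^{1/\alpha}+(\mathsf b_1)_\pm^{1/\alpha}+\sum_{\ell=1}^L|b_\ell|^{1/\alpha}\Bigr)^\alpha .$$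
   Context: For a sequence $h=\{h(j)\}_{j=0}^\infty$, the Hankel operator $\Gamma(h)$ in $\ell^2(\mathbb{Z}_+)$, $\mathbb{Z}_+=\{0,1,2,\dots\}$, is $(\Gamma(h)u)(j)=\sum_{k=0}^\infty h(j+k)u(k)$. For a compact self-adjoint operator $A$, $\{\lambda_n^+(A)\}_{n\ge1}$ is the non-increasing sequence of positive eigenvalues of $A$, counted with multiplicities and appended by zeros if there are only finitely many; $\lambda_n^-(A)=\lambda_n^+(-A)$. For $x\in\mathbb{R}$, $x_\pm=(|x|\pm x)/2$. The coefficient is $$\varkappa(\alpha)=2^{-\alpha}\pi^{1-2\alpha}\bigl(B(\tfrac1{2\alpha},\tfrac12)\bigr)^\alpha,$$ with $B$ the Beta function. $M(\alpha)=[\alpha]+1$ if $\alpha\ge1/2$ and $M(\alpha)=0$ if $\alpha<1/2$, where $[\alpha]$ is the integer part of $\alpha$. For a sequence $g$, the iterated differences are $g^{(0)}=g$ and $g^{(m+1)}(j)=g^{(m)}(j+1)-g^{(m)}(j)$. *)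

(* Defs.v *)
From HB Require Import structures.
From mathcomp Require Import all_boot all_order all_algebra.
From mathcomp Require Import complex.
From mathcomp Require Import all_classical all_reals all_analysis.
Set Implicit Arguments.
Unset Strict Implicit.
Unset Printing Implicit Defensive.
Import Order.TTheory GRing.Theory Num.Theory.
Import numFieldNormedType.Exports.
Local Open Scope classical_set_scope.
Local Open Scope complex_scope.
Local Open Scope ring_scope.

(* The Hilbert space is the complex l^2(Z_+): square-summable sequences
   nat -> R[i].  The ascriptions R[i]^o and R^o only select the normed-module
   structure of R[i], resp. R, over itself. *)
Section l2.
Context {R : realType}.
Implicit Types (u v : R[i]^nat) (A : R[i]^nat -> R[i]^nat).

Definition l2 u : Prop :=
  cvgn (series (fun k => Normc.normc (u k) ^+ 2 : R)).

Definition l2norm u : R :=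
  Num.sqrt (limn (series (fun k => Normc.normc (u k) ^+ 2 : R))).

Definition l2dot u v : R[i] :=
  limn (series (fun k => u k * (v k)^* : R[i]^o)).

(* A bounded everywhere-defined symmetric operator is self-adjoint, and
   compactness (here: the image of a bounded sequence has a norm-convergent
   subsequence) includes boundedness.  Only the values of A on l2 matter. *)
Record compact_selfadjoint A : Prop := CompactSelfadjoint {
  csa_l2 : forall u, l2 u -> l2 (A u);
  csa_linear : forall (c : R[i]) u v, l2 u -> l2 v ->
    A (fun k => c * u k + v k) = (fun k => c * A u k + A v k);
  csa_symmetric : forall u v, l2 u -> l2 v -> l2dot (A u) v = l2dot u (A v);
  csa_compact : forall (u : nat -> R[i]^nat) (C : R),
    (forall n, l2 (u n) /\ l2norm (u n) <= C) ->
    exists (s : nat -> nat) (v : R[i]^nat),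
      [/\ {homo s : m n / (m < n)%N}, l2 v &
          (fun n => l2norm (fun k => A (u (s n)) k - v k) : R^o) @ \oo --> (0 : R^o)] }.

Definition l2_eigenspace A (t : R) : set (R[i]^nat) :=
  [set u | l2 u /\ A u = (fun k => t%:C * u k)].

(* For S a linear subspace: S has a basis with d elements.  Linear
   independence is the uniqueness of the coefficients. *)
Definition has_dim (S : set (R[i]^nat)) (d : nat) : Prop :=
  exists e : 'I_d -> R[i]^nat,
    (forall i, S (e i)) /\
    (forall u, S u ->
      exists! c : {ffun 'I_d -> R[i]}, u = (fun k => \sum_(i < d) c i * e i k)).

(* The terms are lam 1, lam 2, ...; lam 0 is irrelevant.  Each t > 0 occurs
   exactly as often as its multiplicity as an eigenvalue of A (zero times if
   it is not an eigenvalue), so the remaining terms, if any, are zeros. *)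
Record pos_eigenvalue_seq A (lam : R^nat) : Prop := PosEigenvalueSeq {
  pes_ge0 : forall n, (0 < n)%N -> 0 <= lam n;
  pes_noninc : forall m n, (0 < m)%N -> (m <= n)%N -> lam n <= lam m;
  pes_mult : forall t, 0 < t ->
    exists2 d, has_dim (l2_eigenspace A t) d &
      ([set n | (0 < n)%N /\ lam n = t] #= `I_d)%card }.

(* For compact self-adjoint A such a sequence exists, and its terms of index
   n >= 1 are uniquely determined; the default value 0 is then not used. *)
Definition lambda_plus A : R^nat :=
  xget (fun=> 0 : R) [set lam | pos_eigenvalue_seq A lam].

Definition lambda_minus A : R^nat := lambda_plus (fun u k => - A u k).

(* For square-summable h the series converges for every u in l2, by the
   Cauchy-Schwarz inequality. *)
Definition hankel (h : R^nat) : R[i]^nat -> R[i]^nat :=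
  fun u j => limn (series (fun k => (h (j + k)%N)%:C * u k : R[i]^o)).

End l2.

Section coefficients.
Context {R : realType}.
Implicit Types alpha x : R.

(* For positive arguments. mathcomp-analysis's beta_fun takes natural numbers
   only. *)
Definition Beta (a b : R) : R :=
  Rintegral (@lebesgue_measure R) `[0, 1]%classic
    (fun t => t `^ (a - 1) * (1 - t) `^ (b - 1)).

Definition varkappa alpha : R :=
  2 `^ (- alpha) * pi `^ (1 - 2 * alpha) *
  Beta (1 / (2 * alpha)) (1 / 2) `^ alpha.

Definition Mdiff alpha : nat :=
  if alpha < 1 / 2 then 0%N else (Num.truncn alpha).+1.

Definition pospart x : R := (`|x| + x) / 2.
Definition negpart x : R := (`|x| - x) / 2.

(* g^(m)(j) = o(j^(-1-m) (log j)^(-alpha)) for all m <= M(alpha), where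
   telescope g j = g j.+1 - g j. *)
Definition error_seq alpha (g : R^nat) : Prop :=
  forall m, (m <= Mdiff alpha)%N ->
    iter m telescope g =o_\oo
      (fun j => j%:R ^- (1 + m) * ln j%:R `^ (- alpha) : R^o).

End coefficients.

(* Main.v *)
(* By the min-max principle, an eigenvalue count #{n : lambda_n > t} is the least
   codimension of a subspace on which the quadratic form of Gamma(h) is at most t.
   This is subadditive over sums of forms, so it can be estimated piece by piece on
   finite sections, uniformly in their size.
   - The error kernels g contribute o(t^(-1/alpha)).  On a dyadic block of indices, cut
     into cells, one imposes that binomial moments vanish on every cell; Newton's formula
     with the bound on g^(M) and Hilbert's inequality then bound the form.  For
     alpha < 1/2 a Hilbert-Schmidt bound suffices.
   - j^(-1) (log j)^(-alpha) is replaced by a sum over m of the exponentials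
     exp(-j q^m) with weights (1 - q) q^m (m d)^(-alpha), q = exp(-d).  The Gram matrix of
     these exponentials, multiplied by the oscillating factors 1, (-1)^j, cos, sin, is
     up to negligible terms block diagonal (distinct frequencies decouple), and each block
     is (m d)^(-alpha) times a Toeplitz matrix with entries (1 - q) / (2 cosh(k d / 2)).
   - Cutting m into blocks on which (m d)^(-alpha) is almost constant and diagonalizing
     the truncated Toeplitz matrices in a sine basis gives the counting function in terms
     of the symbol, which tends to pi / cosh(pi xi) as d -> 0.  The integral of
     (pi / cosh(pi xi))^(1/alpha) is a Beta function, whence varkappa(alpha). *)

Require Import Defs.
From HB Require Import structures.
From mathcomp Require Import all_boot all_order all_algebra.
From mathcomp Require Import complex finmap.
From mathcomp Require Import all_classical all_reals all_analysis.
From mathcomp Require Import measurable_realfun.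
From mathcomp Require Import ring lra zify.
Set Implicit Arguments.
Unset Strict Implicit.
Unset Printing Implicit Defensive.
Import Order.TTheory GRing.Theory Num.Theory.
Import numFieldNormedType.Exports.
Local Open Scope classical_set_scope.
Local Open Scope ring_scope.

(** * Forms bounded on a subspace of finite codimension *)

Section codimension.
Context {R : realType}.

(** The bounds must be uniform in the size [N] of the section. The number [M] of exponentials may
    grow with [N], like [ln N], but neither the range of [t] nor the counts may. The step [d] and
    the bandwidth [r] are fixed first, and [t] tends to 0 afterwards. The block length is a small
    multiple of [t^(-1/alpha)]: the number of blocks then stays bounded, and the conditions spent on
    the first block and on block margins are negligible. The two halves of the count are not
    symmetric. For a lower bound they remain, and one shows that test vectors built from the
    positive channels hardly see them, because the cross terms only contain oscillating sums. For
    the error kernels only the size of the kernel has to be small; its highest difference need only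
    be bounded. The approximation by exponentials meets exactly this requirement, uniformly in [d].
    Since [h] is real, the analysis takes place in real [l^2]. The eigenvalues are produced by
    successive maximization of the form, and the complex statements follow by separating real and
    imaginary parts. *)

Definition linear_functional (I : Type) (f : (I -> R) -> R) : Prop :=
  forall a u v, f (fun i => a * u i + v i) = a * f u + f v.

Definition linear_map (I J : Type) (F : (I -> R) -> (J -> R)) : Prop :=
  forall a u v, F (fun i => a * u i + v i) = (fun j => a * F u j + F v j).

(** [x] is real, not a natural number, so that counts such as [eps * t^(-1/alpha)] add up without
    rounding. Independence of the functionals is not asked for: [n] only bounds the codimension. *)
Definition codim_le (I : Type) (x : R) (P : (I -> R) -> Prop) : Prop :=
  exists (n : nat) (f : nat -> (I -> R) -> R),
    [/\ n%:R <= x, forall k, linear_functional (f k) &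
        forall u, (forall k, (k < n)%N -> f k u = 0) -> P u].

Lemma codim_leW (I : Type) (x y : R) (P Q : (I -> R) -> Prop) :
  x <= y -> (forall u, P u -> Q u) -> codim_le x P -> codim_le y Q.
Proof.
move=> xy PQ [n [f [nx lf H]]]; exists n, f; split=> //.
  exact: le_trans nx xy.
by move=> u /H /PQ.
Qed.

Lemma codim_le_true (I : Type) (x : R) (P : (I -> R) -> Prop) :
  0 <= x -> (forall u, P u) -> codim_le x P.
Proof. by move=> x0 HP; exists 0%N, (fun _ _ => 0); split=> // k a u v; rewrite mulr0 addr0. Qed.

Lemma codim_le1 (I : Type) (f : (I -> R) -> R) :
  linear_functional f -> codim_le 1 (fun u => f u = 0).
Proof. by move=> lf; exists 1%N, (fun _ => f); split=> // u /(_ 0%N); apply. Qed.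

Lemma codim_leI (I : Type) (x y : R) (P Q : (I -> R) -> Prop) :
  codim_le x P -> codim_le y Q -> codim_le (x + y) (fun u => P u /\ Q u).
Proof.
move=> [n [f [nx lf Hf]]] [m [g [my lg Hg]]].
exists (n + m)%N, (fun k => if (k < n)%N then f k else g (k - n)%N); split.
- by rewrite natrD lerD.
- by move=> k; case: ifP.
- move=> u Hu; split.
    by apply: Hf => k kn; have := Hu k; rewrite kn; apply; rewrite ltn_addr.
  apply: Hg => k km; have := Hu (n + k)%N.
  have -> : (n + k < n)%N = false by rewrite ltnNge leq_addr.
  by rewrite addKn; apply; rewrite ltn_add2l.
Qed.

Lemma codim_le_seq (I : Type) (T : eqType) (s : seq T) (x : T -> R)
    (P : T -> (I -> R) -> Prop) :
  (forall i, i \in s -> codim_le (x i) (P i)) ->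
  codim_le (\sum_(i <- s) x i) (fun u => forall i, i \in s -> P i u).
Proof.
elim: s => [|i s IH] H; first by rewrite big_nil; apply: codim_le_true.
rewrite big_cons.
have h1 := H i (mem_head _ _).
have h2 : codim_le (\sum_(j <- s) x j) (fun u => forall i, i \in s -> P i u).
  by apply: IH => j js; apply: H; rewrite inE js orbT.
apply: codim_leW (codim_leI h1 h2) => // u [Pi Ps] j.
by rewrite inE => /orP[/eqP -> //|/Ps].
Qed.

Lemma codim_le_fin (I : Type) (T : finType) (x : T -> R)
    (P : T -> (I -> R) -> Prop) :
  (forall i, codim_le (x i) (P i)) ->
  codim_le (\sum_i x i) (fun u => forall i, P i u).
Proof.
move=> H; have := @codim_le_seq I T (enum T) x P (fun i _ => H i).
rewrite big_enum /=.
by apply: codim_leW => // u Hu i; apply: Hu; rewrite mem_enum.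
Qed.

Lemma codim_le_comp (I J : Type) (x : R) (F : (I -> R) -> (J -> R))
    (P : (J -> R) -> Prop) :
  linear_map F -> codim_le x P -> codim_le x (fun u => P (F u)).
Proof.
move=> lF [n [f [nx lf H]]]; exists n, (fun k u => f k (F u)); split=> //.
- by move=> k a u v; rewrite lF lf.
- by move=> u Hu; apply: H.
Qed.

Lemma linear_functional_sum (I : Type) (f : (I -> R) -> R) (d : nat)
    (c : 'I_d -> R) (e : 'I_d -> I -> R) : linear_functional f ->
  f (fun i => \sum_(k < d) c k * e k i) = \sum_(k < d) c k * f (e k).
Proof.
move=> lf; have f0 : f (fun=> 0) = 0.
  have := lf 1 (fun=> 0) (fun=> 0); rewrite !mul1r addr0.
  by move=> /(congr1 (fun z => z - f (fun=> 0))); rewrite subrr addrK.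
suff H (s : seq 'I_d) :
    f (fun i => \sum_(k <- s) c k * e k i) = \sum_(k <- s) c k * f (e k).
  exact: H.
elim: s => [|k s IH].
  by rewrite big_nil; under [X in f X]eq_fun do rewrite big_nil.
by under [X in f X]eq_fun do rewrite big_cons; rewrite lf IH big_cons.
Qed.

(** A [d] by [n] matrix with [n < d] has a nonzero left kernel vector. Only the coefficients are
    nonzero; the combination itself may vanish when the [e k] are dependent. *)
Lemma codim_le_nontrivial (I : Type) (x : R) (P : (I -> R) -> Prop) (d : nat)
    (e : 'I_d -> I -> R) : codim_le x P -> x < d%:R ->
  exists c : 'I_d -> R, (exists k, c k != 0) /\
    P (fun i => \sum_(k < d) c k * e k i).
Proof.
move=> [n [f [nx lf H]]] xd.
have nd : (n < d)%N by rewrite -(ltr_nat R); apply: le_lt_trans xd.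
pose M : 'M[R]_(d, n) := \matrix_(i, j) f j (e i).
have : kermx M != 0.
  rewrite -mxrank_eq0 mxrank_ker subn_eq0 -ltnNge.
  exact: leq_ltn_trans (rank_leq_col _) nd.
case/rowV0Pn => c /sub_kermxP cM c0.
exists (fun k => c 0 k); split.
  apply: contrapT => /forallNP Hc; move/negP: c0; apply; apply/eqP/rowP => k.
  by rewrite mxE; have /negP/negPn/eqP := Hc k.
apply: H => k kn; rewrite linear_functional_sum //.
have := congr1 (fun A : 'rV_n => A 0 (Ordinal kn)) cM; rewrite !mxE => E.
by rewrite -[RHS]E; apply: eq_bigr => i _; rewrite !mxE.
Qed.

End codimension.

(** * Hilbert's inequality by a weighted Schur test *)

Section hilbert_inequality.
Context {R : realType}.
Implicit Types u v : nat -> R.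

(** This is the row sum of the Schur test with weight [1 / sqrt (k + 1)]. Up to [k = p] the factor
    [p + k] is replaced by [p], beyond it by [k + 1]; in both ranges the sum compares with a
    telescoping one in square roots. *)
Lemma schur_weight_sum (p N : nat) : (0 < p)%N ->
  \sum_(k < N) Num.sqrt p%:R / (Num.sqrt k.+1%:R * (p + k)%:R) <= 4 :> R.
Proof.
move=> p0.
set S := fun N : nat => \sum_(k < N) Num.sqrt p%:R / (Num.sqrt k.+1%:R * (p + k)%:R) : R.
have sp0 : 0 < Num.sqrt p%:R :> R by rewrite sqrtr_gt0 ltr0n.
have sp2 : Num.sqrt p%:R ^+ 2 = p%:R :> R by rewrite sqr_sqrtr.
(* Discrete primitives of the two majorants, [2 sqrt (n / p)] and [4 - 2 sqrt (p / n)]; they agree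
   at [n = p]. *)
suff H n : S n <= if (n <= p)%N then 2 * (Num.sqrt n%:R / Num.sqrt p%:R)
                  else 4 - 2 * (Num.sqrt p%:R / Num.sqrt n%:R).
  apply: (le_trans (H N)); case: leqP => Np.
    have : Num.sqrt N%:R / Num.sqrt p%:R <= 1 :> R.
      by rewrite ler_pdivrMr // mul1r ler_sqrt ?ler_nat.
    lra.
  have : 0 <= Num.sqrt p%:R / Num.sqrt N%:R :> R by rewrite divr_ge0 // sqrtr_ge0.
  lra.
elim: n => [|n IH]; first by rewrite /S big_ord0 leq0n sqrtr0 mul0r mulr0.
have -> : S n.+1 = S n + Num.sqrt p%:R / (Num.sqrt n.+1%:R * (p + n)%:R).
  by rewrite /S big_ord_recr.
set a : R := Num.sqrt n%:R in IH *; set b : R := Num.sqrt n.+1%:R.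
have a0 : 0 <= a by exact: sqrtr_ge0.
have b0 : 0 < b by rewrite sqrtr_gt0 ltr0n.
have ab : b ^+ 2 = a ^+ 2 + 1 by rewrite !sqr_sqrtr // -natr1.
have leab : a <= b by rewrite ler_sqrt ?ler_nat.
set s : R := Num.sqrt p%:R in sp0 sp2 IH *.
case: ltnP => np.
  rewrite (ltnW np) in IH.
  have h1 : s / (b * (p + n)%:R) <= s / (b * s ^+ 2).
    rewrite ler_pM2l // lef_pV2 ?posrE ?mulr_gt0 ?exprn_gt0 ?ltr0n ?addn_gt0 ?p0 //.
    by rewrite ler_pM2l // sp2 ler_nat leq_addr.
  have h2 : s / (b * s ^+ 2) <= 2 * (b / s) - 2 * (a / s).
    have -> : s / (b * s ^+ 2) = b^-1 / s by field; rewrite ?lt0r_neq0.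
    rewrite !mulrA -mulrBl ler_pM2r ?invr_gt0 // -[b^-1]mul1r ler_pdivrMr //. nra.
  lra.
have n0 : (0 < n)%N by apply: leq_trans np.
have a1 : 0 < a by rewrite sqrtr_gt0 ltr0n.
have h1 : s / (b * (p + n)%:R) <= s / (b * b ^+ 2).
  rewrite ler_pM2l // lef_pV2 ?posrE ?mulr_gt0 ?exprn_gt0 ?ltr0n ?addn_gt0 ?p0 //.
  by rewrite ler_pM2l // sqr_sqrtr // ler_nat -addn1 addnC leq_add2r.
have h2 : s / (b * b ^+ 2) <= 2 * (s / a) - 2 * (s / b).
  have -> : 2 * (s / a) - 2 * (s / b) = s * (2 * (b - a) / (a * b)).
    by field; rewrite ?lt0r_neq0.
  rewrite ler_pM2l // -[_^-1]mul1r ler_pdivrMr; last by rewrite mulr_gt0 // exprn_gt0.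
  rewrite mulrAC ler_pdivlMr ?mulr_gt0 // mul1r.
  have hh : a <= 2 * (b - a) * b ^+ 2.
    have h3 : (b - a) * (b + a) = 1 by rewrite -subr_sqr ab addrAC subrr add0r.
    have : a * (b + a) <= 2 * (b - a) * b ^+ 2 * (b + a).
      have -> : 2 * (b - a) * b ^+ 2 * (b + a) = 2 * b ^+ 2 * ((b - a) * (b + a)) by ring.
      rewrite h3 mulr1. nra.
    by rewrite ler_pM2r // ltr_pwDl.
  have -> : 2 * (b - a) * (b * b ^+ 2) = (2 * (b - a) * b ^+ 2) * b by ring.
  by rewrite ler_pM2r.
move: IH; case: leqP => np'.
  move=> IH.
  have e1 : a = s by rewrite /a /s; congr (Num.sqrt _%:R); apply/eqP; rewrite eqn_leq np' np.
  rewrite e1 in IH h2 *; rewrite divff ?lt0r_neq0 // in IH h2; lra.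
lra.
Qed.

Lemma hilbert_inequality N u v :
  \sum_(j < N) \sum_(k < N) `|u j| * `|v k| / (j + k).+1%:R
    <= 2 * (\sum_(j < N) u j ^+ 2 + \sum_(j < N) v j ^+ 2).
Proof.
(* These weights satisfy [w j k * w k j = (j + k + 1)^(-2)], so the arithmetic-geometric mean splits
   the kernel. *)
pose w (j k : nat) : R := Num.sqrt j.+1%:R / (Num.sqrt k.+1%:R * (j.+1 + k)%:R).
have le1 j k : `|u j| * `|v k| / (j + k).+1%:R
    <= (u j ^+ 2 * w j k + v k ^+ 2 * w k j) / 2.
  rewrite /w !addSn [in X in _ <= X](addnC k j).
  set a : R := Num.sqrt j.+1%:R; set b : R := Num.sqrt k.+1%:R.
  have a0 : 0 < a by rewrite sqrtr_gt0 ltr0n.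
  have b0 : 0 < b by rewrite sqrtr_gt0 ltr0n.
  set c : R := (j + k).+1%:R; have c0 : 0 < c by rewrite ltr0n.
  have -> : (u j ^+ 2 * (a / (b * c)) + v k ^+ 2 * (b / (a * c))) / 2
     = (u j ^+ 2 * (a / b) + v k ^+ 2 * (b / a)) / 2 / c.
    by field; rewrite ?lt0r_neq0.
  rewrite ler_pM2r ?invr_gt0 //.
  have -> : (u j ^+ 2 * (a / b) + v k ^+ 2 * (b / a)) / 2
     = `|u j| * `|v k| + (`|u j| * a - `|v k| * b) ^+ 2 / (2 * (a * b)).
    rewrite -[u j ^+ 2]real_normK ?num_real // -[v k ^+ 2]real_normK ?num_real //.
    by field; rewrite ?lt0r_neq0.
  by rewrite lerDl divr_ge0 ?sqr_ge0 // ltW // !mulr_gt0.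
have H (x : nat -> R) (j : nat) : \sum_(k < N) x j ^+ 2 * w j k <= 4 * x j ^+ 2.
  rewrite -mulr_sumr mulrC; apply: ler_wpM2r; first exact: sqr_ge0.
  exact: schur_weight_sum.
apply: (@le_trans _ _ (\sum_(j < N) \sum_(k < N) (u j ^+ 2 * w j k + v k ^+ 2 * w k j) / 2)).
  by apply: ler_sum => j _; apply: ler_sum => k _; exact: le1.
under eq_bigr => j _ do rewrite -mulr_suml big_split /=.
rewrite -mulr_suml big_split /= [X in _ + X]exchange_big /=.
have Hu : \sum_(j < N) \sum_(k < N) u j ^+ 2 * w j k <= 4 * \sum_(j < N) u j ^+ 2.
  by rewrite mulr_sumr; apply: ler_sum => j _; exact: H.
have Hv : \sum_(k < N) \sum_(j < N) v k ^+ 2 * w k j <= 4 * \sum_(j < N) v j ^+ 2.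
  by rewrite mulr_sumr; apply: ler_sum => j _; exact: H.
by rewrite ler_pdivrMr //; lra.
Qed.

End hilbert_inequality.

(** * Quadratic forms on finite sections *)

Section quadratic_forms.
Context {R : realType}.
Implicit Types (u : nat -> R) (g : nat -> R).

Definition qform (q : nat -> nat -> R) (N : nat) u : R :=
  \sum_(j < N) \sum_(k < N) q j k * (u j * u k).

Definition hform g N u : R := qform (fun j k => g (j + k)%N) N u.

Definition sqnorm (N : nat) u : R := \sum_(j < N) u j ^+ 2.

Lemma sqnorm_ge0 N u : 0 <= sqnorm N u.
Proof. by apply: sumr_ge0 => j _; exact: sqr_ge0. Qed.

Lemma sqnorm_eq0 N u : sqnorm N u = 0 -> forall j, (j < N)%N -> u j = 0.
Proof.
move=> /eqP; rewrite psumr_eq0; last by move=> i _; exact: sqr_ge0.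
by move=> /allP H j jN; have /eqP := H (Ordinal jN) (mem_index_enum _); move=> /eqP; rewrite sqrf_eq0 => /eqP.
Qed.

Lemma linear_dot N (c : nat -> R) : linear_functional (fun u => \sum_(j < N) c j * u j).
Proof.
move=> a u v; rewrite mulr_sumr -big_split /=; apply: eq_bigr => j _; ring.
Qed.

Lemma ler_sum_nat (n : nat) (F : 'I_n -> R) (B : R) :
  (forall i, F i <= B) -> \sum_(i < n) F i <= n%:R * B.
Proof.
move=> H; apply: (@le_trans _ _ (\sum_(i < n) B)); first exact: ler_sum.
by rewrite sumr_const card_ord mulr_natl.
Qed.

(** Newton's forward formula by induction on [M]. Each order is one more sum over at most [x] terms,
    whence the crude factor [x ^ M.+1] where a binomial coefficient would be exact. *)
Lemma newton_taylor (M : nat) (c x : nat) (B : R) g :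
  (forall y, (y < x)%N -> `|iter M.+1 telescope g (c + y)%N| <= B) ->
  `|g (c + x)%N - \sum_(s < M.+1) 'C(x, s)%:R * iter s telescope g c|
    <= x%:R ^+ M.+1 * B.
Proof.
have sumE g' y : g' (c + y)%N = g' c + \sum_(z < y) telescope g' (c + z)%N.
  elim: y => [|y IH]; first by rewrite addn0 big_ord0 addr0.
  by rewrite big_ord_recr /= addrA -IH addnS /telescope [RHS]addrC subrK.
elim: M g x => [|M IH] g x H.
  rewrite big_ord_recl big_ord0 bin0 mul1r addr0 /= sumE addrAC subrr add0r expr1.
  apply: (le_trans (ler_norm_sum _ _ _)).
  by apply: ler_sum_nat => z; exact: (H z).
rewrite big_ord_recl bin0 mul1r /= sumE opprD addrA (addrC (g c)) addrK.
have -> : \sum_(i < M.+1) 'C(x, bump 0 i)%:R * telescope (iter i telescope g) c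
   = \sum_(z < x) \sum_(s < M.+1) 'C(z, s)%:R * iter s telescope (telescope g) c.
  rewrite exchange_big /=; apply: eq_bigr => i _.
  rewrite -mulr_suml /bump leq0n add1n -iterS iterSr; congr (_ * _).
  elim: x {H} => [|x IHx]; first by rewrite big_ord0 bin0n.
  by rewrite big_ord_recr /= -IHx binS natrD addrC.
rewrite -sumrB; apply: (le_trans (ler_norm_sum _ _ _)).
rewrite exprS -mulrA; apply: ler_sum_nat => z.
apply: (le_trans (IH _ _ _)).
  by move=> y yz; rewrite -iterSr; apply: H; exact: ltn_trans yz (ltn_ord z).
have B0 : 0 <= B by apply: le_trans (H z (ltn_ord z)).
apply: ler_wpM2r => //; rewrite lerXn2r ?nnegrE ?ler0n // ler_nat.
exact: ltnW.
Qed.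

Lemma qform_hilbert (K : nat -> nat -> R) (P : nat -> nat -> bool) (T : R) N u :
  0 <= T ->
  (forall j k, (j < N)%N -> (k < N)%N -> u j != 0 -> u k != 0 -> P j k ->
     `|K j k| <= T / (j + k).+1%:R) ->
  `|\sum_(k < N) \sum_(j < N | P j k) K j k * (u j * u k)| <= T * (4 * sqnorm N u).
Proof.
move=> T0 H.
apply: (@le_trans _ _ (T * \sum_(k < N) \sum_(j < N) `|u k| * `|u j| / (k + j).+1%:R)).
  rewrite mulr_sumr; apply: (le_trans (ler_norm_sum _ _ _)); apply: ler_sum => k _.
  rewrite mulr_sumr big_mkcond; apply: (le_trans (ler_norm_sum _ _ _)); apply: ler_sum => j _.
  case: ifP => [Pjk|_]; last by rewrite normr0 mulr_ge0 // divr_ge0 // mulr_ge0.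
  have [->|uj] := eqVneq (u j) 0; first by rewrite !(mul0r, mulr0, normr0).
  have [->|uk] := eqVneq (u k) 0; first by rewrite !(mul0r, mulr0, normr0).
  rewrite !normrM (mulrC `|u j|) (addnC k).
  have -> : T * (`|u k| * `|u j| / (j + k).+1%:R) = T / (j + k).+1%:R * (`|u k| * `|u j|) by ring.
  apply: ler_wpM2r; first exact: mulr_ge0.
  exact: H.
apply: ler_wpM2l => //; apply: (le_trans (hilbert_inequality _ _ _)).
by rewrite /sqnorm; lra.
Qed.

(* The larger of the two indices carries the gain from the vanishing moments. *)
Lemma hform_cells (M N : nat) (c lv : nat -> nat) (cstr : nat -> bool) (T : R) g u :
  0 <= T -> (forall j, u j != 0 -> lv (c j) = lv j) ->
  (forall j k, (j < N)%N -> (k < N)%N -> u j != 0 -> u k != 0 -> (lv k <= lv j)%N ->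
     `|g (j + k)%N - (if cstr (lv j) then
         \sum_(s < M) 'C(j - c j, s)%:R * iter s telescope g (c j + k)%N else 0)|
     <= T / (j + k).+1%:R) ->
  (forall a s, (a < N)%N -> cstr (lv a) -> (s < M)%N ->
     \sum_(j < N | c j == a) 'C(j - c j, s)%:R * u j = 0) ->
  (forall j, u j != 0 -> (c j <= j)%N) ->
  `|hform g N u| <= 8 * T * sqnorm N u.
Proof.
move=> T0 lvc HK mom cj.
pose K j k := g (j + k)%N - (if cstr (lv j) then
         \sum_(s < M) 'C(j - c j, s)%:R * iter s telescope g (c j + k)%N else 0).
(* Both triangles of the double sum, one with and one without the equal levels, are treated at once,
   [P] being the comparison. Subtracting the Newton polynomial from the kernel changes nothing, as
   it only pairs with moments of [u] over cells. *)
have main (P : nat -> nat -> bool) : (forall a b, P a b -> (b <= a)%N) ->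
    `|\sum_(k < N) \sum_(j < N | P (lv j) (lv k)) g (j + k)%N * (u j * u k)|
      <= T * (4 * sqnorm N u).
  move=> HP.
  have -> : \sum_(k < N) \sum_(j < N | P (lv j) (lv k)) g (j + k)%N * (u j * u k)
    = \sum_(k < N) \sum_(j < N | P (lv j) (lv k)) K j k * (u j * u k).
    apply: eq_bigr => k _; apply/eqP; rewrite -subr_eq0 -sumrB; apply/eqP.
    pose G (j : nat) := (if cstr (lv j) then
         \sum_(s < M) 'C(j - c j, s)%:R * iter s telescope g (c j + k)%N else 0) * (u j * u k).
    transitivity (\sum_(j < N | P (lv j) (lv k)) G j).
      by apply: eq_bigr => j _; rewrite /K /G; ring.
    have N0 : (0 < N)%N := leq_ltn_trans (leq0n _) (ltn_ord k).
    (* The cell start [c j] is known to be below [N] only where [u j] is nonzero; [insubd] supplies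
       a default elsewhere. *)
    pose cc (j : 'I_N) : 'I_N := insubd (Ordinal N0) (c j).
    have ccE (j : 'I_N) : u j != 0 -> cc j = c j :> nat.
      by move=> uj; rewrite val_insubd (leq_ltn_trans (cj _ uj) (ltn_ord j)).
    rewrite (bigID (fun j : 'I_N => u j != 0)) /= [X in _ + X]big1 ?addr0; last first.
      by move=> j /andP[_ /negPn/eqP uj]; rewrite /G uj mul0r mulr0.
    rewrite (partition_big cc xpredT) //=; apply: big1 => a _.
    have [Pa|nPa] := boolP (P (lv a) (lv k) && cstr (lv a)); last first.
      apply: big1 => j /andP[/andP[Pj uj] /eqP ja].
      have := ccE _ uj; rewrite ja => aE.
      have la : lv a = lv j by rewrite aE lvc.
      by move: nPa; rewrite la Pj /= /G => /negbTE ->; rewrite mul0r.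
    have/andP[Pa1 Pa2] := Pa.
    transitivity (\sum_(j < N | c j == a) G j).
      rewrite [RHS](bigID (fun j : 'I_N => u j != 0)) /= [X in _ = _ + X]big1 ?addr0; last first.
        by move=> j /andP[_ /negPn/eqP uj]; rewrite /G uj mul0r mulr0.
      apply: eq_bigl => j; rewrite andbC andbA andbC [RHS]andbC.
      have [uj|] := boolP (u j != 0); last by rewrite !andFb.
      rewrite !andTb -(inj_eq val_inj) /= ccE //.
      by case: eqP => //= ca; rewrite -(lvc _ uj) ca Pa1.
    transitivity (\sum_(s < M) (\sum_(j < N | c j == a) 'C(j - c j, s)%:R * u j)
         * (iter s telescope g (a + k)%N * u k)).
      under [RHS]eq_bigr do rewrite mulr_suml.
      rewrite exchange_big /=; apply: eq_bigr => j /eqP ja.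
      have [uj|uj] := eqVneq (u j) 0.
        by rewrite /G uj mul0r mulr0 big1 // => s _; rewrite mulr0 mul0r.
      rewrite /G -(lvc _ uj) ja Pa2 mulr_suml; apply: eq_bigr => s _; ring.
    by apply: big1 => s _; rewrite mom ?mul0r.
  apply: (@qform_hilbert K (fun j k => P (lv j) (lv k)) T N u T0) => j k jN kN uj uk Pjk.
  by apply: HK => //; apply: HP.
have -> : hform g N u =
    \sum_(k < N) \sum_(j < N | (lv k <= lv j)%N) g (j + k)%N * (u j * u k) +
    \sum_(k < N) \sum_(j < N | (lv k < lv j)%N) g (j + k)%N * (u j * u k).
  rewrite /hform /qform exchange_big /=.
  under eq_bigr => k _ do rewrite (bigID (fun j : 'I_N => (lv k <= lv j)%N)) /=.
  rewrite big_split /=; congr (_ + _).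
  under eq_bigr => k _ do rewrite big_mkcond /=.
  rewrite exchange_big /=; apply: eq_bigr => j _; rewrite [RHS]big_mkcond.
  by apply: eq_bigr => k _; rewrite -ltnNge addnC (mulrC (u j)).
apply: (le_trans (ler_normD _ _)).
have -> : 8 * T * sqnorm N u = T * (4 * sqnorm N u) + T * (4 * sqnorm N u) by ring.
apply: lerD; first exact: (main (fun a b => (b <= a)%N)).
by apply: (main (fun a b => (b < a)%N)) => a b; exact: ltnW.
Qed.

(** Bessel's inequality for matrices: the rank-one matrices built from an orthonormal system are
    orthonormal for the Hilbert-Schmidt product. *)
Lemma orthonormal_qform_sum (q : nat -> nat -> R) (N m : nat) (e : nat -> nat -> R) :
  (forall i i', (i < m)%N -> (i' < m)%N ->
     \sum_(j < N) e i j * e i' j = (i == i')%:R) ->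
  \sum_(i < m) qform q N (e i) ^+ 2 <= \sum_(j < N) \sum_(k < N) q j k ^+ 2.
Proof.
move=> oe.
pose x i := qform q N (e i).
pose X (j k : nat) := \sum_(i < m) x i * (e i j * e i k).
have h1 : \sum_(j < N) \sum_(k < N) q j k * X j k = \sum_(i < m) x i ^+ 2.
  transitivity (\sum_(j < N) \sum_(k < N) \sum_(i < m) x i * (q j k * (e i j * e i k))).
    apply: eq_bigr => j _; apply: eq_bigr => k _; rewrite /X mulr_sumr.
    by apply: eq_bigr => i _; rewrite mulrCA.
  under eq_bigr => j _ do rewrite exchange_big /=.
  rewrite exchange_big /=; apply: eq_bigr => i _.
  under eq_bigr => j _ do rewrite -mulr_sumr.
  by rewrite -mulr_sumr expr2.
have h2 : \sum_(j < N) \sum_(k < N) X j k ^+ 2 = \sum_(i < m) x i ^+ 2.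
  transitivity (\sum_(j < N) \sum_(k < N) \sum_(i < m) \sum_(i' < m)
      x i * x i' * ((e i j * e i' j) * (e i k * e i' k))).
    apply: eq_bigr => j _; apply: eq_bigr => k _; rewrite expr2 /X mulr_suml.
    apply: eq_bigr => i _; rewrite mulr_sumr; apply: eq_bigr => i' _; ring.
  under eq_bigr => j _ do rewrite exchange_big /=.
  rewrite exchange_big /=; apply: eq_bigr => i _.
  under eq_bigr => j _ do rewrite exchange_big /=.
  rewrite exchange_big /=.
  transitivity (\sum_(i' < m) x i * x i' * ((i == i')%:R * (i == i')%:R)).
    apply: eq_bigr => i' _.
    under eq_bigr => j _ do rewrite -mulr_sumr -mulr_sumr.
    rewrite -mulr_sumr -mulr_suml.
    by rewrite (oe i i').
  rewrite (bigD1 i) //= eqxx !mulr1 big1 ?addr0 ?expr2 // => i' ii'.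
  by rewrite eq_sym (negbTE ii') !mulr0.
have : 0 <= \sum_(j < N) \sum_(k < N) (q j k - X j k) ^+ 2.
  by apply: sumr_ge0 => j _; apply: sumr_ge0 => k _; exact: sqr_ge0.
under eq_bigr => j _.
  under eq_bigr => k _ do rewrite sqrrB -mulr_natl.
  rewrite big_split sumrB /= -mulr_sumr.
  over.
rewrite big_split sumrB /= -mulr_sumr h1 h2 -/(x _); lra.
Qed.

Lemma qform_scale (q : nat -> nat -> R) N a u :
  qform q N (fun j => a * u j) = a ^+ 2 * qform q N u.
Proof.
rewrite /qform mulr_sumr; apply: eq_bigr => j _; rewrite mulr_sumr.
apply: eq_bigr => k _; ring.
Qed.

(** Take an orthonormal family of maximal size on which the form exceeds [t] in absolute value. The
    preceding inequality bounds its size, and on its orthogonal complement the form is at most [t],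
    since a normalized counterexample would enlarge the family. This replaces diagonalization of
    [q]. *)
Lemma qform_hilbert_schmidt (q : nat -> nat -> R) (N : nat) (t : R) : 0 < t ->
  codim_le ((\sum_(j < N) \sum_(k < N) q j k ^+ 2) / t ^+ 2)
    (fun u => `|qform q N u| <= t * sqnorm N u).
Proof.
move=> t0; set H := \sum_(j < N) _.
pose P (m : nat) := exists e : nat -> nat -> R,
  (forall i i', (i < m)%N -> (i' < m)%N ->
     \sum_(j < N) e i j * e i' j = (i == i')%:R) /\
  (forall i, (i < m)%N -> t < `|qform q N (e i)|).
have Pb m : P m -> m%:R <= H / t ^+ 2.
  move=> [e [oe te]]; rewrite ler_pdivlMr ?exprn_gt0 //.
  apply: le_trans (orthonormal_qform_sum q oe).
  rewrite mulr_natl -{1}(card_ord m) -sumr_const; apply: ler_sum => i _.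
  rewrite -[leRHS]real_normK ?num_real // lerXn2r ?nnegrE ?normr_ge0 ?(ltW t0) //.
  exact: ltW (te i (ltn_ord i)).
have H0 : 0 <= H / t ^+ 2.
  rewrite divr_ge0 ?sqr_ge0 // /H.
  by apply: sumr_ge0 => j _; apply: sumr_ge0 => k _; exact: sqr_ge0.
have exP : exists m, `[< P m >].
  by exists 0%N; apply/asboolP; exists (fun _ _ => 0); split.
have bP m : `[< P m >] -> (m <= Num.truncn (H / t ^+ 2))%N.
  by move=> /asboolP/Pb; rewrite truncn_ge_nat.
case: (ex_maxnP exP bP) => m /asboolP Pm maxm.
have [e [oe te]] := Pm.
exists m, (fun i u => \sum_(j < N) e i j * u j); split.
- exact: Pb.
- by move=> k; exact: linear_dot.
move=> u Hu; rewrite leNgt; apply/negP => Hlt.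
have n0 : 0 < sqnorm N u.
  rewrite lt_neqAle sqnorm_ge0 andbT eq_sym; apply/eqP => /sqnorm_eq0 uz.
  have q0 : qform q N u = 0.
    by apply: big1 => j _; apply: big1 => k _; rewrite uz // mul0r mulr0.
  by move: Hlt; rewrite q0 normr0 ltNge mulr_ge0 ?sqnorm_ge0 // ltW.
pose s := (Num.sqrt (sqnorm N u))^-1.
have s2 : s ^+ 2 = (sqnorm N u)^-1 by rewrite exprVn sqr_sqrtr // ltW.
have : `[< P m.+1 >].
  apply/asboolP; exists (fun i j => if i == m then s * u j else e i j).
  have ou i : (i < m)%N -> \sum_(j < N) e i j * (s * u j) = 0.
    move=> im; under eq_bigr => j _ do rewrite mulrCA.
    by rewrite -mulr_sumr (Hu i im) mulr0.
  have ltm z : (z < m.+1)%N -> z != m -> (z < m)%N by lia.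
  split=> [i i' im im'|i im].
    have [ei|ni] := eqVneq i m; have [ei'|ni'] := eqVneq i' m.
    - rewrite ei ei' eqxx; under eq_bigr => j _ do rewrite -expr2 exprMn.
      by rewrite -mulr_sumr s2 mulVf // gt_eqF.
    - rewrite ei eq_sym (negbTE ni') -[RHS](ou i' (ltm _ im' ni')).
      by apply: eq_bigr => j _; rewrite mulrC.
    - by rewrite ei' (negbTE ni) -[RHS](ou i (ltm _ im ni)).
    - by apply: oe; exact: ltm.
  have [ei|ni] := eqVneq i m; last by apply: te; exact: ltm.
  by rewrite qform_scale normrM ger0_norm ?sqr_ge0 // s2 mulrC ltr_pdivlMr.
by move=> /maxm; rewrite ltnn.
Qed.

End quadratic_forms.

(** * Error kernels *)

Section dyadic.
Context {R : realType}.
Implicit Types (u : nat -> R) (g : nat -> R).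

(** Cells have length about [P / K], but at least 1; rounding at most doubles their number. *)
Lemma cell_count (P K : nat) : (0 < K)%N -> (P %/ maxn 1 (P %/ K) <= 2 * K)%N.
Proof.
move=> K0; have [PK|KP] := ltnP P K.
  by rewrite (divn_small PK) /maxn /= divn1; lia.
have q1 : (0 < P %/ K)%N by rewrite divn_gt0.
rewrite (maxn_idPr q1); apply: (@leq_trans ((2 * K * (P %/ K)) %/ (P %/ K))%N).
  apply: leq_div2r; have := ltn_ceil P K0; nia.
by rewrite mulnK.
Qed.

(** [K a] is roughly the number of cells on level [a]. A Newton remainder over a cell gains the cell
    length [2 ^ a / K a] to the power [M.+1], which is what the assumed bound on the differences can
    afford. Levels from [A] on carry no conditions: there the kernel itself is small. *)
Lemma hform_dyadic (M N A j0 : nat) (K : nat -> nat) (T : R) g :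
  (1 < j0)%N -> (forall a, (0 < K a)%N) -> 0 <= T ->
  (forall j k, (j0 <= j < N)%N -> (k < N)%N -> (A <= trunc_log 2 j)%N ->
     (trunc_log 2 k <= trunc_log 2 j)%N -> `|g (j + k)%N| <= T / (j + k).+1%:R) ->
  (forall a i, (0 < a < A)%N -> (2 ^ a <= i)%N -> (j0 <= i < N + N)%N ->
     `|iter M.+1 telescope g i| <= T / 2 * ((K a)%:R / (2 ^ a)%:R) ^+ M.+1 / i%:R) ->
  codim_le (\sum_(a < A) (M.+1 * (2 * K a).+1)%:R)
    (fun u => (forall j, (j < j0)%N -> u j = 0) -> `|hform g N u| <= 8 * T * sqnorm N u).
Proof.
move=> j00 K0 T0 H1 H2.
pose lv := trunc_log 2; pose len a := maxn 1 (2 ^ a %/ K a).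
have len0 a : (0 < len a)%N by rewrite leq_max.
(* The first index of the cell that contains [j]. *)
pose c j := (2 ^ lv j + (j - 2 ^ lv j) %/ len (lv j) * len (lv j))%N.
have lvb j : (0 < j)%N -> (2 ^ lv j <= j < 2 ^ (lv j).+1)%N.
  by move=> j1; apply: trunc_log_bounds.
have cj j : (0 < j)%N -> (c j <= j)%N.
  move=> /lvb /andP[h1 h2]; rewrite /c; have := leq_trunc_div (j - 2 ^ lv j) (len (lv j)); lia.
have lvc j : (0 < j)%N -> lv (c j) = lv j.
  move=> j1; have /andP[h1 h2] := lvb _ j1.
  apply: trunc_log_eq => //; rewrite leq_addr /=.
  by apply: leq_ltn_trans (cj _ j1) h2.
have xK j : (0 < j)%N -> ((j - c j) * K (lv j) <= 2 ^ lv j)%N.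
  move=> j1; have /andP[h1 h2] := lvb _ j1.
  have -> : (j - c j = (j - 2 ^ lv j) %% len (lv j))%N.
    by rewrite /c; have := divn_eq (j - 2 ^ lv j) (len (lv j)); lia.
  have := ltn_pmod (j - 2 ^ lv j) (len0 (lv j)).
  rewrite /len; case: (2 ^ lv j %/ K (lv j))%N (leq_trunc_div (2 ^ lv j) (K (lv j))) => [|q] hq.
    by rewrite maxn0 modn1.
  rewrite (maxn_idPr _) // => hm; apply: leq_trans hq; apply: leq_mul => //.
  exact: ltnW.
pose mom (a i s : nat) u := \sum_(j < N | c j == (2 ^ a + i * len a)%N) 'C(j - c j, s)%:R * u j : R.
have H : codim_le (\sum_(a < A) (M.+1 * (2 * K a).+1)%:R)
    (fun u => forall (a : 'I_A) (i : 'I_(2 * K a).+1) (s : 'I_M.+1), mom a i s u = 0).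
  apply: (@codim_le_fin R nat _ (fun a : 'I_A => (M.+1 * (2 * K a).+1)%:R)
     (fun a u => forall (i : 'I_(2 * K a).+1) (s : 'I_M.+1), mom a i s u = 0)) => a.
  have -> : (M.+1 * (2 * K a).+1)%:R = \sum_(i < (2 * K a).+1) M.+1%:R :> R.
    by rewrite sumr_const card_ord mulrnA.
  apply: (@codim_le_fin R nat _ (fun i : 'I__ => M.+1%:R)
     (fun i u => forall s : 'I_M.+1, mom a i s u = 0)) => i.
  have -> : M.+1%:R = \sum_(i < M.+1) 1 :> R by rewrite sumr_const card_ord.
  apply: (@codim_le_fin R nat _ (fun _ : 'I_M.+1 => 1) (fun (s : 'I_M.+1) u => mom a i s u = 0)) => s.
  apply: codim_le1.
  have -> : mom a i s = fun u => \sum_(j < N)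
      (if c j == (2 ^ a + i * len a)%N then 'C(j - c j, s)%:R else 0) * u j.
    apply/funext => u; rewrite /mom big_mkcond; apply: eq_bigr => j _.
    by case: ifP => //; rewrite mul0r.
  exact: (linear_dot N (fun j => if c j == (2 ^ a + i * len a)%N then 'C(j - c j, s)%:R else 0)).
apply: codim_leW H => // u Hu u0.
have upos j : u j != 0 -> (j0 <= j)%N.
  by move=> uj; rewrite leqNgt; apply/negP => /u0 /eqP; apply/negP.
have upos' j : u j != 0 -> (0 < j)%N by move=> /upos; apply: leq_trans; exact: ltnW.
apply: (@hform_cells _ M.+1 N c lv (fun a => a < A)%N) => //.
- by move=> j /upos'; exact: lvc.
- move=> j k jN kN uj uk lvkj; case: ltnP => aA; last first.
    by rewrite subr0; apply: H1 => //; rewrite (upos _ uj).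
  have j1 := upos' _ uj.
  have [h1 h2] := andP (lvb _ j1).
  have cjk : (j + k = (c j + k) + (j - c j))%N by have := cj _ j1; lia.
  set x := (j - c j)%N in cjk *; rewrite cjk.
  have Bd : forall y, (y < x)%N -> `|iter M.+1 telescope g (c j + k + y)%N| <=
      T / 2 * ((K (lv j))%:R / (2 ^ lv j)%:R) ^+ M.+1 / (2 ^ lv j + k)%:R.
    move=> y yx.
    have c2 : (2 ^ lv j <= c j)%N by rewrite leq_addr.
    have hj0 : (j0 <= c j + k + y < N + N)%N by have := upos _ uk; lia.
    have h3 : (2 ^ lv j <= c j + k + y)%N by lia.
    have lv0 : (0 < lv j < A)%N.
      by rewrite aA andbT trunc_log_gt0 /=; apply: leq_trans (upos _ uj).
    apply: (le_trans (H2 (lv j) _ lv0 h3 hj0)).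
    apply: ler_wpM2l.
      by rewrite mulr_ge0 ?divr_ge0 ?exprn_ge0 // divr_ge0.
    rewrite lef_pV2 ?posrE ?ltr0n ?ler_nat; lia.
  apply: (le_trans (newton_taylor Bd)).
  rewrite -/x -cjk.
  have p0 : 0 < (2 ^ lv j)%:R :> R by rewrite ltr0n expn_gt0.
  have -> : x%:R ^+ M.+1 * (T / 2 * ((K (lv j))%:R / (2 ^ lv j)%:R) ^+ M.+1 / (2 ^ lv j + k)%:R)
     = ((x * K (lv j))%:R / (2 ^ lv j)%:R) ^+ M.+1 * (T * (2 * (2 ^ lv j + k)%:R)^-1) :> R.
    by rewrite natrM !exprMn invfM; ring.
  rewrite -[leRHS]mul1r; apply: ler_pM.
  + by rewrite exprn_ge0 // divr_ge0.
  + by rewrite mulr_ge0 // invr_ge0 mulr_ge0.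
  + rewrite exprn_ile1 ?divr_ge0 // ler_pdivrMr // mul1r ler_nat.
    exact: xK.
  (* The spare factor 2 turns [2 ^ lv j + k] into [j + k + 1], because [j < 2 ^ (lv j).+1]. *)
  + apply: ler_wpM2l => //; rewrite lef_pV2 ?posrE ?ltr0n //.
      by rewrite -natrM ler_nat; move: h2; rewrite expnS; lia.
- move=> a s aN aA sM.
  case: (pickP (fun j : 'I_N => c j == a)) => [j /eqP ja|none]; last by rewrite big_pred0.
  have li : ((j - 2 ^ lv j) %/ len (lv j) < (2 * K (lv j)).+1)%N.
    rewrite ltnS; apply: (leq_trans _ (cell_count (2 ^ lv j) (K0 (lv j)))).
    apply: leq_div2r; case: (posnP j) => [->|j1]; first by rewrite sub0n.
    by have /andP[_] := lvb _ j1; rewrite expnS; lia.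
  have lvj : (lv j < A)%N.
    case: (posnP j) => [j0'|j1]; last by rewrite -(lvc _ j1) ja.
    move: aA; rewrite -ja j0' /c /lv trunc_log0 /= sub0n div0n mul0n addn0.
    by rewrite trunc_log1.
  have := Hu (Ordinal lvj) (Ordinal li) (Ordinal sM); rewrite /mom /= -/(c j) ja.
  by [].
- by move=> j /upos'; exact: cj.
Qed.

Lemma ler_powRl (p x y : R) : 0 <= p -> 0 <= x -> x <= y -> x `^ p <= y `^ p.
Proof. by move=> p0 x0 xy; apply: ge0_ler_powR; rewrite ?nnegrE // (le_trans x0). Qed.

Lemma powRV (p x : R) : 0 <= x -> x^-1 `^ p = x `^ (- p).
Proof. by move=> x0; rewrite -(powR_inv1 x0) -powRrM mulN1r. Qed.

Lemma powRD_gt0 (x r s : R) : 0 < x -> x `^ (r + s) = x `^ r * x `^ s.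
Proof. by move=> x0; rewrite powRD // (gt_eqF x0) implybT. Qed.

Lemma bernoulli_powR (x p : R) : 0 <= x -> 0 < p < 1 -> x `^ p <= 1 + p * (x - 1).
Proof.
move=> x0 /andP[p0 p1].
have q0 : 0 < (1 - p)^-1 by rewrite invr_gt0 subr_gt0.
have pi0 : 0 < p^-1 by rewrite invr_gt0.
have := @conjugate_powR R (x `^ p) 1 p^-1 (1 - p)^-1 (powR_ge0 _ _) ler01 pi0 q0.
rewrite !invrK mulr1 -powRrM divff ?gt_eqF // powRr1 // powR1 /=.
by move=> H; apply: (le_trans (H _)); lra.
Qed.

(** Comparison with the integral of [x^(-s)]; Bernoulli's inequality for [(A / (A + 1))^(1 - s)] is
    the induction step. The term [a = 0] vanishes, since a power of zero with nonzero exponent is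
    zero here. *)
Lemma sum_powR_le (s : R) (A : nat) : 0 < s < 1 ->
  \sum_(a < A.+1) a%:R `^ (- s) <= A%:R `^ (1 - s) / (1 - s).
Proof.
move=> /andP[s0 s1].
elim: A => [|A IH].
  by rewrite big_ord1 !powR0 ?mul0r //; lra.
rewrite big_ord_recr /=; apply: (le_trans (lerD IH (lexx _))).
have A1 : 0 < A.+1%:R :> R by rewrite ltr0n.
have p0 : 0 < 1 - s by lra.
rewrite ler_pdivlMr // mulrDl divfK ?gt_eqF //.
set x : R := A%:R / A.+1%:R.
have -> : A%:R `^ (1 - s) = x `^ (1 - s) * A.+1%:R `^ (1 - s).
  by rewrite -powRM ?divr_ge0 // /x divfK // gt_eqF.
have -> : A.+1%:R `^ (- s) = A.+1%:R^-1 * A.+1%:R `^ (1 - s).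
  by rewrite powRD ?gt_eqF ?implybT // powRr1 // mulrA mulVf ?mul1r // gt_eqF.
have B := @bernoulli_powR x (1 - s) (divr_ge0 (ler0n _ _) (ler0n _ _)).
have hp : 0 < 1 - s < 1 by lra.
have Bx := B hp.
have xE : x = 1 - A.+1%:R^-1.
  rewrite /x -[X in X / _](addrK 1) natr1 mulrBl divff ?gt_eqF // mul1r //.
set P := A.+1%:R `^ (1 - s); have P0 : 0 <= P by exact: powR_ge0.
rewrite -subr_ge0.
have -> : P - (x `^ (1 - s) * P + A.+1%:R^-1 * P * (1 - s))
   = P * (1 - x `^ (1 - s) - A.+1%:R^-1 * (1 - s)) by ring.
have Bx' : x `^ (1 - s) <= 1 - A.+1%:R^-1 * (1 - s).
  apply: (le_trans Bx); rewrite xE le_eqVlt; apply/orP; left; apply/eqP; ring.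
by apply: mulr_ge0 => //; rewrite -addrA -opprD subr_ge0 -lerBrDr.
Qed.

Definition logpow (alpha : R) (j : nat) : R := ln j%:R `^ (- alpha).

Lemma ln2_gt0 : 0 < ln (2 : R).
Proof. by apply: ln_gt0; rewrite ltr1n. Qed.

Lemma ln2_lt1 : ln (2 : R) < 1.
Proof.
by rewrite -ltr_expR lnK ?posrE //; apply: lt_le_trans (expR_gt1Dx (oner_neq0 _)) _.
Qed.

Lemma ln_ge_dyadic (a j : nat) : (2 ^ a <= j)%N -> a%:R * ln 2 <= ln j%:R :> R.
Proof.
move=> aj; have -> : a%:R * ln 2 = ln (2 ^ a)%:R :> R.
  by rewrite natrX lnXn // mulr_natl.
by rewrite ler_ln ?posrE ?ltr0n ?expn_gt0 ?ler_nat //; apply: leq_trans aj; rewrite expn_gt0.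
Qed.

Lemma powRN_le (alpha x y : R) : 0 < alpha -> 0 < x -> x <= y -> y `^ (- alpha) <= x `^ (- alpha).
Proof.
move=> a0 x0 xy; have y0 := lt_le_trans x0 xy.
rewrite !powRN lef_pV2 ?posrE ?powR_gt0 //.
by apply: ge0_ler_powR; rewrite ?nnegrE ?(ltW a0) ?(ltW x0) ?(ltW y0).
Qed.

Lemma logpow_dyadic (alpha : R) (a j : nat) : 0 < alpha -> (0 < a)%N -> (2 ^ a <= j)%N ->
  logpow alpha j <= (a%:R * ln 2) `^ (- alpha).
Proof.
move=> al a0 aj; apply: powRN_le => //; last exact: ln_ge_dyadic.
by rewrite mulr_gt0 ?ltr0n // ln2_gt0.
Qed.


(** With [m = M.+1], level [a] receives about [(C a^(-alpha) / t)^(1/m)] cells, up to a level [A] of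
    order [(eps / t)^(1/alpha)]. As [alpha < m], the sum of these counts is governed by its upper
    end and is of order [eps^(1/alpha - 1/m) t^(-1/alpha)]. Hence only the size of [g] has to be
    small; for the highest difference any fixed [C] will do. *)
Lemma hform_small_smooth (alpha : R) (M : nat) (C eta : R) :
  0 < alpha < M.+1%:R -> 0 < C -> 0 < eta ->
  exists2 eps, 0 < eps & forall (t : R) (N j0 : nat) g, 0 < t <= eps -> (2 <= j0)%N ->
    (forall j, (j0 <= j < N + N)%N -> `|g j| <= eps * (j%:R^-1 * logpow alpha j)) ->
    (forall j, (j0 <= j < N + N)%N ->
       `|iter M.+1 telescope g j| <= C * (j%:R ^- M.+2 * logpow alpha j)) ->
    codim_le (eta * t `^ (- alpha^-1))
      (fun u => (forall j, (j < j0)%N -> u j = 0) -> `|hform g N u| <= t * sqnorm N u).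
Proof.
move=> /andP[al0 alM] C0 eta0.
pose m : R := M.+1%:R; have m0 : 0 < m by rewrite ltr0n.
pose s := alpha / m; have s0 : 0 < s by rewrite divr_gt0.
have s1 : s < 1 by rewrite /s ltr_pdivrMr // mul1r.
pose l2 : R := ln 2; have l20 : 0 < l2 := ln2_gt0.
(* Constants in front of [eps^(1/alpha)] and of [eps^(1/alpha - 1/m)] *)
pose c1 : R := 16 `^ alpha^-1 / l2 * 2.
pose k1 : R := m * 3 * c1.
pose k2 : R := m * 2 * ((16 * C) `^ m^-1 * l2 `^ (- s) * (c1 `^ (1 - s) / (1 - s))).
have c10 : 0 < c1 by rewrite mulr_gt0 // divr_gt0 ?powR_gt0.
have k10 : 0 < k1 by rewrite /k1 mulr_gt0 // mulr_gt0.
have s10 : 0 < 1 - s by lra.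
have k20 : 0 < k2.
  rewrite /k2 mulr_gt0 ?[0 < m * 2]mulr_gt0 // mulr_gt0 ?mulr_gt0 ?invr_gt0 ?powR_gt0 //.
  by rewrite mulr_gt0.
pose p2 := alpha^-1 - m^-1.
have p20 : 0 < p2 by rewrite subr_gt0 ltf_pV2 ?posrE.
have ex_eps (k p : R) : 0 < k -> 0 < p -> exists2 e, 0 < e & forall x, 0 < x -> x <= e -> k * x `^ p <= eta / 2.
  move=> k0 p0; exists ((eta / 2 / k) `^ p^-1); first by rewrite powR_gt0 // !divr_gt0.
  move=> x x0 xe; rewrite mulrC -ler_pdivlMr //.
  have e0 : 0 <= eta / 2 / k by rewrite ltW // !divr_gt0.
  have -> : eta / 2 / k = ((eta / 2 / k) `^ p^-1) `^ p.
    by rewrite -powRrM mulVf ?gt_eqF // powRr1.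
  by apply: ler_powRl => //; exact: ltW.
have ai0 : 0 < alpha^-1 by rewrite invr_gt0.
have [e1 e10 H1] := ex_eps k1 alpha^-1 k10 ai0.
have [e2 e20 H2] := ex_eps k2 p2 k20 p20.
pose eps := Num.min e1 e2.
have eps0 : 0 < eps by rewrite lt_min e10.
exists eps => // t N j0 g /andP[t0 teps] j02 Hg HD.
pose T := t / 8; have T0 : 0 < T by rewrite divr_gt0.
(* Beyond level [X] the logarithmic factor alone brings [g] below the threshold. *)
pose X := (2 * eps / T) `^ alpha^-1 / l2.
have X0 : 0 < X by rewrite divr_gt0 // powR_gt0 // divr_gt0 // mulr_gt0.
have XE : X * 2 = c1 * eps `^ alpha^-1 * t `^ (- alpha^-1).
  rewrite /X /T /c1; have -> : 2 * eps / (t / 8) = 16 * eps / t.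
    by field; rewrite gt_eqF.
  rewrite !powRM ?invr_ge0 ?mulr_ge0 ?(ltW eps0) ?(ltW t0) // powRN.
  have -> : t^-1 `^ alpha^-1 = (t `^ alpha^-1)^-1 by rewrite powRV ?powRN // ltW.
  by ring.
(* This is what [t <= eps] is for: rounding [X] up then costs at most a factor 2. *)
have X1 : 1 <= X.
  rewrite /X ler_pdivlMr // mul1r; apply: (@le_trans _ _ 1); first exact: ltW ln2_lt1.
  have {1}-> : 1 = 1 `^ alpha^-1 :> R by rewrite powR1.
  apply: ler_powRl => //; first exact: ltW.
  rewrite /T ler_pdivlMr ?divr_gt0 //; lra.
pose A := (Num.truncn X).+1.
have XA : X < A%:R by rewrite /A truncnS_gt.
have AX : A%:R <= X * 2.
  have : (Num.truncn X)%:R <= X by rewrite truncn_le ltW.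
  rewrite /A -natr1; lra.
(* [Y a] solves [C (a ln 2)^(-alpha) = T / 2 * Y^m], the balance between the bound on the
   differences and the accuracy required of a cell. *)
pose Y a := (2 * C * (a%:R * l2) `^ (- alpha) / T) `^ m^-1.
pose K a := (Num.truncn (Y a)).+1.
have Y0 a : 0 <= Y a by exact: powR_ge0.
have YK a : Y a <= (K a)%:R by rewrite ltW // /K truncnS_gt.
have KY a : (K a)%:R <= Y a + 1.
  by rewrite /K -natr1 lerD2r truncn_le.
have lvb j : (0 < j)%N -> (2 ^ trunc_log 2 j <= j < 2 ^ (trunc_log 2 j).+1)%N.
  by move=> j1; apply: trunc_log_bounds.
have D := @hform_dyadic M N A j0 K T g j02 (fun=> isT) (ltW T0).
apply: codim_leW (D _ _).
- have cnt a : (M.+1 * (2 * K a).+1)%:R <= m * (2 * Y a + 3).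
    rewrite natrM; apply: ler_wpM2l; first exact: ltW.
    rewrite -natr1 natrM; have := KY a; lra.
  apply: (le_trans (ler_sum _ (fun (a : 'I_A) _ => cnt a))).
  rewrite -mulr_sumr big_split /= -mulr_sumr sumr_const card_ord.
  have YE a : Y a = ((16 * C) `^ m^-1 * t `^ (- m^-1) * l2 `^ (- s)) * a%:R `^ (- s).
    rewrite /Y /T; have -> : 2 * C * (a%:R * l2) `^ (- alpha) / (t / 8)
        = (16 * C) * t^-1 * (l2 `^ (- alpha) * a%:R `^ (- alpha)).
      by rewrite powRM ?(ltW l20) //; field; rewrite gt_eqF.
    have [tn Cn] : 0 <= t^-1 /\ 0 <= 16 * C by rewrite invr_ge0 mulr_ge0 ?ltW.
    rewrite (powRM _ (mulr_ge0 Cn tn) (mulr_ge0 (powR_ge0 _ _) (powR_ge0 _ _))).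
    rewrite (powRM _ Cn tn) (powRM _ (powR_ge0 _ _) (powR_ge0 _ _)).
    rewrite -!powRrM !mulNr -/s.
    rewrite powRV ?(ltW t0) //.
    by rewrite !mulrA.
  have SY : \sum_(a < A) Y a <= ((16 * C) `^ m^-1 * t `^ (- m^-1) * l2 `^ (- s)) *
       ((X * 2) `^ (1 - s) / (1 - s)).
    rewrite (eq_bigr _ (fun (a : 'I_A) _ => YE a)) -mulr_sumr; apply: ler_wpM2l.
      by rewrite !mulr_ge0 ?powR_ge0.
    have hs : 0 < s < 1 by rewrite s0.
    apply: (le_trans (sum_powR_le (Num.truncn X) hs)).
    rewrite ler_pM2r ?invr_gt0 //; apply: ge0_ler_powR; rewrite ?nnegrE ?(ltW s10) //.
      by rewrite mulr_ge0 // ltW.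
    by apply: le_trans AX; rewrite /A -natr1 lerDl.
  have E2 : ((16 * C) `^ m^-1 * t `^ (- m^-1) * l2 `^ (- s)) *
       ((X * 2) `^ (1 - s) / (1 - s)) * 2 * m = k2 * eps `^ p2 * t `^ (- alpha^-1).
    have aE : alpha^-1 * (1 - s) = p2 by rewrite /s /p2; field; rewrite !gt_eqF.
    rewrite XE (powRM _ (mulr_ge0 (ltW c10) (powR_ge0 _ _)) (powR_ge0 _ _)).
    rewrite (powRM _ (ltW c10) (powR_ge0 _ _)) -!powRrM aE mulNr aE.
    have -> : t `^ (- alpha^-1) = t `^ (- m^-1) * t `^ (- p2).
      by rewrite -powRD_gt0 //; congr (t `^ _); rewrite /p2; ring.
    by rewrite /k2; ring.
  have h1 : m * (3 * A%:R) <= k1 * eps `^ alpha^-1 * t `^ (- alpha^-1).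
    have -> : k1 * eps `^ alpha^-1 * t `^ (- alpha^-1) = m * (3 * (X * 2)).
      by rewrite XE /k1; ring.
    by rewrite ler_pM2l // ler_pM2l.
  have tp := powR_gt0 (- alpha^-1) t0.
  have h3 : k1 * eps `^ alpha^-1 * t `^ (- alpha^-1) <= eta / 2 * t `^ (- alpha^-1).
    by rewrite ler_pM2r // H1 // /eps ge_min lexx.
  have h4 : k2 * eps `^ p2 * t `^ (- alpha^-1) <= eta / 2 * t `^ (- alpha^-1).
    by rewrite ler_pM2r // H2 // /eps ge_min lexx orbT.
  have h5 : m * (2 * \sum_(a < A) Y a) <= k2 * eps `^ p2 * t `^ (- alpha^-1).
    rewrite -E2; set S := \sum_(a < A) Y a; have -> : m * (2 * S) = S * 2 * m by ring.
    by rewrite !ler_pM2r.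
  rewrite -mulr_natr mulrDr; lra.
- by move=> u Hu u0; have := Hu u0; rewrite /T (mulrCA 8) divff ?mulr1.
- move=> j k /andP[j0j jN] kN Aj kj.
  have j1 : (0 < j)%N by clear -j02 j0j; lia.
  have /andP[b1 b2] := lvb _ j1.
  have jk : (j0 <= j + k < N + N)%N by clear -j0j jN kN; lia.
  apply: (le_trans (Hg _ jk)).
  have L : logpow alpha (j + k) <= (A%:R * l2) `^ (- alpha).
    apply: logpow_dyadic => //; apply: leq_trans (leq_addr _ _).
    by apply: leq_trans b1; rewrite leq_exp2l.
  have L2 : (A%:R * l2) `^ (- alpha) <= T / (2 * eps).
    apply: (@le_trans _ _ ((X * l2) `^ (- alpha))).
      by apply: powRN_le => //; [exact: mulr_gt0|rewrite ler_pM2r //; exact: ltW].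
    rewrite /X divfK ?gt_eqF // -powRrM mulrN mulVf ?gt_eqF // powR_inv1.
      by rewrite invf_div.
    by rewrite ltW // divr_gt0 // mulr_gt0.
  have jk0 : 0 < (j + k)%:R :> R by rewrite ltr0n; clear -j1; lia.
  apply: (@le_trans _ _ (eps * ((j + k)%:R^-1 * (T / (2 * eps))))).
    apply: ler_wpM2l; first exact: ltW.
    by apply: ler_wpM2l; [rewrite invr_ge0 ltW|exact: le_trans L L2].
  have gen (e z : R) : 0 < e -> 0 < z -> e * (z^-1 * (T / (2 * e))) = T * (2 * z)^-1.
    by move=> e0 z0; field; rewrite !gt_eqF.
  rewrite (gen _ _ eps0 jk0).
  apply: ler_wpM2l; first exact: ltW.
  rewrite lef_pV2 ?posrE ?ltr0n // ?mulr_gt0 //.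
  by rewrite -natrM ler_nat; clear -j1; lia.
- move=> a i /andP[a1 aA] ai ij.
  have i2 : (2 <= i)%N by clear -j02 ij; lia.
  have i0 : 0 < i%:R :> R by rewrite ltr0n; clear -i2; lia.
  apply: (le_trans (HD _ ij)).
  have p0 : 0 < (2 ^ a)%:R :> R by rewrite ltr0n expn_gt0.
  have L := logpow_dyadic al0 a1 ai.
  have iM : i%:R ^- M.+2 <= (2 ^ a)%:R ^- M.+1 * i%:R^-1 :> R.
    rewrite exprS invfM mulrC ler_pM2r ?invr_gt0 // lef_pV2 ?posrE ?exprn_gt0 //.
    by rewrite lerXn2r ?nnegrE // ler_nat.
  apply: (@le_trans _ _ (C * ((2 ^ a)%:R ^- M.+1 * i%:R^-1 * (a%:R * l2) `^ (- alpha)))).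
    apply: ler_wpM2l; first exact: ltW.
    by apply: ler_pM => //; rewrite ?powR_ge0 // invr_ge0 exprn_ge0.
  have KM : 2 * C * (a%:R * l2) `^ (- alpha) / T <= (K a)%:R ^+ M.+1.
    apply: (@le_trans _ _ (Y a ^+ M.+1)).
      rewrite -powR_mulrn // /Y -powRrM mulVf ?gt_eqF // powRr1 //.
      by rewrite divr_ge0 ?(ltW T0) // !mulr_ge0 ?powR_ge0 // ltW.
    by rewrite lerXn2r ?nnegrE.
  have -> : T / 2 * ((K a)%:R / (2 ^ a)%:R) ^+ M.+1 / i%:R
    = T / 2 * (K a)%:R ^+ M.+1 * ((2 ^ a)%:R ^- M.+1 * i%:R^-1).
    by rewrite exprMn exprVn; ring.
  have -> : C * ((2 ^ a)%:R ^- M.+1 * i%:R^-1 * (a%:R * l2) `^ (- alpha))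
    = C * (a%:R * l2) `^ (- alpha) * ((2 ^ a)%:R ^- M.+1 * i%:R^-1) by ring.
  apply: ler_wpM2r; first by rewrite mulr_ge0 ?invr_ge0 ?exprn_ge0.
  move: KM; rewrite ler_pdivrMr //; lra.
Qed.

End dyadic.

(** * Error kernels for alpha below 1/2 *)

Section rough.
Context {R : realType}.
Implicit Types (u : nat -> R) (g : nat -> R).

Lemma sum_ltn_le (N B : nat) : \sum_(j < N) (j < B)%N%:R <= B%:R :> R.
Proof.
suff : \sum_(j < N) (j < B)%N%:R = (minn N B)%:R :> R.
  by move=> ->; rewrite ler_nat geq_minr.
elim: N => [|N IH]; first by rewrite big_ord0 min0n.
by rewrite big_ord_recr /= IH -natrD; congr _%:R; lia.
Qed.

Lemma powR_eventually_small (k p eta : R) : 0 < k -> 0 < p -> 0 < eta ->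
  exists2 e, 0 < e & forall x, 0 < x -> x <= e -> k * x `^ p <= eta.
Proof.
move=> k0 p0 eta0; exists ((eta / k) `^ p^-1); first by rewrite powR_gt0 // divr_gt0.
move=> x x0 xe; rewrite mulrC -ler_pdivlMr //.
have e0 : 0 <= eta / k by rewrite ltW // divr_gt0.
have -> : eta / k = ((eta / k) `^ p^-1) `^ p.
  by rewrite -powRrM mulVf ?gt_eqF // powRr1.
by apply: ler_powRl => //; exact: ltW.
Qed.

(** Pairs with [j + k] on level [a] lie in a square of side [2 ^ a.+1]. *)
Lemma sum_dyadic_le (F : nat -> R) (N A : nat) :
  (forall a, 0 <= F a) ->
  \sum_(j < N) \sum_(k < N | (trunc_log 2 (j + k) < A)%N) F (trunc_log 2 (j + k))
    <= \sum_(a < A) (2 ^ a.+1)%:R ^+ 2 * F a.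
Proof.
move=> F0.
pose lv := trunc_log 2.
have -> : \sum_(j < N) \sum_(k < N | (lv (j + k)%N < A)%N) F (lv (j + k)%N)
    = \sum_(a < A) \sum_(j < N) \sum_(k < N) (lv (j + k)%N == a)%:R * F a.
  rewrite exchange_big /=; apply: eq_bigr => j _; rewrite exchange_big /= big_mkcond.
  apply: eq_bigr => k _; case: ltnP => lA.
    rewrite (bigD1 (Ordinal lA)) //= eqxx mul1r big1 ?addr0 // => i.
    by rewrite -(inj_eq val_inj) /= eq_sym => /negbTE ->; rewrite mul0r.
  rewrite big1 // => i _; case: eqP => [E|_]; last by rewrite mul0r.
  by move: lA; rewrite E leqNgt ltn_ord.
apply: ler_sum => a _.
apply: (@le_trans _ _ (\sum_(j < N) \sum_(k < N) (j < 2 ^ a.+1)%N%:R * (k < 2 ^ a.+1)%N%:R * F a)).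
  apply: ler_sum => j _; apply: ler_sum => k _; apply: ler_wpM2r => //.
  case: eqP => [E|_]; last by rewrite -natrM ler0n.
  have jk : (j + k < 2 ^ a.+1)%N by rewrite -E; apply: trunc_log_ltn.
  by rewrite -natrM ler_nat; lia.
under eq_bigr => j _ do rewrite -mulr_suml -mulr_sumr.
rewrite -mulr_suml -mulr_suml expr2; apply: ler_wpM2r => //.
by apply: ler_pM; rewrite ?sum_ltn_le // sumr_ge0.
Qed.

(** Since [2 * alpha < 1], the squared Hilbert-Schmidt norm of the levels below [A] grows like
    [eps^2 A^(1 - 2 alpha)]. With [A] of order [(eps / t)^(1/alpha)], dividing by [t^2] leaves
    [eps^(1/alpha) t^(-1/alpha)]. The higher levels fall to Hilbert's inequality. *)
Lemma hform_small_rough (alpha eta : R) : 0 < alpha < 1 / 2 -> 0 < eta ->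
  exists2 eps, 0 < eps & forall (t : R) (N j0 : nat) g, 0 < t <= eps -> (2 <= j0)%N ->
    (forall j, (j0 <= j < N + N)%N -> `|g j| <= eps * (j%:R^-1 * logpow alpha j)) ->
    codim_le (eta * t `^ (- alpha^-1))
      (fun u => (forall j, (j < j0)%N -> u j = 0) -> `|hform g N u| <= t * sqnorm N u).
Proof.
move=> /andP[al0 al2] eta0.
pose l2 : R := ln 2; have l20 : 0 < l2 := ln2_gt0.
pose s := 2 * alpha; have s0 : 0 < s by rewrite mulr_gt0.
have s1 : s < 1 by rewrite /s; lra.
have s10 : 0 < 1 - s by lra.
pose c1 : R := 16 `^ alpha^-1 / l2 * 2.
have c10 : 0 < c1 by rewrite mulr_gt0 // divr_gt0 ?powR_gt0.
pose k1 : R := 16 * l2 `^ (- s) * (c1 `^ (1 - s) / (1 - s)).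
have k10 : 0 < k1.
  by rewrite /k1 mulr_gt0 ?[0 < 16 * _]mulr_gt0 ?powR_gt0 // divr_gt0 ?powR_gt0.
have ai0 : 0 < alpha^-1 by rewrite invr_gt0.
have [eps eps0 Heps] := powR_eventually_small k10 ai0 eta0.
exists eps => // t N j0 g /andP[t0 teps] j02 Hg.
pose T := t / 8; have T0 : 0 < T by rewrite divr_gt0.
pose X := (2 * eps / T) `^ alpha^-1 / l2.
have X0 : 0 < X by rewrite divr_gt0 // powR_gt0 // divr_gt0 // mulr_gt0.
have XE : X * 2 = c1 * eps `^ alpha^-1 * t `^ (- alpha^-1).
  rewrite /X /T /c1; have -> : 2 * eps / (t / 8) = 16 * eps / t.
    by field; rewrite gt_eqF.
  rewrite !powRM ?invr_ge0 ?mulr_ge0 ?(ltW eps0) ?(ltW t0) // powRV ?(ltW t0) //.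
  by ring.
pose A := (Num.truncn X).+1.
have XA : X < A%:R by rewrite /A truncnS_gt.
pose lv := trunc_log 2.
pose q1 (j k : nat) := if (j0 <= j)%N && (j0 <= k)%N && (lv (j + k)%N < A)%N then g (j + k)%N else 0.
pose q2 (j k : nat) := if (A <= lv (j + k)%N)%N then g (j + k)%N else 0.
have lvb j : (0 < j)%N -> (2 ^ lv j <= j)%N by move=> j1; apply: trunc_logP.
have t2 : 0 < t / 2 by rewrite divr_gt0.
apply: codim_leW (qform_hilbert_schmidt q1 N t2).
- pose F (a : nat) := eps ^+ 2 * (2 ^ a)%:R ^- 2 * (l2 `^ (- s) * a%:R `^ (- s)).
  have F0 a : 0 <= F a by rewrite !mulr_ge0 ?powR_ge0 ?invr_ge0 ?exprn_ge0 // ltW.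
  have HS : \sum_(j < N) \sum_(k < N) q1 j k ^+ 2 <= \sum_(a < A) (2 ^ a.+1)%:R ^+ 2 * F a.
    apply: le_trans (sum_dyadic_le N A F0).
    apply: ler_sum => j _; rewrite [leRHS]big_mkcond; apply: ler_sum => k _.
    rewrite /q1 -/lv; case: (ltnP (lv (j + k)%N) A) => lA; last first.
      by rewrite andbF expr0n.
    rewrite andbT; case: ifP => [/andP[h1 h2]|_]; last by rewrite expr0n /= F0.
    have jk : (j0 <= j + k < N + N)%N.
      by have := ltn_ord j; have := ltn_ord k; clear -h1; lia.
    have jk0 : (0 < j + k)%N by clear -j02 jk; lia.
    have lv0 : (0 < lv (j + k)%N)%N.
      by rewrite /lv trunc_log_gt0 /=; clear -j02 jk; lia.
    have L := logpow_dyadic al0 lv0 (lvb _ jk0).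
    have -> : F (lv (j + k)%N) = (eps * ((2 ^ lv (j + k)%N)%:R^-1 * ((lv (j + k)%N)%:R * l2) `^ (- alpha))) ^+ 2.
      have sq (x : R) : (x `^ (- alpha)) ^+ 2 = x `^ (- s).
        by rewrite -powR_mulrn ?powR_ge0 // -powRrM; congr (_ `^ _); rewrite /s; ring.
      rewrite /F (powRM _ (ler0n _ _) (ltW l20)) 3!exprMn !sq exprVn; ring.
    rewrite -[leLHS]real_normK ?num_real // lerXn2r ?nnegrE ?normr_ge0 //.
      by rewrite !mulr_ge0 ?powR_ge0 ?invr_ge0 // ltW.
    apply: (le_trans (Hg _ jk)); apply: ler_wpM2l; first exact: ltW.
    apply: ler_pM => //; rewrite ?invr_ge0 ?powR_ge0 //.
    by rewrite lef_pV2 ?posrE ?ltr0n ?expn_gt0 // ler_nat lvb.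
  rewrite ler_pdivrMr ?exprn_gt0 //; apply: (le_trans HS).
  have -> : \sum_(a < A) (2 ^ a.+1)%:R ^+ 2 * F a
     = 4 * eps ^+ 2 * l2 `^ (- s) * \sum_(a < A) a%:R `^ (- s).
    rewrite mulr_sumr; apply: eq_bigr => a _; rewrite /F expnS natrM.
    by field; rewrite gt_eqF // ltr0n expn_gt0.
  have hs : 0 < s < 1 by rewrite s0.
  have := sum_powR_le (Num.truncn X) hs; rewrite -/A => SP.
  have XX : (Num.truncn X)%:R `^ (1 - s) <= (X * 2) `^ (1 - s).
    apply: ler_powRl; rewrite ?(ltW s10) //.
    apply: (@le_trans _ _ X); first by rewrite truncn_le ltW.
    by lra.
  have E0 : 0 < 4 * eps ^+ 2 * l2 `^ (- s) by rewrite !mulr_gt0 ?exprn_gt0 ?powR_gt0.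
  apply: (@le_trans _ _ (4 * eps ^+ 2 * l2 `^ (- s) * ((X * 2) `^ (1 - s) / (1 - s)))).
    rewrite ler_pM2l //; apply: (le_trans SP).
    by rewrite ler_pM2r ?invr_gt0.
  have aE : alpha^-1 * (1 - s) = alpha^-1 - 2 by rewrite /s; field; rewrite gt_eqF.
  rewrite XE (powRM _ (mulr_ge0 (ltW c10) (powR_ge0 _ _)) (powR_ge0 _ _)).
  rewrite (powRM _ (ltW c10) (powR_ge0 _ _)) -!powRrM aE mulNr aE.
  rewrite opprB.
  have -> : eps `^ (alpha^-1 - 2) = eps `^ alpha^-1 / eps ^+ 2.
    by rewrite powRD_gt0 // powRN powR_mulrn // ltW.
  have -> : t `^ (2 - alpha^-1) = t `^ (- alpha^-1) * t ^+ 2.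
    by rewrite addrC powRD_gt0 // powR_mulrn // ltW.
  have := Heps eps eps0 (lexx _) => Hk.
  have tp : 0 <= t `^ (- alpha^-1) * (t / 2) ^+ 2 by rewrite mulr_ge0 ?powR_ge0 ?sqr_ge0.
  have := ler_wpM2r tp Hk; rewrite [in leRHS]mulrA; apply: le_trans.
  rewrite /k1 le_eqVlt; apply/orP; left; apply/eqP; field; rewrite !gt_eqF //.
- move=> u H1 u0.
  have upos j : u j != 0 -> (j0 <= j)%N.
    by move=> uj; rewrite leqNgt; apply/negP => /u0 /eqP; apply/negP.
  have -> : hform g N u = qform q1 N u + qform q2 N u.
    rewrite /hform /qform -big_split; apply: eq_bigr => j _.
    rewrite -big_split; apply: eq_bigr => k _ /=; rewrite -mulrDl.
    have [->|uj] := eqVneq (u j) 0; first by rewrite !mul0r !mulr0.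
    have [->|uk] := eqVneq (u k) 0; first by rewrite !mulr0.
    congr (_ * _); rewrite /q1 /q2 (upos _ uj) (upos _ uk) /=.
    by case: ltnP; rewrite ?addr0 ?add0r.
  apply: (le_trans (ler_normD _ _)).
  have H2 : `|qform q2 N u| <= T * (4 * sqnorm N u).
    rewrite /qform exchange_big /=.
    apply: (@qform_hilbert R q2 (fun _ _ => true) T N u (ltW T0)) => j k jN kN uj uk _.
    have := upos _ uj; have := upos _ uk => kj0 jj0.
    have jk : (j0 <= j + k < N + N)%N by clear -jj0 jN kN; lia.
    have jk1 : (0 < j + k)%N by clear -j02 jk; lia.
    rewrite /q2; case: (leqP A (lv (j + k)%N)) => lA; last by rewrite normr0 divr_ge0 // ltW.
    apply: (le_trans (Hg _ jk)).
    have L : logpow alpha (j + k) <= (A%:R * l2) `^ (- alpha).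
      by apply: logpow_dyadic => //; apply: leq_trans (lvb _ jk1); rewrite leq_exp2l.
    have L2 : (A%:R * l2) `^ (- alpha) <= T / (2 * eps).
      apply: (@le_trans _ _ ((X * l2) `^ (- alpha))).
        by apply: powRN_le => //; [exact: mulr_gt0|rewrite ler_pM2r //; exact: ltW].
      rewrite /X divfK ?gt_eqF // -powRrM mulrN mulVf ?gt_eqF // powR_inv1.
        by rewrite invf_div.
      by rewrite ltW // divr_gt0 // mulr_gt0.
    have jk0 : 0 < (j + k)%:R :> R by rewrite ltr0n.
    apply: (@le_trans _ _ (eps * ((j + k)%:R^-1 * (T / (2 * eps))))).
      apply: ler_wpM2l; first exact: ltW.
      by apply: ler_wpM2l; [rewrite invr_ge0 ltW|exact: le_trans L L2].
    have gen (e z : R) : 0 < e -> 0 < z -> e * (z^-1 * (T / (2 * e))) = T * (2 * z)^-1.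
      by move=> e0 z0; field; rewrite !gt_eqF.
    rewrite (gen _ _ eps0 jk0); apply: ler_wpM2l; first exact: ltW.
    rewrite lef_pV2 ?posrE ?ltr0n // ?mulr_gt0 //.
    by rewrite -natrM ler_nat; clear -jk1; lia.
  have := sqnorm_ge0 N u; rewrite /T in H2; lra.
Qed.

End rough.

(** * Toeplitz forms *)

Section sine_transform.
Context {R : realType}.

Lemma sum_cos_telescope (n : nat) (th a : R) :
  2 * sin (th / 2) * (\sum_(j < n) cos (th * j%:R + a))
    = sin (th * n%:R - th / 2 + a) - sin (a - th / 2).
Proof.
elim: n => [|n IH]; first by rewrite big_ord0 mulr0 mulr0n mulr0 sub0r [- _ + a]addrC subrr.
rewrite big_ord_recr /= mulrDr IH.
have -> : sin (th * n%:R - th / 2 + a) = sin ((th * n%:R + a) - th / 2).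
  by congr sin; ring.
have -> : sin (th * n.+1%:R - th / 2 + a) = sin ((th * n%:R + a) + th / 2).
  by congr sin; rewrite -natr1; field.
set A := th * n%:R + a; rewrite (sinB A) (sinD A); ring.
Qed.

Lemma sum_cos_pi (n m : nat) : (0 < m < n + n)%N ->
  \sum_(j < n) cos (pi * m%:R / n%:R * j%:R) = (odd m)%:R :> R.
Proof.
move=> /andP[m0 mn]; have n0 : 0 < n%:R :> R by rewrite ltr0n; lia.
set th : R := pi * m%:R / n%:R.
have s0 : 0 < sin (th / 2).
  apply: sin_gt0_pi; have mm : 0 < m%:R :> R by rewrite ltr0n.
  rewrite /th !divr_gt0 ?mulr_gt0 ?pi_gt0 //= ltr_pdivrMr // ltr_pdivrMr //.
  rewrite -mulrA ltr_pM2l ?pi_gt0 // -natrM ltr_nat; lia.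
have := sum_cos_telescope n th 0.
rewrite addr0 sub0r sinN opprK.
have -> : th * n%:R - th / 2 = - (th / 2) + pi *+ m.
  by rewrite /th divfK ?gt_eqF // mulr_natr addrC.
have -> : sin (- (th / 2) + pi *+ m) = (-1) ^+ m * sin (- (th / 2)).
  by rewrite (alternatingn (@sinDpi R)).
rewrite sinN -signr_odd.
under eq_bigr do rewrite addr0.
move=> E; have s1 : 2 * sin (th / 2) != 0 by rewrite mulf_neq0 ?gt_eqF.
apply: (mulfI s1); rewrite E; case: (odd m) => /=; ring.
Qed.

Lemma sine_orthogonality (n l l' : nat) : (0 < l < n)%N -> (0 < l' < n)%N ->
  \sum_(i < n) sin (pi * l%:R / n%:R * i%:R) * sin (pi * l'%:R / n%:R * i%:R)
    = (n%:R / 2) * (l == l')%:R :> R.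
Proof.
wlog ll : l l' / (l <= l')%N.
  move=> H hl hl'; case: (leqP l l') => [ll|/ltnW ll]; first exact: H.
  rewrite eq_sym -H //; apply: eq_bigr => i _; exact: mulrC.
move=> hl hl'; have n0 : n%:R != 0 :> R by rewrite pnatr_eq0; lia.
have -> : \sum_(i < n) sin (pi * l%:R / n%:R * i%:R) * sin (pi * l'%:R / n%:R * i%:R)
   = (\sum_(i < n) cos (pi * (l' - l)%:R / n%:R * i%:R)
     - \sum_(i < n) cos (pi * (l' + l)%:R / n%:R * i%:R)) / 2 :> R.
  rewrite -sumrB mulr_suml; apply: eq_bigr => i _.
  have -> : pi * (l' - l)%:R / n%:R * i%:R = pi * l'%:R / n%:R * i%:R - pi * l%:R / n%:R * i%:R :> R.
    by rewrite natrB //; field.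
  have -> : pi * (l' + l)%:R / n%:R * i%:R = pi * l'%:R / n%:R * i%:R + pi * l%:R / n%:R * i%:R :> R.
    by rewrite natrD; field.
  by rewrite cosB cosD; field.
rewrite (@sum_cos_pi n (l' + l)); last by lia.
have [->|nll] := eqVneq l l'.
  rewrite subnn mulr0 mul0r addnn odd_double /=.
  under eq_bigr do rewrite mul0r cos0.
  by rewrite sumr_const card_ord; field.
rewrite sum_cos_pi; last by lia.
by rewrite oddB // oddD subrr mul0r mulr0.
Qed.

Lemma sum_rev_shift (n k : nat) (f : nat -> nat -> R) :
  \sum_(i < n | (k <= i)%N) f i (i - k)%N = \sum_(i < n | (i + k < n)%N) f (i + k)%N i.
Proof.
have [kn|nk] := leqP k n; last first.
  by rewrite !big_pred0 // => i; have := ltn_ord i; lia.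
rewrite -(big_mkord (fun i => k <= i)%N (fun i => f i (i - k)%N)).
rewrite -(big_mkord (fun i => i + k < n)%N (fun i => f (i + k)%N i)).
rewrite (@big_cat_nat _ _ _ k) //= big1_seq ?add0r; last first.
  by move=> i; rewrite mem_index_iota; lia.
rewrite [RHS](@big_cat_nat _ _ _ (n - k)) ?leq_subr //= [X in _ = _ + X]big1_seq ?addr0; last first.
  by move=> i; rewrite mem_index_iota; lia.
rewrite -{1}[k]add0n big_addn big_seq_cond [RHS]big_seq_cond; apply: eq_big => i.
  by rewrite mem_index_iota; lia.
by move=> _; rewrite addnK.
Qed.

(** The discrete sine transform is its own inverse up to a factor. The mode [l = 0] is identically
    zero and stands in the sum only to keep it over ['I_n]. *)
Lemma sine_expansion (n : nat) (x : nat -> R) (i : nat) : (i < n)%N -> x 0%N = 0 ->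
  x i = \sum_(l < n) (2 / n%:R * \sum_(j < n) x j * sin (pi * l%:R / n%:R * j%:R))
          * sin (pi * l%:R / n%:R * i%:R).
Proof.
move=> iN x0; have n0 : (0 < n)%N by lia.
have nR : n%:R != 0 :> R by rewrite pnatr_eq0; lia.
have [->|i0] := posnP i.
  by rewrite x0 big1 // => l _; rewrite mulr0 sin0 mulr0.
transitivity (\sum_(j < n) x j * (2 / n%:R *
   \sum_(l < n) sin (pi * j%:R / n%:R * l%:R) * sin (pi * i%:R / n%:R * l%:R))).
  rewrite (bigD1 (Ordinal iN)) //= sine_orthogonality ?i0 // eqxx mulr1 big1 ?addr0.
    by field.
  move=> j ji; have [->|j0] := posnP j; first by rewrite x0 mul0r.
  have ji' : j != i :> nat by rewrite -(inj_eq val_inj) in ji.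
  by rewrite sine_orthogonality ?i0 ?j0 ?ltn_ord // (negbTE ji') !mulr0.
under [RHS]eq_bigr do rewrite mulr_sumr mulr_suml.
rewrite [RHS]exchange_big /=; apply: eq_bigr => j _; rewrite !mulr_sumr.
apply: eq_bigr => l _.
have -> : pi * l%:R / n%:R * j%:R = pi * j%:R / n%:R * l%:R :> R by ring.
have -> : pi * l%:R / n%:R * i%:R = pi * i%:R / n%:R * l%:R :> R by ring.
ring.
Qed.

(** Where [x i] is nonzero, [i - k] and [i + k] still lie in the block, so the sine expansion is
    valid at both, and [sin (a + b) + sin (a - b) = 2 sin a cos b] makes the sum of the two shifts
    multiply each mode by [2 cos]. *)
Lemma sine_autocorrelation (n r k : nat) (z x : nat -> R) : (k <= r)%N -> z 0%N = 0 ->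
  (forall i, (i < n)%N -> x i = \sum_(l < n) z l * sin (pi * l%:R / n%:R * i%:R)) ->
  (forall i, (i < n)%N -> (i < r)%N || (n <= i + r)%N -> x i = 0) ->
  \sum_(i < n) x i * x (i + k)%N
    = n%:R / 2 * \sum_(l < n) cos (pi * l%:R / n%:R * k%:R) * z l ^+ 2.
Proof.
move=> kr z0 xz xm.
pose th (l : nat) : R := pi * l%:R / n%:R.
have up : \sum_(i < n) x i * x (i + k)%N = \sum_(i < n | (i + k < n)%N) x (i + k)%N * x i.
  rewrite [RHS]big_mkcond; apply: eq_bigr => i _; case: ifP => [_|h]; first exact: mulrC.
  by rewrite xm ?mul0r //; apply/orP; right; move/negbT: h; lia.
have down : \sum_(i < n) x i * (x (i + k)%N + (if (k <= i)%N then x (i - k)%N else 0))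
    = 2 * \sum_(i < n) x i * x (i + k)%N.
  under eq_bigr do rewrite mulrDr.
  rewrite big_split /= mulr_natl mulr2n; congr (_ + _).
  rewrite up -(sum_rev_shift n k (fun a b => x a * x b)) [RHS]big_mkcond.
  by apply: eq_bigr => i _; case: ifP; rewrite ?mulr0.
have step : \sum_(i < n) x i * (x (i + k)%N + (if (k <= i)%N then x (i - k)%N else 0))
   = \sum_(i < n) \sum_(l < n) 2 * cos (th l * k%:R) * z l * (x i * sin (th l * i%:R)).
  apply: eq_bigr => i _.
  have [e|ne] := eqVneq (x i) 0.
    by rewrite e mul0r big1 // => l _; rewrite mul0r mulr0.
  have/andP[ri inr] : (r <= i)%N && (i + r < n)%N.
    by apply: contraNT ne => h; apply/eqP/xm => //; lia.
  have ki : (k <= i)%N by lia.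
  rewrite ki (xz (i + k)%N); last by lia.
  rewrite (xz (i - k)%N); last by lia.
  rewrite -big_split /= mulr_sumr; apply: eq_bigr => l _.
  rewrite -/(th l).
  have -> : th l * (i + k)%:R = th l * i%:R + th l * k%:R by rewrite natrD mulrDr.
  have -> : th l * (i - k)%:R = th l * i%:R - th l * k%:R by rewrite natrB // mulrBr.
  rewrite sinD sinB; ring.
have mode (l : 'I_n) : z l * (\sum_(i < n) x i * sin (th l * i%:R)) = n%:R / 2 * z l ^+ 2.
  have [->|l0] := posnP l; first by rewrite z0 mul0r expr0n mulr0.
  transitivity (z l * \sum_(l' < n) z l' * \sum_(i < n) sin (th l' * i%:R) * sin (th l * i%:R)).
    congr (_ * _); under eq_bigr => i _ do rewrite (xz i (ltn_ord i)) mulr_suml.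
    rewrite exchange_big /=; apply: eq_bigr => l' _; rewrite mulr_sumr.
    by apply: eq_bigr => i _; rewrite mulrA.
  rewrite (bigD1 l) //= sine_orthogonality ?l0 ?ltn_ord // eqxx mulr1 big1 ?addr0.
    by ring.
  move=> l' ll'; have [->|l0'] := posnP l'; first by rewrite z0 mul0r.
  rewrite sine_orthogonality ?l0 ?l0' ?ltn_ord //.
  by rewrite -(inj_eq val_inj) in ll'; rewrite (negbTE ll') !mulr0.
have two : 2 != 0 :> R by [].
apply: (mulfI two); rewrite -down step exchange_big /= !mulr_sumr; apply: eq_bigr => l _.
by rewrite -mulr_sumr -mulrA mode -/(th l); field.
Qed.

End sine_transform.

(** * Counting for Toeplitz forms against a monotone weight *)

Section toeplitz.
Context {R : realType}.
Implicit Types (a W y : nat -> R).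

Definition index_dist (m m' : nat) : nat := (m - m' + (m' - m))%N.

Definition toeplitz_form a (M : nat) y : R :=
  \sum_(m < M) \sum_(m' < M) a (index_dist m m') * (y m * y m').

Definition band_symbol a (r : nat) (th : R) : R :=
  a 0%N + 2 * \sum_(k < r) a k.+1 * cos (th * k.+1%:R).

Definition autocorr (M k : nat) y : R := \sum_(m < M) y m * y (m + k)%N.

Definition cosine_coef a (k : nat) : R := if k == 0%N then a 0%N else 2 * a k.

Lemma sum_ord_extend (M M' : nat) (F : nat -> R) : (M <= M')%N ->
  (forall m, (M <= m)%N -> F m = 0) -> \sum_(m < M') F m = \sum_(m < M) F m.
Proof.
move=> MM F0; rewrite (big_ord_widen M' F MM) [RHS]big_mkcond.
by apply: eq_bigr => m _; case: ltnP => // /F0.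
Qed.

Lemma sum_ord_blocks (P n M : nat) (F : nat -> R) :
  \sum_(m < P * n + M) F m
    = \sum_(p < P) \sum_(i < n) F (p * n + i)%N + \sum_(i < M) F (P * n + i)%N.
Proof.
elim: P F => [|P IH] F; first by rewrite big_ord0 add0r !mul0n !add0n.
have -> : (P.+1 * n + M = n + (P * n + M))%N by lia.
rewrite big_split_ord /= (IH (fun m => F (n + m)%N)) big_ord_recl addrA mul0n; congr (_ + _ + _).
  by apply: eq_bigr => p _; apply: eq_bigr => i _; congr F; rewrite lift0; lia.
by apply: eq_bigr => i _; congr F; lia.
Qed.

Lemma sum_ord_shift (M m : nat) (G : nat -> R) : (forall i, (M <= i)%N -> G i = 0) ->
  \sum_(i < M | (m <= i)%N) G i = \sum_(k < M) G (m + k)%N.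
Proof.
move=> G0; rewrite (sum_rev_shift M m (fun i _ => G i)) big_mkcond.
apply: eq_bigr => k _; case: ifP => [_|/negbT h]; first by rewrite addnC.
by rewrite G0 //; lia.
Qed.

Lemma toeplitz_autocorr a M K y : (M <= K)%N -> (forall m, (M <= m)%N -> y m = 0) ->
  toeplitz_form a M y = \sum_(k < K) cosine_coef a k * autocorr M k y.
Proof.
move=> MK y0.
have -> : \sum_(k < K) cosine_coef a k * autocorr M k y = \sum_(k < M) cosine_coef a k * autocorr M k y.
  apply: (sum_ord_extend MK (F := fun k => cosine_coef a k * autocorr M k y)) => k Mk; rewrite /autocorr big1 ?mulr0 // => m _.
  by rewrite (y0 (m + k)%N) ?mulr0 //; lia.
have le (m : 'I_M) : \sum_(m' < M | (m <= m')%N) a (index_dist m m') * (y m * y m')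
    = \sum_(k < M) a k * (y m * y (m + k)%N).
  rewrite (@sum_ord_shift M m (fun m' => a (index_dist m m') * (y m * y m'))).
    by apply: eq_bigr => k _; congr (a _ * _); rewrite /index_dist; lia.
  by move=> i /y0 ->; rewrite !mulr0.
have lt (m : 'I_M) : \sum_(m' < M | (m < m')%N) a (index_dist m m') * (y m * y m')
    = \sum_(k < M | k != 0%N :> nat) a k * (y m * y (m + k)%N).
  transitivity (\sum_(m' < M | (m <= m')%N) (m' != m :> nat)%:R * (a (index_dist m m') * (y m * y m'))).
    rewrite big_mkcond [RHS]big_mkcond; apply: eq_bigr => m' _.
    by case: ltngtP => h //=; rewrite ?mul1r ?mul0r.
  rewrite (@sum_ord_shift M m (fun m' => (m' != m)%:R * (a (index_dist m m') * (y m * y m')))).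
    rewrite [RHS]big_mkcond; apply: eq_bigr => k _.
    rewrite -[X in (_ != X)]addn0 eqn_add2l; case: eqP => _ /=; rewrite ?mul0r ?mul1r //.
    by congr (a _ * _); rewrite /index_dist; lia.
  by move=> i /y0 ->; rewrite !mulr0.
transitivity (\sum_(m < M) \sum_(k < M) a k * (y m * y (m + k)%N)
   + \sum_(m < M) \sum_(k < M | k != 0%N :> nat) a k * (y m * y (m + k)%N)).
  have -> : toeplitz_form a M y =
     \sum_(m < M) \sum_(m' < M | (m <= m')%N) a (index_dist m m') * (y m * y m')
     + \sum_(m < M) \sum_(m' < M | (m < m')%N) a (index_dist m m') * (y m * y m').
    rewrite /toeplitz_form.
    under eq_bigr => m _ do rewrite (bigID (fun m' : 'I_M => (m <= m')%N)) /=.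
    rewrite big_split; congr (_ + _).
    under eq_bigr => m _ do rewrite big_mkcond /=.
    rewrite exchange_big; apply: eq_bigr => m _; rewrite [RHS]big_mkcond /=.
    apply: eq_bigr => m' _; rewrite -ltnNge; case: ifP => // _.
    by rewrite (mulrC (y m)); congr (a _ * _); rewrite /index_dist addnC.
  by congr (_ + _); apply: eq_bigr => m _; [exact: le|exact: lt].
under [X in _ + X]eq_bigr => m _ do rewrite big_mkcond /=.
rewrite exchange_big [X in _ + X]exchange_big -big_split /=; apply: eq_bigr => k _.
rewrite /cosine_coef /autocorr -mulr_sumr; case: eqP => [->|_] /=.
  by rewrite [X in _ + X]big1 ?addr0.
by rewrite -mulr_sumr; ring.
Qed.

Lemma autocorr_bound M k y : (forall m, (M <= m)%N -> y m = 0) ->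
  `|autocorr M k y| <= sqnorm M y.
Proof.
move=> y0; apply: (le_trans (ler_norm_sum _ _ _)).
apply: (@le_trans _ _ (\sum_(m < M) (y m ^+ 2 + y (m + k)%N ^+ 2) / 2)).
  apply: ler_sum => m _; rewrite ler_norml; apply/andP; split.
    have := sqr_ge0 (y m + y (m + k)%N); rewrite sqrrD; lra.
  have := sqr_ge0 (y m - y (m + k)%N); rewrite sqrrB; lra.
rewrite -mulr_suml big_split /=.
have : \sum_(m < M) y (m + k)%N ^+ 2 <= sqnorm M y.
  have -> : \sum_(m < M) y (m + k)%N ^+ 2 = \sum_(m < M | (k <= m)%N) y m ^+ 2.
    rewrite (@sum_ord_shift M k (fun m => y m ^+ 2)); last by move=> i /y0 ->; rewrite expr0n.
    by apply: eq_bigr => m _; rewrite addnC.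
  by rewrite big_mkcond; apply: ler_sum => m _; case: ifP => // _; exact: sqr_ge0.
rewrite -/(sqnorm M y); lra.
Qed.

(** Each diagonal contributes at most its coefficient times the squared norm, so cutting the matrix
    to bandwidth [r] costs the sum of the discarded coefficients. *)
Lemma toeplitz_band a M r y (e : R) : (forall k, 0 <= a k) ->
  (forall K, \sum_(k < K | (r < k)%N) 2 * a k <= e) ->
  (forall m, (M <= m)%N -> y m = 0) ->
  `|toeplitz_form a M y - \sum_(k < r.+1) cosine_coef a k * autocorr M k y|
    <= e * sqnorm M y.
Proof.
move=> a0 He y0.
rewrite (@toeplitz_autocorr a M (r.+1 + M) y) //; last exact: leq_addl.
rewrite big_split_ord /= addrAC subrr add0r.
apply: (le_trans (ler_norm_sum _ _ _)).
apply: (@le_trans _ _ ((\sum_(i < M) 2 * a (r.+1 + i)%N) * sqnorm M y)).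
  rewrite mulr_suml; apply: ler_sum => i _; rewrite /cosine_coef /= normrM.
  rewrite ger0_norm ?mulr_ge0 //; apply: ler_wpM2l; first by rewrite mulr_ge0.
  exact: autocorr_bound.
apply: ler_wpM2r; first exact: sqnorm_ge0.
apply: le_trans (He (r.+1 + M)%N); rewrite [leRHS]big_mkcond big_split_ord /=.
rewrite [X in _ <= X + _]big1 ?add0r; last first.
  by move=> i _; rewrite ltnNge -ltnS ltn_ord.
by apply: ler_sum => i _; rewrite ltnS leq_addr.
Qed.

Lemma band_symbolE a r (th : R) :
  band_symbol a r th = \sum_(k < r.+1) cosine_coef a k * cos (th * k%:R).
Proof.
rewrite big_ord_recl /cosine_coef /= mulr0 cos0 mulr1 /band_symbol; congr (_ + _).
rewrite mulr_sumr; apply: eq_bigr => k _; by rewrite mulrA.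
Qed.

(* Zero margins of width [r] keep the band matrix away from the ends of the block,
   so that the sine basis diagonalizes it exactly. *)
Lemma block_symbol a (n r : nat) (z x : nat -> R) : z 0%N = 0 ->
  (forall i, (i < n)%N -> x i = \sum_(l < n) z l * sin (pi * l%:R / n%:R * i%:R)) ->
  (forall i, (i < n)%N -> (i < r)%N || (n <= i + r)%N -> x i = 0) ->
  \sum_(k < r.+1) cosine_coef a k * (\sum_(i < n) x i * x (i + k)%N)
    = n%:R / 2 * \sum_(l < n) band_symbol a r (pi * l%:R / n%:R) * z l ^+ 2.
Proof.
move=> z0 xz xm.
under eq_bigr => k _ do
  rewrite (@sine_autocorrelation R n r k z x (ltn_ord k : k <= r)%N z0 xz xm) mulrCA.
rewrite -mulr_sumr; congr (_ * _).
under eq_bigr => k _ do rewrite mulr_sumr.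
rewrite exchange_big; apply: eq_bigr => l _.
by rewrite band_symbolE mulr_suml; apply: eq_bigr => k _; rewrite mulrA.
Qed.

Lemma block_sqnorm (n r : nat) (z x : nat -> R) : z 0%N = 0 ->
  (forall i, (i < n)%N -> x i = \sum_(l < n) z l * sin (pi * l%:R / n%:R * i%:R)) ->
  (forall i, (i < n)%N -> (i < r)%N || (n <= i + r)%N -> x i = 0) ->
  \sum_(i < n) x i ^+ 2 = n%:R / 2 * \sum_(l < n) z l ^+ 2.
Proof.
move=> z0 xz xm; have := @sine_autocorrelation R n r 0 z x (leq0n _) z0 xz xm.
under eq_bigr do rewrite addn0 -expr2.
by move=> ->; congr (_ * _); apply: eq_bigr => l _; rewrite mulr0 cos0 mul1r.
Qed.

(** The indices are cut into [P] blocks of length [n] and a remainder. The conditions are: [n] to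
    remove the first block, [2 r] margins per block, and one for each sine mode of a block on which
    [gam] times the symbol exceeds [t * W], with [W] taken at the left end of the block. On the
    remainder [W] is so large that the crude bound [S] on the whole matrix suffices. *)
Lemma toeplitz_upper a W (n r P M : nat) (e S gam t : R) :
  (forall k, 0 <= a k) -> (forall m m', (m <= m')%N -> W m <= W m') ->
  (0 < n)%N -> (0 < r)%N -> 0 < gam -> 0 < t ->
  (forall K, \sum_(k < K | (r < k)%N) 2 * a k <= e) ->
  \sum_(k < r.+1) cosine_coef a k + e <= S -> gam * S <= t * W (P * n)%N ->
  codim_le (n%:R + P%:R * (2 * r%:R) + \sum_(p < P) \sum_(l < n)
      [&& (0 < p)%N, (0 < l)%N &
        t * W (p * n)%N < gam * (band_symbol a r (pi * l%:R / n%:R) + e)]%:R)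
    (fun y => (forall m, (M <= m)%N -> y m = 0) ->
       (forall m, (m < n)%N -> y m = 0) /\
       gam * toeplitz_form a M y <= t * \sum_(m < M) W m * y m ^+ 2).
Proof.
move=> a0 Wmono n0 r0 g0 t0 He HS HP.
pose th (l : nat) : R := pi * l%:R / n%:R.
pose cond (p l : nat) := [&& (0 < p)%N, (0 < l)%N & t * W (p * n)%N < gam * (band_symbol a r (th l) + e)].
have c1 : codim_le n%:R (fun y => forall i : 'I_n, y i = 0).
  have -> : n%:R = \sum_(i < n) 1 :> R by rewrite sumr_const card_ord.
  apply: (@codim_le_fin R nat _ (fun _ : 'I_n => 1) (fun i y => y i = 0)) => i.
  by apply: codim_le1.
have c2 : codim_le (P%:R * (2 * r%:R)) (fun y => forall (p : 'I_P) (i : 'I_r),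
    y (p * n + i)%N = 0 /\ y (p * n + (n.-1 - i))%N = 0).
  have -> : P%:R * (2 * r%:R) = \sum_(p < P) \sum_(i < r) (1 + 1) :> R.
    by rewrite !sumr_const !card_ord -[RHS]mulr_natl -[X in _ = _ * X]mulr_natl; ring.
  apply: (@codim_le_fin R nat _ (fun _ : 'I_P => \sum_(i < r) (1 + 1))
    (fun p y => forall i : 'I_r, y (p * n + i)%N = 0 /\ y (p * n + (n.-1 - i))%N = 0)) => p.
  apply: (@codim_le_fin R nat _ (fun _ : 'I_r => 1 + 1)
    (fun i y => y (p * n + i)%N = 0 /\ y (p * n + (n.-1 - i))%N = 0)) => i.
  by apply: codim_leI; apply: codim_le1.
have c3 : codim_le (\sum_(p < P) \sum_(l < n) (cond p l)%:R)
   (fun y => forall (p : 'I_P) (l : 'I_n), cond p l ->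
      \sum_(j < n) y (p * n + j)%N * sin (th l * j%:R) = 0).
  apply: (@codim_le_fin R nat _ (fun p : 'I_P => \sum_(l < n) (cond p l)%:R)
    (fun p y => forall l : 'I_n, cond p l -> \sum_(j < n) y (p * n + j)%N * sin (th l * j%:R) = 0)) => p.
  apply: (@codim_le_fin R nat _ (fun l : 'I_n => (cond p l)%:R)
    (fun l y => cond p l -> \sum_(j < n) y (p * n + j)%N * sin (th l * j%:R) = 0)) => l.
  case: (cond p l); last by apply: codim_le_true.
  apply: codim_leW (lexx _) _ (codim_le1 (f := fun y => \sum_(j < n) y (p * n + j)%N * sin (th l * j%:R)) _) => //.
  by move=> c u v; rewrite mulr_sumr -big_split; apply: eq_bigr => j _ /=; ring.
apply: codim_leW (codim_leI (codim_leI c1 c2) c3) => // y [[y1 y2] y3] yM.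
have y1' m : (m < n)%N -> y m = 0 by move=> mn; exact: (y1 (Ordinal mn)).
split=> //.
(* Padding by zeros makes all [P] blocks complete whatever [M] is. *)
set M1 := (P * n + M)%N.
have MM : (M <= M1)%N by exact: leq_addl.
have yM1 m : (M1 <= m)%N -> y m = 0 by move=> h; apply: yM; exact: leq_trans MM h.
have -> : toeplitz_form a M y = toeplitz_form a M1 y.
  by rewrite (@toeplitz_autocorr a M M1) // (@toeplitz_autocorr a M1 M1) //;
     apply: eq_bigr => k _; congr (_ * _); rewrite /autocorr (sum_ord_extend MM (F := fun m => y m * y (m + k)%N)) // => m /yM ->; rewrite mul0r.
rewrite -(sum_ord_extend MM (F := fun m => W m * y m ^+ 2)); last first.
  by move=> m /yM ->; rewrite expr0n mulr0.
have := toeplitz_band a0 He yM1; rewrite ler_norml => /andP[_ band].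
pose blk (p : nat) i := y (p * n + i)%N.
have blkm (p : 'I_P) (i : nat) : (i < n)%N -> (i < r)%N || (n <= i + r)%N -> blk p i = 0.
  move=> iN /orP[ir|ir]; first by have [] := y2 p (Ordinal ir).
  have h : (n.-1 - i < r)%N by lia.
  have [_] := y2 p (Ordinal h); rewrite /blk /=.
  by have -> : (n.-1 - (n.-1 - i) = i)%N by lia.
pose z p (l : nat) := 2 / n%:R * \sum_(j < n) blk p j * sin (th l * j%:R).
have z0 p : z p 0%N = 0.
  by rewrite /z big1 ?mulr0 // => j _; rewrite /th !(mulr0, mul0r) sin0 mulr0.
have tail0 i : (M <= i)%N -> y (P * n + i)%N = 0 by move=> h; apply: yM; lia.
have main : gam * (\sum_(k < r.+1) cosine_coef a k * autocorr M1 k y + e * sqnorm M1 y)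
   <= t * \sum_(m < M1) W m * y m ^+ 2.
  have -> : \sum_(k < r.+1) cosine_coef a k * autocorr M1 k y =
     \sum_(p < P) (\sum_(k < r.+1) cosine_coef a k * \sum_(i < n) blk p i * blk p (i + k)%N)
     + \sum_(k < r.+1) cosine_coef a k * autocorr M k (fun i => y (P * n + i)%N).
    rewrite [X in _ = X + _]exchange_big -big_split; apply: eq_bigr => k _ /=.
    rewrite -mulr_sumr -mulrDr /autocorr /M1 (sum_ord_blocks P n M (fun m => y m * y (m + k)%N)).
    by congr (_ * (_ + _)); [apply: eq_bigr => p _|]; apply: eq_bigr => i _; rewrite /blk addnA.
  rewrite /sqnorm /M1 (sum_ord_blocks P n M (fun m => y m ^+ 2)).
  rewrite (sum_ord_blocks P n M (fun m => W m * y m ^+ 2)).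
  rewrite (mulrDr e) addrACA mulrDr (mulrDr t); apply: lerD.
    rewrite mulr_sumr -big_split /= !mulr_sumr; apply: ler_sum => p _.
    have xz i : (i < n)%N -> blk p i = \sum_(l < n) z p l * sin (pi * l%:R / n%:R * i%:R).
      move=> iN; apply: (sine_expansion iN).
      by apply: blkm; rewrite ?r0.
    rewrite (block_symbol a (z0 p) xz (blkm p)).
    apply: (@le_trans _ _ (t * (W (p * n)%N * \sum_(i < n) blk p i ^+ 2))); last first.
      apply: ler_wpM2l; first exact: ltW.
      rewrite mulr_sumr; apply: ler_sum => i _; apply: ler_wpM2r; first exact: sqr_ge0.
      by apply: Wmono; exact: leq_addr.
    rewrite (block_sqnorm (z0 p) xz (blkm p)).
    set N2 : R := n%:R / 2; have N20 : 0 <= N2 by rewrite divr_ge0.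
    have -> : gam * (N2 * (\sum_(l < n) band_symbol a r (pi * l%:R / n%:R) * z p l ^+ 2) + e * (N2 * \sum_(l < n) z p l ^+ 2))
       = N2 * \sum_(l < n) gam * (band_symbol a r (th l) + e) * z p l ^+ 2.
      rewrite mulrCA -mulrDr mulrCA; congr (_ * _).
      by rewrite !mulr_sumr -big_split mulr_sumr; apply: eq_bigr => l _ /=; rewrite /th; ring.
    have -> : t * (W (p * n)%N * (N2 * \sum_(l < n) z p l ^+ 2))
       = N2 * \sum_(l < n) t * W (p * n)%N * z p l ^+ 2.
      by rewrite -mulr_sumr; ring.
    apply: ler_wpM2l => //; apply: ler_sum => l _.
    have [p0|p0] := posnP p.
      have -> : z p l = 0.
        by rewrite /z big1 ?mulr0 // => j _; rewrite /blk p0 mul0n add0n y1' ?mul0r.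
      by rewrite expr0n !mulr0.
    have [l0|l0] := posnP l; first by rewrite l0 z0 expr0n !mulr0.
    case: (boolP (cond p l)) => [cl|].
      by rewrite /z (y3 p l cl) mulr0 expr0n !mulr0.
    rewrite /cond p0 l0 /= -leNgt => h; apply: ler_wpM2r => //; exact: sqr_ge0.
  set y' := fun i => y (P * n + i)%N.
  apply: (@le_trans _ _ (gam * S * sqnorm M y')).
    rewrite -mulrA; apply: ler_wpM2l; first exact: ltW.
    apply: (@le_trans _ _ ((\sum_(k < r.+1) cosine_coef a k + e) * sqnorm M y')).
      rewrite mulrDl; apply: lerD => //; rewrite mulr_suml; apply: ler_sum => k _.
      apply: ler_wpM2l; first by rewrite /cosine_coef; case: ifP; rewrite ?mulr_ge0.
      by apply: (le_trans (ler_norm _)); exact: autocorr_bound.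
    by apply: ler_wpM2r => //; exact: sqnorm_ge0.
  apply: (@le_trans _ _ (t * W (P * n)%N * sqnorm M y')).
    by apply: ler_wpM2r => //; exact: sqnorm_ge0.
  rewrite -mulrA; apply: ler_wpM2l; first exact: ltW.
  rewrite /sqnorm mulr_sumr; apply: ler_sum => i _; apply: ler_wpM2r; first exact: sqr_ge0.
  by apply: Wmono; exact: leq_addr.
apply: le_trans main; apply: ler_wpM2l; first exact: ltW.
by rewrite -lerBlDl.
Qed.

Lemma codim_le_card (K : finType) (x : R) (P : (K -> R) -> Prop) :
  codim_le x P -> (forall z, P z -> forall k, z k = 0) -> #|K|%:R <= x.
Proof.
move=> HP Pz; rewrite leNgt; apply/negP => xK.
have [c [[i ci] Pc]] := codim_le_nontrivial (fun (i : 'I_#|K|) k => (k == enum_val i)%:R) HP xK.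
have := Pz _ Pc (enum_val i).
rewrite (bigD1 i) //= eqxx mulr1 big1 ?addr0 => [ci0|j ji]; first by rewrite ci0 eqxx in ci.
by rewrite (inj_eq enum_val_inj) eq_sym (negbTE ji) mulr0.
Qed.

(** Sequences are synthesized from sine coefficients [z], and conditions remove the margins and the
    modes that are not counted. If the form is at most [t * W] on what remains, then all [z] vanish,
    because each counted mode contributes positively; so there must be at least as many conditions
    as coefficients. The weight is now taken at the right end of each block. The channels [c] are
    treated jointly because the hypothesis couples them. *)
Lemma toeplitz_lower (C : finType) a W (n r P : nat) (e t x : R) (gam : C -> R) :
  (forall k, 0 <= a k) -> (forall m m', (m <= m')%N -> W m <= W m') ->
  (0 < n)%N -> 0 < t -> (forall c, 0 <= gam c) ->
  (forall K, \sum_(k < K | (r < k)%N) 2 * a k <= e) ->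
  codim_le x (fun y : C * nat -> R =>
    (forall c m, (m < n)%N || (P * n <= m)%N -> y (c, m) = 0) ->
    \sum_c gam c * toeplitz_form a (P * n) (fun m => y (c, m))
      <= t * \sum_c \sum_(m < P * n) W m * y (c, nat_of_ord m) ^+ 2) ->
  \sum_c \sum_(p < P) \sum_(l < n)
    [&& (0 < p)%N, (0 < l)%N &
      t * W (p.+1 * n)%N < gam c * (band_symbol a r (pi * l%:R / n%:R) - e)]%:R
    <= x + #|C|%:R * (P%:R * (2 * r%:R)).
Proof.
move=> a0 Wmono n0 t0 g0 He H.
pose th (l : nat) : R := pi * l%:R / n%:R.
pose good (c : C) (p l : nat) := [&& (0 < p)%N, (0 < l)%N &
   t * W (p.+1 * n)%N < gam c * (band_symbol a r (th l) - e)].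
pose K : finType := (C * 'I_P * 'I_n)%type.
pose zz (z : K -> R) (c : C) (p : nat) (l : nat) : R :=
  \sum_(p' < P) \sum_(l' < n) (((p' : nat) == p) && ((l' : nat) == l))%:R * z (c, p', l').
have zzE z c (p : 'I_P) (l : 'I_n) : zz z c p l = z (c, p, l).
  rewrite /zz (bigD1 p) //= (bigD1 l) //= !eqxx mul1r big1 ?addr0 => [|l' ll']; last first.
    by rewrite -(inj_eq val_inj) /= in ll'; rewrite (negbTE ll') andbF mul0r.
  rewrite big1 ?addr0 // => p' pp'; rewrite -(inj_eq val_inj) /= in pp'.
  by apply: big1 => l' _; rewrite (negbTE pp') mul0r.
(* Block 0 is left empty, as the hypothesis concerns sequences that vanish below [n]. *)
pose Y (z : K -> R) (cm : C * nat) : R :=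
  if (n <= cm.2)%N && (cm.2 < P * n)%N then
    \sum_(l < n) zz z cm.1 (cm.2 %/ n)%N l * sin (th l * (cm.2 %% n)%:R) else 0.
have linzz b z z' c p l : zz (fun k => b * z k + z' k) c p l = b * zz z c p l + zz z' c p l.
  rewrite /zz mulr_sumr -big_split; apply: eq_bigr => p' _.
  by rewrite mulr_sumr -big_split; apply: eq_bigr => l' _ /=; ring.
have linY : linear_map Y.
  move=> b z z'; apply/funext => -[c m]; rewrite /Y /=; case: ifP => _; last by rewrite mulr0 addr0.
  by rewrite mulr_sumr -big_split; apply: eq_bigr => l _ /=; rewrite linzz; ring.
have H1 := codim_le_comp linY H.
have H2 : codim_le (#|C|%:R * (P%:R * (2 * r%:R))) (fun z => forall (c : C) (p : 'I_P) (i : 'I_r),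
    Y z (c, (p * n + i)%N) = 0 /\ Y z (c, (p * n + (n.-1 - i))%N) = 0).
  have linYm cm : linear_functional (fun z => Y z cm).
    by move=> b u v; rewrite linY.
  have -> : #|C|%:R * (P%:R * (2 * r%:R)) = \sum_(c : C) \sum_(p < P) \sum_(i < r) (1 + 1) :> R.
    rewrite !sumr_const !card_ord -[RHS]mulr_natl -[X in _ = _ * X]mulr_natl -[X in _ = _ * (_ * X)]mulr_natl; ring.
  apply: (@codim_le_fin R K _ (fun c : C => \sum_(p < P) \sum_(i < r) (1 + 1))
    (fun c z => forall (p : 'I_P) (i : 'I_r), Y z (c, (p * n + i)%N) = 0 /\ Y z (c, (p * n + (n.-1 - i))%N) = 0)) => c.
  apply: (@codim_le_fin R K _ (fun _ : 'I_P => \sum_(i < r) (1 + 1))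
    (fun p z => forall i : 'I_r, Y z (c, (p * n + i)%N) = 0 /\ Y z (c, (p * n + (n.-1 - i))%N) = 0)) => p.
  apply: (@codim_le_fin R K _ (fun _ : 'I_r => 1 + 1)
    (fun i z => Y z (c, (p * n + i)%N) = 0 /\ Y z (c, (p * n + (n.-1 - i))%N) = 0)) => i.
  by apply: codim_leI; apply: codim_le1.
have H3 : codim_le (\sum_(k : K) (~~ good k.1.1 k.1.2 k.2)%:R)
    (fun z : K -> R => forall k : K, ~~ good k.1.1 k.1.2 k.2 -> z k = 0).
  apply: (@codim_le_fin R K _ (fun k : K => (~~ good k.1.1 k.1.2 k.2)%:R)
     (fun k (z : K -> R) => ~~ good k.1.1 k.1.2 k.2 -> z k = 0)) => k.
  case: (good _ _ _) => /=; first by apply: codim_le_true.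
  by apply: codim_leW (lexx _) _ (codim_le1 (f := fun z => z k) _) => //.
have key := codim_le_card (codim_leI (codim_leI H1 H2) H3).
have cardE : #|K|%:R = \sum_(k : K) (good k.1.1 k.1.2 k.2)%:R + \sum_(k : K) (~~ good k.1.1 k.1.2 k.2)%:R :> R.
  rewrite -big_split /= -sum1_card natr_sum; apply: eq_bigr => k _.
  by case: (good _ _ _); rewrite ?addr0 ?add0r.
suff KL : #|K|%:R <= x + #|C|%:R * (P%:R * (2 * r%:R)) + \sum_(k : K) (~~ good k.1.1 k.1.2 k.2)%:R.
  have -> : \sum_c \sum_(p < P) \sum_(l < n) (good c p l)%:R = \sum_(k : K) (good k.1.1 k.1.2 k.2)%:R :> R.
    by rewrite pair_big pair_big.
  by move: KL; rewrite cardE; lra.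
apply: key => z [[Hz margin] bad] [[c0 p0] l0].
have zbad c (p : 'I_P) (l : 'I_n) : ~~ good c p l -> z (c, p, l) = 0 by move=> h; exact: (bad (c, p, l)).
have Ysupp c m : (m < n)%N || (P * n <= m)%N -> Y z (c, m) = 0.
  by rewrite /Y /= => /orP[|] h; case: ifP => //; lia.
have Yblk c (p : 'I_P) (i : nat) : (i < n)%N ->
    Y z (c, (p * n + i)%N) = \sum_(l < n) zz z c p l * sin (pi * l%:R / n%:R * i%:R).
  move=> iN; rewrite /Y /= divnMDl // divn_small // addn0 modnMDl modn_small //.
  have -> : (p * n + i < P * n)%N.
    apply: (@leq_trans (p.+1 * n)); first by rewrite mulSn addnC ltn_add2r.
    by rewrite leq_mul2r ltn_ord orbT.
  rewrite andbT; case: leqP => // h.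
  have p00 : p = 0%N :> nat by case: (posnP p) h => //; nia.
  rewrite big1 // => l _; rewrite zzE zbad ?mul0r //.
  by rewrite /good p00.
have {}Hz := Hz Ysupp.
pose zc c (p : 'I_P) (l : nat) := zz z c p l.
have zc0 c p : zc c p 0%N = 0.
  rewrite /zc (zzE z c p (Ordinal n0)); apply: zbad.
  by rewrite /good /= andbF.
have blkm c (p : 'I_P) (i : nat) : (i < n)%N -> (i < r)%N || (n <= i + r)%N -> Y z (c, (p * n + i)%N) = 0.
  move=> iN /orP[ir|ir]; first by have [] := margin c p (Ordinal ir).
  have h : (n.-1 - i < r)%N by lia.
  have [_] := margin c p (Ordinal h) => /=.
  by have -> : (n.-1 - (n.-1 - i) = i)%N by lia.
have N2 : 0 < n%:R / 2 :> R by rewrite divr_gt0 // ltr0n.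
have lowc c : gam c * toeplitz_form a (P * n) (fun m => Y z (c, m)) >=
    \sum_(p < P) n%:R / 2 * \sum_(l < n) gam c * (band_symbol a r (th l) - e) * z (c, p, l) ^+ 2.
  have ys m : (P * n <= m)%N -> Y z (c, m) = 0 by move=> h; apply: Ysupp; rewrite h orbT.
  have := toeplitz_band a0 He ys; rewrite ler_norml => /andP[band _].
  have {}band : \sum_(k < r.+1) cosine_coef a k * autocorr (P * n) k (fun m => Y z (c, m))
     - e * sqnorm (P * n) (fun m => Y z (c, m)) <= toeplitz_form a (P * n) (fun m => Y z (c, m)).
    by move: band; rewrite lerBrDl addrC; apply: le_trans; rewrite addrC.
  apply: le_trans (ler_wpM2l (g0 c) band).
  have -> : \sum_(k < r.+1) cosine_coef a k * autocorr (P * n) k (fun m => Y z (c, m))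
     = \sum_(p < P) n%:R / 2 * \sum_(l < n) band_symbol a r (th l) * z (c, p, l) ^+ 2.
    transitivity (\sum_(p < P) \sum_(k < r.+1) cosine_coef a k *
        \sum_(i < n) Y z (c, (p * n + i)%N) * Y z (c, (p * n + (i + k))%N)).
      rewrite exchange_big; apply: eq_bigr => k _; rewrite -mulr_sumr /autocorr.
      have := sum_ord_blocks P n 0 (fun m => Y z (c, m) * Y z (c, (m + k)%N)).
      rewrite addn0 big_ord0 addr0 => ->; congr (_ * _).
      by apply: eq_bigr => p _; apply: eq_bigr => i _; rewrite addnA.
    apply: eq_bigr => p _.
    have := block_symbol a (zc0 c p) (x := fun i => Y z (c, (p * n + i)%N)) (Yblk c p) (blkm c p).
    by move=> ->; congr (_ * _); apply: eq_bigr => l _; rewrite /zc zzE.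
  have -> : sqnorm (P * n) (fun m => Y z (c, m)) = \sum_(p < P) n%:R / 2 * \sum_(l < n) z (c, p, l) ^+ 2.
    have := sum_ord_blocks P n 0 (fun m => Y z (c, m) ^+ 2).
    rewrite addn0 big_ord0 addr0 /sqnorm => ->; apply: eq_bigr => p _.
    rewrite (block_sqnorm (zc0 c p) (x := fun i => Y z (c, (p * n + i)%N)) (Yblk c p) (blkm c p)).
    by congr (_ * _); apply: eq_bigr => l _; rewrite /zc zzE.
  rewrite (mulr_sumr _ _ _ e) -sumrB mulr_sumr le_eqVlt; apply/orP; left; apply/eqP.
  apply: eq_bigr => p _; rewrite mulrCA -mulrBr [RHS]mulrCA; congr (_ * _).
  by rewrite mulr_sumr -sumrB mulr_sumr; apply: eq_bigr => l _; ring.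
have upc c : \sum_(m < P * n) W m * Y z (c, nat_of_ord m) ^+ 2 <=
    \sum_(p < P) n%:R / 2 * \sum_(l < n) W (p.+1 * n)%N * z (c, p, l) ^+ 2.
  have := sum_ord_blocks P n 0 (fun m => W m * Y z (c, m) ^+ 2).
  rewrite addn0 big_ord0 addr0 => ->; apply: ler_sum => p _.
  rewrite -mulr_sumr mulrCA.
  have := block_sqnorm (zc0 c p) (x := fun i => Y z (c, (p * n + i)%N)) (Yblk c p) (blkm c p).
  under [X in _ = _ * X -> _]eq_bigr do rewrite /zc zzE.
  move=> <-; rewrite mulr_sumr; apply: ler_sum => i _; apply: ler_wpM2r; first exact: sqr_ge0.
  apply: Wmono; rewrite mulSn addnC leq_add2r; exact: ltnW.
have tot : \sum_c \sum_(p < P) n%:R / 2 * \sum_(l < n)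
    (gam c * (band_symbol a r (th l) - e) - t * W (p.+1 * n)%N) * z (c, p, l) ^+ 2 <= 0.
  have := le_trans (ler_sum _ (fun c _ => lowc c))
     (le_trans Hz (ler_wpM2l (ltW t0) (ler_sum _ (fun c _ => upc c)))).
  rewrite mulr_sumr -subr_le0 -sumrB; apply: le_trans; apply: ler_sum => c _.
  rewrite mulr_sumr -sumrB; apply: ler_sum => p _.
  rewrite mulrCA -mulrBr ler_pM2l // mulr_sumr -sumrB; apply: ler_sum => l _.
  by rewrite [t * (_ * _)]mulrA -mulrBl.
have pos c (p : 'I_P) (l : 'I_n) : 0 <= (gam c * (band_symbol a r (th l) - e) - t * W (p.+1 * n)%N) * z (c, p, l) ^+ 2.
  case: (boolP (good c p l)) => [/and3P[_ _ h]|/zbad ->]; last by rewrite expr0n mulr0.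
  by rewrite mulr_ge0 ?sqr_ge0 // subr_ge0 ltW.
case: (boolP (good c0 p0 l0)) => [gd|/zbad //].
have/and3P[_ _ h] := gd.
have Sp c (p : 'I_P) : 0 <= n%:R / 2 * \sum_(l < n)
    (gam c * (band_symbol a r (th l) - e) - t * W (p.+1 * n)%N) * z (c, p, l) ^+ 2.
  by apply: mulr_ge0; [exact: ltW|apply: sumr_ge0 => l _].
(* A sum of nonnegative terms that is at most 0 has only zero terms; the three sums are peeled off
   down to the mode [(c0, p0, l0)]. *)
have e1 : \sum_c \sum_(p < P) n%:R / 2 * \sum_(l < n)
    (gam c * (band_symbol a r (th l) - e) - t * W (p.+1 * n)%N) * z (c, p, l) ^+ 2 = 0.
  by apply/eqP; rewrite eq_le tot /=; apply: sumr_ge0 => c _; apply: sumr_ge0.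
have e2 := @psumr_eq0P _ _ xpredT _ (fun c _ => sumr_ge0 _ (fun p _ => Sp c p)) e1 c0 isT.
have e3 := @psumr_eq0P _ _ xpredT _ (fun p _ => Sp c0 p) e2 p0 isT.
have /eqP := e3; rewrite mulf_eq0 gt_eqF //= => /eqP e4.
have e5 := @psumr_eq0P _ _ xpredT _ (fun l _ => pos c0 p0 l) e4 l0 isT.
move: e5 => /eqP; rewrite mulf_eq0 subr_eq0 gt_eqF //= sqrf_eq0 => /eqP.
exact.
Qed.

End toeplitz.

(** * Sums of exponentials *)

Section gram.
Context {R : realType}.

Lemma cauchy_schwarz_sum (T : finType) (a b : T -> R) :
  (\sum_i a i * b i) ^+ 2 <= (\sum_i a i ^+ 2) * (\sum_i b i ^+ 2).
Proof.
have : 0 <= \sum_i \sum_j (a i * b j - a j * b i) ^+ 2.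
  by apply: sumr_ge0 => i _; apply: sumr_ge0 => j _; exact: sqr_ge0.
have -> : \sum_i \sum_j (a i * b j - a j * b i) ^+ 2 =
   \sum_i \sum_j (a i ^+ 2 * b j ^+ 2) + \sum_i \sum_j (b i ^+ 2 * a j ^+ 2)
   - 2 * \sum_i \sum_j (a i * b i) * (a j * b j).
  rewrite mulr_sumr -big_split -sumrB; apply: eq_bigr => i _.
  by rewrite mulr_sumr -big_split -sumrB; apply: eq_bigr => j _ /=; ring.
have dist (f g : T -> R) : \sum_i \sum_j f i * g j = (\sum_i f i) * (\sum_j g j).
  by rewrite mulr_suml; apply: eq_bigr => i _; rewrite mulr_sumr.
rewrite !dist expr2 (mulrC (\sum_i b i ^+ 2)); lra.
Qed.

(* With [u = A^T v], the hypothesis says [|A u|^2 <= t |u|^2]. *)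
Lemma adjoint_bound (J K : finType) (A : K -> J -> R) (v : K -> R) (t : R) : 0 < t ->
  \sum_k (\sum_j A k j * \sum_k' A k' j * v k') ^+ 2
    <= t * \sum_j (\sum_k A k j * v k) ^+ 2 ->
  \sum_j (\sum_k A k j * v k) ^+ 2 <= t * \sum_k v k ^+ 2.
Proof.
move=> t0; set u := fun j => \sum_k A k j * v k; set w := fun k => \sum_j A k j * u j.
move=> H.
have X : \sum_k w k * v k = \sum_j u j ^+ 2.
  rewrite /w; under eq_bigr do rewrite mulr_suml.
  rewrite exchange_big; apply: eq_bigr => j _.
  have -> : u j ^+ 2 = \sum_k u j * (A k j * v k) by rewrite -mulr_sumr expr2.
  by apply: eq_bigr => k _; ring.
have : 0 <= \sum_k (w k - t * v k) ^+ 2 by apply: sumr_ge0 => k _; exact: sqr_ge0.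
have -> : \sum_k (w k - t * v k) ^+ 2 = \sum_k w k ^+ 2 - 2 * t * (\sum_k w k * v k) + t ^+ 2 * \sum_k v k ^+ 2.
  by rewrite !mulr_sumr -sumrB -big_split; apply: eq_bigr => k _ /=; ring.
have H' : \sum_k w k ^+ 2 <= t * \sum_j u j ^+ 2 := H.
rewrite X -/(u _) => H0.
have : t * \sum_j u j ^+ 2 <= t * (t * \sum_k v k ^+ 2) by rewrite mulrA -expr2; lra.
by rewrite ler_pM2l.
Qed.

Lemma abel_sum_bound (x f : nat -> R) (B : R) (n : nat) :
  (forall m, `|\sum_(j < m) x j| <= B) -> (forall j, 0 <= f j) -> (forall j, f j.+1 <= f j) ->
  `|\sum_(j < n) x j * f j| <= B * f 0%N.
Proof.
move=> HB f0 fd.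
have E : \sum_(j < n) x j * f j = (\sum_(i < n) x i) * f n
    + \sum_(j < n) (\sum_(i < j.+1) x i) * (f j - f j.+1).
  elim: n => [|n IH]; first by rewrite !big_ord0 mul0r addr0.
  by rewrite big_ord_recr /= IH [in RHS]big_ord_recr /= !big_ord_recr /=; ring.
have T : \sum_(j < n) (f j - f j.+1) = f 0%N - f n.
  elim: n {E} => [|n IH]; first by rewrite big_ord0 subrr.
  by rewrite big_ord_recr /= IH; ring.
rewrite E; apply: (le_trans (ler_normD _ _)).
have -> : B * f 0%N = B * f n + B * (f 0%N - f n) by ring.
apply: lerD; first by rewrite normrM (ger0_norm (f0 n)); apply: ler_wpM2r.
rewrite -T mulr_sumr; apply: (le_trans (ler_norm_sum _ _ _)); apply: ler_sum => j _.
have d0 : 0 <= f j - f j.+1 by rewrite subr_ge0.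
by rewrite normrM (ger0_norm d0); apply: ler_wpM2r.
Qed.

Lemma geometric_expR_sum (s : R) (N : nat) : 0 < s ->
  \sum_(j < N) expR (- (j%:R * s)) = (1 - expR (- (N%:R * s))) / (1 - expR (- s)).
Proof.
move=> s0; have d0 : 1 - expR (- s) != 0.
  by rewrite subr_eq0 eq_sym lt_eqF // expR_lt1 oppr_lt0.
elim: N => [|N IH]; first by rewrite big_ord0 mul0r oppr0 expR0 subrr mul0r.
rewrite big_ord_recr /= IH.
have -> : - (N.+1%:R * s) = - (N%:R * s) + - s by rewrite -natr1; ring.
rewrite expRD; by field.
Qed.

Lemma inv_1m_expRN (s : R) : 0 < s -> s^-1 <= (1 - expR (- s))^-1 <= s^-1 + 1.
Proof.
move=> s0; have d0 : 0 < 1 - expR (- s) by rewrite subr_gt0 expR_lt1 oppr_lt0.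
have e1 := expR_ge1Dx (- s).
have e2 := expR_ge1Dx s.
apply/andP; split; first by rewrite lef_pV2 ?posrE //; lra.
have -> : s^-1 + 1 = (s / (1 + s))^-1 by field; rewrite !gt_eqF // ltr_wpDl.
have s1 : 0 < 1 + s by rewrite ltr_wpDl.
rewrite lef_pV2 ?posrE ?divr_gt0 //.
have : expR (- s) <= (1 + s)^-1 by rewrite expRN lef_pV2 ?posrE ?expR_gt0.
have -> : s / (1 + s) = 1 - (1 + s)^-1 by field; rewrite gt_eqF.
lra.
Qed.

(** [1 / (1 - exp (-s))] lies between [1 / s] and [1 / s + 1], and the rest of the geometric sum
    dies out uniformly in [s >= lo]. A bounded error is enough: it is later multiplied by the small
    total weight of the nodes in use. *)
Lemma geometric_expR_approx (lo : R) : 0 < lo ->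
  exists N0 : nat, forall (N : nat) (s : R), (N0 <= N)%N -> lo <= s ->
    `|\sum_(j < N) expR (- (j%:R * s)) - s^-1| <= 1.
Proof.
move=> lo0.
exists (Num.truncn ((1 - expR (- lo))^-1 / lo)).+1 => N s NN ls.
have s0 : 0 < s := lt_le_trans lo0 ls.
rewrite geometric_expR_sum //.
have /andP[h1 h2] := inv_1m_expRN s0.
set D := (1 - expR (- s))^-1 in h1 h2 *.
have d0 : 0 < 1 - expR (- lo) by rewrite subr_gt0 expR_lt1 oppr_lt0.
have D0 : 0 < D by rewrite /D invr_gt0 subr_gt0 expR_lt1 oppr_lt0.
have DD : D <= (1 - expR (- lo))^-1.
  rewrite /D lef_pV2 ?posrE //; last by rewrite subr_gt0 expR_lt1 oppr_lt0.
  by rewrite lerD2l lerN2 ler_expR lerN2.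
have small : expR (- (N%:R * s)) * D <= 1.
  rewrite expRN mulrC ler_pdivrMr ?expR_gt0 // mul1r.
  apply: (le_trans DD); apply: (@le_trans _ _ (N%:R * s)); last first.
    by apply: le_trans (expR_ge1Dx _); rewrite lerDr.
  rewrite -ler_pdivrMr //; apply: (@le_trans _ _ ((1 - expR (- lo))^-1 / lo)).
    by rewrite ler_pM2l ?invr_gt0 // lef_pV2.
  apply: ltW; apply: lt_le_trans (truncnS_gt _) _.
  by rewrite ler_nat.
have p0 : 0 <= expR (- (N%:R * s)) * D by rewrite mulr_ge0 ?expR_ge0 // ltW.
rewrite mulrBl mul1r ler_norml; apply/andP; split; lra.
Qed.

(** [chi c] are the oscillating factors and [kap c] is the mean of [chi c ^ 2]. By [chiB], products
    of two factors minus their mean have bounded partial sums. [lam] and [om] are the nodes and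
    weights of a sum of exponentials. *)
Context (C : finType) (chi : C -> nat -> R) (kap : C -> R) (B : R) (lam om : nat -> R).
Context (chiB : forall c c' n,
  `|\sum_(j < n) (chi c j * chi c' j - (c == c')%:R * kap c)| <= B).
Context (lam0 : forall m, 0 < lam m) (om0 : forall m, 0 <= om m).
Context (kap01 : forall c, 0 <= kap c <= 1).
Implicit Types (gam : C -> R) (v : C * nat -> R).

Definition frame gam (c : C) (m j : nat) : R :=
  Num.sqrt (gam c * om m) * (chi c j * expR (- (j%:R * lam m))).

(** The squared amplitudes of the frame elements, summed. Entrywise errors of Gram matrices are
    bounded by products of two amplitudes, so Cauchy-Schwarz turns this mass into an operator
    bound. *)
Definition frame_mass gam (M n0 : nat) : R :=
  \sum_c \sum_(m < M | (n0 <= m)%N) gam c * om m.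

Definition synthesis gam (M : nat) v (j : nat) : R :=
  \sum_c \sum_(m < M) frame gam c m j * v (c, nat_of_ord m).

Definition coef_sqnorm (M : nat) v : R := \sum_c \sum_(m < M) v (c, nat_of_ord m) ^+ 2.

Lemma coef_sqnorm_ge0 M v : 0 <= coef_sqnorm M v.
Proof. by apply: sumr_ge0 => c _; apply: sumr_ge0 => m _; exact: sqr_ge0. Qed.

Lemma frame_mass_ge0 gam M n0 : (forall c, 0 <= gam c) -> 0 <= frame_mass gam M n0.
Proof. by move=> g0; apply: sumr_ge0 => c _; apply: sumr_ge0 => m _; exact: mulr_ge0. Qed.

Lemma osc_bound_ge0 : 0 <= B \/ forall c : C, False.
Proof.
case: (pickP (fun _ : C => true)) => [c _|none]; last by right=> c; have := none c.
by left; apply: le_trans (chiB c c 0%N); exact: normr_ge0.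
Qed.

Lemma frame_inner gam gam' (c c' : C) (m m' N : nat) :
  \sum_(j < N) frame gam c m j * frame gam' c' m' j
    = Num.sqrt (gam c * om m) * Num.sqrt (gam' c' * om m') *
      ((c == c')%:R * kap c * \sum_(j < N) expR (- (j%:R * (lam m + lam m')))
       + \sum_(j < N) (chi c j * chi c' j - (c == c')%:R * kap c) * expR (- (j%:R * (lam m + lam m')))).
Proof.
rewrite mulr_sumr -big_split mulr_sumr; apply: eq_bigr => j _ /=.
have -> : - (j%:R * (lam m + lam m')) = - (j%:R * lam m) + - (j%:R * lam m') by ring.
by rewrite /frame expRD; ring.
Qed.

Lemma frame_osc_bound (c c' : C) (s : R) (N : nat) : 0 < s ->
  `|\sum_(j < N) (chi c j * chi c' j - (c == c')%:R * kap c) * expR (- (j%:R * s))| <= B.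
Proof.
move=> s0.
have := @abel_sum_bound (fun j => chi c j * chi c' j - (c == c')%:R * kap c)
  (fun j => expR (- (j%:R * s))) B N (chiB c c').
rewrite mul0r oppr0 expR0 mulr1; apply => [j|j]; first exact: expR_ge0.
by rewrite ler_expR lerN2 ler_wpM2r ?ler_nat // ltW.
Qed.

Lemma frame_abs_bound gam (M n0 : nat) v : (forall c, 0 <= gam c) ->
  (forall c m, (m < n0)%N -> v (c, m) = 0) ->
  (\sum_c \sum_(m < M) Num.sqrt (gam c * om m) * `|v (c, nat_of_ord m)|) ^+ 2
    <= frame_mass gam M n0 * coef_sqnorm M v.
Proof.
move=> gam0 v0; rewrite /coef_sqnorm.
rewrite pair_big pair_big /=.
have -> : \sum_(p : C * 'I_M) Num.sqrt (gam p.1 * om p.2) * `|v (p.1, nat_of_ord p.2)|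
  = \sum_(p : C * 'I_M) ((n0 <= p.2)%N%:R * Num.sqrt (gam p.1 * om p.2)) * `|v (p.1, nat_of_ord p.2)|.
  apply: eq_bigr => -[c m] _ /=; case: leqP => h; first by rewrite mul1r.
  by rewrite v0 // normr0 !mulr0.
apply: (le_trans (cauchy_schwarz_sum _ _)).
rewrite le_eqVlt; apply/orP; left; apply/eqP; congr (_ * _).
  rewrite /frame_mass; under [RHS]eq_bigr => c _ do rewrite big_mkcond.
  rewrite pair_big; apply: eq_bigr => -[c m] _ /=; rewrite exprMn sqr_sqrtr ?mulr_ge0 //.
  by case: leqP => _; rewrite ?expr1n ?mul1r // expr0n mul0r.
by apply: eq_bigr => p _; rewrite real_normK ?num_real.
Qed.

(** Entry by entry, the mean of [chi c * chi c'] gives [1 / (lam m + lam m')] on equal channels, and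
    Abel summation bounds the rest by [B]. The error is dominated by a rank-one form, hence by the
    mass of the nodes [m >= n0] that [v] uses. [N0] only has to resolve the smallest of the [M]
    nodes. *)
Lemma synthesis_sqnorm_approx gam (M : nat) : (forall c, 0 <= gam c) ->
  exists N0 : nat, forall (N n0 : nat) v, (N0 <= N)%N ->
  (forall c m, (m < n0)%N -> v (c, m) = 0) ->
  `|sqnorm N (synthesis gam M v) - \sum_c gam c * kap c * \sum_(m < M) \sum_(m' < M)
      Num.sqrt (om m) * Num.sqrt (om m') / (lam m + lam m') * (v (c, nat_of_ord m) * v (c, nat_of_ord m'))|
  <= (B + 1) * (frame_mass gam M n0 * coef_sqnorm M v).
Proof.
move=> gam0.
have [lo lo0 Hlo] : exists2 lo : R, 0 < lo & forall m, (m < M)%N -> lo <= lam m.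
  elim: M => [|M [lo lo0 IH]]; first by exists 1.
  exists (Num.min lo (lam M)); first by rewrite lt_min lo0 lam0.
  move=> m; rewrite ltnS leq_eqVlt => /orP[/eqP ->|/IH h]; first by rewrite ge_min lexx orbT.
  by rewrite ge_min h.
have [N0 HN0] := geometric_expR_approx lo0.
exists N0 => N n0 v NN v0.
case: osc_bound_ge0 => [B0|C0]; last first.
  have C0' (F : C -> R) : \sum_c F c = 0 by apply: big1 => c; have := C0 c.
  rewrite /frame_mass /sqnorm big1 => [|j _]; last by rewrite /synthesis C0' expr0n.
  by rewrite !C0' subrr normr0 mul0r mulr0.
apply: le_trans (ler_wpM2l (addr_ge0 B0 ler01) (frame_abs_bound M gam0 v0)).
pose s c m := Num.sqrt (gam c * om m).
pose S m m' := \sum_(j < N) expR (- (j%:R * (lam m + lam m'))) : R.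
pose r c c' m m' := \sum_(j < N) (chi c j * chi c' j - (c == c')%:R * kap c) * expR (- (j%:R * (lam m + lam m'))).
have -> : sqnorm N (synthesis gam M v) = \sum_c \sum_(m < M) \sum_c' \sum_(m' < M)
   s c m * s c' m' * ((c == c')%:R * kap c * S m m' + r c c' m m') * (v (c, nat_of_ord m) * v (c', nat_of_ord m')).
  transitivity (\sum_(j < N) \sum_c \sum_(m < M) \sum_c' \sum_(m' < M)
      (frame gam c m j * frame gam c' m' j) * (v (c, nat_of_ord m) * v (c', nat_of_ord m'))).
    apply: eq_bigr => j _; rewrite expr2 {1}/synthesis mulr_suml; apply: eq_bigr => c _.
    rewrite mulr_suml; apply: eq_bigr => m _; rewrite /synthesis mulr_sumr; apply: eq_bigr => c' _.
    by rewrite mulr_sumr; apply: eq_bigr => m' _; ring.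
  rewrite exchange_big; apply: eq_bigr => c _; rewrite exchange_big; apply: eq_bigr => m _.
  rewrite exchange_big; apply: eq_bigr => c' _; rewrite exchange_big; apply: eq_bigr => m' _.
  by rewrite -mulr_suml frame_inner.
have -> : \sum_c gam c * kap c * \sum_(m < M) \sum_(m' < M)
      Num.sqrt (om m) * Num.sqrt (om m') / (lam m + lam m') * (v (c, nat_of_ord m) * v (c, nat_of_ord m'))
  = \sum_c \sum_(m < M) \sum_c' \sum_(m' < M)
   s c m * s c' m' * ((c == c')%:R * kap c * (lam m + lam m')^-1) * (v (c, nat_of_ord m) * v (c', nat_of_ord m')).
  apply: eq_bigr => c _; rewrite mulr_sumr; apply: eq_bigr => m _.
  rewrite (bigD1 c) //= [X in _ = _ + X]big1 ?addr0; last first.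
    move=> c' cc'; apply: big1 => m' _; rewrite eq_sym (negbTE cc') !mul0r mulr0 mul0r //.
  rewrite mulr_sumr; apply: eq_bigr => m' _; rewrite eqxx /s !sqrtrM //.
  rewrite -{1}(sqr_sqrtr (gam0 c)) mul1r; ring.
rewrite -sumrB; under eq_bigr => c _ do rewrite -sumrB.
rewrite expr2 mulr_suml mulr_sumr; apply: (le_trans (ler_norm_sum _ _ _)); apply: ler_sum => c _.
rewrite mulr_suml mulr_sumr; apply: (le_trans (ler_norm_sum _ _ _)); apply: ler_sum => m _.
rewrite -sumrB mulr_sumr mulr_sumr; apply: (le_trans (ler_norm_sum _ _ _)); apply: ler_sum => c' _.
rewrite -sumrB mulr_sumr mulr_sumr; apply: (le_trans (ler_norm_sum _ _ _)); apply: ler_sum => m' _.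
rewrite -mulrBl -mulrBr !normrM (ger0_norm (sqrtr_ge0 _)) (ger0_norm (sqrtr_ge0 _)).
rewrite -/(s c m) -/(s c' m').
have -> : (B + 1) * (s c m * `|v (c, nat_of_ord m)| * (s c' m' * `|v (c', nat_of_ord m')|))
  = s c m * s c' m' * (B + 1) * (`|v (c, nat_of_ord m)| * `|v (c', nat_of_ord m')|) by ring.
apply: ler_wpM2r; first exact: mulr_ge0.
apply: ler_wpM2l; first by rewrite mulr_ge0 // sqrtr_ge0.
rewrite addrAC -mulrBr; apply: (le_trans (ler_normD _ _)); rewrite addrC.
apply: lerD; first by apply: frame_osc_bound; rewrite addr_gt0.
have /andP[k0 k1] := kap01 c.
have h : `|S m m' - (lam m + lam m')^-1| <= 1.
  apply: HN0 => //; rewrite -[lo]addr0; apply: lerD; [exact: Hlo|exact: ltW].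
rewrite normrM; apply: (@le_trans _ _ (1 * 1)); last by rewrite mulr1.
apply: ler_pM => //.
by rewrite normrM (ger0_norm k0); case: eqP => _; rewrite ?normr1 ?normr0 ?mul1r ?mul0r.
Qed.

(** As [gam * gam' = 0] channel by channel, no pair of equal channels contributes, and every other
    entry is a purely oscillating sum, bounded by [B]. *)
Lemma synthesis_cross_bound gam gam' (M M' N n0 : nat) v :
  (forall c, 0 <= gam c) -> (forall c, 0 <= gam' c) -> (forall c, gam c * gam' c = 0) ->
  (forall c m, (m < n0)%N -> v (c, m) = 0) ->
  \sum_c \sum_(m < M') (\sum_(j < N) frame gam' c m j * synthesis gam M v j) ^+ 2
    <= B ^+ 2 * (frame_mass gam' M' 0 * (frame_mass gam M n0 * coef_sqnorm M v)).
Proof.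
move=> g0 g0' gg v0.
case: osc_bound_ge0 => [B0|C0]; last first.
  have C0' (F : C -> R) : \sum_c F c = 0 by apply: big1 => c; have := C0 c.
  by rewrite /frame_mass !C0' mul0r mulr0.
have fa := frame_abs_bound M g0 v0.
set X := \sum_c \sum_(m < M) _ in fa.
apply: le_trans (ler_wpM2l (sqr_ge0 B) (ler_wpM2l (frame_mass_ge0 M' 0 g0') fa)).
rewrite /frame_mass mulrCA mulr_suml; apply: ler_sum => c' _.
rewrite mulr_suml; apply: ler_sum => m' _.
have -> : gam' c' * om m' * (B ^+ 2 * X ^+ 2) = (Num.sqrt (gam' c' * om m') * (B * X)) ^+ 2.
  by rewrite !exprMn sqr_sqrtr // mulr_ge0.
have X0 : 0 <= X by apply: sumr_ge0 => c _; apply: sumr_ge0 => m _; rewrite mulr_ge0 ?sqrtr_ge0.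
rewrite -[leLHS]real_normK ?num_real // lerXn2r ?nnegrE ?normr_ge0 ?mulr_ge0 ?sqrtr_ge0 //.
have -> : \sum_(j < N) frame gam' c' m' j * synthesis gam M v j
   = \sum_c \sum_(m < M) v (c, nat_of_ord m) * \sum_(j < N) frame gam c m j * frame gam' c' m' j.
  under eq_bigr => j _ do rewrite /synthesis mulr_sumr.
  rewrite exchange_big; apply: eq_bigr => c _.
  under eq_bigr => j _ do rewrite mulr_sumr.
  rewrite exchange_big; apply: eq_bigr => m _; rewrite mulr_sumr.
  by apply: eq_bigr => j _; ring.
rewrite /X mulr_sumr mulr_sumr; apply: (le_trans (ler_norm_sum _ _ _)); apply: ler_sum => c _.
rewrite mulr_sumr mulr_sumr; apply: (le_trans (ler_norm_sum _ _ _)); apply: ler_sum => m _.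
rewrite frame_inner normrM normrM.
have [cc|cc] := eqVneq c c'.
  have -> : Num.sqrt (gam c * om m) * Num.sqrt (gam' c' * om m') = 0.
    by rewrite -sqrtrM ?mulr_ge0 // mulrACA -cc gg mul0r sqrtr0.
  by rewrite normr0 mul0r mulr0 !mulr_ge0 ?sqrtr_ge0.
rewrite !mul0r add0r normrM (ger0_norm (sqrtr_ge0 _)) (ger0_norm (sqrtr_ge0 _)).
have := @frame_osc_bound c c' (lam m + lam m') N (addr_gt0 (lam0 _) (lam0 _)).
rewrite (negbTE cc) mul0r => ob.
have -> : Num.sqrt (gam' c' * om m') * (B * (Num.sqrt (gam c * om m) * `|v (c, nat_of_ord m)|))
  = `|v (c, nat_of_ord m)| * (Num.sqrt (gam c * om m) * Num.sqrt (gam' c' * om m') * B) by ring.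
apply: ler_wpM2l => //; apply: ler_wpM2l; first by rewrite mulr_ge0 ?sqrtr_ge0.
by [].
Qed.

End gram.

(** * The model kernel, its differences and its approximation by exponentials *)

Section differences.
Context {R : realType}.
Implicit Types (f df : R -> R).

Lemma mean_value f df (a b : R) : a < b ->
  (forall x, a <= x <= b -> is_derive x 1 f (df x)) ->
  exists2 c, a < c < b & f b - f a = df c * (b - a).
Proof.
move=> ab H; have [x|x xab|c cab E] := @MVT R f df a b ab.
- by rewrite in_itv /= => /andP[h1 h2]; apply: H; rewrite !ltW.
- by apply: derivable_within_continuous => y; rewrite in_itv /= => /H [].
by exists c => //; move: cab; rewrite in_itv.
Qed.

Definition diffR (h : R) f : R -> R := fun x => f (x + h) - f x.

Lemma is_derive_diffR (lo h : R) f df : 0 <= h ->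
  (forall x, lo < x -> is_derive x 1 f (df x)) ->
  forall x, lo < x -> is_derive x 1 (diffR h f) (diffR h df x).
Proof.
move=> h0 H x lx; have lxh : lo < x + h by apply: lt_le_trans lx _; rewrite lerDl.
have d1 : is_derive x 1 (fun y => y + h) 1.
  have := is_deriveD (is_derive_id x 1) (is_derive_cst h x 1).
  by rewrite addr0.
have d2 : is_derive x 1 (f \o (fun y => y + h)) (df (x + h) * 1).
  by apply: is_derive1_comp; apply: H.
rewrite mulr1 in d2.
exact: (is_deriveB d2 (H x lx)).
Qed.

Lemma is_derive_iter_diffR (lo h : R) f df (k : nat) : 0 <= h ->
  (forall x, lo < x -> is_derive x 1 f (df x)) ->
  forall x, lo < x -> is_derive x 1 (iter k (diffR h) f) (iter k (diffR h) df x).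
Proof.
by move=> h0 H; elim: k => [//|k IH] x lx; apply: (is_derive_diffR h0 IH).
Qed.

(** Differences commute with differentiation, so one difference is traded for one derivative while
    [k] differences remain. *)
Lemma iter_diffR_mean_value (lo h : R) f df (k : nat) (x : R) : 0 < h ->
  (forall x, lo < x -> is_derive x 1 f (df x)) -> lo < x ->
  exists2 c, x < c < x + h & iter k.+1 (diffR h) f x = iter k (diffR h) df c * h.
Proof.
move=> h0 H lx.
have D y : x <= y <= x + h -> is_derive y 1 (iter k (diffR h) f) (iter k (diffR h) df y).
  by move=> /andP[h1 _]; exact: (is_derive_iter_diffR k (ltW h0) H (lt_le_trans lx h1)).
have xh : x < x + h by rewrite ltrDl.
have [c cx E] := mean_value xh D.
by exists c => //; rewrite iterS /diffR E addrAC subrr add0r.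
Qed.

Lemma iter_diffR_linear (h a b : R) f g (k : nat) (x : R) :
  iter k (diffR h) (fun y => a * f y + b * g y) x
    = a * iter k (diffR h) f x + b * iter k (diffR h) g x.
Proof.
have -> : iter k (diffR h) (fun y => a * f y + b * g y)
  = fun y => a * iter k (diffR h) f y + b * iter k (diffR h) g y; last by [].
elim: k => [//|k IH]; apply/funext => y; rewrite iterS IH !iterS /diffR; ring.
Qed.

Lemma telescopeE (u : nat -> R) (n : nat) : telescope u n = u n.+1 - u n.
Proof. by []. Qed.

Lemma iter_telescope_diffR (f : R -> R) (k : nat) (j : nat) :
  iter k telescope (fun i => f i%:R) j = iter k (diffR 1) f j%:R.
Proof.
elim: k j => [//|k IH] j; rewrite !iterS telescopeE /diffR !IH.
by rewrite -natr1.
Qed.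

(* [x^-a (ln x)^-b] for [x > 1], in a form that is easy to differentiate *)
Definition log_power (a b x : R) : R := expR (- (a * ln x) - b * ln (ln x)).

Lemma log_power_gt0 a b x : 0 < log_power a b x.
Proof. exact: expR_gt0. Qed.

Lemma log_powerE (n : nat) (alpha : R) (j : nat) : (2 <= j)%N ->
  log_power n%:R alpha j%:R = j%:R ^- n * logpow alpha j.
Proof.
move=> j2; have j0 : 0 < j%:R :> R by rewrite ltr0n; lia.
have l0 : 0 < ln j%:R :> R by apply: ln_gt0; rewrite ltr1n.
rewrite /log_power expRD expRN expRM_natl lnK ?posrE //; congr (_ * _).
by rewrite /logpow /powR gt_eqF // mulNr.
Qed.

Lemma log_power_le a b (x y : R) : 0 <= a -> 0 <= b -> 1 < x -> x <= y ->
  log_power a b y <= log_power a b x.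
Proof.
move=> a0 b0 x1 xy; rewrite /log_power ler_expR.
have x0 : 0 < x by apply: lt_trans x1.
have lx := ln_gt0 x1.
have h1 : ln x <= ln y by rewrite ler_ln ?posrE // (lt_le_trans x0).
have h2 : ln (ln x) <= ln (ln y) by rewrite ler_ln ?posrE // (lt_le_trans lx).
have := ler_wpM2l a0 h1; have := ler_wpM2l b0 h2; lra.
Qed.

Lemma is_derive_log_power a b (x : R) : 1 < x ->
  is_derive x 1 (log_power a b) (- a * log_power (a + 1) b x + - b * log_power (a + 1) (b + 1) x).
Proof.
move=> x1; have x0 : 0 < x by apply: lt_trans x1.
have lx := ln_gt0 x1.
have d1 := is_derive1_ln x0.
have d2 : is_derive x 1 (@ln R \o @ln R) ((ln x)^-1 * x^-1).
  by apply: is_derive1_comp; exact: is_derive1_ln.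
have d3 := is_deriveB (is_deriveN (is_deriveZ a d1)) (is_deriveZ b d2).
have d4 := is_derive1_comp (is_derive_expR _) d3.
apply: (is_derive_eq (f := log_power a b) d4).
rewrite /log_power /GRing.scale /=.
have e1 c : expR (- ((a + 1) * ln x) - c) = x^-1 * expR (- (a * ln x) - c).
  rewrite -[in X in _ = X * _](lnK x0) -expRN -expRD; congr expR; ring.
have e2 : expR (- (a * ln x) - (b + 1) * ln (ln x)) = (ln x)^-1 * expR (- (a * ln x) - b * ln (ln x)).
  rewrite -[in X in _ = X * _](lnK lx) -expRN -expRD; congr expR; ring.
rewrite !e1 e2; ring.
Qed.

(** The derivative stays within the family [log_power], with [a] raised by 1, which gives an
    induction on [k]; the extra logarithm in one of the two terms is absorbed by [ln x >= ln 2]. *)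
Lemma iter_diffR_log_power (k : nat) (a b : R) : 0 <= a -> 0 <= b ->
  exists2 c, 0 <= c & forall x, 2 <= x ->
    `|iter k (diffR 1) (log_power a b) x| <= c * log_power (a + k%:R) b x.
Proof.
elim: k a b => [|k IH] a b a0 b0.
  by exists 1 => // x _; rewrite addr0 mul1r ger0_norm // ltW // log_power_gt0.
have [c1 c10 H1] := IH (a + 1) b (addr_ge0 a0 ler01) b0.
have [c2 c20 H2] := IH (a + 1) (b + 1) (addr_ge0 a0 ler01) (addr_ge0 b0 ler01).
exists (a * c1 + b * (c2 / ln 2)).
  by apply: addr_ge0; apply: mulr_ge0 => //; apply: divr_ge0 => //; exact: ltW ln2_gt0.
move=> x x2; have x1 : 1 < x by apply: lt_le_trans x2; rewrite ltr1n.
have [c /andP[xc _] ->] := iter_diffR_mean_value k ltr01 (@is_derive_log_power a b) x1.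
rewrite mulr1 iter_diffR_linear.
have c2' : 2 <= c by apply: le_trans x2 (ltW xc).
apply: (le_trans (ler_normD _ _)); rewrite !normrM !normrN (ger0_norm a0) (ger0_norm b0) mulrDl.
have aE : a + k.+1%:R = a + 1 + k%:R by rewrite -natr1; ring.
have ak0 : 0 <= a + 1 + k%:R by rewrite !addr_ge0.
have mono b' : 0 <= b' -> log_power (a + 1 + k%:R) b' c <= log_power (a + 1 + k%:R) b' x.
  by move=> b'0; apply: log_power_le => //; exact: ltW.
apply: lerD.
  rewrite -mulrA; apply: ler_wpM2l => //; apply: (le_trans (H1 c c2')).
  by rewrite aE; apply: ler_wpM2l => //; exact: mono.
rewrite -mulrA; apply: ler_wpM2l => //; apply: (le_trans (H2 c c2')).
rewrite -mulrA; apply: ler_wpM2l => //; rewrite aE.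
apply: (le_trans (mono _ (addr_ge0 b0 ler01))).
have lx : ln 2 <= ln x by rewrite ler_ln ?posrE // (lt_le_trans _ x2).
have l2 : 0 < ln 2 :> R := ln2_gt0.
have lx0 := lt_le_trans l2 lx.
have -> : log_power (a + 1 + k%:R) (b + 1) x = (ln x)^-1 * log_power (a + 1 + k%:R) b x.
  rewrite /log_power -[in X in _ = X * _](lnK lx0) -expRN -expRD; congr expR; ring.
by apply: ler_wpM2r; [exact: ltW (log_power_gt0 _ _ _)|rewrite lef_pV2].
Qed.

Definition model_kernel (alpha : R) (j : nat) : R := j%:R^-1 * logpow alpha j.

Lemma iter_telescope_model_kernel (alpha : R) (k : nat) : 0 < alpha ->
  exists2 c, 0 < c & forall j, (2 <= j)%N ->
    `|iter k telescope (model_kernel alpha) j| <= c * (j%:R ^- k.+1 * logpow alpha j).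
Proof.
move=> al0; have [c c0 Hc] := iter_diffR_log_power k ler01 (ltW al0).
exists (c + 1); first by rewrite ltr_wpDl.
move=> j j2; have j2' : 2 <= j%:R :> R by rewrite ler_nat.
have -> : iter k telescope (model_kernel alpha) j = iter k telescope (fun i => log_power 1 alpha i%:R) j.
  have : forall i, (2 <= i)%N -> iter k telescope (model_kernel alpha) i = iter k telescope (fun i => log_power 1 alpha i%:R) i.
    elim: k {c c0 Hc} => [|k IH] i i2.
      by rewrite /= -[1]/(1%:R) log_powerE // expr1.
    by rewrite !iterS !telescopeE !IH // leqW.
  exact.
rewrite iter_telescope_diffR; apply: (le_trans (Hc _ j2')).
have -> : 1 + k%:R = k.+1%:R :> R by rewrite -natr1 addrC.
rewrite -log_powerE //; apply: ler_wpM2r; first exact: ltW (log_power_gt0 _ _ _).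
by rewrite lerDl.
Qed.


(* [1 / (j (ln j)^alpha)] behaves like [int_0^1 exp(-j x) |ln x|^(-alpha) dx]; these are the
   nodes [x = q^m], [q = exp(-d)], and weights of a geometric Riemann sum for it. *)
Definition node (d : R) (m : nat) : R := expR (- (m%:R * d)).

Definition node_weight (alpha d : R) (m : nat) : R :=
  (1 - expR (- d)) * node d m * (m%:R * d) `^ (- alpha).

Definition expo_model (alpha d : R) (M : nat) (x : R) : R :=
  \sum_(m < M) node_weight alpha d m * expR (- (x * node d m)).

Lemma node_gt0 d m : 0 < node d m. Proof. exact: expR_gt0. Qed.

Lemma node_succ d m : node d m - node d m.+1 = (1 - expR (- d)) * node d m.
Proof.
have -> : node d m.+1 = expR (- d) * node d m.
  by rewrite /node -expRD; congr expR; rewrite -natr1; ring.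
ring.
Qed.

Lemma node_weight_ge0 alpha d m : 0 <= d -> 0 <= node_weight alpha d m.
Proof.
move=> d0; rewrite /node_weight mulr_ge0 ?powR_ge0 // mulr_ge0 ?(ltW (node_gt0 _ _)) //.
by rewrite subr_ge0 expR_le1 oppr_le0.
Qed.

(** A Riemann sum for the integral of [exp (- x y)] over [0 < y < 1], evaluated at the larger end of
    each cell, where the integrand is smallest; the proof telescopes against the primitive. *)
Lemma geometric_sum_upper (d x : R) (M : nat) : 0 < x ->
  \sum_(m < M) (1 - expR (- d)) * node d m * expR (- (x * node d m)) <= x^-1.
Proof.
move=> x0.
suff H : \sum_(m < M) (1 - expR (- d)) * node d m * expR (- (x * node d m))
   <= x^-1 * (expR (- (x * node d M)) - expR (- (x * node d 0))).
  apply: (le_trans H); rewrite -[leRHS]mulr1; apply: ler_wpM2l; first by rewrite invr_ge0 ltW.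
  have : expR (- (x * node d M)) <= 1 by rewrite expR_le1 oppr_le0 mulr_ge0 // ltW // node_gt0.
  have := expR_ge0 (- (x * node d 0)); lra.
elim: M => [|M IH]; first by rewrite big_ord0 subrr mulr0.
rewrite big_ord_recr /=; apply: (le_trans (lerD IH (lexx _))).
rewrite -node_succ -lerBrDl -mulrBr.
have -> : expR (- (x * node d M.+1)) - expR (- (x * node d 0)) - (expR (- (x * node d M)) - expR (- (x * node d 0)))
  = expR (- (x * node d M)) * (expR (x * (node d M - node d M.+1)) - 1).
  rewrite mulrBr -expRD.
  have -> : - (x * node d M) + x * (node d M - node d M.+1) = - (x * node d M.+1) by ring.
  by ring.
rewrite [leLHS]mulrC [leRHS]mulrCA ler_pM2l ?expR_gt0 // ler_pdivlMl //.
by have := expR_ge1Dx (x * (node d M - node d M.+1)); lra.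
Qed.

Lemma geometric_sum_lower (d x : R) (M : nat) : 0 < x ->
  expR (- d) / x * (expR (- (x * node d M)) - expR (- x))
    <= \sum_(m < M.+1 | (0 < m)%N) (1 - expR (- d)) * node d m * expR (- (x * node d m)).
Proof.
move=> x0; elim: M => [|M IH].
  rewrite /node mul0r oppr0 expR0 mulr1 subrr mulr0; apply: sumr_ge0 => -[[|m] //].
rewrite big_mkcond big_ord_recr /= -big_mkcond /=; apply: le_trans (lerD IH (lexx _)).
have -> : (1 - expR (- d)) * node d M.+1 = expR (- d) * (node d M - node d M.+1).
  rewrite node_succ.
  have -> : node d M.+1 = expR (- d) * node d M.
    by rewrite /node -expRD; congr expR; rewrite -natr1; ring.
  ring.
rewrite -lerBlDl -mulrBr -!mulrA ler_pM2l ?expR_gt0 // mulrC ler_pdivrMr //.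
have -> : expR (- (x * node d M.+1)) - expR (- x) - (expR (- (x * node d M)) - expR (- x))
  = expR (- (x * node d M.+1)) * (1 - expR (- (x * (node d M - node d M.+1)))).
  rewrite mulrBr mulr1 -expRD.
  have -> : - (x * node d M.+1) + - (x * (node d M - node d M.+1)) = - (x * node d M) by ring.
  by ring.
rewrite -mulrA mulrCA ler_pM2l ?expR_gt0 //.
by have := expR_ge1Dx (- (x * (node d M - node d M.+1))); rewrite mulrC; lra.
Qed.

Lemma ln_le_powR (s x : R) : 0 < s -> 1 <= x -> ln x <= x `^ s / s.
Proof.
move=> s0 x1; have x0 : 0 < x := lt_le_trans ltr01 x1.
rewrite ler_pdivlMr // mulrC -ln_powR.
by apply: ltW; apply: ln_sublinear; rewrite powR_gt0.
Qed.

Lemma powRN_eventually (s e : R) : 0 < s -> 0 < e ->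
  exists2 x0, 1 <= x0 & forall x, x0 <= x -> x `^ (- s) <= e.
Proof.
move=> s0 e0; exists (Num.max 1 (e `^ (- s^-1))); first by rewrite le_max lexx.
move=> x; rewrite ge_max => /andP[x1 xe].
have -> : e = (e `^ (- s^-1)) `^ (- s).
  by rewrite -powRrM mulrNN mulVf ?gt_eqF // powRr1 // ltW.
by apply: powRN_le => //; rewrite powR_gt0.
Qed.

(** The nodes are split at [m d = exp (- kap) ln x]. Above, the weight is at most
    [(ln x)^(-alpha) exp (kap alpha)]. Below, [x * node d m] exceeds [x^(1 - exp (- kap))], so that
    half of the exponential pays for the trivial bound [d^(-alpha)] on the weight. *)
Lemma expo_model_upper (alpha d kap x : R) (M : nat) :
  0 < alpha -> 0 < d -> 0 < kap -> 1 < x ->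
  expo_model alpha d M x <= x^-1 * ((ln x) `^ (- alpha) * expR (kap * alpha)
     + d `^ (- alpha) * (2 * expR (- (x `^ (1 - expR (- kap)) / 2)))).
Proof.
move=> al0 d0 k0 x1; have x0 : 0 < x := lt_trans ltr01 x1.
have lx := ln_gt0 x1.
pose E := expR (- (x `^ (1 - expR (- kap)) / 2)).
pose w m := (1 - expR (- d)) * node d m.
have w0 m : 0 <= w m by rewrite /w -node_succ subr_ge0 ler_expR lerN2 ler_wpM2r ?ler_nat // ltW.
have wE y m : 0 <= w m * expR y := mulr_ge0 (w0 m) (expR_ge0 y).
have A0 : 0 <= (ln x) `^ (- alpha) * expR (kap * alpha) := mulr_ge0 (powR_ge0 _ _) (expR_ge0 _).
have B0 : 0 <= d `^ (- alpha) * E := mulr_ge0 (powR_ge0 _ _) (expR_ge0 _).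
have term m : node_weight alpha d m * expR (- (x * node d m)) <=
   (ln x) `^ (- alpha) * expR (kap * alpha) * (w m * expR (- (x * node d m)))
   + d `^ (- alpha) * E * (w m * expR (- (x / 2 * node d m))).
  rewrite /node_weight -/(w m).
  have [->|m0] := posnP m.
    rewrite mul0r powR0 ?oppr_eq0 ?gt_eqF // mulr0 mul0r.
    exact: addr_ge0 (mulr_ge0 A0 (wE _ _)) (mulr_ge0 B0 (wE _ _)).
  have m1 : 1 <= m%:R :> R by rewrite ler1n.
  have md0 : 0 < m%:R * d by rewrite mulr_gt0 // ltr0n.
  have [h|h] := lerP (expR (- kap) * ln x) (m%:R * d).
    have p1 : (m%:R * d) `^ (- alpha) <= (ln x) `^ (- alpha) * expR (kap * alpha).
      apply: (le_trans (powRN_le al0 _ h)); first by rewrite mulr_gt0 ?expR_gt0.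
      rewrite powRM ?expR_ge0 ?(ltW lx) // mulrC; apply: ler_wpM2l; first exact: powR_ge0.
      by rewrite -expRM mulrNN.
    rewrite -[leLHS]addr0; apply: lerD; last exact: mulr_ge0 B0 (wE _ _).
    by rewrite mulrAC [leRHS]mulrC; apply: ler_wpM2l.
  rewrite -[leLHS]add0r; apply: lerD; first exact: mulr_ge0 A0 (wE _ _).
  have p1 : (m%:R * d) `^ (- alpha) <= d `^ (- alpha).
    by apply: powRN_le => //; rewrite -[leLHS]mul1r ler_wpM2r // ltW.
  have nd : x `^ (1 - expR (- kap)) <= x * node d m.
    rewrite /node /powR gt_eqF // -{2}(lnK x0) -expRD ler_expR mulrBl mul1r lerD2l lerN2.
    exact: ltW.
  have e1 : expR (- (x * node d m)) <= E * expR (- (x / 2 * node d m)).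
    by rewrite /E -expRD ler_expR; lra.
  have -> : d `^ (- alpha) * E * (w m * expR (- (x / 2 * node d m)))
    = w m * d `^ (- alpha) * (E * expR (- (x / 2 * node d m))) by ring.
  apply: ler_pM; rewrite ?expR_ge0 //; first exact: mulr_ge0 (w0 m) (powR_ge0 _ _).
  exact: ler_wpM2l.
apply: (le_trans (ler_sum _ (fun m _ => term (nat_of_ord m)))).
rewrite big_split /= -!mulr_sumr.
have -> : x^-1 * ((ln x) `^ (- alpha) * expR (kap * alpha) + d `^ (- alpha) * (2 * E))
  = (ln x) `^ (- alpha) * expR (kap * alpha) * x^-1 + d `^ (- alpha) * E * (x / 2)^-1.
  by rewrite invfM invrK; ring.
apply: lerD; apply: ler_wpM2l => //.
  exact: geometric_sum_upper.
by apply: geometric_sum_upper; rewrite divr_gt0.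
Qed.

(** Only nodes with [m d <= exp kap * ln x] are kept, where the weight is at least
    [(exp kap * ln x)^(-alpha)]; they already exhaust the integral up to a negative power of [x].
    Hence the requirement that [M] be of the order of [ln x]. *)
Lemma expo_model_lower (alpha d kap x : R) (M : nat) :
  0 < alpha -> 0 < d -> 0 < kap -> 1 < x -> expR kap * ln x / d + 1 <= M%:R ->
  x^-1 * ((ln x) `^ (- alpha) * (expR (- (kap * alpha)) * expR (- d) *
     (1 - expR d * x `^ (- (expR kap - 1)) - x^-1)))
   <= expo_model alpha d M x.
Proof.
move=> al0 d0 k0 x1 HM; have x0 : 0 < x := lt_trans ltr01 x1.
have lx := ln_gt0 x1.
pose X := expR kap * ln x / d; have X0 : 0 < X by rewrite divr_gt0 // mulr_gt0 ?expR_gt0.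
pose M' := Num.truncn X.
have M'X : M'%:R <= X by rewrite truncn_le ltW.
have XM' : X < M'%:R + 1 by rewrite natr1 truncnS_gt.
have MM : (M'.+1 <= M)%N by rewrite -(ler_nat R) -natr1; apply: le_trans HM; rewrite lerD2r.
pose w m := (1 - expR (- d)) * node d m.
have w0 m : 0 <= w m by rewrite /w -node_succ subr_ge0 ler_expR lerN2 ler_wpM2r ?ler_nat // ltW.
apply: (@le_trans _ _ ((ln x) `^ (- alpha) * expR (- (kap * alpha)) *
  \sum_(m < M'.+1 | (0 < m)%N) w m * expR (- (x * node d m)))); last first.
  rewrite /expo_model (big_ord_widen_cond M (fun m => (0 < m)%N) (fun m => w m * expR (- (x * node d m))) MM).
  rewrite big_mkcond mulr_sumr; apply: ler_sum => m _.
  case: ifP => [/andP[m0 mM]|_]; last first.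
    by rewrite mulr0 mulr_ge0 ?expR_ge0 // node_weight_ge0 // ltW.
  have md0 : 0 < m%:R * d by rewrite mulr_gt0 // ltr0n.
  rewrite mulrA; apply: ler_wpM2r; first exact: expR_ge0.
  rewrite /node_weight -/(w m) mulrC; apply: ler_wpM2l => //.
  have mX : m%:R * d <= expR kap * ln x.
    rewrite -ler_pdivlMr //; apply: le_trans M'X; rewrite ler_nat; exact: mM.
  apply: le_trans (powRN_le al0 md0 mX).
  rewrite powRM ?expR_ge0 ?(ltW lx) // mulrC; apply: ler_wpM2r; first exact: powR_ge0.
  by rewrite -expRM mulrN.
have := geometric_sum_lower d M' x0; rewrite -/(w _) => GL.
apply: le_trans (ler_wpM2l _ GL); last by rewrite mulr_ge0 ?powR_ge0 ?expR_ge0.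
have -> : x^-1 * ((ln x) `^ (- alpha) * (expR (- (kap * alpha)) * expR (- d) *
     (1 - expR d * x `^ (- (expR kap - 1)) - x^-1)))
  = (ln x) `^ (- alpha) * expR (- (kap * alpha)) * (expR (- d) / x *
     (1 - expR d * x `^ (- (expR kap - 1)) - x^-1)) by ring.
apply: ler_wpM2l; first by rewrite mulr_ge0 ?powR_ge0 ?expR_ge0.
apply: ler_wpM2l; first by rewrite divr_ge0 ?expR_ge0 // ltW.
apply: lerD.
  apply: le_trans (expR_ge1Dx _); rewrite lerD2l lerN2.
  rewrite /node /powR gt_eqF // -{1}(lnK x0) -!expRD ler_expR.
  have : X * d < (M'%:R + 1) * d by rewrite ltr_pM2r.
  rewrite /X divfK ?gt_eqF //; lra.
rewrite lerN2 expRN lef_pV2 ?posrE ?expR_gt0 //.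
by apply: le_trans (expR_ge1Dx _); rewrite lerDr.
Qed.

End differences.

Section model_error.
Context {R : realType}.

Lemma exists_ln1D (alpha e : R) : 0 < alpha -> 0 < e ->
  exists2 kap : R, 0 < kap & expR (kap * alpha) = 1 + e.
Proof.
move=> al0 e0; have e1 : 0 < 1 + e by rewrite ltr_wpDl.
exists (ln (1 + e) / alpha); first by rewrite divr_gt0 // ln_gt0 // ltrDl.
by rewrite divfK ?gt_eqF // lnK.
Qed.

Lemma expo_model_approx (alpha eps : R) : 0 < alpha -> 0 < eps < 1 ->
  exists2 d0, 0 < d0 & forall d, 0 < d <= d0 -> exists X0 c : R, 2 <= X0 /\
    forall x, X0 <= x ->
      (forall M, expo_model alpha d M x <= (1 + eps) * (x^-1 * ln x `^ (- alpha))) /\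
      (forall M : nat, c * ln x + 1 <= M%:R ->
         (1 - eps) * (x^-1 * ln x `^ (- alpha)) <= expo_model alpha d M x).
Proof.
move=> al0 /andP[e0 e1].
have [kap k0 kE] := exists_ln1D al0 (divr_gt0 e0 (ltr0Sn R 1)).
exists (Num.min 1 (eps / 8)); first by rewrite lt_min ltr01 divr_gt0.
move=> d /andP[dp]; rewrite le_min => /andP[d1 de].
pose s := 1 - expR (- kap); have s0 : 0 < s by rewrite subr_gt0 expR_lt1 oppr_lt0.
pose sg := s / (2 * alpha); have sg0 : 0 < sg by rewrite divr_gt0 // mulr_gt0.
pose K := 4 * d `^ (- alpha) * sg `^ (- alpha).
have K0 : 0 < K by rewrite !mulr_gt0 ?powR_gt0.
have [x1 x11 H1] := powRN_eventually (divr_gt0 s0 (ltr0Sn R 1)) (divr_gt0 (divr_gt0 e0 (ltr0Sn R 1)) K0).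
pose eta := expR kap - 1; have eta0 : 0 < eta by rewrite subr_gt0 expR_gt1.
have [x2 x21 H2] := powRN_eventually eta0 (divr_gt0 e0 (ltr0Sn R 63)).
pose X0 := Num.max 2 (Num.max (x1) (Num.max x2 (16 / eps))).
exists X0, (expR kap / d); split; first by rewrite /X0 le_max lexx.
move=> x; rewrite /X0 !ge_max => /and4P[h2 h3 h4 h5].
have xx1 : 1 < x by apply: lt_le_trans h2; rewrite ltr1n.
have x0 : 0 < x := lt_trans ltr01 xx1.
have lx := ln_gt0 xx1.
split=> M.
  apply: (le_trans (expo_model_upper M al0 dp k0 xx1)).
  rewrite [leRHS]mulrCA; apply: ler_wpM2l; first by rewrite invr_ge0 ltW.
  rewrite kE.
  have lp : 0 < ln x `^ (- alpha) by rewrite powR_gt0.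
  suff : d `^ (- alpha) * (2 * expR (- (x `^ s / 2))) <= eps / 2 * ln x `^ (- alpha).
    by rewrite -/s; lra.
  have xs : 0 < x `^ s by rewrite powR_gt0.
  have E1 : expR (- (x `^ s / 2)) <= 2 * x `^ (- s).
    rewrite expRN powRN -[leRHS]invrK lef_pV2 ?posrE ?expR_gt0 ?invr_gt0 ?mulr_gt0 ?invr_gt0 //.
    rewrite invfM invrK; apply: le_trans (expR_ge1Dx _); lra.
  have L1 : ln x `^ alpha <= sg `^ (- alpha) * x `^ (s / 2).
    apply: (@le_trans _ _ ((x `^ sg / sg) `^ alpha)).
      by apply: ler_powRl; [exact: ltW|exact: ltW|apply: ln_le_powR => //; exact: ltW].
    rewrite powRM ?powR_ge0 ?invr_ge0 ?(ltW sg0) // powRV ?(ltW sg0) // -powRrM mulrC.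
    have -> : sg * alpha = s / 2 by rewrite /sg; field; rewrite gt_eqF.
    by [].
  have hx : x `^ (- (s / 2)) <= eps / 2 / K by apply: H1; exact: h3.
  have hx2 : K * x `^ (- (s / 2)) <= eps / 2 by rewrite mulrC -ler_pdivlMr.
  rewrite (powRN (ln x)) ler_pdivlMr ?powR_gt0 //; apply: le_trans hx2.
  have -> : K * x `^ (- (s / 2)) = d `^ (- alpha) * (2 * (2 * x `^ (- s))) * (sg `^ (- alpha) * x `^ (s / 2)).
    have -> : x `^ (- (s / 2)) = x `^ (- s) * x `^ (s / 2).
      by rewrite -powRD_gt0 //; congr (_ `^ _); field.
    by rewrite /K; ring.
  apply: ler_pM => //; rewrite ?powR_ge0 ?mulr_ge0 ?powR_ge0 ?expR_ge0 //.
  apply: ler_wpM2l; first exact: powR_ge0.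
  exact: ler_wpM2l.
move=> HM.
have HM' : expR kap * ln x / d + 1 <= M%:R by move: HM; rewrite mulrAC.
apply: le_trans (expo_model_lower al0 dp k0 xx1 HM').
rewrite mulrCA; apply: ler_wpM2l; first by rewrite invr_ge0 ltW.
rewrite mulrC; apply: ler_wpM2l; first exact: powR_ge0.
rewrite expRN kE -/eta.
have a1 : 1 - eps / 2 <= (1 + eps / 2)^-1.
  rewrite -[leRHS]mul1r ler_pdivlMr; last by lra.
  by have := sqr_ge0 eps; rewrite expr2; lra.
have a2 : 1 - eps / 8 <= expR (- d) by apply: le_trans (expR_ge1Dx _); lra.
have ed : expR d <= 4.
  have : 4^-1 <= expR (- d).
    apply: (@le_trans _ _ (expR (- 1))); last by rewrite ler_expR lerN2.
    have -> : expR (-1) = expR (- (2^-1)) ^+ 2 :> R by rewrite -expRM_natl; congr expR; field.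
    have := expR_ge1Dx (- (2^-1 : R)) => h.
    apply: (@le_trans _ _ ((2^-1) ^+ 2)); first by rewrite expr2; lra.
    by rewrite lerXn2r ?nnegrE ?expR_ge0 //; lra.
  by rewrite expRN lef_pV2 ?posrE ?expR_gt0.
have a3 : 1 - eps / 8 <= 1 - expR d * x `^ (- eta) - x^-1.
  have b1 : expR d * x `^ (- eta) <= 4 * (eps / 64).
    by apply: ler_pM => //; rewrite ?expR_ge0 ?powR_ge0 //; apply: H2.
  have b2 : x^-1 <= eps / 16.
    by rewrite -[eps / 16]invrK lef_pV2 ?posrE ?invr_gt0 ?divr_gt0 // invf_div.
  by lra.
have c1 : (1 - eps / 2) * (1 - eps / 8) <= (1 + eps / 2)^-1 * expR (- d).
  by apply: ler_pM => //; lra.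
have c2 : (1 - eps / 2) * (1 - eps / 8) * (1 - eps / 8) <= (1 + eps / 2)^-1 * expR (- d) * (1 - expR d * x `^ (- eta) - x^-1).
  by apply: ler_pM => //; [apply: mulr_ge0; lra|lra].
apply: le_trans c2.
have := mulr_ge0 (ltW e0) (ltW e0); nra.
Qed.

Lemma iter_telescope_expo_model (alpha d : R) (M k j : nat) :
  iter k telescope (fun i => expo_model alpha d M i%:R) j
    = \sum_(m < M) node_weight alpha d m * (expR (- node d m) - 1) ^+ k * expR (- (j%:R * node d m)).
Proof.
elim: k j => [|k IH] j; first by apply: eq_bigr => m _; rewrite expr0 mulr1.
rewrite iterS telescopeE !IH -sumrB; apply: eq_bigr => m _.
have -> : - (j.+1%:R * node d m) = - (j%:R * node d m) + - node d m by rewrite -natr1; ring.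
by rewrite expRD exprS; ring.
Qed.

Lemma expr_mul_expRN_le (k : nat) (y : R) : 0 <= y -> y ^+ k * expR (- y) <= k`!%:R.
Proof.
move=> y0; rewrite expRN ler_pdivrMr ?expR_gt0 //.
case: k => [|k]; first by rewrite expr0 fact0 mul1r -expR0 ler_expR.
have f0 : 0 < k.+1`!%:R :> R by rewrite ltr0n fact_gt0.
rewrite -ler_pdivrMl // mulrC; apply: le_trans (expR_ge1Dxn k y0).
by rewrite lerDr.
Qed.

(** Each difference of an exponential brings a factor of at most [node d m]. Half of the exponential
    converts [node ^ k] into [j ^ -k] by [y ^ k exp (-y) <= k!]; the other half is the model at
    [j / 2]. *)
Lemma expo_model_diff_bound (alpha d : R) (M k j : nat) : 0 <= d -> (0 < j)%N ->
  `|iter k telescope (fun i => expo_model alpha d M i%:R) j|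
    <= k`!%:R * 2 ^+ k * j%:R ^- k * expo_model alpha d M (j%:R / 2).
Proof.
move=> d0 j0; have jR : 0 < j%:R :> R by rewrite ltr0n.
rewrite iter_telescope_expo_model; apply: (le_trans (ler_norm_sum _ _ _)).
rewrite /expo_model mulr_sumr; apply: ler_sum => m _.
have w0 := node_weight_ge0 alpha m d0; have n0 := node_gt0 d m.
rewrite 2!normrM (ger0_norm w0) (ger0_norm (expR_ge0 _)) normrX -mulrA [leRHS]mulrCA.
apply: ler_wpM2l => //.
have h1 : `|expR (- node d m) - 1| <= node d m.
  have := expR_ge1Dx (- node d m).
  have : expR (- node d m) <= 1 by rewrite expR_le1 oppr_le0 ltW.
  by move=> h2 h3; rewrite ler_norml; apply/andP; split; lra.
have -> : - (j%:R * node d m) = - (j%:R / 2 * node d m) + - (j%:R / 2 * node d m) by field.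
rewrite expRD mulrA; apply: ler_wpM2r; first exact: expR_ge0.
apply: (@le_trans _ _ (node d m ^+ k * expR (- (j%:R / 2 * node d m)))).
  by apply: ler_wpM2r; [exact: expR_ge0|rewrite lerXn2r ?nnegrE ?normr_ge0 // ltW].
have y0 : 0 <= j%:R / 2 * node d m by rewrite mulr_ge0 ?divr_ge0 // ltW.
have := expr_mul_expRN_le k y0.
have -> : node d m ^+ k = (j%:R / 2 * node d m) ^+ k * (2 ^+ k * j%:R ^- k).
  by rewrite -exprVn -exprMn -exprMn; congr (_ ^+ _); field; rewrite gt_eqF.
move=> h; rewrite mulrAC -[leRHS]mulrA; apply: ler_wpM2r => //.
Qed.

Lemma iter_telescopeB (f g : nat -> R) (k j : nat) :
  iter k telescope (fun i => f i - g i) j = iter k telescope f j - iter k telescope g j.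
Proof.
elim: k j => [//|k IH] j; rewrite !iterS !telescopeE !IH; ring.
Qed.

(** The order of quantifiers matters: [C] precedes [eps] and [d]. The error of the kernel becomes
    small with [d], while its difference of order [k] is merely bounded, uniformly in [d]. *)
Lemma model_error (alpha : R) (k : nat) : 0 < alpha -> exists2 C, 0 < C &
  forall eps, 0 < eps < 1 -> exists2 d0, 0 < d0 & forall d, 0 < d <= d0 ->
    exists (j0 : nat) (c : R), (2 <= j0)%N /\ forall (M j : nat), (j0 <= j)%N -> c * ln j%:R + 1 <= M%:R ->
      `|model_kernel alpha j - expo_model alpha d M j%:R| <= eps * (j%:R^-1 * logpow alpha j) /\
      `|iter k telescope (fun i => model_kernel alpha i - expo_model alpha d M i%:R) j|
         <= C * (j%:R ^- k.+1 * logpow alpha j).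
Proof.
move=> al0; have [C1 C10 H1] := iter_telescope_model_kernel k al0.
pose C2 : R := k`!%:R * 2 ^+ k * (4 * 2 `^ alpha).
exists (C1 + C2).
  by rewrite addr_gt0 // !mulr_gt0 ?exprn_gt0 ?powR_gt0 // ltr0n fact_gt0.
move=> eps e01; have [d0 d00 Hd] := expo_model_approx al0 e01.
exists d0 => // d dd; have [X0 [c [X02 HX]]] := Hd d dd.
have /andP[dp _] := dd.
have /andP[e0 e1] := e01.
pose T := Num.truncn (2 * X0); have HT : 2 * X0 < T.+1%:R := truncnS_gt _.
exists T.+1.+4, c; split=> // M j jX HM.
have jX2 : 2 * X0 < j%:R.
  by apply: lt_le_trans HT _; rewrite ler_nat; clear -jX; lia.
have j4 : (4 <= j)%N by clear -jX; lia.
have j4' : 4 <= j%:R :> R by rewrite ler_nat.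
have jR : 0 < j%:R :> R by lra.
have Xj : X0 <= j%:R by lra.
have Xj2 : X0 <= j%:R / 2 by lra.
split.
  have [/(_ M) h1 /(_ M HM) h2] := HX _ Xj.
  rewrite /model_kernel /logpow ler_norml; apply/andP; split; lra.
rewrite iter_telescopeB; apply: (le_trans (ler_normB _ _)); rewrite mulrDl; apply: lerD.
  by apply: H1; exact: leq_trans j4.
apply: (le_trans (expo_model_diff_bound alpha M k (ltW dp) _)); first exact: leq_trans j4.
have [/(_ M) h1 _] := HX _ Xj2.
have l4 : 0 < ln j%:R :> R by apply: ln_gt0; rewrite ltr1n; exact: leq_trans j4.
have lj : ln j%:R / 2 <= ln (j%:R / 2) :> R.
  have : ln (2 ^+ 2) <= ln j%:R :> R by rewrite ler_ln ?posrE ?exprn_gt0 // expr2; lra.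
  rewrite lnXn // ln_div ?posrE //; lra.
have lpow : ln (j%:R / 2) `^ (- alpha) <= 2 `^ alpha * logpow alpha j.
  apply: (le_trans (powRN_le al0 _ lj)); first by rewrite divr_gt0.
  rewrite powRM ?invr_ge0 ?(ltW l4) // powRV // opprK mulrC //.
have e2 : expo_model alpha d M (j%:R / 2) <= 4 * (j%:R^-1 * (2 `^ alpha * logpow alpha j)).
  apply: (le_trans h1).
  have -> : (j%:R / 2)^-1 = 2 * j%:R^-1 :> R by rewrite invf_div.
  have g : 0 <= j%:R^-1 * ln (j%:R / 2) `^ (- alpha) by rewrite mulr_ge0 ?powR_ge0 // invr_ge0 ltW.
  have g2 : j%:R^-1 * ln (j%:R / 2) `^ (- alpha) <= j%:R^-1 * (2 `^ alpha * logpow alpha j).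
    by apply: ler_wpM2l => //; rewrite invr_ge0 ltW.
  by nra.
have -> : C2 * (j%:R ^- k.+1 * logpow alpha j)
   = k`!%:R * 2 ^+ k * j%:R ^- k * (4 * (j%:R^-1 * (2 `^ alpha * logpow alpha j))).
  by rewrite /C2 exprSr invfM; ring.
by apply: ler_wpM2l => //; rewrite !mulr_ge0 ?exprn_ge0 // invr_ge0 exprn_ge0.
Qed.

End model_error.

(** * The symbol of the Gram matrix *)

Section partial_fractions.
Context {R : realType}.
Implicit Types (x y : R).

Definition coshR x : R := (expR x + expR (- x)) / 2.
Definition sinhR x : R := (expR x - expR (- x)) / 2.

Lemma coshR_ge1 x : 1 <= coshR x.
Proof. by rewrite /coshR; have := expR_ge1Dx x; have := expR_ge1Dx (- x); lra. Qed.

Lemma is_derive_expRN x : is_derive x 1 (fun y => expR (- y)) (- expR (- x)).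
Proof.
have := is_derive1_comp (is_derive_expR (- x)) (is_deriveNid x 1).
by rewrite mulrN1.
Qed.

Lemma is_derive_coshR x : is_derive x 1 coshR (sinhR x).
Proof.
have D := is_deriveM (is_deriveD (is_derive_expR x) (is_derive_expRN x)) (is_derive_cst (2^-1 : R) x 1).
by apply: is_derive_eq D _; rewrite /GRing.scale /= mulr0 add0r mulrC.
Qed.

Lemma is_derive_sinhR x : is_derive x 1 sinhR (coshR x).
Proof.
have D := is_deriveM (is_deriveB (is_derive_expR x) (is_derive_expRN x)) (is_derive_cst (2^-1 : R) x 1).
by apply: is_derive_eq D _; rewrite /GRing.scale /= mulr0 add0r mulrC opprK.
Qed.

Lemma sinhR_ge0 x : 0 <= x -> 0 <= sinhR x.
Proof.
move=> x0; have : expR (- x) <= expR x by rewrite ler_expR; lra.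
by rewrite /sinhR; lra.
Qed.

Lemma coshR_le x y : 0 <= x -> x <= y -> coshR x <= coshR y.
Proof.
move=> x0; rewrite le_eqVlt => /orP[/eqP -> //|xy].
have [c /andP[xc _] E] := mean_value xy (fun z _ => is_derive_coshR z).
have : 0 <= sinhR c * (y - x).
  by rewrite mulr_ge0 ?subr_ge0 ?(ltW xy) // sinhR_ge0 // (le_trans x0) // ltW.
lra.
Qed.

Lemma sinhR_le x : 0 <= x -> sinhR x <= x * coshR x.
Proof.
rewrite le_eqVlt => /orP[/eqP <-|x0].
  by rewrite /sinhR oppr0 subrr mul0r mul0r.
have [c /andP[c0 cx] E] := mean_value x0 (fun z _ => is_derive_sinhR z).
have s0 : sinhR 0 = 0 by rewrite /sinhR oppr0 subrr mul0r.
move: E; rewrite s0 !subr0 => ->; rewrite mulrC ler_pM2l //.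
by apply: coshR_le; exact: ltW.
Qed.

Lemma coshR_sub1_le x : 0 <= x -> coshR x - 1 <= x ^+ 2 * coshR x.
Proof.
rewrite le_eqVlt => /orP[/eqP <-|x0].
  by rewrite /coshR oppr0 expR0 expr2 !mul0r; lra.
have [c /andP[c0 cx] E] := mean_value x0 (fun z _ => is_derive_coshR z).
have c1 : coshR 0 = 1 by rewrite /coshR oppr0 expR0; lra.
move: E; rewrite c1 subr0 => ->.
have h := sinhR_le (ltW c0); have cc := coshR_le (ltW c0) (ltW cx).
rewrite mulrC expr2 -mulrA ler_pM2l //; apply: (le_trans h).
by apply: ler_pM => //; [exact: ltW|apply: le_trans (coshR_ge1 _)|exact: ltW].
Qed.

Lemma sin_lower : exists2 c : R, 0 < c & forall y, 0 <= y -> y <= pi / 2 -> c * y <= sin y.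
Proof.
have p2 : pi / 2 < 2 :> R := pihalf_lt2 R.
have p1 : 1 <= pi / 2 :> R := pihalf_ge1 R.
have c1 : 0 < cos 1 :> R := cos1_gt0 R.
have s1 : 0 < sin 1 :> R by apply: sin2_gt0; rewrite ltr01 ltr1n.
exists (Num.min (cos 1) (sin 1 / 2)); first by rewrite lt_min c1 divr_gt0.
move=> y; rewrite le_eqVlt => /orP[/eqP <-|y0] yp; first by rewrite mulr0 sin0.
have [y1|y1] := leP y 1.
  have [c /andP[c0 cy] E] := mean_value y0 (fun z _ => is_derive_sin z).
  move: E; rewrite sin0 !subr0 => ->; rewrite ler_pM2r //.
  rewrite ge_min; apply/orP; left.
  have [->|c1'] := eqVneq c 1; first by [].
  apply: ltW; rewrite ltr_cos ?in_itv /=; try (apply/andP; split); lra.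
apply: (@le_trans _ _ (sin 1 / 2 * y)).
  by rewrite ler_pM2r // ge_min lexx orbT.
apply: (@le_trans _ _ (sin 1)); first by rewrite mulrAC -mulrA ger_pMr // ler_pdivrMr //; lra.
apply: ltW; rewrite ltr_sin ?in_itv /=; try (apply/andP; split); lra.
Qed.

Definition half_int (l : nat) : R := l%:R + 2^-1.

Lemma half_int_gt0 l : 0 < half_int l.
Proof. by rewrite /half_int ltr_wpDl // invr_gt0. Qed.

Lemma sum_cos_half_int (n : nat) (x : R) :
  2 * sin (x / 2) * (\sum_(l < n) cos (half_int l * x)) = sin (n%:R * x).
Proof.
have := sum_cos_telescope n x (x / 2); rewrite subrr sin0 subr0.
have -> : x * n%:R - x / 2 + x / 2 = n%:R * x by ring.
move=> <-; congr (_ * _); apply: eq_bigr => l _; congr cos; rewrite /half_int; ring.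
Qed.

Lemma is_derive_bigsum (n : nat) (f : nat -> R -> R) (df : nat -> R) x :
  (forall l, is_derive x 1 (f l) (df l)) ->
  is_derive x 1 (fun y => \sum_(l < n) f l y) (\sum_(l < n) df l).
Proof.
move=> H; elim: n => [|n IH].
  have -> : (fun y => \sum_(l < 0) f l y) = cst 0 by apply/funext => y; rewrite big_ord0.
  by rewrite big_ord0; exact: is_derive_cst.
have -> : (fun y => \sum_(l < n.+1) f l y) = (fun y => \sum_(l < n) f l y) + f n.
  by apply/funext => y; rewrite big_ord_recr.
by rewrite big_ord_recr; exact: is_deriveD.
Qed.

Lemma is_derive_scaled (f df : R -> R) (a x : R) : is_derive (a * x) 1 f (df (a * x)) ->
  is_derive x 1 (fun y => f (a * y)) (a * df (a * x)).
Proof.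
move=> H; have d : is_derive x 1 (fun y => a * y) a.
  by have := is_deriveZ a (is_derive_id x 1); rewrite /GRing.scale /= mulr1.
by have := is_derive1_comp H d; rewrite mulrC.
Qed.

Definition osc_primitive (xi b x : R) : R :=
  (b * (sin (b * x) * coshR (xi * x)) + xi * (cos (b * x) * sinhR (xi * x))) / (b ^+ 2 + xi ^+ 2).

Lemma is_derive_osc_primitive (xi b x : R) : 0 < b ->
  is_derive x 1 (osc_primitive xi b) (coshR (xi * x) * cos (b * x)).
Proof.
move=> b0; have d0 : b ^+ 2 + xi ^+ 2 != 0.
  by rewrite gt_eqF // ltr_pwDl ?exprn_gt0 ?sqr_ge0.
have ds := is_derive_scaled (is_derive_sin (b * x)).
have dc := is_derive_scaled (df := fun y => - sin y) (is_derive_cos (b * x)).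
have dch := is_derive_scaled (is_derive_coshR (xi * x)).
have dsh := is_derive_scaled (is_derive_sinhR (xi * x)).
have D := is_deriveM (is_deriveD (is_deriveZ b (is_deriveM ds dch)) (is_deriveZ xi (is_deriveM dc dsh)))
   (is_derive_cst ((b ^+ 2 + xi ^+ 2)^-1) x 1).
apply: is_derive_eq D _; rewrite /GRing.scale /=.
by field.
Qed.


Lemma sin_le x : 0 <= x -> sin x <= x.
Proof.
rewrite le_eqVlt => /orP[/eqP <-|x0]; first by rewrite sin0.
have [c /andP[c0 cx] E] := mean_value x0 (fun z _ => is_derive_sin z).
move: E; rewrite sin0 !subr0 => ->; rewrite ger_pMl //; exact: cos_le1.
Qed.

(* [cosh (xi x) - 1] cancels the singularity of the Dirichlet kernel at [0]. *)
Definition dirichlet_weight (xi x : R) : R := (coshR (xi * x) - 1) / (2 * sin (x / 2)).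

Definition dirichlet_weight_derive (xi x : R) : R :=
  (xi * sinhR (xi * x) * (2 * sin (x / 2)) - (coshR (xi * x) - 1) * cos (x / 2)) / (2 * sin (x / 2)) ^+ 2.

Lemma is_derive_dirichlet_weight (xi x : R) : 0 < x -> x <= pi ->
  is_derive x 1 (dirichlet_weight xi) (dirichlet_weight_derive xi x).
Proof.
move=> x0 xp; have s0 : 0 < sin (x / 2) by apply: sin_gt0_pi; have := pi_gt0 R; lra.
have ds : is_derive x 1 (fun y => sin (y / 2)) (2^-1 * cos (x / 2)).
  have := is_derive_scaled (a := 2^-1) (is_derive_sin (2^-1 * x)).
  under eq_fun => y do rewrite mulrC.
  by rewrite (mulrC _ x).
have dch := is_derive_scaled (is_derive_coshR (xi * x)).
have D2 := is_deriveZ 2 ds.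
have nz : (2 \*: (fun y => sin (y / 2)) : R -> R) x != 0 by rewrite mulf_neq0 ?lt0r_neq0.
have DV := @is_deriveV R (2 \*: (fun y => sin (y / 2)) : R -> R) x _ _ nz D2.
have D := is_deriveM (is_deriveB dch (is_derive_cst (1:R) x 1)) DV.
apply: is_derive_eq D _; rewrite /dirichlet_weight_derive.
rewrite -[((fun y => coshR (xi * y)) - cst 1) x]/(coshR (xi * x) - 1).
rewrite -[(2 \*: (fun y => sin (y / 2))) x]/(2 * sin (x / 2)) /GRing.scale /=.
by field; rewrite lt0r_neq0.
Qed.

Lemma dirichlet_weight_bound (K : R) : 0 <= K -> exists2 C, 0 <= C &
  forall xi x, 0 <= xi -> xi <= K -> 0 < x -> x <= pi ->
    `|dirichlet_weight xi x| <= C /\ `|dirichlet_weight_derive xi x| <= C.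
Proof.
move=> K0; have [c c0 sc] := sin_lower; have p0 := pi_gt0 R.
have pi2 : pi <= 4 :> R by have := pihalf_lt2 R; lra.
pose E := coshR (K * pi); have E1 : 1 <= E := coshR_ge1 _.
have A0 : 0 <= K ^+ 2 * E by rewrite mulr_ge0 ?sqr_ge0 //; lra.
exists (4 * (K ^+ 2 * E) / c + 2 * (K ^+ 2 * E) / c ^+ 2).
  by rewrite addr_ge0 // divr_ge0 ?(mulr_ge0 _ A0) ?exprn_ge0 ?(ltW c0).
move=> xi x xi0 xiK x0 xp.
have hE : coshR (xi * x) <= E.
  by apply: coshR_le; [rewrite mulr_ge0 // ltW|apply: ler_pM => //; exact: ltW].
have xx0 : 0 <= xi * x by rewrite mulr_ge0 // ltW.
have sl : c * x <= 2 * sin (x / 2) by have := sc (x / 2); lra.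
have sg : 2 * sin (x / 2) <= x by have := @sin_le (x / 2); lra.
have cx : 0 < c * x by rewrite mulr_gt0.
have s0 : 0 < 2 * sin (x / 2) by lra.
have xi2 : xi ^+ 2 <= K ^+ 2 by rewrite ler_sqr.
have nn : `|coshR (xi * x) - 1| <= x ^+ 2 * (K ^+ 2 * E).
  rewrite ger0_norm ?subr_ge0 ?coshR_ge1 //.
  apply: (le_trans (coshR_sub1_le xx0)).
  rewrite exprMn (mulrC (xi ^+ 2)) -mulrA; apply: ler_wpM2l; first exact: sqr_ge0.
  by apply: ler_pM => //; [exact: sqr_ge0|have := coshR_ge1 (xi * x); lra].
have nn2 : `|xi * sinhR (xi * x)| <= x * (K ^+ 2 * E).
  rewrite ger0_norm; last by apply: mulr_ge0 => //; exact: sinhR_ge0.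
  apply: (@le_trans _ _ (xi * (xi * x * coshR (xi * x)))).
    by apply: ler_wpM2l => //; exact: sinhR_le.
  have -> : xi * (xi * x * coshR (xi * x)) = x * (xi ^+ 2 * coshR (xi * x)) by ring.
  apply: ler_wpM2l; first exact: ltW.
  by apply: ler_pM => //; [exact: sqr_ge0|have := coshR_ge1 (xi * x); lra].
have B1 : 0 <= 4 * (K ^+ 2 * E) / c by rewrite divr_ge0 ?(ltW c0) ?(mulr_ge0 _ A0).
have B2 : 0 <= 2 * (K ^+ 2 * E) / c ^+ 2 by rewrite divr_ge0 ?exprn_ge0 ?(ltW c0) ?(mulr_ge0 _ A0).
split.
  apply: (@le_trans _ _ (4 * (K ^+ 2 * E) / c)); last by rewrite lerDl.
  rewrite /dirichlet_weight normrM normfV (gtr0_norm s0) ler_pdivrMr //.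
  apply: (le_trans nn).
  apply: (@le_trans _ _ (4 * (K ^+ 2 * E) / c * (c * x))); last by apply: ler_wpM2l.
  have -> : 4 * (K ^+ 2 * E) / c * (c * x) = (4 * x) * (K ^+ 2 * E) by field; rewrite lt0r_neq0.
  by apply: ler_wpM2r => //; rewrite expr2; apply: ler_wpM2r; lra.
apply: (@le_trans _ _ (2 * (K ^+ 2 * E) / c ^+ 2)); last by rewrite lerDr.
rewrite /dirichlet_weight_derive normrM normfV (gtr0_norm (exprn_gt0 _ s0)) ler_pdivrMr ?exprn_gt0 //.
apply: (@le_trans _ _ (2 * (K ^+ 2 * E) / c ^+ 2 * (c * x) ^+ 2)); last first.
  by apply: ler_wpM2l => //; rewrite ler_sqr // nnegrE ltW.
have -> : 2 * (K ^+ 2 * E) / c ^+ 2 * (c * x) ^+ 2 = x * (K ^+ 2 * E) * x + x ^+ 2 * (K ^+ 2 * E).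
  by field; rewrite lt0r_neq0.
apply: (le_trans (ler_normB _ _)); apply: lerD.
  rewrite normrM (gtr0_norm s0); apply: ler_pM => //; exact: ltW.
rewrite normrM; apply: (le_trans _ nn).
by rewrite -[leRHS]mulr1; apply: ler_wpM2l => //; exact: cos_max.
Qed.

(** Half of the partial fractions [pi / cosh (pi xi) = 2 sum (-1)^l b / (b^2 + xi^2)],
    [b = l + 1/2]. They arise because [1 / (2 cosh (x / 2))] is the alternating sum of
    [exp (- b |x|)], each with Fourier transform [2 b / (b^2 + xi^2)]. *)
Definition alternating_sum (L : nat) (xi : R) : R :=
  \sum_(l < L) (-1) ^+ l * half_int l / (half_int l ^+ 2 + xi ^+ 2).

Lemma sin_half_int_pi l : sin (half_int l * pi) = (-1) ^+ l :> R.
Proof.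
elim: l => [|l IH]; first by rewrite /half_int add0r mulrC sin_pihalf.
have -> : half_int l.+1 * pi = half_int l * pi + pi :> R by rewrite /half_int -natr1; ring.
by rewrite sinDpi IH exprS mulN1r.
Qed.

Lemma cos_half_int_pi l : cos (half_int l * pi) = 0 :> R.
Proof.
elim: l => [|l IH]; first by rewrite /half_int add0r mulrC cos_pihalf.
have -> : half_int l.+1 * pi = half_int l * pi + pi :> R by rewrite /half_int -natr1; ring.
by rewrite cosDpi IH oppr0.
Qed.

(** At [xi = 0] the sum is twice the Leibniz series. The derivatives of the polynomial [S] and of
    [atan] differ by at most [x^(2 L)], the derivative of [T], so [S - atan] lies between [-T] and
    [T]. *)
Lemma leibniz_pi (L : nat) : `|alternating_sum L 0 - pi / 2| <= 2 / L.+1%:R.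
Proof.
pose S (x : R) := \sum_(l < L) (-1) ^+ l * x ^+ (2 * l).+1 / (2 * l).+1%:R.
have dS x : is_derive x 1 S (\sum_(l < L) (-1) ^+ l * x ^+ (2 * l)).
  apply: (@is_derive_bigsum L (fun l x => (-1) ^+ l * x ^+ (2 * l).+1 / (2 * l).+1%:R)
     (fun l => (-1) ^+ l * x ^+ (2 * l))) => l.
  have D := is_deriveZ ((-1) ^+ l / (2 * l).+1%:R) (is_deriveX (2 * l).+1 (is_derive_id x 1)).
  have -> : (fun y => (-1) ^+ l * y ^+ (2 * l).+1 / (2 * l).+1%:R) = (-1) ^+ l / (2 * l).+1%:R *: (id : R -> R) ^+ (2 * l).+1 :> (R -> R).
    by apply/funext => y /=; rewrite /GRing.scale /= exprfctE mulrAC.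
  apply: is_derive_eq D _; rewrite /GRing.scale /= ?mulr1.
  by rewrite mulrA mulfVK // pnatr_eq0.
pose T (x : R) := x ^+ (2 * L).+1 / (2 * L).+1%:R.
have dT x : is_derive x 1 T (x ^+ (2 * L)).
  have D := is_deriveZ ((2 * L).+1%:R^-1) (is_deriveX (2 * L).+1 (is_derive_id x 1)).
  have -> : T = (2 * L).+1%:R^-1 *: (id : R -> R) ^+ (2 * L).+1 :> (R -> R).
    by apply/funext => y /=; rewrite /T /GRing.scale /= exprfctE mulrC.
  apply: is_derive_eq D _; rewrite /GRing.scale /= ?mulr1.
  by rewrite mulrA mulVf ?mul1r // pnatr_eq0.
have geo (x : R) : \sum_(l < L) (-1) ^+ l * x ^+ (2 * l) - (1 + x ^+ 2)^-1 = - (- (x ^+ 2)) ^+ L / (1 + x ^+ 2).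
  have nz : 1 + x ^+ 2 != 0 by rewrite gt_eqF // ltr_pwDl // sqr_ge0.
  have := subrX1 (- (x ^+ 2)) L.
  under eq_bigr => l _ do rewrite -mulN1r exprMn -exprM.
  set G := \sum_(l < L) _; move=> E; apply: (mulIf nz).
  by rewrite mulrBl mulVf // mulfVK //; lra.
have key (x : R) : 0 < x -> `|S x - atan x| <= T x.
  move=> x0.
  have S0 : S 0 = 0 by rewrite /S big1 // => l _; rewrite expr0n mulr0 mul0r.
  have T0 : T 0 = 0 by rewrite /T expr0n mul0r.
  have dm (z : R) := is_deriveB (is_deriveB (dS z) (is_derive1_atan z)) (dT z).
  have dp (z : R) := is_deriveD (is_deriveB (dS z) (is_derive1_atan z)) (dT z).
  have [c /andP[c0 _] E1] := mean_value x0 (fun z _ => dm z).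
  have [c' /andP[c'0 _] E2] := mean_value x0 (fun z _ => dp z).
  have b (z : R) : `|\sum_(l < L) (-1) ^+ l * z ^+ (2 * l) - (1 + z ^+ 2)^-1| <= z ^+ (2 * L).
    rewrite geo normrM normrN normrX normrN normfV (ger0_norm (sqr_ge0 z)) exprM.
    rewrite [X in _ / X]ger0_norm ?addr_ge0 ?sqr_ge0 //.
    have z2 := sqr_ge0 z; have z3 : 0 <= (z ^+ 2) ^+ L := exprn_ge0 L z2.
    by rewrite ler_pdivrMr ?ltr_pwDl // mulrDr mulr1 lerDl; exact: mulr_ge0.
  have := b c; have := b c'; rewrite !ler_norml => /andP[h1 _] /andP[_ h2].
  move: E1 E2; rewrite /= !fctE S0 T0 atan0 !subr0 addr0 => E1 E2.
  have e1 : S x - atan x - T x <= 0 by rewrite E1; apply: mulr_le0_ge0; [rewrite subr_le0|exact: ltW].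
  have e2 : 0 <= S x - atan x + T x.
    by rewrite -[leRHS]subr0 E2; apply: mulr_ge0; [rewrite -lerBlDr sub0r|exact: ltW].
  move: e1 e2; rewrite subr_le0 => e1 e2; rewrite e1 andbT.
  by rewrite -subr_ge0 opprK.
have := key 1 ltr01; rewrite atan1 /T expr1n.
have -> : S 1 = alternating_sum L 0 / 2.
  rewrite /S /alternating_sum mulr_suml; apply: eq_bigr => l _.
  rewrite expr1n expr0n /= addr0 /half_int mulr1 -natr1 natrM.
  have l0 : 0 <= (l%:R : R) by [].
  by field; rewrite gt_eqF //; lra.
have -> : alternating_sum L 0 / 2 - pi / 4 = (alternating_sum L 0 - pi / 2) / 2 by field.
rewrite normrM normfV (gtr0_norm (_ : 0 < 2)) // ler_pdivrMr // => /le_trans; apply.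
rewrite mul1r mulrC ler_pM2l // lef_pV2 ?posrE ?ltr0n // ler_nat; lia.
Qed.

Lemma osc_primitive_pi (xi : R) l :
  osc_primitive xi (half_int l) pi = coshR (pi * xi) * ((-1) ^+ l * half_int l / (half_int l ^+ 2 + xi ^+ 2)).
Proof. by rewrite /osc_primitive sin_half_int_pi cos_half_int_pi (mulrC xi pi); ring. Qed.

Lemma coshR0 : coshR 0 = 1.
Proof. by rewrite /coshR oppr0 expR0; lra. Qed.

(** Up to the factor [cosh (pi xi)], the sum is the integral over [(0, pi)] of [cosh (xi x)] against
    the Dirichlet kernel [sin (L x) / (2 sin (x / 2))]. Subtracting the case [xi = 0] leaves
    [dirichlet_weight xi x * sin (L x)], and one integration by parts gives the rate [1 / L]. *)
Lemma alternating_sum_approx (K : R) : 0 <= K -> exists2 C, 0 <= C &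
  forall L xi, (0 < L)%N -> 0 <= xi -> xi <= K ->
    `|2 * alternating_sum L xi - pi / coshR (pi * xi)| <= C / L%:R.
Proof.
move=> K0; have [C C0 HC] := dirichlet_weight_bound K0; have p0 := pi_gt0 R.
have pi2 : pi <= 4 :> R by have := pihalf_lt2 R; lra.
exists (2 * (6 * C + 3)); first by lra.
move=> L xi L0 xi0 xiK; have L0' : 0 < L%:R :> R by rewrite ltr0n.
pose G x := \sum_(l < L) osc_primitive xi (half_int l) x.
pose G0 x := \sum_(l < L) osc_primitive 0 (half_int l) x.
have dG x : is_derive x 1 G (coshR (xi * x) * \sum_(l < L) cos (half_int l * x)).
  rewrite mulr_sumr; apply: (@is_derive_bigsum L (fun l => osc_primitive xi (half_int l))
    (fun l => coshR (xi * x) * cos (half_int l * x))) => l.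
  exact: is_derive_osc_primitive (half_int_gt0 l).
have dG0 x : is_derive x 1 G0 (\sum_(l < L) cos (half_int l * x)).
  apply: (@is_derive_bigsum L (fun l => osc_primitive 0 (half_int l))
    (fun l => cos (half_int l * x))) => l.
  have := is_derive_osc_primitive 0 x (half_int_gt0 l).
  by rewrite mul0r coshR0 mul1r.
(* Integration by parts written as a primitive: the added term removes [sin (L x)] from the
   derivative of [G - G0] and leaves a term with the factor [1 / L]. *)
pose H x := G x - G0 x + L%:R^-1 * (dirichlet_weight xi x * cos (L%:R * x)).
have dH x : 0 < x -> x <= pi -> is_derive x 1 H (L%:R^-1 * (dirichlet_weight_derive xi x * cos (L%:R * x))).
  move=> x0 xp; have s0 : 0 < sin (x / 2) by apply: sin_gt0_pi; lra.
  have dc := is_derive_scaled (df := fun y => - sin y) (is_derive_cos (L%:R * x)).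
  have D := is_deriveD (is_deriveB (dG x) (dG0 x))
     (is_deriveZ (L%:R^-1) (is_deriveM (is_derive_dirichlet_weight xi x0 xp) dc)).
  apply: is_derive_eq D _; rewrite /GRing.scale /=.
  have <- := sum_cos_half_int L x; rewrite /dirichlet_weight.
  set S := \sum_(l < L) _.
  by field; apply/andP; split; rewrite lt0r_neq0.
have GG0 : G 0 - G0 0 = 0.
  rewrite /G /G0 !big1 ?subrr // => l _; rewrite /osc_primitive !mulr0 sin0 /sinhR oppr0 subrr;
  by rewrite !(mul0r, mulr0) addr0 mul0r.
(* [dirichlet_weight] is a quotient 0 / 0 at the origin, so the mean value theorem is applied on
   [[e, pi]] with small [e]. *)
have [e /andP[e0 ep] Ge] : exists2 e, 0 < e < pi & `|G e - G0 e| <= L%:R^-1.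
  have cG : (G \- G0) x @[x --> (0:R)] --> (G \- G0) 0.
    have /differentiable_continuous : differentiable (G \- G0) (0:R).
      by apply/derivable1_diffP; have [] := is_deriveB (dG 0) (dG0 0).
    exact.
  have Lp : 0 < (L%:R^-1 : R) by rewrite invr_gt0.
  have /cvgrPdist_le/(_ _ Lp) := cG.
  move=> /nbhs_ballP[d /= d0 Hd].
  exists (Num.min (d / 2) (pi / 2)).
    by rewrite lt_min !divr_gt0 //= gt_min; apply/orP; right; lra.
  have m0 : 0 < Num.min (d / 2) (pi / 2) by rewrite lt_min !divr_gt0.
  have := Hd (Num.min (d / 2) (pi / 2)); rewrite /ball /= GG0 sub0r normrN sub0r normrN; apply.
  rewrite gtr0_norm // gt_min; apply/orP; left; lra.
have dH' x : e <= x <= pi -> is_derive x 1 H (L%:R^-1 * (dirichlet_weight_derive xi x * cos (L%:R * x))).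
  by move=> /andP[ex xp]; apply: dH xp; exact: lt_le_trans ex.
have [c /andP[ec cp] E] := mean_value ep dH'.
have c0 : 0 < c by lra.
have cos1 z : `|cos z : R| <= 1 by exact: cos_max.
have bw x z : 0 < x -> x <= pi -> `|L%:R^-1 * (dirichlet_weight xi x * cos z)| <= C / L%:R.
  move=> x0 xp; rewrite normrM (gtr0_norm (_ : 0 < L%:R^-1)) ?invr_gt0 // mulrC ler_pM2r ?invr_gt0 //.
  rewrite normrM -[leRHS]mulr1; apply: ler_pM => //; exact: (HC xi x xi0 xiK x0 xp).1.
have bd : `|H pi - H e| <= 4 * C / L%:R.
  rewrite E normrM (gtr0_norm (_ : 0 < pi - e)) ?subr_gt0 //.
  have -> : 4 * C / L%:R = C / L%:R * 4 by ring.
  apply: ler_pM; [exact: normr_ge0|by rewrite subr_ge0 ltW| |lra].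
  rewrite normrM (gtr0_norm (_ : 0 < L%:R^-1)) ?invr_gt0 // mulrC ler_pM2r ?invr_gt0 //.
  rewrite normrM -[leRHS]mulr1; apply: ler_pM => //; exact: (HC xi c xi0 xiK c0 (ltW cp)).2.
have Gpi : G pi = coshR (pi * xi) * alternating_sum L xi.
  by rewrite /alternating_sum mulr_sumr; apply: eq_bigr => l _; rewrite osc_primitive_pi.
have G0pi : G0 pi = alternating_sum L 0.
  by apply: eq_bigr => l _; rewrite osc_primitive_pi mulr0 coshR0 mul1r.
have lei : `|alternating_sum L 0 - pi / 2| <= 2 / L%:R.
  apply: (le_trans (leibniz_pi L)).
  by rewrite ler_pM2l // lef_pV2 ?posrE ?ltr0n // ler_nat leqnSn.
have ch1 := coshR_ge1 (pi * xi).
have main : `|coshR (pi * xi) * alternating_sum L xi - pi / 2| <= (6 * C + 3) / L%:R.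
  rewrite -Gpi.
  have -> : G pi - pi / 2 = (H pi - H e) + (G e - G0 e) + L%:R^-1 * (dirichlet_weight xi e * cos (L%:R * e))
     - L%:R^-1 * (dirichlet_weight xi pi * cos (L%:R * pi)) + (alternating_sum L 0 - pi / 2).
    by rewrite /H -G0pi; ring.
  have -> : (6 * C + 3) / L%:R = 4 * C / L%:R + L%:R^-1 + C / L%:R + C / L%:R + 2 / L%:R by ring.
  apply: (le_trans (ler_normD _ _)); apply: lerD lei.
  apply: (le_trans (ler_normB _ _)); apply: lerD; last exact: bw.
  apply: (le_trans (ler_normD _ _)); apply: lerD; last by apply: bw => //; exact: ltW.
  by apply: (le_trans (ler_normD _ _)); apply: lerD.
have -> : 2 * alternating_sum L xi - pi / coshR (pi * xi) = 2 * (coshR (pi * xi) * alternating_sum L xi - pi / 2) / coshR (pi * xi).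
  by field; rewrite gt_eqF //; lra.
rewrite normrM normfV normrM (gtr0_norm (_ : 0 < 2)) // (gtr0_norm (_ : 0 < coshR _)); last by lra.
rewrite ler_pdivrMr; last by lra.
rewrite -[leLHS]mulr1; apply: ler_pM => //.
by rewrite -mulrA ler_pM2l.
Qed.

End partial_fractions.

(** * Convergence of the symbol on bounded frequencies *)

Section symbol.
Context {R : realType}.
Implicit Types (x y d xi : R).

Definition sech_coef d (k : nat) : R := (1 - expR (- d)) / (2 * coshR (k%:R * d / 2)).

Lemma expRN_le_inv x : 0 <= x -> expR (- x) <= (1 + x)^-1.
Proof.
move=> x0; rewrite expRN lef_pV2 ?posrE ?expR_gt0 //; last by lra.
exact: expR_ge1Dx.
Qed.

Lemma sub1_expRN_bounds x : 0 <= x -> x - x ^+ 2 <= 1 - expR (- x) <= x.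
Proof.
move=> x0; apply/andP; split; last by have := expR_ge1Dx (- x); lra.
have := expRN_le_inv x0; suff : (1 + x)^-1 <= 1 - x + x ^+ 2 by lra.
have x1 : 0 < 1 + x by lra.
rewrite -div1r ler_pdivrMr //; have := mulr_ge0 x0 (sqr_ge0 x).
by rewrite expr2; nra.
Qed.

Lemma half_angle_sin2 x : 2 * sin (x / 2) ^+ 2 = 1 - cos x.
Proof.
have -> : cos x = cos (x / 2 + x / 2) by congr cos; field.
by rewrite cosD; have := cos2Dsin2 (x / 2); rewrite !expr2; lra.
Qed.

Lemma sin2_bounds x : 0 <= x -> x <= 1 -> x ^+ 2 - x ^+ 4 <= sin x ^+ 2 <= x ^+ 2.
Proof.
move=> x0 x1; have sl := sin_le x0.
have s0 : 0 <= sin x by apply: sin_ge0_pi; rewrite x0 /=; have := pihalf_ge1 R; lra.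
apply/andP; split; last by rewrite ler_sqr.
move: x0; rewrite le_eqVlt => /orP[/eqP <-|x0]; first by rewrite sin0 !expr0n /= subrr.
have [c /andP[c0 cx] E] := mean_value x0 (fun z _ => is_derive_sin z).
have h0 : 0 <= c / 2 by lra.
have cc : 1 - c ^+ 2 / 2 <= cos c.
  have -> : cos c = 1 - 2 * sin (c / 2) ^+ 2.
    by rewrite half_angle_sin2; ring.
  have sh : sin (c / 2) ^+ 2 <= (c / 2) ^+ 2.
    rewrite ler_sqr ?nnegrE //; first exact: sin_le.
    by apply: sin_ge0_pi; rewrite h0 /=; have := pihalf_ge1 R; lra.
  by move: sh; rewrite !expr2; lra.
have c2 : c ^+ 2 <= x ^+ 2 by rewrite ler_sqr ?nnegrE; lra.
have x2 : x ^+ 2 <= 1 by rewrite expr_le1 // ltW.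
have lo : x * (1 - x ^+ 2 / 2) <= sin x.
  move: E; rewrite sin0 !subr0 => ->; rewrite mulrC ler_pM2r //; lra.
apply: (@le_trans _ _ ((x * (1 - x ^+ 2 / 2)) ^+ 2)); last first.
  by rewrite ler_sqr ?nnegrE // mulr_ge0 ?ltW //; lra.
have -> : (x * (1 - x ^+ 2 / 2)) ^+ 2 = x ^+ 2 - x ^+ 4 + (x ^+ 3 / 2) ^+ 2 by field.
by rewrite lerDl sqr_ge0.
Qed.

(** The denominator [1 - 2 u cos th + u^2] is written so that nothing cancels as [u] tends to 1 and
    [th] to 0. *)
Definition poisson_kernel (u th : R) : R := (1 - u ^+ 2) / ((1 - u) ^+ 2 + 4 * u * sin (th / 2) ^+ 2).

Lemma quotient_perturbation (N N0 D D0 c e : R) : 0 < c -> c <= D -> c <= D0 ->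
  `|N - N0| <= e -> `|D - D0| <= e -> `|N / D - N0 / D0| <= e / c + `|N0| * e / c ^+ 2.
Proof.
move=> c0 cD cD0 hN hD.
have D0' : 0 < D := lt_le_trans c0 cD; have D00 : 0 < D0 := lt_le_trans c0 cD0.
have -> : N / D - N0 / D0 = (N - N0) / D - N0 * (D - D0) / (D * D0).
  by field; apply/andP; split; rewrite lt0r_neq0.
have e0 : 0 <= e := le_trans (normr_ge0 _) hN.
apply: (le_trans (ler_normB _ _)); apply: lerD.
  rewrite normrM normfV (gtr0_norm D0'); apply: ler_pM => //; first by rewrite invr_ge0 ltW.
  by rewrite lef_pV2.
rewrite normrM normfV normrM (gtr0_norm (mulr_gt0 D0' D00)).
apply: ler_pM.
- exact: mulr_ge0.
- by rewrite invr_ge0 ltW // mulr_gt0.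
- by apply: ler_wpM2l.
- by rewrite lef_pV2 ?posrE ?exprn_gt0 ?mulr_gt0 // expr2 ler_pM // ltW.
Qed.

(** Numerator, with the factor [1 - exp (- d)], and denominator are both of order [d^2]; after
    division by [d^2] each has a limit, with an error linear in [d]. *)
Lemma poisson_limit (b K : R) : 0 < b -> 0 <= K -> exists2 C, 0 <= C & exists2 d0, 0 < d0 &
  forall d xi, 0 < d -> d <= d0 -> 0 <= xi -> xi <= K ->
    `|(1 - expR (- d)) * poisson_kernel (expR (- (b * d))) (d * xi) - 2 * b / (b ^+ 2 + xi ^+ 2)| <= C * d.
Proof.
move=> b0 K0.
(* A sum of the coefficients that occur in the error terms below, not optimized; [c] bounds the
   rescaled denominators from below. *)
pose C1 := b + 3 * b ^+ 2 + 3 * b * K ^+ 2 + K ^+ 4 + 2 * b + 2 * b ^+ 2 + 2 * b ^+ 3 + 5 * b ^+ 2.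
pose c := b ^+ 2 / 4.
have c0 : 0 < c by rewrite divr_gt0 ?exprn_gt0.
have b2 : 0 < b ^+ 2 by rewrite exprn_gt0.
have b3 : 0 < b ^+ 3 by rewrite exprn_gt0.
have K2 := sqr_ge0 K; have K4 : 0 <= K ^+ 4 by rewrite exprn_even_ge0.
have bK2 : 0 <= b * K ^+ 2 by rewrite mulr_ge0 // ltW.
have C10 : 0 <= C1 by rewrite /C1; lra.
exists (C1 / c + 2 * b * C1 / c ^+ 2).
  by rewrite addr_ge0 ?divr_ge0 ?mulr_ge0 ?exprn_ge0 // ltW.
exists (Num.min (Num.min 1 (2 * b)^-1) (K + 1)^-1).
  by rewrite !lt_min ltr01 !invr_gt0 mulr_gt0 //=; lra.
move=> d xi d0; rewrite !le_min => /andP[/andP[d1 db] dK] xi0 xiK.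
have bd0 : 0 < b * d by rewrite mulr_gt0.
have bd1 : b * d <= 1 / 2.
  move: db; rewrite -(ler_pM2l (_ : 0 < 2 * b)) ?mulr_gt0 // divff ?mulf_neq0 ?lt0r_neq0 //; lra.
have dK1 : d * K <= 1.
  move: dK; rewrite -(ler_pM2l (_ : 0 < K + 1)); last by lra.
  by rewrite divff ?gt_eqF //; [nra|lra].
have dxi0 : 0 <= d * xi by rewrite mulr_ge0 // ltW.
have dxi1 : d * xi <= 1 by apply: le_trans dK1; rewrite ler_pM2l.
set u := expR (- (b * d)); set q := expR (- d).
have /andP[u1 u2] := sub1_expRN_bounds (ltW bd0).
have /andP[q1 q2] := sub1_expRN_bounds (ltW d0).
rewrite -/u in u1 u2; rewrite -/q in q1 q2.
have u0 : 0 < u by exact: expR_gt0.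
(* As [d] tends to 0 these tend to [b], [1] and [xi ^ 2]. *)
pose x := (1 - u) / d; pose y := (1 - q) / d; pose z := 4 * sin (d * xi / 2) ^+ 2 / d ^+ 2.
have dn : d != 0 by rewrite lt0r_neq0.
have -> : (1 - q) * poisson_kernel u (d * xi) = y * x * (1 + u) / (x ^+ 2 + u * z).
  rewrite /poisson_kernel /y /x /z; field; rewrite dn /=.
  rewrite gt_eqF // ltr_pwDl //.
    by rewrite exprn_gt0 // subr_gt0 /u -[ltRHS]expR0 ltr_expR oppr_lt0.
  by apply: mulr_ge0; [exact: ltW|rewrite mulr_ge0 ?sqr_ge0].
have xl : b - b ^+ 2 * d <= x.
  by rewrite /x ler_pdivlMr // (_ : (b - b ^+ 2 * d) * d = b * d - (b * d) ^+ 2) //; ring.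
have xu : x <= b by rewrite /x ler_pdivrMr.
have yl : 1 - d <= y by rewrite /y ler_pdivlMr // (_ : (1 - d) * d = d - d ^+ 2) //; ring.
have yu : y <= 1 by rewrite /y ler_pdivrMr // mul1r.
have [zl zu] : xi ^+ 2 - K ^+ 4 * d <= z /\ z <= xi ^+ 2.
  have h2 : 0 <= d * xi / 2 by lra.
  have h21 : d * xi / 2 <= 1 by lra.
  have /andP[sl su] := sin2_bounds h2 h21.
  rewrite /z ler_pdivlMr ?exprn_gt0 // ler_pdivrMr ?exprn_gt0 //; split; last first.
    by rewrite -exprMn; apply: le_trans (_ : 4 * (d * xi / 2) ^+ 2 <= _); [rewrite ler_pM2l|rewrite (_ : 4 * (d * xi / 2) ^+ 2 = (xi * d) ^+ 2) //; field].
  apply: (@le_trans _ _ (4 * ((d * xi / 2) ^+ 2 - (d * xi / 2) ^+ 4))); last by rewrite ler_pM2l.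
  have -> : 4 * ((d * xi / 2) ^+ 2 - (d * xi / 2) ^+ 4) = (xi ^+ 2 - xi ^+ 4 * d ^+ 2 / 4) * d ^+ 2 by field.
  rewrite ler_pM2r ?exprn_gt0 // lerB //.
  have k4 : xi ^+ 4 <= K ^+ 4 by rewrite lerXn2r.
  have xi4 : 0 <= xi ^+ 4 by rewrite exprn_even_ge0.
  have d2 : d ^+ 2 <= d by rewrite expr2 ger_pMl.
  have d20 : 0 <= d ^+ 2 by exact: sqr_ge0.
  have := ler_pM xi4 d20 k4 d2; have := mulr_ge0 K4 (ltW d0); clear; lra.
have z0 : 0 <= z by rewrite /z divr_ge0 ?sqr_ge0 // mulr_ge0 ?sqr_ge0.
have xb : b / 2 <= x.
  apply: le_trans xl; have -> : b - b ^+ 2 * d = b * (1 - b * d) by ring.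
  by rewrite ler_pM2l //; clear -bd1; lra.
have x0 : 0 < x by lra.
have D1 : c <= x ^+ 2 + u * z.
  have : (b / 2) ^+ 2 <= x ^+ 2 by rewrite ler_sqr ?nnegrE ?(ltW x0) // divr_ge0 // ltW.
  have := mulr_ge0 (ltW u0) z0; rewrite /c !expr2; clear; lra.
have D2 : c <= b ^+ 2 + xi ^+ 2 by have := sqr_ge0 xi; rewrite /c; lra.
have ul : 1 - b * d <= u by lra.
have uu : u <= 1 by rewrite /u -[leRHS]expR0 ler_expR oppr_le0 ltW.
have y0 : 0 <= y by rewrite /y divr_ge0 ?(ltW d0) // subr_ge0 /q -[leRHS]expR0 ler_expR oppr_le0 ltW.
clearbody u q x y z.
have hx : `|x - b| <= b ^+ 2 * d by rewrite ler_norml; apply/andP; split; have := mulr_ge0 (ltW b2) (ltW d0); clear -xl xu; lra.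
have hy : `|y - 1| <= d by rewrite ler_norml; apply/andP; split; clear -yl yu d0; lra.
have hu : `|u - 1| <= b * d by rewrite ler_norml; apply/andP; split; clear -ul uu bd0; lra.
have hz : `|z - xi ^+ 2| <= K ^+ 4 * d by rewrite ler_norml; apply/andP; split; have := mulr_ge0 K4 (ltW d0); clear -zl zu; lra.
have EN : `|y * x * (1 + u) - 2 * b| <= C1 * d.
  have -> : y * x * (1 + u) - 2 * b = y * x * (u - 1) + 2 * y * (x - b) + 2 * b * (y - 1) by ring.
  apply: (@le_trans _ _ (b * (b * d) + 2 * (b ^+ 2 * d) + 2 * b * d)); last first.
    rewrite /C1; have := mulr_ge0 (ltW b0) (ltW d0); have := mulr_ge0 (ltW b2) (ltW d0).
    have := mulr_ge0 (ltW b3) (ltW d0); have := mulr_ge0 bK2 (ltW d0); have := mulr_ge0 K4 (ltW d0).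
    rewrite !expr2; clear; lra.
  apply: (le_trans (ler_normD _ _)); apply: lerD.
    apply: (le_trans (ler_normD _ _)); apply: lerD.
      rewrite normrM (ger0_norm (mulr_ge0 y0 (ltW x0))); apply: ler_pM => //.
        by rewrite mulr_ge0 // ltW.
      by rewrite -[leRHS]mul1r; apply: ler_pM => //; exact: ltW.
    rewrite normrM normrM (ger0_norm y0) (gtr0_norm (_ : 0 < 2)) //.
    by apply: ler_pM => //; [rewrite mulr_ge0|rewrite ger_pMr].
  by rewrite normrM (gtr0_norm (_ : 0 < 2 * b)) ?mulr_gt0 // ler_pM2l ?mulr_gt0.
have ED : `|x ^+ 2 + u * z - (b ^+ 2 + xi ^+ 2)| <= C1 * d.
  have -> : x ^+ 2 + u * z - (b ^+ 2 + xi ^+ 2) = (x + b) * (x - b) + u * (z - xi ^+ 2) + xi ^+ 2 * (u - 1) by ring.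
  apply: (@le_trans _ _ (2 * b * (b ^+ 2 * d) + K ^+ 4 * d + K ^+ 2 * (b * d))); last first.
    rewrite /C1; have := mulr_ge0 (ltW b0) (ltW d0); have := mulr_ge0 (ltW b2) (ltW d0).
    have := mulr_ge0 (ltW b3) (ltW d0); have := mulr_ge0 bK2 (ltW d0); have := mulr_ge0 K4 (ltW d0).
    rewrite (exprS b 2); clear; lra.
  apply: (le_trans (ler_normD _ _)); apply: lerD.
    apply: (le_trans (ler_normD _ _)); apply: lerD.
      rewrite normrM (gtr0_norm (_ : 0 < x + b)); last by rewrite addr_gt0.
      by apply: ler_pM => //; [rewrite ltW // addr_gt0|clear -xu; lra].
    rewrite normrM (gtr0_norm u0) -[leRHS]mul1r; apply: ler_pM => //; exact: ltW.
  rewrite normrM (ger0_norm (sqr_ge0 xi)); apply: ler_pM => //; first exact: sqr_ge0.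
  by rewrite ler_sqr.
have := quotient_perturbation c0 D1 D2 EN ED.
rewrite (gtr0_norm (_ : 0 < 2 * b)) ?mulr_gt0 //.
by have -> : C1 * d / c + 2 * b * (C1 * d) / c ^+ 2 = (C1 / c + 2 * b * C1 / c ^+ 2) * d by ring.
Qed.

Lemma band_symbol_geometric (u th : R) r :
  band_symbol (fun k => u ^+ k) r th * ((1 - u) ^+ 2 + 4 * u * sin (th / 2) ^+ 2)
  = 1 - u ^+ 2 - 2 * u ^+ r.+1 * cos (th * r.+1%:R) + 2 * u ^+ r.+2 * cos (th * r%:R).
Proof.
have -> : 4 * u * sin (th / 2) ^+ 2 = 2 * u * (1 - cos th) by rewrite -half_angle_sin2; ring.
rewrite /band_symbol; elim: r => [|r IH].
  by rewrite big_ord0 !mulr0 !mulr1 cos0 expr0 !expr1 addr0 mul1r; ring.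
rewrite big_ord_recr /= [2 * (_ + _)]mulrDr [X in X * _]addrA mulrDl IH.
have -> : cos (th * r.+2%:R) = 2 * cos (th * r.+1%:R) * cos th - cos (th * r%:R).
  have -> : th * r.+2%:R = th * r.+1%:R + th by rewrite -[r.+2]addn1 natrD; ring.
  have -> : th * r%:R = th * r.+1%:R - th by rewrite -[r.+1]addn1 natrD; ring.
  by rewrite cosD cosB; ring.
by rewrite !exprS; ring.
Qed.

Lemma band_symbol_geometric_approx (u th : R) r : 0 < u -> u < 1 ->
  `|band_symbol (fun k => u ^+ k) r th - poisson_kernel u th| <= 4 * u ^+ r / (1 - u) ^+ 2.
Proof.
move=> u0 u1; set D := (1 - u) ^+ 2 + 4 * u * sin (th / 2) ^+ 2.
have d0 : 0 < (1 - u) ^+ 2 by rewrite exprn_gt0 // subr_gt0.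
have dD : (1 - u) ^+ 2 <= D by rewrite lerDl; apply: mulr_ge0; [rewrite mulr_ge0 // ltW|exact: sqr_ge0].
have D0 : 0 < D := lt_le_trans d0 dD.
have := band_symbol_geometric u th r; rewrite -/D => E.
have -> : band_symbol (fun k => u ^+ k) r th - poisson_kernel u th =
  (2 * u ^+ r.+2 * cos (th * r%:R) - 2 * u ^+ r.+1 * cos (th * r.+1%:R)) / D.
  rewrite /poisson_kernel -/D; apply: (mulIf (lt0r_neq0 D0)).
  by rewrite mulrBl E !mulfVK ?lt0r_neq0 //; ring.
have ur : 0 <= u ^+ r by rewrite exprn_ge0 // ltW.
rewrite normrM normfV (gtr0_norm D0); apply: ler_pM => //.
- by rewrite invr_ge0 ltW.
- apply: (le_trans (ler_normB _ _)).
  have b k m : `|2 * u ^+ (k + r) * cos (th * m%:R)| <= 2 * u ^+ r.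
    rewrite normrM (ger0_norm (_ : 0 <= 2 * u ^+ (k + r))) ?mulr_ge0 ?exprn_ge0 ?(ltW u0) //.
    rewrite -[leRHS]mulr1; apply: ler_pM => //; [by rewrite mulr_ge0 ?exprn_ge0 ?(ltW u0)| |exact: cos_max].
    by rewrite ler_pM2l // exprD ler_piMl // exprn_ile1 // ltW.
  have := b 2%N r; have := b 1%N r.+1; rewrite add2n add1n; lra.
- by rewrite lef_pV2.
Qed.


Lemma coshR_gt0 x : 0 < coshR x.
Proof. exact: lt_le_trans ltr01 (coshR_ge1 x). Qed.

Lemma geometric_expansion (rho : R) (L : nat) : 0 < rho ->
  rho / (1 + rho ^+ 2) = \sum_(l < L) (-1) ^+ l * rho ^+ (2 * l).+1 + (-1) ^+ L * rho ^+ (2 * L).+1 / (1 + rho ^+ 2).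
Proof.
move=> r0; have d0 : 1 + rho ^+ 2 != 0 by rewrite gt_eqF // ltr_pwDl // sqr_ge0.
elim: L => [|L IH]; first by rewrite big_ord0 add0r expr0 mul1r muln0 expr1.
rewrite big_ord_recr /= {1}IH -addrA; congr (_ + _).
have -> : (2 * L.+1).+1 = ((2 * L).+1 + 2)%N by lia.
by rewrite exprD (exprS _ L); field.
Qed.

(** An alternating geometric series in [exp (- k d)] with its exact remainder, which is again
    dominated by a geometric sequence in [k] and can be summed. *)
Lemma sech_coefE d k (L : nat) : sech_coef d k = (1 - expR (- d)) *
  (\sum_(l < L) (-1) ^+ l * expR (- (half_int l * d)) ^+ k
   + (-1) ^+ L * expR (- (half_int L * d)) ^+ k / (1 + expR (- (k%:R * d)))).
Proof.
pose rho := expR (- (k%:R * d / 2)).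
have e2 : expR (- (k%:R * d)) = rho ^+ 2 by rewrite -expRM_natl; congr expR; rewrite mulr_natl; field.
have el (l : nat) : expR (- (half_int l * d)) ^+ k = rho ^+ (2 * l).+1.
  have E : (2 * l).+1%:R = 2 * l%:R + 1 :> R by rewrite -natr1 natrM.
  by rewrite -!expRM_natl; congr expR; rewrite E /half_int; field.
rewrite /sech_coef; congr (_ * _).
have -> : (2 * coshR (k%:R * d / 2))^-1 = rho / (1 + rho ^+ 2).
  rewrite /coshR -/rho; have := expRxMexpNx_1 (k%:R * d / 2); rewrite -/rho.
  have := expR_gt0 (k%:R * d / 2); set w := expR _ => w0 E.
  have -> : rho = w^-1 by rewrite -[LHS]mul1r -(mulVf (lt0r_neq0 w0)) -mulrA E mulr1.
  by field; rewrite lt0r_neq0 //= gt_eqF // ltr_pwDr // sqr_ge0.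
rewrite (geometric_expansion L (expR_gt0 _)) e2 el; congr (_ + _).
by apply: eq_bigr => l _; rewrite el.
Qed.

Lemma sech_coef_ge0 d k : 0 <= d -> 0 <= sech_coef d k.
Proof.
move=> d0; rewrite /sech_coef divr_ge0 ?mulr_ge0 ?(ltW (coshR_gt0 _)) //.
by rewrite subr_ge0 -[leRHS]expR0 ler_expR oppr_le0.
Qed.

Lemma sech_coef_le d k : 0 <= d -> sech_coef d k <= (1 - expR (- d)) * expR (- (d / 2)) ^+ k.
Proof.
move=> d0; have q0 : 0 <= 1 - expR (- d) by rewrite subr_ge0 -[leRHS]expR0 ler_expR oppr_le0.
have c0 := coshR_gt0 (k%:R * d / 2); have e0 := expR_gt0 (- (k%:R * (d / 2))).
apply: ler_wpM2l => //; rewrite -expRM_natl mulrN expRN lef_pV2 ?posrE ?expR_gt0 ?(mulr_gt0 _ c0) //.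
by rewrite /coshR -[k%:R * d / 2]mulrA; lra.
Qed.

Lemma band_symbolD (a b : nat -> R) r th :
  band_symbol (fun k => a k + b k) r th = band_symbol a r th + band_symbol b r th.
Proof.
rewrite /band_symbol addrACA -mulrDr -big_split /=; congr (_ + 2 * _).
by apply: eq_bigr => k _; rewrite mulrDl.
Qed.

Lemma band_symbolZ c (a : nat -> R) r th : band_symbol (fun k => c * a k) r th = c * band_symbol a r th.
Proof.
rewrite /band_symbol mulrDr [c * (2 * _)]mulrCA; congr (_ + 2 * _).
by rewrite mulr_sumr; apply: eq_bigr => k _; rewrite mulrA.
Qed.

Lemma band_symbol_sum (L : nat) (a : nat -> nat -> R) r th :
  band_symbol (fun k => \sum_(l < L) a l k) r th = \sum_(l < L) band_symbol (a l) r th.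
Proof.
elim: L => [|L IH].
  rewrite big_ord0 /band_symbol big_ord0 add0r big1 ?mulr0 // => k _; by rewrite big_ord0 mul0r.
rewrite big_ord_recr /= -IH -(band_symbolD (fun k => \sum_(l < L) a l k)); congr band_symbol.
by apply/funext => k; rewrite big_ord_recr.
Qed.

Lemma band_symbol_norm_le (a b : nat -> R) r th : (forall k, `|a k| <= b k) ->
  `|band_symbol a r th| <= 2 * \sum_(k < r.+1) b k.
Proof.
move=> H; have b0 k : 0 <= b k := le_trans (normr_ge0 _) (H k).
rewrite big_ord_recl mulrDr; apply: (le_trans (ler_normD _ _)); apply: lerD.
  by apply: (le_trans (H 0%N)); have := b0 0%N; lra.
rewrite normrM (gtr0_norm (_ : 0 < 2)) // ler_pM2l //.
apply: (le_trans (ler_norm_sum _ _ _)); apply: ler_sum => k _.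
by rewrite normrM -[leRHS]mulr1; apply: ler_pM => //; exact: cos_max.
Qed.

Lemma geometric_partial_le (u : R) n : 0 <= u -> u < 1 -> \sum_(k < n) u ^+ k <= (1 - u)^-1.
Proof.
move=> u0 u1; have d0 : 0 < 1 - u by lra.
rewrite -[leRHS]mul1r ler_pdivlMr // mulrC.
have -> : (1 - u) * \sum_(k < n) u ^+ k = 1 - u ^+ n.
  by rewrite -[1 - u ^+ n]opprB subrX1 -mulNr opprB.
by rewrite gerBl exprn_ge0.
Qed.

Lemma expr_vanish (u C e : R) : 0 <= u -> u < 1 -> 0 < e ->
  exists r0, forall r, (r0 <= r)%N -> C * u ^+ r <= e.
Proof.
move=> u0 u1 e0; have : (fun r => C * u ^+ r) @ \oo --> C * 0.
  by apply: cvgMr; apply: cvg_expr; rewrite ger0_norm.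
rewrite mulr0 => /cvgrPdist_le/(_ _ e0) [r0 _ H]; exists r0 => r /H.
rewrite sub0r normrN; exact: le_trans (ler_norm _).
Qed.

Lemma partial_symbol_approx (L : nat) (K e : R) : 0 <= K -> 0 < e ->
  exists2 d0, 0 < d0 & forall d, 0 < d -> d <= d0 -> exists r0, forall r xi, (r0 <= r)%N ->
    0 <= xi -> xi <= K ->
    `|(1 - expR (- d)) * band_symbol (fun k => \sum_(l < L) (-1) ^+ l * expR (- (half_int l * d)) ^+ k) r (d * xi)
      - 2 * alternating_sum L xi| <= e.
Proof.
move=> K0; elim: L e => [|L IH] e e0.
  exists 1 => // d _ _; exists 0%N => r xi _ _ _; rewrite (band_symbol_sum 0 (fun l k => (-1) ^+ l * expR (- (half_int l * d)) ^+ k)) /alternating_sum !big_ord0.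
  by rewrite !mulr0 subrr normr0 ltW.
have e2 : 0 < e / 2 by rewrite divr_gt0.
have e4 : 0 < e / 4 by rewrite divr_gt0.
have [d1 d10 H1] := IH _ e2.
have [C C0 [d2 d20 H2]] := poisson_limit (half_int_gt0 L) K0.
have C1 : 0 < C + 1 by lra.
exists (Num.min d1 (Num.min d2 (e / 4 / (C + 1)))).
  by rewrite !lt_min d10 d20 divr_gt0.
move=> d d0; rewrite !le_min => /andP[dd1 /andP[dd2 dC]].
have [r1 Hr1] := H1 d d0 dd1.
have bd : 0 < half_int L * d by rewrite mulr_gt0 ?half_int_gt0.
set u := expR (- (half_int L * d)).
have u0 : 0 < u by exact: expR_gt0.
have u1 : u < 1 by rewrite -[ltRHS]expR0 ltr_expR oppr_lt0.
have [r2 Hr2] := expr_vanish (4 / (1 - u) ^+ 2) (ltW u0) u1 e4.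
exists (maxn r1 r2) => r xi; rewrite geq_max => /andP[rr1 rr2] xi0 xiK.
have A1 := Hr1 r xi rr1 xi0 xiK; have A2 := H2 d xi d0 dd2 xi0 xiK.
have A3 := band_symbol_geometric_approx (d * xi) r u0 u1.
rewrite -/u in A2.
move: A1; rewrite (band_symbol_sum L (fun l k => (-1) ^+ l * expR (- (half_int l * d)) ^+ k)).
rewrite (band_symbol_sum L.+1 (fun l k => (-1) ^+ l * expR (- (half_int l * d)) ^+ k)).
rewrite /alternating_sum !big_ord_recr /=.
set S1 := \sum_(l < L) _; set S2 := \sum_(l < L) _ => A1.
rewrite band_symbolZ; set P := band_symbol _ _ _ in A3 *; set Q := poisson_kernel _ _ in A2 A3.
set q := 1 - expR (- d) in A1 A2 *; set b := half_int L in A2 *.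
have -> : q * (S1 + (-1) ^+ L * P) - 2 * (S2 + (-1) ^+ L * b / (b ^+ 2 + xi ^+ 2)) =
  (q * S1 - 2 * S2) + (-1) ^+ L * ((q * Q - 2 * b / (b ^+ 2 + xi ^+ 2)) + q * (P - Q)) by ring.
have -> : e = e / 2 + (e / 4 + e / 4) by field.
have q0 : 0 <= q by rewrite subr_ge0 -[leRHS]expR0 ler_expR oppr_le0 ltW.
have q1 : q <= 1 by rewrite gerBl ltW // expR_gt0.
apply: (le_trans (ler_normD _ _)); apply: lerD => //.
rewrite normrM normrX normrN1 expr1n mul1r.
apply: (le_trans (ler_normD _ _)); apply: lerD.
  apply: (le_trans A2); apply: (@le_trans _ _ ((C + 1) * d)); first by rewrite ler_pM2r //; lra.
  by rewrite mulrC -ler_pdivlMr.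
rewrite normrM (ger0_norm q0) -[leRHS]mul1r; apply: ler_pM => //.
by apply: (le_trans A3); rewrite mulrAC; exact: Hr2.
Qed.

(** The order of choice is [L], then [d], then [r]. The tail of the partial fractions is of order
    [1 / L]. So is the remainder of the alternating series, whose sum over [k] is about [1 / (L d)]
    before the factor [1 - exp (- d)]. The [L] terms kept converge one by one. *)
Lemma band_symbol_sech_limit (K e : R) : 0 <= K -> 0 < e ->
  exists2 d0, 0 < d0 & forall d, 0 < d -> d <= d0 -> exists r0, forall r xi, (r0 <= r)%N ->
    0 <= xi -> xi <= K ->
    `|band_symbol (sech_coef d) r (d * xi) - pi / coshR (pi * xi)| <= e.
Proof.
move=> K0 e0; have [C C0 HC] := alternating_sum_approx K0.
pose L := (Num.truncn ((C + 4) * 4 / e)).+1.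
have L0 : 0 < L%:R :> R by rewrite ltr0n.
have L1 : (C + 4) / L%:R <= e / 4.
  rewrite ler_pdivrMr // mulrC -ler_pdivrMr ?divr_gt0 //.
  have -> : (C + 4) / (e / 4) = (C + 4) * 4 / e by field; rewrite lt0r_neq0.
  exact/ltW/truncnS_gt.
have e4 : 0 < e / 4 by rewrite divr_gt0.
have [d1 d10 H1] := partial_symbol_approx L K0 e4.
exists (Num.min d1 (e / 16)); first by rewrite lt_min d10 divr_gt0.
move=> d d0; rewrite le_min => /andP[dd1 dd2].
have [r0 Hr] := H1 d d0 dd1; exists r0 => r xi rr xi0 xiK.
have A1 := Hr r xi rr xi0 xiK; have A2 := HC L xi (ltn0Sn _) xi0 xiK.
set q := 1 - expR (- d) in A1.
have -> : sech_coef d = (fun k => q * (\sum_(l < L) (-1) ^+ l * expR (- (half_int l * d)) ^+ k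
   + (-1) ^+ L * expR (- (half_int L * d)) ^+ k / (1 + expR (- (k%:R * d))))).
  by apply/funext => k; exact: sech_coefE.
rewrite band_symbolZ band_symbolD.
set B1 := band_symbol _ _ _ in A1 *; set B2 := band_symbol _ _ _.
have -> : q * (B1 + B2) - pi / coshR (pi * xi) = (q * B1 - 2 * alternating_sum L xi)
   + (2 * alternating_sum L xi - pi / coshR (pi * xi)) + q * B2 by ring.
have q0 : 0 <= q by rewrite subr_ge0 -[leRHS]expR0 ler_expR oppr_le0 ltW.
have qd : q <= d by have := expR_ge1Dx (- d); rewrite /q; lra.
have bd : 0 < half_int L * d by rewrite mulr_gt0 ?half_int_gt0.
set u := expR (- (half_int L * d)).
have u0 : 0 < u by exact: expR_gt0.
have u1 : u < 1 by rewrite -[ltRHS]expR0 ltr_expR oppr_lt0.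
have nB2 : `|B2| <= 2 / (1 - u).
  apply: (@le_trans _ _ (2 * \sum_(k < r.+1) u ^+ k)).
    apply: band_symbol_norm_le => k.
    rewrite !normrM normrX normrN1 expr1n mul1r (gtr0_norm (exprn_gt0 _ u0)) -[leRHS]mulr1.
    apply: ler_pM => //; first exact: exprn_ge0 (ltW u0).
    have e1 := expR_gt0 (- (k%:R * d)).
    by rewrite normfV gtr0_norm ?invf_le1 ?addr_gt0 // lerDl ltW.
  by rewrite ler_pM2l //; apply: geometric_partial_le => //; exact: ltW.
have qB2 : `|q * B2| <= e / 2.
  rewrite normrM (ger0_norm q0).
  apply: (@le_trans _ _ (d * (2 / (1 - u)))); first exact: ler_pM.
  have hu : half_int L * d / (1 + half_int L * d) <= 1 - u.
    have := expRN_le_inv (ltW bd); rewrite -/u => hu.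
    have -> : half_int L * d / (1 + half_int L * d) = 1 - (1 + half_int L * d)^-1 by field; rewrite gt_eqF //; lra.
    lra.
  have p0 : 0 < half_int L * d / (1 + half_int L * d) by rewrite divr_gt0 //; lra.
  apply: (@le_trans _ _ (d * (2 / (half_int L * d / (1 + half_int L * d))))).
    by rewrite ler_pM2l // ler_pM2l // lef_pV2 // posrE; lra.
  have -> : d * (2 / (half_int L * d / (1 + half_int L * d))) = 2 / half_int L + 2 * d.
    by field; rewrite (lt0r_neq0 d0) (lt0r_neq0 (half_int_gt0 L)) gt_eqF //; lra.
  have : 2 / half_int L <= (C + 4) / L%:R.
    apply: ler_pM => //; [by rewrite invr_ge0 ltW // half_int_gt0|lra|].
    by rewrite lef_pV2 ?posrE ?half_int_gt0 // lerDl invr_ge0.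
  lra.
have CL : C / L%:R <= e / 4 by apply: le_trans L1; rewrite ler_pM2r ?invr_gt0 //; lra.
have -> : e = e / 4 + e / 4 + e / 2 by field.
apply: (le_trans (ler_normD _ _)); apply: lerD => //.
apply: (le_trans (ler_normD _ _)); apply: lerD => //.
exact: le_trans CL.
Qed.

End symbol.

(** * Decay of the symbol at high frequency *)

Section symbol_decay.
Context {R : realType}.
Implicit Types (x y d xi : R).

Lemma index_dist_le i r : (i <= r)%N -> index_dist i r = (r - i)%N.
Proof. rewrite /index_dist; lia. Qed.

Lemma index_dist_ge i r : (r <= i)%N -> index_dist i r = (i - r)%N.
Proof. rewrite /index_dist; lia. Qed.

Lemma iter_telescope_diffR_affine (f : R -> R) (h x0 : R) (k j : nat) :
  iter k telescope (fun i => f (i%:R * h + x0)) j = iter k (diffR h) f (j%:R * h + x0).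
Proof.
elim: k j => [//|k IH] j; rewrite !iterS telescopeE /diffR !IH -natr1.
by congr (iter k _ f _ - _); ring.
Qed.

Lemma iter_telescopeZ (c : R) (f : nat -> R) (k j : nat) :
  iter k telescope (fun i => c * f i) j = c * iter k telescope f j.
Proof. by elim: k j => [//|k IH] j; rewrite !iterS !telescopeE !IH mulrBr. Qed.

(** [1 / (2 cosh (x / 2))] times a power of [tanh (x / 2)]. Derivatives stay in the span of this
    family, so iterated differences can be bounded by induction. *)
Definition sech_tanh (i : nat) x : R :=
  (sinhR (2^-1 * x) / coshR (2^-1 * x)) ^+ i / (2 * coshR (2^-1 * x)).

Lemma coshR2_sub_sinhR2 x : coshR x ^+ 2 - sinhR x ^+ 2 = 1.
Proof.
have E := expRxMexpNx_1 x; rewrite /coshR /sinhR.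
have -> : ((expR x + expR (- x)) / 2) ^+ 2 - ((expR x - expR (- x)) / 2) ^+ 2 = expR x * expR (- x) by field.
by [].
Qed.

Lemma is_derive_sech_tanh i x :
  is_derive x 1 (sech_tanh i) (2^-1 * (i%:R * sech_tanh i.-1 x) + - (2^-1 * i.+1%:R) * sech_tanh i.+1 x).
Proof.
have c0 := coshR_gt0 (2^-1 * x).
have dch := is_derive_scaled (is_derive_coshR (2^-1 * x)).
have dsh := is_derive_scaled (is_derive_sinhR (2^-1 * x)).
have nz : (fun y => coshR (2^-1 * y)) x != 0 by rewrite gt_eqF.
have dV := @is_deriveV R (fun y => coshR (2^-1 * y)) x _ _ nz dch.
have dT := is_deriveM dsh dV.
have D := is_deriveM (is_deriveX i dT) (is_deriveZ 2^-1 dV).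
have -> : sech_tanh i = ((fun y => sinhR (2^-1 * y)) * (fun y => (coshR (2^-1 * y))^-1)) ^+ i
    * (2^-1 \*: (fun y => (coshR (2^-1 * y))^-1)) :> (R -> R).
  apply/funext => y; change (sech_tanh i y = (((fun y => sinhR (2^-1 * y)) * (fun y => (coshR (2^-1 * y))^-1)) ^+ i) y
    * (2^-1 * (coshR (2^-1 * y))^-1)).
  by rewrite exprfctE /sech_tanh (invfM 2 (coshR _)).
apply: is_derive_eq D _; rewrite /sech_tanh.
rewrite exprfctE /=.
set c := coshR _ in c0 *; set s := sinhR _.
have -> : ((fun y => sinhR (2^-1 * y)) * (fun y => (coshR (2^-1 * y))^-1)) x = s / c by [].
case: i => [|i]; rewrite /GRing.scale /=.
  by rewrite !expr0 expr1 !mul0r !mulr0 mul1r addr0 add0r mulr1; field; rewrite lt0r_neq0.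
rewrite !exprS -(natr1 i.+1) -(natr1 i).
set T := (s / c) ^+ i.
by field; rewrite lt0r_neq0.
Qed.

Lemma sech_tanh_le i x : `|sech_tanh i x| <= expR (- (`|x| / 2)).
Proof.
have c0 := coshR_gt0 (2^-1 * x).
have sc : `|sinhR (2^-1 * x) / coshR (2^-1 * x)| <= 1.
  rewrite normrM normfV (gtr0_norm c0) ler_pdivrMr // mul1r -(ler_sqr _ (ltW c0)) ?nnegrE //.
  by rewrite real_normK ?num_real // -subr_ge0 coshR2_sub_sinhR2.
have c2 : 0 < 2 * coshR (2^-1 * x) by exact: mulr_gt0.
rewrite /sech_tanh normrM normrX normfV (gtr0_norm c2).
rewrite -[leRHS]mul1r; apply: ler_pM; rewrite ?exprn_ge0 ?invr_ge0 ?(mulr_ge0 _ (ltW c0)) //.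
- by rewrite exprn_ile1.
rewrite expRN lef_pV2 ?posrE ?expR_gt0 //.
have e1 := expR_gt0 (2^-1 * x); have e2 := expR_gt0 (- (2^-1 * x)).
rewrite /coshR mulrCA divff // mulr1; have [x0|x0] := ger0P x.
  by rewrite mulrC lerDl ltW.
by rewrite (_ : - x / 2 = - (2^-1 * x)) ?lerDr ?(ltW e1) //; ring.
Qed.

Lemma diff_sech_tanh_bound p : forall i, exists2 C, 0 <= C & forall h x, 0 < h -> h <= 1 ->
  `|iter p (diffR h) (sech_tanh i) x| <= C * h ^+ p * expR (- (`|x| / 2)).
Proof.
elim: p => [|p IH] i.
  by exists 1 => // h x _ _; rewrite expr0 !mul1r; exact: sech_tanh_le.
have [C1 C10 H1] := IH i.-1; have [C2 C20 H2] := IH i.+1.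
have ei : 0 <= expR (1 / 2 : R) by rewrite ltW ?expR_gt0.
exists ((i%:R * C1 + i.+1%:R * C2) * expR (1 / 2)).
  by rewrite mulr_ge0 ?addr_ge0 ?mulr_ge0.
move=> h x h0 h1.
have lx : x - 1 < x by rewrite gtrBl.
have [c /andP[xc ch] ->] := iter_diffR_mean_value p h0 (fun y _ => is_derive_sech_tanh i y) lx.
have ec : expR (- (`|c| / 2)) <= expR (1 / 2) * expR (- (`|x| / 2)).
  rewrite -expRD ler_expR.
  have : `|x| <= `|c| + 1 by rewrite -lerBlDl; apply: le_trans (lerB_dist _ _) _; rewrite ltr0_norm; lra.
  lra.
have -> : (fun y => 2^-1 * (i%:R * sech_tanh i.-1 y) + - (2^-1 * i.+1%:R) * sech_tanh i.+1 y)
  = (fun y => (2^-1 * i%:R) * sech_tanh i.-1 y + - (2^-1 * i.+1%:R) * sech_tanh i.+1 y).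
  by apply/funext => y; ring.
rewrite iter_diffR_linear normrM (gtr0_norm h0) exprSr.
set E := expR (1 / 2) in ei ec *.
have -> : (i%:R * C1 + i.+1%:R * C2) * E * (h ^+ p * h) * expR (- (`|x| / 2)) =
   (i%:R * C1 + i.+1%:R * C2) * h ^+ p * (E * expR (- (`|x| / 2))) * h by ring.
rewrite ler_pM2r //.
apply: (@le_trans _ _ ((i%:R * C1 + i.+1%:R * C2) * h ^+ p * expR (- (`|c| / 2)))); last first.
  by apply: ler_wpM2l => //; rewrite mulr_ge0 ?addr_ge0 ?mulr_ge0 ?exprn_ge0 // ltW.
have -> : (i%:R * C1 + i.+1%:R * C2) * h ^+ p * expR (- (`|c| / 2)) =
  i%:R * (C1 * h ^+ p * expR (- (`|c| / 2))) + i.+1%:R * (C2 * h ^+ p * expR (- (`|c| / 2))) by ring.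
have hh : 0 <= 2^-1 * i%:R :> R by rewrite mulr_ge0 // invr_ge0.
have hh' : 0 <= 2^-1 * i.+1%:R :> R by rewrite mulr_ge0 // invr_ge0.
apply: (le_trans (ler_normD _ _)); apply: lerD.
  rewrite normrM (ger0_norm hh).
  apply: ler_pM => //; last exact: H1.
  by rewrite ler_piMl // invf_le1 // ler1n.
rewrite normrM normrN (ger0_norm hh').
apply: ler_pM => //; last exact: H2.
by rewrite ler_piMl // invf_le1 // ler1n.
Qed.

Lemma abel_sum_telescope (F s : nat -> R) n :
  \sum_(i < n) F i * (s i.+1 - s i) = F n * s n - F 0%N * s 0%N - \sum_(i < n) telescope F i * s i.+1.
Proof.
elim: n => [|n IH]; first by rewrite !big_ord0 subrr subr0.
by rewrite !big_ord_recr /= IH telescopeE; ring.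
Qed.

(** Summation by parts [p] times; each one gains a factor [2 sin (th / 2)], shifts the phase and
    leaves boundary terms. *)
Lemma oscillating_sum_bound (p n : nat) (F : nat -> R) (th ph : R) :
  `|2 * sin (th / 2)| ^+ p * `|\sum_(i < n) F i * cos (th * i%:R + ph)| <=
  2 ^+ p * \sum_(k < p) (`|iter k telescope F n| + `|iter k telescope F 0%N|) + \sum_(i < n) `|iter p telescope F i|.
Proof.
have s2 : `|2 * sin (th / 2)| <= 2.
  by rewrite normrM ger0_norm // ler_piMr // sin_max.
elim: p F ph => [|p IH] F ph.
  rewrite big_ord0 mulr0 add0r expr0 mul1r; apply: (le_trans (ler_norm_sum _ _ _)).
  apply: ler_sum => i _; rewrite normrM ler_piMr //; exact: cos_max.
pose s (i : nat) := sin (th * i%:R - th / 2 + ph).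
have E : 2 * sin (th / 2) * \sum_(i < n) F i * cos (th * i%:R + ph) = \sum_(i < n) F i * (s i.+1 - s i).
  rewrite mulr_sumr; apply: eq_bigr => i _; rewrite mulrCA; congr (_ * _); rewrite /s.
  have -> : th * i.+1%:R - th / 2 + ph = (th * i%:R + ph) + th / 2 by rewrite -natr1; field.
  have -> : th * i%:R - th / 2 + ph = (th * i%:R + ph) - th / 2 by ring.
  by rewrite sinD sinB; ring.
have Es (i : nat) : s i.+1 = cos (th * i%:R + (th / 2 + ph - pi / 2)).
  have -> : th * i%:R + (th / 2 + ph - pi / 2) = (th * i.+1%:R - th / 2 + ph) - pi / 2 by rewrite -natr1; field.
  by rewrite cosB cos_pihalf sin_pihalf mulr0 add0r mulr1.
rewrite exprSr -mulrA -normrM E abel_sum_telescope.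
have -> : \sum_(i < n) telescope F i * s i.+1 = \sum_(i < n) telescope F i * cos (th * i%:R + (th / 2 + ph - pi / 2)).
  by apply: eq_bigr => i _; rewrite Es.
have := IH (telescope F) (th / 2 + ph - pi / 2).
set S := \sum_(i < n) _ => HS.
have sp : `|2 * sin (th / 2)| ^+ p <= 2 ^+ p by apply: lerXn2r; rewrite ?nnegrE.
have s0 : 0 <= `|2 * sin (th / 2)| ^+ p by rewrite exprn_ge0.
have p2 : 0 <= 2 ^+ p :> R by rewrite exprn_ge0.
rewrite big_ord_recl /=.
under [\sum_(i < p) (`|_| + _)]eq_bigr => i _ do rewrite /= -!iterS !iterSr.
rewrite -iterS iterSr.
set B := \sum_(i < p) _ in HS *.
have B0 : 0 <= B by apply: sumr_ge0 => i _; rewrite addr_ge0.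
apply: (@le_trans _ _ (2 ^+ p * (`|F n| + `|F 0%N|) + (2 ^+ p * B + \sum_(i < n) `|iter p telescope (telescope F) i|))).
  apply: (@le_trans _ _ (`|2 * sin (th / 2)| ^+ p * (`|F n| + `|F 0%N|) + `|2 * sin (th / 2)| ^+ p * `|S|)).
    rewrite -mulrDr; apply: ler_wpM2l => //.
    have sn i : `|s i| <= 1 by exact: sin_max.
    apply: (le_trans (ler_normB _ _)); apply: lerD => //.
    by apply: (le_trans (ler_normB _ _)); apply: lerD; rewrite normrM ler_piMr.
  by apply: lerD => //; apply: ler_wpM2r => //; rewrite addr_ge0.
rewrite addrA -mulrDr; apply: lerD => //.
by apply: ler_wpM2r; [rewrite !addr_ge0|rewrite exprS ler_peMl // ler1n].
Qed.

(** Unfolded to a two-sided sum centred at [r], the coefficients are samples of a smooth function;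
    the one-sided sum would give boundary terms at [k = 0] in the summation by parts. *)
Lemma band_symbol_fullE (a : nat -> R) r (th : R) :
  band_symbol a r th = \sum_(i < r + r.+1) a (index_dist i r) * cos (th * i%:R + - (th * r%:R)).
Proof.
rewrite big_split_ord /= big_ord_recl /= (reindex_inj rev_ord_inj) /=.
have -> : \sum_(j < r) a (index_dist (r - j.+1) r) * cos (th * (r - j.+1)%:R + - (th * r%:R))
  = \sum_(k < r) a k.+1 * cos (th * k.+1%:R).
  apply: eq_bigr => k _; have kr := ltn_ord k.
  have -> : index_dist (r - k.+1) r = k.+1 by rewrite /index_dist; lia.
  by congr (_ * _); rewrite -cosN natrB //; congr cos; ring.
have -> : \sum_(i < r) a (index_dist (r + bump 0 i) r) * cos (th * (r + bump 0 i)%:R + - (th * r%:R))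
  = \sum_(k < r) a k.+1 * cos (th * k.+1%:R).
  apply: eq_bigr => k _; rewrite /bump /= add1n.
  have -> : index_dist (r + k.+1) r = k.+1 by rewrite /index_dist; lia.
  by congr (_ * _); rewrite natrD; congr cos; ring.
have -> : index_dist (r + 0) r = 0%N by rewrite /index_dist; lia.
by rewrite addn0 subrr cos0 mulr1 /band_symbol; ring.
Qed.

(** After [p] summations by parts the differences sum to order [d ^ p], against a factor
    [(d xi) ^ p] gained. The boundary terms decay geometrically in [r] and make up [e]. That [C] is
    independent of [d] allows summation over the full range [xi <= pi / d]. *)
Lemma band_symbol_sech_decay p : exists2 C, 0 <= C & forall d e, 0 < d -> d <= 1 -> 0 < e ->
  exists r0, forall r xi, (r0 <= r)%N -> 1 <= xi -> d * xi <= pi ->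
    band_symbol (sech_coef d) r (d * xi) <= C / xi ^+ p + e.
Proof.
have [c c0 sc] := @sin_lower R.
have [C HC] : exists C : nat -> R, forall k, 0 <= C k /\ forall h x, 0 < h -> h <= 1 ->
    `|iter k (diffR h) (sech_tanh 0) x| <= C k * h ^+ k * expR (- (`|x| / 2)).
  have : forall k, exists C : R, 0 <= C /\ forall h x, 0 < h -> h <= 1 ->
    `|iter k (diffR h) (sech_tanh 0) x| <= C * h ^+ k * expR (- (`|x| / 2)).
    by move=> k; have [C C0 HC] := diff_sech_tanh_bound k 0; exists C.
  by case/choice => C HC; exists C.
exists (8 * C p / c ^+ p).
  by rewrite divr_ge0 ?mulr_ge0 ?exprn_ge0 ?(ltW c0) //; case: (HC p).
move=> d e d0 d1 e0.
pose B := 2 ^+ p * \sum_(k < p) (C k + C k).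
have cd0 : 0 < (c * d) ^+ p by rewrite exprn_gt0 // mulr_gt0.
pose u := expR (- (d / 2)).
have u0 : 0 < u by exact: expR_gt0.
have u1 : u < 1 by rewrite -[ltRHS]expR0 ltr_expR oppr_lt0 divr_gt0.
have [r0 Hr0] := expr_vanish (B / (c * d) ^+ p) (ltW u0) u1 e0.
exists r0 => r xi rr xi1 dxi.
have xi0 : 0 < xi by lra.
have q0 : 0 <= 1 - expR (- d) by rewrite subr_ge0 -[leRHS]expR0 ler_expR oppr_le0 ltW.
have q1 : 1 - expR (- d) <= 1 by rewrite gerBl ltW // expR_gt0.
have qd : 1 - expR (- d) <= d by have := expR_ge1Dx (- d); lra.
pose F (i : nat) := (1 - expR (- d)) * sech_tanh 0 (i%:R * d + - (r%:R * d)).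
have EF : band_symbol (sech_coef d) r (d * xi) = \sum_(i < r + r.+1) F i * cos (d * xi * i%:R + - (d * xi * r%:R)).
  rewrite band_symbol_fullE; apply: eq_bigr => i _; congr (_ * _).
  rewrite /F /sech_coef /sech_tanh expr0 mul1r; congr (_ / (2 * _)).
  have ch y : coshR (- y) = coshR y by rewrite /coshR opprK addrC.
  have [ir|ir] := leqP i r.
    rewrite (index_dist_le ir).
    by rewrite -ch natrB //; congr coshR; field.
  rewrite (index_dist_ge (ltnW ir)).
  by rewrite natrB ?(ltnW ir) //; congr coshR; field.
have DF k i : `|iter k telescope F i| <= (1 - expR (- d)) * (C k * d ^+ k) * u ^+ index_dist i r.
  have -> : iter k telescope F i = (1 - expR (- d)) * iter k (diffR d) (sech_tanh 0) (i%:R * d + - (r%:R * d)).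
    by rewrite iter_telescopeZ iter_telescope_diffR_affine.
  rewrite normrM (ger0_norm q0) -mulrA; apply: ler_wpM2l => //.
  apply: (le_trans ((HC k).2 d _ d0 d1)).
  have -> : `|i%:R * d - r%:R * d| = (index_dist i r)%:R * d; last first.
    by rewrite /u -expRM_natl; rewrite (_ : - ((index_dist i r)%:R * d / 2) = (index_dist i r)%:R * - (d / 2)) //; ring.
  rewrite -mulrBl normrM (gtr0_norm d0); congr (_ * _).
  have [ir|ir] := leqP i r.
    rewrite (index_dist_le ir).
    by rewrite distrC -natrB // normr_nat.
  rewrite (index_dist_ge (ltnW ir)).
  by rewrite -natrB ?(ltnW ir) // normr_nat.
have bd k i : index_dist i r = r \/ index_dist i r = r.+1 -> `|iter k telescope F i| <= C k * u ^+ r.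
  move=> Hi; apply: (le_trans (DF k i)).
  have Ck := (HC k).1.
  have ur : u ^+ index_dist i r <= u ^+ r.
    case: Hi => -> //; rewrite exprS ger_pMl ?exprn_gt0 //; exact: ltW.
  apply: ler_pM => //; rewrite ?mulr_ge0 ?exprn_ge0 ?(ltW d0) ?(ltW u0) //.
  rewrite -[leRHS]mul1r; apply: ler_pM; rewrite ?mulr_ge0 ?exprn_ge0 ?(ltW d0) //.
  by rewrite ler_piMr // exprn_ile1 // ltW.
have th0 : 0 < d * xi by rewrite mulr_gt0.
have sl : c * (d * xi) <= 2 * sin (d * xi / 2) by have := sc (d * xi / 2); lra.
have cth : 0 < c * (d * xi) by rewrite mulr_gt0.
have slp : (c * (d * xi)) ^+ p <= `|2 * sin (d * xi / 2)| ^+ p.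
  by apply: lerXn2r; rewrite ?nnegrE ?(ltW cth) // ger0_norm //; lra.
have main := oscillating_sum_bound p (r + r.+1) F (d * xi) (- (d * xi * r%:R)).
rewrite -EF in main; set S := band_symbol _ _ _ in main *.
have hB : 2 ^+ p * \sum_(k < p) (`|iter k telescope F (r + r.+1)| + `|iter k telescope F 0%N|) <= B * u ^+ r.
  rewrite /B -mulrA mulr_suml; apply: ler_wpM2l; first by rewrite exprn_ge0.
  apply: ler_sum => k _; rewrite mulrDl; apply: lerD; apply: bd; [right; rewrite index_dist_ge ?leq_addr // addKn //|left; rewrite index_dist_le // subn0 //].
have hS : \sum_(i < r + r.+1) `|iter p telescope F i| <= 8 * C p * d ^+ p.
  have Cp := (HC p).1.
  apply: (@le_trans _ _ (\sum_(i < r + r.+1) (1 - expR (- d)) * (C p * d ^+ p) * u ^+ index_dist i r)).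
    by apply: ler_sum => i _; exact: DF.
  rewrite -mulr_sumr.
  have -> : \sum_(i < r + r.+1) u ^+ index_dist i r = band_symbol (fun k => u ^+ k) r 0.
    by rewrite band_symbol_fullE; apply: eq_bigr => i _; rewrite !mul0r oppr0 addr0 cos0 mulr1.
  have bu : band_symbol (fun k => u ^+ k) r 0 <= 2 / (1 - u).
    apply: le_trans (ler_norm _) _.
    apply: (@le_trans _ _ (2 * \sum_(k < r.+1) u ^+ k)).
      by apply: band_symbol_norm_le => m; rewrite ger0_norm // exprn_ge0 // ltW.
    by rewrite ler_pM2l //; apply: geometric_partial_le => //; exact: ltW.
  have u4 : d / 4 <= 1 - u.
    have d2 : 0 <= d / 2 by rewrite divr_ge0 // ltW.
    have /andP[h _] := sub1_expRN_bounds d2.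
    have dd : d ^+ 2 <= d by rewrite expr2 ger_pMl.
    by move: h; rewrite -/u expr_div_n (_ : 2 ^+ 2 = 4 :> R); [lra|ring].
  have u8 : 2 / (1 - u) <= 8 / d.
    by rewrite ler_pdivrMr ?subr_gt0 // mulrAC ler_pdivlMr //; lra.
  apply: (@le_trans _ _ (d * (C p * d ^+ p) * (8 / d))).
    apply: ler_pM; rewrite ?mulr_ge0 ?exprn_ge0 ?(ltW d0) //.
    - rewrite /band_symbol addr_ge0 ?exprn_ge0 ?(ltW u0) // mulr_ge0 // sumr_ge0 // => k _.
      by rewrite mul0r cos0 mulr1 exprn_ge0 // ltW.
    - by apply: ler_wpM2r => //; rewrite mulr_ge0 ?exprn_ge0 // ltW.
    - exact: le_trans u8.
  by rewrite (_ : d * (C p * d ^+ p) * (8 / d) = 8 * C p * d ^+ p) //; field; rewrite lt0r_neq0.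
have T : (c * (d * xi)) ^+ p * `|S| <= B * u ^+ r + 8 * C p * d ^+ p.
  apply: le_trans (lerD hB hS); apply: le_trans main.
  by apply: ler_wpM2r.
apply: (le_trans (ler_norm S)).
rewrite -(ler_pM2l (_ : 0 < (c * (d * xi)) ^+ p)) ?exprn_gt0 //.
apply: (le_trans T); rewrite mulrDr addrC; apply: lerD.
  rewrite (_ : (c * (d * xi)) ^+ p * (8 * C p / c ^+ p / xi ^+ p) = 8 * C p * d ^+ p) //.
  by rewrite !exprMn; field; rewrite !expf_neq0 // lt0r_neq0.
apply: (@le_trans _ _ ((c * d) ^+ p * e)).
  by have := Hr0 r rr; rewrite mulrAC ler_pdivrMr // mulrC [e * _]mulrC.
rewrite ler_pM2r // mulrA; apply: lerXn2r; rewrite ?nnegrE ?mulr_ge0 ?(ltW c0) ?(ltW d0) ?(ltW xi0) //.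
by rewrite ler_peMr // ltW // mulr_gt0.
Qed.

End symbol_decay.

(** * The Beta integral *)

Section beta_integral.
Context {R : realType}.
Implicit Types (x y a : R).
Let mu := @lebesgue_measure R.

Lemma one_powR a : 1 `^ a = 1.
Proof. by rewrite powR1. Qed.

(** For integrands that may blow up at both ends: integrate over [[c n, 1 - c n]] by the primitive
    and pass to the limit by monotone convergence. *)
Lemma integrable_bounded_primitive (f G : R -> R) (M : R) : measurable_fun setT f ->
  (forall t : R, 0 < t < 1 -> 0 <= f t) -> (forall t : R, 0 < t < 1 -> {for t, continuous f}) ->
  (forall t : R, 0 < t < 1 -> is_derive t 1 G (f t)) -> (forall t : R, 0 < t < 1 -> `|G t| <= M) ->
  (\int[mu]_(t in `]0%R, 1%R[) (f t)%:E <= (2 * M)%:E)%E.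
Proof.
move=> mf f0 cf dG bG.
(* The shift by 3 keeps [c n] below [1 - c n] for every [n]. *)
pose c (n : nat) : R := n.+3%:R^-1.
have c0 n : 0 < c n by rewrite invr_gt0.
have c3 n : c n <= 3^-1 by rewrite lef_pV2 ?posrE // ler_nat.
pose S n := `[c n, 1 - c n]%classic.
have inS n t : c n <= t <= 1 - c n -> 0 < t < 1.
  by move=> /andP[h1 h2]; have h := c0 n; apply/andP; split; lra.
have US : \bigcup_n S n = `]0, 1[%classic.
  apply/seteqP; split => t /=.
    by move=> [n _]; rewrite /S /= in_itv /= => /inS; rewrite in_itv.
  rewrite in_itv /= => /andP[t0 t1].
  have m0 : 0 < Num.min t (1 - t) by rewrite lt_min t0 subr_gt0.
  pose n := Num.truncn (Num.min t (1 - t))^-1; exists n => //.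
  have : c n <= Num.min t (1 - t).
    rewrite /c -[leRHS]invrK lef_pV2 ?posrE ?invr_gt0 //.
    apply: (@le_trans _ _ n.+1%:R); last by rewrite ler_nat; lia.
    exact/ltW/truncnS_gt.
  by rewrite /S /= in_itv /= le_min => /andP[-> h]; rewrite lerBrDr -lerBrDl.
have mEf : measurable_fun setT (EFin \o f) by exact/measurable_EFinP.
have cvgS := @ge0_nondecreasing_set_cvg_integral _ (measurableTypeR R) R S (EFin \o f) (@lebesgue_measure R).
have SE n : (\int[mu]_(t in S n) (f t)%:E = (G (1 - c n) - G (c n))%:E)%E.
  have lt : c n < 1 - c n by have := c3 n; lra.
  rewrite (@continuous_FTC2 R f G) //.
  - apply: continuous_in_subspaceT => t; rewrite inE /= in_itv /= => /inS; exact: cf.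
  - have dc (t : R) : 0 < t < 1 -> {for t, continuous G}.
      by move=> /dG dGt; apply: differentiable_continuous; apply/derivable1_diffP; case: dGt.
    split.
    + by move=> t; rewrite in_itv /= => /andP[h1 h2]; case: (dG t _); rewrite ?(@inS n) // !ltW.
    + apply: cvg_at_right_filter; apply: dc; apply: (@inS n); rewrite lexx ltW //.
    + apply: cvg_at_left_filter; apply: dc; apply: (@inS n); rewrite lexx ltW //.
  - move=> t; rewrite in_itv /= => /andP[h1 h2]; rewrite derive1E.
    by have [_ ->] : is_derive t 1 G (f t) by apply: dG; apply: (@inS n); rewrite !ltW.
have cv : (\int[lebesgue_measure]_(x in S n) (EFin \o f) x)%E @[n --> \oo] -->
    (\int[lebesgue_measure]_(x in \bigcup_n S n) (EFin \o f) x)%E.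
  apply: cvgS.
  - apply/nondecreasing_seqP => n; rewrite subsetEset => t; rewrite /S /= !in_itv /= => /andP[h1 h2].
    have : c n.+1 <= c n by rewrite lef_pV2 ?posrE // ler_nat.
    by move=> h; apply/andP; split; lra.
  - by move=> i; exact: measurable_itv.
  - by move=> i; exact: measurable_funTS.
  - by move=> i x; rewrite /S /= in_itv /= => /inS /f0; rewrite lee_fin.
rewrite -US -(cvg_lim _ cv) //; apply: lime_le; first exact: cvgP cv.
apply: nearW => n; rewrite SE lee_fin.
have h1 : 0 < c n < 1 by apply: (@inS n); rewrite lexx; have := c3 n; lra.
have h2 : 0 < 1 - c n < 1 by apply: (@inS n); rewrite lexx andbT; have := c3 n; lra.
have := bG _ h1; have := bG _ h2; rewrite !ler_norml => /andP[_ u1] /andP[u2 _]; lra.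
Qed.

Definition beta_density a (t : R) : R := t `^ (a - 1) * (1 - t) `^ (1 / 2 - 1).

Lemma beta_density_ge0 a t : 0 <= beta_density a t.
Proof. by rewrite mulr_ge0 ?powR_ge0. Qed.

Lemma is_derive_powR1B b (t : R) : t < 1 ->
  is_derive t 1 (fun x : R => (1 - x) `^ b) (- (b * (1 - t) `^ (b - 1))).
Proof.
move=> t1; have t1' : 0 < 1 - t by rewrite subr_gt0.
have d1 : is_derive t 1 (fun x : R => 1 - x) (-1).
  by have := is_deriveB (is_derive_cst (1:R) t 1) (is_derive_id t 1); rewrite sub0r.
have := @is_derive1_comp R (fun x : R => x `^ b) (fun x : R => 1 - x) t _ _ (is_derive1_powR b t1') d1.
by rewrite mulrN1.
Qed.

Lemma continuous_powRl a t : 0 < t -> {for t, continuous (fun x : R => x `^ a)}.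
Proof.
move=> t0; apply: differentiable_continuous; apply/derivable1_diffP.
by case: (is_derive1_powR a t0).
Qed.

Lemma continuous_powR1B a t : t < 1 -> {for t, continuous (fun x : R => (1 - x) `^ a)}.
Proof.
move=> t1; apply: (@continuous_comp _ _ _ (fun x : R => 1 - x) (fun x : R => x `^ a)).
  by apply: continuousB; [exact: cst_continuous|exact: cvg_id].
by apply: continuous_powRl; rewrite subr_gt0.
Qed.

Lemma continuous_beta_density a t : 0 < t < 1 -> {for t, continuous (beta_density a)}.
Proof.
move=> /andP[t0 t1]; apply: continuousM; first exact: continuous_powRl.
exact: continuous_powR1B.
Qed.

Lemma measurable_powR1B a : measurable_fun [set: R] (fun t : R => (1 - t) `^ a).
Proof.
apply: (measurableT_comp (measurable_powR a)).
by apply: measurable_funB; [exact: measurable_cst|exact: measurable_id].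
Qed.

Lemma measurable_beta_density a : measurable_fun [set: R] (beta_density a).
Proof. by apply: measurable_funM; [exact: measurable_powR|exact: measurable_powR1B]. Qed.

Lemma powR_le2 a t : 0 < a -> 1 / 2 <= t -> t <= 1 -> t `^ (a - 1) <= 2.
Proof.
move=> a0 t2 t1; have t0 : 0 < t by lra.
have [a1|a1] := leP 1 a.
  apply: (@le_trans _ _ 1); last by rewrite ler1n.
  rewrite -[leRHS](one_powR (a - 1)); apply: ler_powRl => //; [by rewrite subr_ge0|exact: ltW].
have -> : t `^ (a - 1) = t^-1 `^ (1 - a) by rewrite powRV ?ltW // opprB.
have tv : t^-1 <= 2 by rewrite -[leRHS]invrK lef_pV2 ?posrE // ; lra.
have tv1 : 1 <= t^-1 by rewrite invf_ge1.
apply: le_trans tv; rewrite -[leRHS]powRr1; last by rewrite ltW // invr_gt0.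
by apply: ler_powR => //; lra.
Qed.

(** At each point of [(0, 1)] one of the two factors is at most 2, so the density is dominated by
    twice a sum of pure powers, which has the explicit bounded primitive [G]. *)
Lemma integrable_beta_density a : 0 < a -> mu.-integrable `[0, 1] (EFin \o beta_density a).
Proof.
move=> a0.
pose f (t : R) := t `^ (a - 1) + (1 - t) `^ (1 / 2 - 1).
pose G (t : R) := t `^ a / a - 2 * (1 - t) `^ (1 / 2).
have mf : measurable_fun setT f by apply: measurable_funD; [exact: measurable_powR|exact: measurable_powR1B].
have dG (t : R) : 0 < t < 1 -> is_derive t 1 G (f t).
  move=> /andP[t0 t1]; have t1' : 0 < 1 - t by rewrite subr_gt0.
  have d2 := is_derive_powR1B (1 / 2) t1.
  have D := is_deriveB (is_deriveZ a^-1 (is_derive1_powR a t0)) (is_deriveZ 2 d2).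
  have -> : G = a^-1 \*: (fun x : R => x `^ a) - 2 \*: (fun x : R => (1 - x) `^ (1 / 2)) :> (R -> R).
    by apply/funext => x; rewrite /G mulrC.
  apply: is_derive_eq D _; rewrite /f /GRing.scale /=; field; exact: lt0r_neq0.
have bG (t : R) : 0 < t < 1 -> `|G t| <= a^-1 + 2.
  move=> /andP[t0 t1].
  have p1 : t `^ a <= 1 by rewrite -[leRHS](one_powR a); apply: ler_powRl => //; exact: ltW.
  have p2 : (1 - t) `^ (1 / 2) <= 1.
    by rewrite -[leRHS](one_powR (1 / 2)); apply: ler_powRl => //; lra.
  apply: (le_trans (ler_normB _ _)); apply: lerD.
    by rewrite ger0_norm ?divr_ge0 ?powR_ge0 ?(ltW a0) // ler_piMl // invr_ge0 ltW.
  by rewrite ger0_norm ?mulr_ge0 ?powR_ge0 // ler_piMr.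
have If := integrable_bounded_primitive mf _ _ dG bG.
have mb : measurable_fun setT (beta_density a) := measurable_beta_density a.
apply/integrableP; split; first exact/measurable_EFinP/measurable_funTS.
rewrite integral_itv_bndoo; last first.
  by apply: measurableT_comp => //; apply/measurable_EFinP/measurable_funTS.
apply: (@le_lt_trans _ _ (\int[mu]_(t in `]0%R, 1%R[) (2 * f t)%:E)%E).
  apply: ge0_le_integral => //.
  - by apply: measurableT_comp => //; apply/measurable_EFinP/measurable_funTS.
  - by apply/measurable_EFinP/measurable_funTS; apply: measurable_funM.
  move=> t /=; rewrite in_itv /= => /andP[t0 t1].
  rewrite lee_fin ger0_norm ?beta_density_ge0 // /beta_density /f.
  have q0 := powR_ge0 t (a - 1); have q1 := powR_ge0 (1 - t) (1 / 2 - 1).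
  have [t2|t2] := leP t (1 / 2).
    apply: (@le_trans _ _ (t `^ (a - 1) * 2)); last by lra.
    by apply: ler_wpM2l => //; apply: powR_le2 => //; lra.
  apply: (@le_trans _ _ (2 * (1 - t) `^ (1 / 2 - 1))); last by lra.
  by apply: ler_wpM2r => //; apply: powR_le2; lra.
under eq_integral do rewrite EFinM.
rewrite ge0_integralZl //; last 2 first.
- by apply/measurable_EFinP/measurable_funTS.
- by move=> t _; rewrite lee_fin addr_ge0 ?powR_ge0.
apply: (@le_lt_trans _ _ (2%:E * (2 * (a^-1 + 2))%:E)%E); last by rewrite -EFinM ltry.
apply: lee_wpmul2l; first by rewrite lee_fin.
apply: If.
- by move=> t _; rewrite addr_ge0 ?powR_ge0.
- move=> t /andP[t0 t1]; apply: continuousD; [exact: continuous_powRl|exact: continuous_powR1B].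
Qed.

Definition incomplete_beta a (t : R) : R := parameterized_integral mu 0 t (beta_density a).

Lemma incomplete_beta1 a : incomplete_beta a 1 = Beta a (1 / 2).
Proof. by []. Qed.

Lemma is_derive_incomplete_beta a (t : R) : 0 < a -> 0 < t < 1 ->
  is_derive t 1 (incomplete_beta a) (beta_density a t).
Proof.
move=> a0 /andP[t0 t1].
have h : 0 < t < 1 by rewrite t0.
have [d1 d2] := continuous_FTC1_closed t1 (integrable_beta_density a0) t0 (continuous_beta_density h).
by split; [exact: d1|rewrite -derive1E; exact: d2].
Qed.

Lemma incomplete_beta_ge0 a t : 0 <= incomplete_beta a t.
Proof. by apply: Rintegral_ge0 => x _; exact: beta_density_ge0. Qed.

Lemma incomplete_beta_le1 a (t : R) : 0 < a -> t <= 1 -> incomplete_beta a t <= incomplete_beta a 1.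
Proof.
move=> a0 t1; have I1 := integrable_beta_density a0.
have sub : `[0, t]%classic `<=` `[0, 1]%classic by apply: subset_itvl; rewrite bnd_simp.
rewrite /incomplete_beta /parameterized_integral; apply: fine_le.
- by apply: integrable_fin_num => //; exact: integrableS I1.
- exact: integrable_fin_num.
apply: ge0_subset_integral => //.
- by apply/measurable_EFinP/measurable_funTS; exact: measurable_beta_density.
- by move=> x _; rewrite lee_fin; exact: beta_density_ge0.
Qed.

(* [pi / cosh (pi xi)] is the Fourier transform of [1 / (2 cosh (x / 2))], the limit
   symbol of the Gram matrix; [2 a] stands for [1 / alpha]. *)
Definition sech_pow a (xi : R) : R := (pi / coshR (pi * xi)) `^ (2 * a).

Definition sech2 (xi : R) : R := (coshR (pi * xi)) ^- 2.

(** The substitution [t = 1 / cosh (pi xi) ^ 2] turns the integral of [sech_pow] into an incomplete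
    Beta integral; the sign is there because [t] decreases in [xi]. Increments of this primitive
    replace integrals over the half-line. *)
Definition sech_pow_primitive a (xi : R) : R :=
  - (pi `^ (2 * a - 1) / 2 * incomplete_beta a (sech2 xi)).

(** The integral of [sech_pow a] over [(0, oo)], as the total increment of the primitive. *)
Definition sech_pow_integral a : R := pi `^ (2 * a - 1) / 2 * Beta a (1 / 2).

Lemma coshR_gt1 x : 0 < x -> 1 < coshR x.
Proof.
move=> x0; have s0 : 0 < sinhR (x / 2).
  by rewrite /sinhR divr_gt0 // subr_gt0 ltr_expR; lra.
have -> : coshR x = 1 + 2 * sinhR (x / 2) ^+ 2.
  have E := expRxMexpNx_1 (x / 2).
  have -> : coshR x = (expR (x / 2) * expR (x / 2) + expR (- (x / 2)) * expR (- (x / 2))) / 2.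
    by rewrite -!expRD /coshR; congr ((expR _ + expR _) / 2); field.
  rewrite /sinhR; move: E; set u := expR (x / 2); set v := expR (- (x / 2)) => E.
  have -> : 1 + 2 * ((u - v) / 2) ^+ 2 = (u * u + v * v) / 2 + (1 - u * v) by field.
  by rewrite E subrr addr0.
by rewrite ltrDl mulr_gt0 // exprn_gt0.
Qed.

Lemma sech2_itv (xi : R) : 0 < xi -> 0 < sech2 xi < 1.
Proof.
move=> xi0; have c1 := coshR_gt1 (mulr_gt0 (pi_gt0 R) xi0).
have c0 : 0 < coshR (pi * xi) := coshR_gt0 _.
by rewrite /sech2 invr_gt0 exprn_gt0 //= invf_lt1 ?exprn_gt0 // exprn_egt1.
Qed.

Lemma is_derive_sech2 (xi : R) :
  is_derive xi 1 sech2 (- (2 * pi * sinhR (pi * xi) / coshR (pi * xi) ^+ 3)).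
Proof.
have c0 := coshR_gt0 (pi * xi).
have dch := is_derive_scaled (is_derive_coshR (pi * xi)).
have dX := is_deriveX 2 dch.
have nz : ((fun y => coshR (pi * y)) ^+ 2 : R -> R) xi != 0.
  by rewrite exprfctE expf_neq0 // lt0r_neq0.
have D := @is_deriveV R ((fun y => coshR (pi * y)) ^+ 2 : R -> R) xi _ _ nz dX.
have -> : sech2 = (fun y => (((fun y => coshR (pi * y)) ^+ 2 : R -> R) y)^-1).
  by apply/funext => y; rewrite exprfctE.
apply: is_derive_eq D _; rewrite exprfctE /GRing.scale /=.
set c := coshR _ in c0 *; set s := sinhR _.
by field; exact: lt0r_neq0.
Qed.

Lemma is_derive_sech_pow_primitive a (xi : R) : 0 < a -> 0 < xi ->
  is_derive xi 1 (sech_pow_primitive a) (sech_pow a xi).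
Proof.
move=> a0 xi0; have T01 := sech2_itv xi0; have p0 := pi_gt0 R.
have d1 := is_derive_incomplete_beta a0 T01.
have d2 := @is_derive1_comp R (incomplete_beta a) sech2 xi _ _ d1 (is_derive_sech2 xi).
have D := is_deriveN (is_deriveZ (pi `^ (2 * a - 1) / 2) d2).
apply: is_derive_eq D _; rewrite /GRing.scale /=.
have c0 := coshR_gt0 (pi * xi).
have s0 : 0 < sinhR (pi * xi).
  by rewrite /sinhR divr_gt0 // subr_gt0 ltr_expR; have := mulr_gt0 p0 xi0; lra.
have E := coshR2_sub_sinhR2 (pi * xi).
rewrite /beta_density /sech_pow /sech2.
set c := coshR _ in c0 E *; set s := sinhR _ in s0 E *.
have cn : c != 0 by rewrite lt0r_neq0.
have -> : 1 - c ^- 2 = (s / c) ^+ 2.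
  have s2 : s ^+ 2 = c ^+ 2 - 1 by lra.
  by rewrite (expr_div_n s c) s2; field.
have sc0 : 0 < s / c by rewrite divr_gt0.
have -> : ((s / c) ^+ 2) `^ (1 / 2 - 1) = c / s.
  rewrite -powR_mulrn ?(ltW sc0) // -powRrM (_ : 2%:R * (1 / 2 - 1) = -1); last by field.
  by rewrite powR_inv1 ?(ltW sc0) // invf_div.
have -> : (c ^- 2) `^ (a - 1) = c ^+ 2 * c `^ (- (2 * a)).
  rewrite powRV ?exprn_ge0 ?(ltW c0) // -powR_mulrn ?(ltW c0) // -powRrM -powRD ?cn ?implybT //.
  by congr (_ `^ _); ring.
have -> : (pi / c) `^ (2 * a) = pi * pi `^ (2 * a - 1) * c `^ (- (2 * a)).
  rewrite powRM ?invr_ge0 ?(ltW c0) ?(ltW p0) // powRV ?(ltW c0) //; congr (_ * _).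
  by rewrite -{2}(powRr1 (ltW p0)) -powRD ?(lt0r_neq0 p0) ?implybT //; congr (_ `^ _); ring.
by field; rewrite cn lt0r_neq0.
Qed.

Lemma sech_pow_primitive_le a (x y : R) : 0 < a -> 0 < x ->
  sech_pow_primitive a y - sech_pow_primitive a x <= sech_pow_integral a.
Proof.
move=> a0 x0; have k0 : 0 <= pi `^ (2 * a - 1) / 2 :> R by rewrite divr_ge0 ?powR_ge0.
have /andP[_ /ltW T1] := sech2_itv x0.
rewrite /sech_pow_primitive /sech_pow_integral -incomplete_beta1.
move: (incomplete_beta_le1 a0 T1) (incomplete_beta_ge0 a (sech2 y)) k0.
move: (incomplete_beta a) (pi `^ (2 * a - 1) / 2) => B k B1 B2 k0.
have := ler_wpM2l k0 B1; have := mulr_ge0 k0 B2; lra.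
Qed.

Lemma sech_pow_primitive_ge a (e : R) : 0 < a -> 0 < e ->
  exists x, exists2 K, 0 < x < K & sech_pow_integral a - e <= sech_pow_primitive a K - sech_pow_primitive a x.
Proof.
move=> a0 e0; have p0 := pi_gt0 R.
have k0 : 0 < pi `^ (2 * a - 1) / 2 :> R by rewrite divr_gt0 // powR_gt0.
set k := pi `^ _ / 2 in k0.
have e1 : 0 < e / 2 / k by apply: divr_gt0 => //; exact: divr_gt0.
have I1 := integrable_beta_density a0.
have [d1 d10 H1] : exists2 d1 : R, 0 < d1 & forall t : R, 0 < t -> t < d1 -> incomplete_beta a t <= e / 2 / k.
  have /cvgrPdist_le/(_ _ e1)/nbhs_ballP[d /= d0 H] := parameterized_integral_cvg_left (ltr01 : (0:R) < 1) I1.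
  exists d => // t t0 td; have := H t; rewrite /ball /= sub0r normrN gtr0_norm // => /(_ td).
  by rewrite sub0r normrN; exact: le_trans (ler_norm _).
have [d2 d20 H2] : exists2 d2 : R, 0 < d2 & forall t : R, 1 - d2 < t -> t < 1 -> incomplete_beta a 1 - e / 2 / k <= incomplete_beta a t.
  have /cvgrPdist_le/(_ _ e1) := parameterized_integral_cvg_at_left (ltr01 : (0:R) < 1) I1.
  move=> /nbhs_ballP[d /= d0 H]; exists d => // t t0 td; have := H t; rewrite /ball /= gtr0_norm; last by lra.
  move=> /(_ _ td) h; have := h (ltac:(lra)); rewrite ler_norml => /andP[_].
  rewrite -/(incomplete_beta a 1) -/(incomplete_beta a t); lra.
have [x x0 Tx] : exists2 x : R, 0 < x & 1 - d2 < sech2 x.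
  have cT : {for (0:R), continuous sech2}.
    apply: differentiable_continuous; apply/derivable1_diffP; by case: (is_derive_sech2 0).
  have T0 : sech2 0 = 1 by rewrite /sech2 mulr0 coshR0 expr1n invr1.
  move: cT => /cvgrPdist_lt/(_ _ d20)/nbhs_ballP[d /= d0 H].
  have d2' : 0 < d / 2 by rewrite divr_gt0.
  exists (d / 2) => //; have := H (d / 2); rewrite /ball /= sub0r normrN (gtr0_norm d2') T0.
  move=> h; have h' : d / 2 < d by lra.
  by have := h h'; rewrite ltr_norml => /andP[_]; lra.
pose K := x + 2 / d1.
have K0 : 0 < 2 / d1 by rewrite divr_gt0.
exists x, K; first by rewrite x0 ltrDl.
have xK : 0 < K by rewrite addr_gt0.
have /andP[Tx0 Tx1] := sech2_itv x0; have /andP[TK0 TK1] := sech2_itv xK.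
have TK : sech2 K < d1.
  have p1 : 1 <= pi :> R by have := pihalf_ge1 R; lra.
  have cK : K / 2 < coshR (pi * K).
    have h1 := expR_ge1Dx (pi * K); have h2 := expR_gt0 (- (pi * K)).
    have h3 : K <= pi * K by rewrite ler_peMl // ltW.
    by rewrite /coshR; lra.
  have c1 := coshR_ge1 (pi * K); have c0 := coshR_gt0 (pi * K).
  apply: (@le_lt_trans _ _ (coshR (pi * K))^-1).
    by rewrite /sech2 lef_pV2 ?posrE ?exprn_gt0 // expr2 ler_peMl // ltW.
  rewrite -[ltRHS]invrK ltf_pV2 ?posrE ?invr_gt0 //.
  apply: le_lt_trans cK; rewrite /K -[leLHS]mul1r; lra.
rewrite /sech_pow_primitive /sech_pow_integral -incomplete_beta1 -/k.
have B1 := H1 _ TK0 TK; have B2 := H2 _ Tx Tx1.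
move: k0 B1 B2; clear; move: (incomplete_beta a) k => B k k0 B1 B2.
have := ler_wpM2l (ltW k0) B1; have := ler_wpM2l (ltW k0) B2; rewrite mulrBr.
have -> : k * (e / 2 / k) = e / 2 by field; exact: lt0r_neq0.
lra.
Qed.

Lemma sech_pow_ge0 a xi : 0 <= sech_pow a xi.
Proof. exact: powR_ge0. Qed.

Lemma sech_pow_le a (x y : R) : 0 < a -> 0 <= x -> x <= y -> sech_pow a y <= sech_pow a x.
Proof.
move=> a0 x0 xy; have p0 := pi_gt0 R.
apply: ler_powRl; first by rewrite mulr_ge0 // ltW.
  by rewrite divr_ge0 ?(ltW (coshR_gt0 _)) // ltW.
rewrite ler_pM2l // lef_pV2 ?posrE ?coshR_gt0 //; apply: coshR_le.
  by rewrite mulr_ge0 // ltW.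
by rewrite ler_pM2l.
Qed.

End beta_integral.

(** * Riemann sums of decreasing functions *)

Section riemann_sums.
Context {R : realType}.
Variables (f A : R -> R).
Hypothesis f0 : forall x : R, 0 <= x -> 0 <= f x.
Hypothesis fmono : forall x y : R, 0 <= x -> x <= y -> f y <= f x.
Hypothesis dA : forall x : R, 0 < x -> is_derive x 1 A (f x).

Let step (h : R) l : 0 < h ->
  h * f (l.+2%:R * h) <= A (l.+2%:R * h) - A (l.+1%:R * h) <= h * f (l.+1%:R * h).
Proof.
move=> h0; have lh : 0 < l.+1%:R * h by rewrite mulr_gt0.
have lt : l.+1%:R * h < l.+2%:R * h by rewrite ltr_pM2r // ltr_nat.
have D (z : R) : l.+1%:R * h <= z <= l.+2%:R * h -> is_derive z 1 A (f z).
  by move=> /andP[z1 _]; apply: dA; exact: lt_le_trans z1.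
have [c /andP[c1 c2] ->] := mean_value lt D.
have -> : l.+2%:R * h - l.+1%:R * h = h by rewrite -(natr1 l.+1); ring.
have c0 := lt_trans lh c1.
rewrite [f c * h]mulrC; apply/andP.
by split; rewrite ler_pM2l //; apply: fmono; rewrite ltW.
Qed.

Let mono (y z : R) : 0 < y -> y <= z -> A y <= A z.
Proof.
move=> y0; rewrite le_eqVlt => /orP[/eqP -> //|yz].
have D (w : R) : y <= w <= z -> is_derive w 1 A (f w).
  by move=> /andP[h1 _]; apply: dA; exact: lt_le_trans h1.
have [c /andP[c1 _] E] := mean_value yz D.
rewrite -subr_ge0 E; apply: mulr_ge0; last by rewrite subr_ge0 ltW.
by apply: f0; rewrite ltW // (lt_trans y0).
Qed.

Lemma riemann_sum_upper (I h : R) m : 0 <= I -> (forall x y, 0 < x -> x <= y -> A y - A x <= I) -> 0 < h ->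
  \sum_(l < m) h * f (l.+1%:R * h) <= I + h * f 0.
Proof.
move=> I0 HI h0; case: m => [|m].
  by rewrite big_ord0 addr_ge0 // mulr_ge0 ?f0 // ltW.
have key k : \sum_(l < k.+1) h * f (l.+1%:R * h) <= h * f 0 + (A (k.+1%:R * h) - A (1%:R * h)).
  elim: k => [|k IH].
    by rewrite big_ord1 subrr addr0 ler_pM2l //; apply: fmono; rewrite // mul1r ltW.
  rewrite big_ord_recr /=; have /andP[h1 _] := step k h0; lra.
apply: (le_trans (key m)); rewrite addrC; apply: lerD => //.
by apply: HI; rewrite mul1r // ler_peMl ?ler1n // ltW.
Qed.

(** The interval from [x] to [K] nearly exhausts the integral, so nodes up to [K] suffice; for a
    step [h <= x] the sum dominates the integral from [x] on. *)
Lemma riemann_sum_lower (I e : R) :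
  (exists x, exists2 K, 0 < x < K & I - e <= A K - A x) -> exists2 K, 0 < K &
  exists2 h0, 0 < h0 & forall h, 0 < h -> h <= h0 ->
    exists2 m, m%:R * h <= K & I - e <= \sum_(l < m) h * f (l.+1%:R * h).
Proof.
move=> [x [K /andP[x0 xK] H]].
exists K; first exact: lt_trans xK.
exists x => // h h0 hx; pose m := Num.truncn (K / h).
have Kh : 0 <= K / h by rewrite divr_ge0 // ltW // (lt_trans x0).
have m1 : m%:R * h <= K by rewrite -ler_pdivlMr //; case/andP: (truncn_itv Kh).
have m2 : K <= m.+1%:R * h by rewrite -ler_pdivrMr // ltW // truncnS_gt.
exists m => //; apply: (le_trans H).
have h1 := mono h0 hx; have h2 := mono (lt_trans x0 xK) m2.
apply: (@le_trans _ _ (A (m.+1%:R * h) - A (1%:R * h))).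
  by rewrite mul1r; lra.
elim: m {m1 m2 h2} => [|m IH]; first by rewrite big_ord0 subrr.
rewrite big_ord_recr /=; have /andP[_ h3] := step m h0; lra.
Qed.

End riemann_sums.

Section sech_sums.
Context {R : realType}.

Lemma sech_pow_integral_ge0 (a : R) : 0 <= sech_pow_integral a.
Proof.
rewrite /sech_pow_integral -incomplete_beta1; apply: mulr_ge0 (incomplete_beta_ge0 _ _).
by rewrite divr_ge0 ?powR_ge0.
Qed.

Lemma sech_pow_sum_upper (a h : R) m : 0 < a -> 0 < h ->
  \sum_(l < m) h * sech_pow a (l.+1%:R * h) <= sech_pow_integral a + h * sech_pow a 0.
Proof.
move=> a0; apply: (@riemann_sum_upper R (sech_pow a) (sech_pow_primitive a)).
- by move=> x _; exact: sech_pow_ge0.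
- by move=> x y; exact: sech_pow_le.
- by move=> x; exact: is_derive_sech_pow_primitive.
- exact: sech_pow_integral_ge0.
- by move=> x y x0 _; exact: sech_pow_primitive_le.
Qed.

Lemma sech_pow_sum_lower (a e : R) : 0 < a -> 0 < e -> exists2 K, 0 < K &
  exists2 h0, 0 < h0 & forall h, 0 < h -> h <= h0 ->
    exists2 m, m%:R * h <= K & sech_pow_integral a - e <= \sum_(l < m) h * sech_pow a (l.+1%:R * h).
Proof.
move=> a0 e0; apply: (@riemann_sum_lower R (sech_pow a) (sech_pow_primitive a)).
- by move=> x _; exact: sech_pow_ge0.
- by move=> x y; exact: sech_pow_le.
- by move=> x; exact: is_derive_sech_pow_primitive.
- exact: sech_pow_primitive_ge.
Qed.

End sech_sums.

(** * Power sums of the symbol over the sine modes *)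

Section symbol_sums.
Context {R : realType}.
Implicit Types (d e h p : R).

Lemma sech_coef_partial_le d n : 0 < d -> \sum_(k < n) sech_coef d k <= 2.
Proof.
move=> d0; set u := expR (- (d / 2)).
have u0 : 0 < u by exact: expR_gt0.
have u1 : u < 1 by rewrite -[ltRHS]expR0 ltr_expR oppr_lt0 divr_gt0.
have qE : expR (- d) = u ^+ 2 by rewrite -expRM_natl; congr expR; rewrite mulr_natl; field.
have u2 : u ^+ 2 <= 1 by rewrite exprn_ile1 // ltW.
apply: (@le_trans _ _ (\sum_(k < n) (1 - u ^+ 2) * u ^+ k)).
  by apply: ler_sum => k _; rewrite -qE; apply: sech_coef_le; exact: ltW.
rewrite -mulr_sumr; apply: (@le_trans _ _ ((1 - u ^+ 2) * (1 - u)^-1)).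
  by apply: ler_wpM2l; [rewrite subr_ge0|apply: geometric_partial_le => //; exact: ltW].
have -> : (1 - u ^+ 2) * (1 - u)^-1 = 1 + u by field; rewrite gt_eqF // subr_gt0.
lra.
Qed.

Lemma sech_coef_tail d e : 0 < d -> 0 < e ->
  exists r0, forall r n, (r0 <= r)%N -> \sum_(k < n | (r < k)%N) 2 * sech_coef d k <= e.
Proof.
move=> d0 e0; set u := expR (- (d / 2)).
have u0 : 0 < u by exact: expR_gt0.
have u1 : u < 1 by rewrite -[ltRHS]expR0 ltr_expR oppr_lt0 divr_gt0.
have q0 : 0 <= 1 - expR (- d) by rewrite subr_ge0 -[leRHS]expR0 ler_expR oppr_le0 ltW.
have [r0 H] := expr_vanish (2 * (1 - expR (- d)) / (1 - u)) (ltW u0) u1 e0.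
exists r0 => r n rr; apply: le_trans (H r rr).
rewrite -mulr_sumr -!mulrA; apply: ler_wpM2l => //.
rewrite mulrA mulrC.
apply: (@le_trans _ _ (\sum_(k < n | (r < k)%N) (1 - expR (- d)) * u ^+ k)).
  by apply: ler_sum => k _; apply: sech_coef_le; exact: ltW.
rewrite -mulr_sumr [leRHS]mulrC -mulrA; apply: ler_wpM2l => //.
have [nr|rn] := leqP n r.
  rewrite big1; first by rewrite mulr_ge0 ?exprn_ge0 ?invr_ge0 ?subr_ge0 // ltW.
  by move=> k rk; have := ltn_ord k; rewrite ltnNge (leq_trans nr (ltnW rk)).
apply: (@le_trans _ _ (\sum_(k < r + (n - r)) (r <= k)%:R * u ^+ k)).
  rewrite subnKC ?(ltnW rn) // big_mkcond /=; apply: ler_sum => k _.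
  have uk : 0 <= u ^+ k by rewrite exprn_ge0 // ltW.
  by case: ifP => [/ltnW ->|_]; rewrite ?mul1r // mulr_ge0.
rewrite big_split_ord /= big1 ?add0r; last first.
  by move=> k _; rewrite leqNgt ltn_ord mul0r.
under eq_bigr => k _ do rewrite leq_addr mul1r exprD.
rewrite -mulr_sumr mulrC; apply: ler_wpM2r; first by rewrite exprn_ge0 // ltW.
by apply: geometric_partial_le => //; exact: ltW.
Qed.

Lemma exists_powR1D p e : 0 < p -> 0 < e -> exists2 d, 0 < d & (1 + d) `^ p = 1 + e.
Proof.
move=> p0 e0; have pn : p != 0 by rewrite lt0r_neq0.
exists ((1 + e) `^ p^-1 - 1).
  rewrite subr_gt0 -[ltLHS](one_powR p^-1) gt0_ltr_powR ?nnegrE ?invr_gt0 //; lra.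
by rewrite addrC subrK -powRrM mulVf // powRr1 //; lra.
Qed.

Lemma exists_powR1B p e : 0 < p -> 0 < e -> e < 1 -> exists2 d, 0 < d < 1 & (1 - d) `^ p = 1 - e.
Proof.
move=> p0 e0 e1; have pn : p != 0 by rewrite lt0r_neq0.
exists (1 - (1 - e) `^ p^-1).
  rewrite subr_gt0 gtrBl powR_gt0 ?subr_gt0 // andbT.
  by rewrite -[ltRHS](one_powR p^-1) gt0_ltr_powR ?nnegrE ?invr_gt0 //; lra.
by rewrite opprB addrC subrK -powRrM mulVf // powRr1 //; lra.
Qed.

Lemma inverse_square_sum (D K h : R) m : 0 <= D -> 0 < K -> 0 < h ->
  \sum_(l < m) h * (D / (K + l.+1%:R * h) ^+ 2) <= D / K + h * (D / K ^+ 2).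
Proof.
move=> D0 K0 h0; have pos (x : R) : 0 <= x -> 0 < K + x by lra.
have dA (x : R) : 0 < x -> is_derive x 1 (fun x => - D / (K + x)) (D / (K + x) ^+ 2).
  move=> x0; have Kx := pos _ (ltW x0).
  have d1 : is_derive x 1 (fun x => K + x) 1.
    by have := is_deriveD (is_derive_cst K x 1) (is_derive_id x 1); rewrite add0r.
  have nz : (fun x => K + x) x != 0 by rewrite lt0r_neq0.
  have D1 := is_deriveZ (- D) (@is_deriveV R (fun x => K + x) x _ _ nz d1).
  apply: is_derive_eq D1 _; rewrite /GRing.scale /=; field; exact: lt0r_neq0.
have := @riemann_sum_upper R (fun x => D / (K + x) ^+ 2) (fun x => - D / (K + x)) _ _ dA (D / K) h m _ _ h0.
rewrite addr0; apply.
- by move=> x x0; rewrite divr_ge0 // sqr_ge0.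
- move=> x y x0 xy; have y0 := le_trans x0 xy.
  apply: ler_wpM2l => //; rewrite lef_pV2 ?posrE ?exprn_gt0 ?pos //.
  by rewrite ler_sqr ?nnegrE ?lerD2l // ltW // pos.
- by rewrite divr_ge0 // ltW.
- move=> x y x0 xy; rewrite !mulNr opprK addrC.
  have Ky : 0 < K + y by apply: pos; rewrite ltW // (lt_le_trans x0).
  apply: (@le_trans _ _ (D / (K + x))); first by rewrite gerBl divr_ge0 // ltW.
  by apply: ler_wpM2l => //; rewrite lef_pV2 ?posrE ?pos ?(ltW x0) // lerDl ltW.
Qed.

(** Up to [K] the symbol exceeds its limit by at most a factor [1 + dl], and a Riemann sum of
    [sech_pow] results. Beyond [K] the decay of order [q], with [q * p >= 2], leaves a tail
    comparable with the sum of [x ^ -2], which [K] makes small. *)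
Lemma symbol_sum_upper p e : 0 < p -> 0 < e ->
  exists2 d0, 0 < d0 <= 1 & forall d, 0 < d -> d <= d0 ->
  exists2 e0, 0 < e0 & exists r0, forall r e', (r0 <= r)%N -> 0 <= e' -> e' <= e0 ->
  exists n0, forall n, (n0 <= n)%N ->
    \sum_(l < n.-1) pi / (n%:R * d) *
      Num.max 0 (band_symbol (sech_coef d) r (pi * l.+1%:R / n%:R) + e') `^ p
    <= sech_pow_integral (p / 2) + e.
Proof.
move=> p0 e0; have pi0 := pi_gt0 R.
have a0 : 0 < p / 2 by rewrite divr_gt0.
pose q := (Num.truncn (2 / p)).+1.
have qp : 2 <= q%:R * p by rewrite -ler_pdivrMr // ltW // truncnS_gt.
have [C C0 HC] := @band_symbol_sech_decay R q.
pose D := (C + 1) `^ p; have D0 : 0 <= D := powR_ge0 _ _.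
(* With this [K] the tail [4 * D / K] is at most [e / 6]; the 4 comes from [K + x <= 2 x]. *)
pose K := Num.max 1 (24 * D / e).
have K1 : 1 <= K by rewrite le_max lexx.
have K0 : 0 < K by lra.
have DK : 4 * D / K <= e / 6.
  have hK : 24 * D / e <= K by rewrite le_max lexx orbT.
  by rewrite ler_pdivrMr //; move: hK; rewrite ler_pdivrMr //; lra.
pose I := sech_pow_integral (p / 2).
have I0 : 0 <= I := sech_pow_integral_ge0 _.
have [dl dl0 dlE] : exists2 dl : R, 0 < dl & (1 + dl) `^ p = 1 + e / (3 * (I + 1)).
  by apply: exists_powR1D => //; rewrite divr_gt0 //; lra.
pose sg := pi / coshR (pi * K).
have sg0 : 0 < sg by rewrite divr_gt0 // coshR_gt0.
have ds0 : 0 < dl * sg / 2 by rewrite divr_gt0 // mulr_gt0.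
have [d1 d10 H1] := @band_symbol_sech_limit R K _ (ltW K0) ds0.
exists (Num.min d1 1); first by rewrite lt_min d10 ltr01 ge_min lexx orbT.
move=> d d0; rewrite le_min => /andP[dd1 dle1].
have [r1 Hr1] := H1 d d0 dd1.
(* Chosen so that [2 * e1 <= xi ^ -q] for all [xi <= pi / d]: the two additive errors are then
   absorbed by passing from [C] to [C + 1]. *)
pose e1 := (d / pi) ^+ q / 2.
have e10 : 0 < e1 by rewrite divr_gt0 // exprn_gt0 // divr_gt0.
have [r2 Hr2] := HC d e1 d0 dle1 e10.
exists (Num.min (dl * sg / 2) e1); first by rewrite lt_min ds0.
exists (maxn r1 r2) => r e'; rewrite geq_max => /andP[rr1 rr2] e'0; rewrite le_min => /andP[e'1 e'2].
pose B := (1 + dl) `^ p * sech_pow (p / 2) 0 + 4 * D / K ^+ 2.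
have B0 : 0 <= B.
  apply: addr_ge0; first by apply: mulr_ge0; [exact: powR_ge0|exact: sech_pow_ge0].
  by apply: divr_ge0; [rewrite mulr_ge0|exact: sqr_ge0].
pose n1 := (Num.truncn (pi / d * (B + 1) * 6 / e)).+1.
exists n1 => n nn.
have n0 : 0 < n%:R :> R by rewrite ltr0n; exact: leq_trans nn.
pose h : R := pi / (n%:R * d).
have h0 : 0 < h by rewrite divr_gt0 // mulr_gt0.
have hB : h * B <= e / 6.
  apply: (@le_trans _ _ (h * (B + 1))); first by rewrite ler_pM2l //; lra.
  have : pi / d * (B + 1) * 6 / e <= n%:R.
    by apply: le_trans (_ : n1%:R <= _); [exact/ltW/truncnS_gt|rewrite ler_nat].
  have -> : h * (B + 1) = pi / d * (B + 1) / n%:R by rewrite /h; field; rewrite !lt0r_neq0.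
  by rewrite !ler_pdivrMr //; lra.
pose x (l : nat) : R := l.+1%:R * h.
have x0 l : 0 < x l by rewrite mulr_gt0.
have thE l : pi * l.+1%:R / n%:R = d * x l by rewrite /x /h; field; rewrite !lt0r_neq0.
have key (l : nat) : (l < n.-1)%N -> h * Num.max 0 (band_symbol (sech_coef d) r (pi * l.+1%:R / n%:R) + e') `^ p <=
   (1 + dl) `^ p * (h * sech_pow (p / 2) (x l)) + h * (4 * D / (K + x l) ^+ 2).
  move=> ln.
  have -> : (1 + dl) `^ p * (h * sech_pow (p / 2) (x l)) + h * (4 * D / (K + x l) ^+ 2) =
     h * ((1 + dl) `^ p * sech_pow (p / 2) (x l) + 4 * D / (K + x l) ^+ 2) by ring.
  rewrite ler_pM2l // thE.
  have Kx : 0 < K + x l by rewrite addr_gt0.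
  have m0 : 0 <= Num.max 0 (band_symbol (sech_coef d) r (d * x l) + e') by rewrite le_max lexx.
  have [xK|xK] := leP (x l) K.
    apply: (@le_trans _ _ ((1 + dl) `^ p * sech_pow (p / 2) (x l))); last first.
      by rewrite lerDl; apply: divr_ge0 (sqr_ge0 _); exact: mulr_ge0.
    have sx : sg <= pi / coshR (pi * x l).
      rewrite ler_pM2l // lef_pV2 ?posrE ?coshR_gt0 //; apply: coshR_le.
        by rewrite mulr_ge0 // ltW.
      by rewrite ler_pM2l.
    have s0 : 0 <= pi / coshR (pi * x l) by rewrite (le_trans (ltW sg0)).
    have dl1 : 0 <= 1 + dl by clear -dl0; lra.
    have p2 : 2 * (p / 2) = p by field.
    rewrite /sech_pow p2 -powRM //; apply: ler_powRl => //; first exact: ltW.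
    rewrite ge_max mulr_ge0 //=.
    have := Hr1 r (x l) rr1 (ltW (x0 l)) xK; rewrite ler_norml => /andP[_ u].
    have : dl * sg <= dl * (pi / coshR (pi * x l)) by rewrite ler_pM2l.
    rewrite [(1 + dl) * _]mulrDl mul1r; clear -u e'1; lra.
  apply: (@le_trans _ _ (4 * D / (K + x l) ^+ 2)); last first.
    by rewrite lerDr; apply: mulr_ge0; [exact: powR_ge0|exact: sech_pow_ge0].
  have x1 : 1 <= x l by clear -K1 xK; lra.
  have dx : d * x l <= pi.
    rewrite -thE ler_pdivrMr // ler_pM2l // ler_nat.
    by rewrite (leq_trans ln) // leq_pred.
  have bs : band_symbol (sech_coef d) r (d * x l) + e' <= (C + 1) / x l ^+ q.
    have := Hr2 r (x l) rr2 x1 dx.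
    have : e1 * 2 <= (x l ^+ q)^-1.
      rewrite /e1 mulfVK // -[leRHS]mul1r ler_pdivlMr ?exprn_gt0 // -exprMn.
      have dpx : 0 <= d / pi * x l by rewrite ltW // mulr_gt0 // divr_gt0.
      by rewrite exprn_ile1 // mulrAC ler_pdivrMr // mul1r.
    rewrite [(C + 1) / _]mulrDl mul1r; clear -e'2; lra.
  have Cx : 0 <= (C + 1) / x l ^+ q by rewrite divr_ge0 ?exprn_ge0 ?(ltW (x0 l)) //; clear -C0; lra.
  apply: (@le_trans _ _ (((C + 1) / x l ^+ q) `^ p)).
    by apply: ler_powRl => //; [exact: ltW|rewrite ge_max Cx].
  have xq0 : 0 < x l ^+ q by rewrite exprn_gt0.
  rewrite powRM ?invr_ge0 ?(ltW xq0) //; last by clear -C0; lra.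
  rewrite -/D [4 * D]mulrC -mulrA; apply: ler_wpM2l => //.
  apply: (@le_trans _ _ (x l ^- 2)).
    rewrite powRV ?(ltW xq0) // -powR_mulrn ?(ltW (x0 l)) // -powRrM mulrN.
    rewrite powRN -powR_mulrn ?(ltW (x0 l)) // lef_pV2 ?posrE ?powR_gt0 //.
    by apply: ler_powR.
  rewrite ler_pdivlMr ?exprn_gt0 // mulrC -/(_ / _) ler_pdivrMr ?exprn_gt0 //.
  have -> : 4 * x l ^+ 2 = (2 * x l) ^+ 2 by ring.
  have x2 : 2 * x l = x l + x l by ring.
  have xx := ltW (addr_gt0 (x0 l) (x0 l)).
  by rewrite x2 (ler_sqr (ltW Kx) xx) lerD2r ltW.
apply: (@le_trans _ _ (\sum_(l < n.-1) ((1 + dl) `^ p * (h * sech_pow (p / 2) (x l)) + h * (4 * D / (K + x l) ^+ 2)))).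
  by apply: ler_sum => l _; exact: key.
rewrite big_split /= -mulr_sumr.
have S1 := sech_pow_sum_upper n.-1 a0 h0.
have D4 : 0 <= 4 * D by rewrite mulr_ge0.
have S2 := inverse_square_sum n.-1 D4 K0 h0.
have S1' := ler_wpM2l (powR_ge0 (1 + dl) p) S1.
apply: (le_trans (lerD S1' S2)).
rewrite -/I.
have -> : (1 + dl) `^ p * (I + h * sech_pow (p / 2) 0) + (4 * D / K + h * (4 * D / K ^+ 2)) =
  (1 + dl) `^ p * I + 4 * D / K + h * B by rewrite /B; ring.
have : (1 + dl) `^ p * I <= I + e / 3.
  rewrite dlE mulrDl mul1r lerD2l.
  have I1 : 0 < I + 1 by clear -I0; lra.
  rewrite (_ : e / (3 * (I + 1)) * I = e / 3 * (I / (I + 1))); last by field; rewrite lt0r_neq0.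
  by rewrite ger_pMr ?divr_gt0 // ler_pdivrMr // mul1r lerDl.
by clear -DK hB e0; lra.
Qed.

(** Only the first [m] modes are used, those with rescaled frequency below [K]. The bound on [m] is
    part of the conclusion because counting loses a constant for every mode used. *)
Lemma symbol_sum_lower p e : 0 < p -> 0 < e -> e < 1 ->
  exists K, exists2 d0, 0 < d0 <= 1 & forall d, 0 < d -> d <= d0 ->
  exists2 e0, 0 < e0 & exists r0, forall r e', (r0 <= r)%N -> 0 <= e' -> e' <= e0 ->
  exists n0, forall n, (n0 <= n)%N -> exists m,
    [/\ (m < n)%N, m%:R * (pi / (n%:R * d)) <= K,
      forall l, (l < m)%N -> 0 < band_symbol (sech_coef d) r (pi * l.+1%:R / n%:R) - e' &
      sech_pow_integral (p / 2) - e <= \sum_(l < m) pi / (n%:R * d) *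
        (band_symbol (sech_coef d) r (pi * l.+1%:R / n%:R) - e') `^ p].
Proof.
move=> p0 e0 e1; have pi0 := pi_gt0 R.
have pi1 : 1 <= pi :> R by have := pihalf_ge1 R; lra.
have a0 : 0 < p / 2 by rewrite divr_gt0.
pose I := sech_pow_integral (p / 2); have I0 : 0 <= I := sech_pow_integral_ge0 _.
have e2 : 0 < e / 2 by rewrite divr_gt0.
have [K K0 [h0 h00 Hh]] := sech_pow_sum_lower a0 e2.
have f0 : 0 < e / (2 * (I + 1)) by rewrite divr_gt0 //; lra.
have f1 : e / (2 * (I + 1)) < 1 by rewrite ltr_pdivrMr; lra.
have [dl /andP[dl0 dl1] dlE] := exists_powR1B p0 f0 f1.
pose sg := pi / coshR (pi * K).
have sg0 : 0 < sg by rewrite divr_gt0 // coshR_gt0.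
have ds0 : 0 < dl * sg / 2 by rewrite divr_gt0 // mulr_gt0.
have [d1 d10 H1] := @band_symbol_sech_limit R K _ (ltW K0) ds0.
exists K, (Num.min (Num.min d1 1) (1 / K)).
  by rewrite !lt_min d10 ltr01 divr_gt0 //= !ge_min lexx orbT.
move=> d d0; rewrite !le_min => /andP[/andP[dd1 dle1] dK].
have [r1 Hr1] := H1 d d0 dd1.
exists (dl * sg / 2) => //; exists r1 => r e' rr1 e'0 e'1.
pose n1 := (Num.truncn (pi / d / h0)).+1.
exists n1 => n nn.
have n0 : 0 < n%:R :> R by rewrite ltr0n; exact: leq_trans nn.
pose h : R := pi / (n%:R * d).
have hp : 0 < h by rewrite divr_gt0 // mulr_gt0.
have hh : h <= h0.
  have : pi / d / h0 <= n%:R.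
    by apply: le_trans (_ : n1%:R <= _); [exact/ltW/truncnS_gt|rewrite ler_nat].
  have -> : h = pi / d / n%:R by rewrite /h; field; rewrite !lt0r_neq0.
  by rewrite (ler_pdivrMr _ _ h00) (ler_pdivrMr _ _ n0) [h0 * _]mulrC.
have [m mK Hm] := Hh h hp hh; exists m.
pose x (l : nat) : R := l.+1%:R * h.
have x0 l : 0 < x l by rewrite mulr_gt0.
have thE l : pi * l.+1%:R / n%:R = d * x l by rewrite /x /h; field; rewrite !lt0r_neq0.
have xK l : (l < m)%N -> x l <= K.
  by move=> lm; apply: le_trans mK; rewrite ler_pM2r // ler_nat.
have key l : (l < m)%N -> (1 - dl) * (pi / coshR (pi * x l)) <= band_symbol (sech_coef d) r (pi * l.+1%:R / n%:R) - e'.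
  move=> lm; rewrite thE.
  have sx : sg <= pi / coshR (pi * x l).
    rewrite ler_pM2l // lef_pV2 ?posrE ?coshR_gt0 //; apply: coshR_le.
      by rewrite mulr_ge0 // ltW.
    by rewrite ler_pM2l //; exact: xK.
  have := Hr1 r (x l) rr1 (ltW (x0 l)) (xK l lm); rewrite ler_norml => /andP[u _].
  have : dl * sg <= dl * (pi / coshR (pi * x l)) by rewrite ler_pM2l.
  rewrite [(1 - dl) * _]mulrBl mul1r; clear -u e'1; lra.
have s0 l : 0 < pi / coshR (pi * x l) by rewrite divr_gt0 // coshR_gt0.
split => //.
- rewrite -(ltr_nat R) -(ltr_pM2r hp); apply: (le_lt_trans mK).
  have -> : n%:R * h = pi / d by rewrite /h; field; rewrite !lt0r_neq0.
  rewrite ltr_pdivlMr //; move: dK; rewrite ler_pdivlMr // mulrC => dK.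
  apply: (le_lt_trans dK); have := pihalf_ge1 R; clear; lra.
- by move=> l lm; apply: lt_le_trans (key l lm); rewrite mulr_gt0 // subr_gt0.
apply: (@le_trans _ _ ((1 - dl) `^ p * (I - e / 2))).
  have I1 : 0 < I + 1 by clear -I0; lra.
  have e3 : e / (2 * (I + 1)) * I <= e / 2.
    rewrite (_ : e / (2 * (I + 1)) * I = e / 2 * (I / (I + 1))); last by field; rewrite lt0r_neq0.
    by rewrite ger_pMr // ler_pdivrMr // mul1r lerDl.
  have := mulr_gt0 f0 e2; rewrite dlE -/I !mulrBl !mulrBr !mul1r; clear -e3; lra.
apply: (le_trans (ler_wpM2l (powR_ge0 _ _) Hm)); rewrite mulr_sumr; apply: ler_sum => l _.
rewrite mulrCA ler_pM2l //.
have p2 : 2 * (p / 2) = p by field.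
have dl' : 0 <= 1 - dl by rewrite subr_ge0 ltW.
rewrite /sech_pow p2 -powRM ?(ltW (s0 l)) //; apply: ler_powRl; first exact: ltW.
  exact: mulr_ge0 dl' (ltW (s0 l)).
exact: key.
Qed.

End symbol_sums.

(** * Counting for the model *)

Section model_frame.
Context {R : realType} (C : finType) (alpha d : R).
Hypothesis d0 : 0 < d.
Implicit Types (gam beta : C -> R).

Lemma node_weight0 : 0 < alpha -> node_weight alpha d 0 = 0.
Proof. by move=> al0; rewrite /node_weight mul0r powR0 ?mulr0 // oppr_eq0 lt0r_neq0. Qed.

Lemma node_weight_tail M n : 0 < alpha -> (0 < n)%N ->
  \sum_(m < M | (n <= m)%N) node_weight alpha d m <= node d n * (n%:R * d) `^ (- alpha).
Proof.
move=> al0 n0; have nd0 : 0 < n%:R * d by rewrite mulr_gt0 // ltr0n.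
have q0 : 0 <= 1 - expR (- d) by rewrite subr_ge0 -[leRHS]expR0 ler_expR oppr_le0 ltW.
apply: (@le_trans _ _ ((\sum_(m < M | (n <= m)%N) (node d m - node d m.+1)) * (n%:R * d) `^ (- alpha))).
  rewrite mulr_suml; apply: ler_sum => m nm; rewrite /node_weight node_succ.
  apply: ler_wpM2l; first by rewrite mulr_ge0 // ltW // node_gt0.
  by apply: powRN_le => //; rewrite ler_pM2r // ler_nat.
apply: ler_wpM2r; first exact: powR_ge0.
elim: M => [|M IH]; first by rewrite big_ord0 ltW // node_gt0.
suff -> : \sum_(m < M.+1 | (n <= m)%N) (node d m - node d m.+1) = if (n <= M)%N then node d n - node d M.+1 else 0.
  by case: ifP => _; [rewrite gerBl ltW // node_gt0|rewrite ltW // node_gt0].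
elim: M {IH} => [|M IH].
  by rewrite big_mkcond big_ord1 /= leqn0; case: n n0 {nd0}.
rewrite big_mkcond big_ord_recr /= -big_mkcond /= IH.
have [nM|nM] := leqP n M; first by rewrite (leq_trans nM (leqnSn _)) addrA subrK.
have [E|E] := leqP n M.+1; last by rewrite addr0.
have nE : n = M.+1 by apply/eqP; rewrite eqn_leq E nM.
by rewrite nE add0r.
Qed.

Lemma frame_mass_tail gam M n : 0 < alpha -> (forall c, 0 <= gam c) -> (0 < n)%N ->
  frame_mass (node_weight alpha d) gam M n <= (\sum_c gam c) * (node d n * (n%:R * d) `^ (- alpha)).
Proof.
move=> al0 g0 n0; rewrite /frame_mass mulr_suml; apply: ler_sum => c _.
by rewrite -mulr_sumr; apply: ler_wpM2l => //; exact: node_weight_tail.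
Qed.

Lemma frame_mass_total gam M : 0 < alpha -> (forall c, 0 <= gam c) ->
  frame_mass (node_weight alpha d) gam M 0 <= (\sum_c gam c) * d `^ (- alpha).
Proof.
move=> al0 g0; rewrite /frame_mass mulr_suml; apply: ler_sum => c _.
rewrite -mulr_sumr; apply: ler_wpM2l => //.
apply: (@le_trans _ _ (\sum_(m < M | (1 <= m)%N) node_weight alpha d m)).
  rewrite [leRHS]big_mkcond; apply: ler_sum => m _; case: ifP => // /negbT.
  by rewrite -eqn0Ngt => /eqP ->; rewrite node_weight0.
apply: (le_trans (node_weight_tail M al0 (ltn0Sn 0))); rewrite mul1r ger_pMl ?powR_gt0 //.
by rewrite /node -[leRHS]expR0 ler_expR oppr_le0 mul1r ltW.
Qed.

Definition weight_root (m : nat) : R := Num.sqrt ((m%:R * d) `^ (- alpha)).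

(** The reason for geometric nodes: [sqrt (q^m q^m') / (q^m + q^m')] depends only on [m - m']. *)
Lemma node_weight_pair m m' :
  Num.sqrt (node_weight alpha d m) * Num.sqrt (node_weight alpha d m') / (node d m + node d m')
  = sech_coef d (index_dist m m') * (weight_root m * weight_root m').
Proof.
have q0 : 0 <= 1 - expR (- d) by rewrite subr_ge0 -[leRHS]expR0 ler_expR oppr_le0 ltW.
have E k : Num.sqrt (node_weight alpha d k) = Num.sqrt (1 - expR (- d)) * expR (- (k%:R * d / 2)) * weight_root k.
  rewrite /node_weight sqrtrM ?mulr_ge0 ?(ltW (node_gt0 _ _)) // sqrtrM //; congr (_ * _ * _).
  have -> : node d k = expR (- (k%:R * d / 2)) ^+ 2.
    by rewrite -expRM_natl /node; congr expR; rewrite mulr_natl; field.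
  by rewrite sqrtr_sqr ger0_norm // ltW // expR_gt0.
rewrite !E /sech_coef.
have ss : Num.sqrt (1 - expR (- d)) * Num.sqrt (1 - expR (- d)) = 1 - expR (- d).
  by rewrite -expr2 sqr_sqrtr.
set s := Num.sqrt (1 - expR (- d)) in ss *; rewrite -ss; set w := weight_root m; set w' := weight_root m'.
have N k : node d k = expR (- (k%:R * d / 2)) * expR (- (k%:R * d / 2)).
  by rewrite -expRD /node; congr expR; field.
rewrite !N; set x := expR (- (m%:R * d / 2)); set x' := expR (- (m'%:R * d / 2)).
have x0 : 0 < x by exact: expR_gt0.
have x'0 : 0 < x' by exact: expR_gt0.
have -> : 2 * coshR ((index_dist m m')%:R * d / 2) = x / x' + x' / x.
  have ex k k' : expR (- (k%:R * d / 2)) / expR (- (k'%:R * d / 2)) = expR (- ((k%:R - k'%:R) * d / 2)).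
    by rewrite -expRN -expRD; congr expR; ring.
  rewrite /x /x' !ex /coshR mulrCA divff ?mulr1 //.
  have [mm|mm] := leqP m m'.
    rewrite index_dist_le // natrB //; congr (expR _ + expR _); ring.
  by rewrite index_dist_ge ?(ltnW mm) // natrB ?(ltnW mm) // addrC; congr (expR _ + expR _); ring.
field; rewrite !lt0r_neq0 //= ?addr_gt0 ?mulr_gt0 //.
Qed.

Lemma gram_toeplitz M (v : nat -> R) :
  \sum_(m < M) \sum_(m' < M) Num.sqrt (node_weight alpha d m) * Num.sqrt (node_weight alpha d m')
     / (node d m + node d m') * (v m * v m')
  = toeplitz_form (sech_coef d) M (fun m => weight_root m * v m).
Proof.
apply: eq_bigr => m _; apply: eq_bigr => m' _; rewrite node_weight_pair; ring.
Qed.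

Definition frame_energy (chi : C -> nat -> R) gam (M N : nat) (u : nat -> R) : R :=
  \sum_c \sum_(m < M) (\sum_(j < N) frame chi (node d) (node_weight alpha d) gam c m j * u j) ^+ 2.

Lemma frame_energy_expo (chi : C -> nat -> R) gam (M N : nat) (u : nat -> R) : (forall c, 0 <= gam c) ->
  frame_energy chi gam M N u =
  \sum_c gam c * qform (fun j k => chi c j * chi c k * expo_model alpha d M (j + k)%:R) N u.
Proof.
move=> g0; apply: eq_bigr => c _.
have E j k : expo_model alpha d M (j + k)%:R = \sum_(m < M) node_weight alpha d m *
   (expR (- (j%:R * node d m)) * expR (- (k%:R * node d m))).
  by apply: eq_bigr => m _; rewrite -expRD natrD; congr (_ * expR _); ring.
rewrite /qform mulr_sumr.
transitivity (\sum_(m < M) \sum_(j < N) \sum_(k < N) gam c * (chi c j * chi c k *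
   (node_weight alpha d m * (expR (- (j%:R * node d m)) * expR (- (k%:R * node d m)))) * (u j * u k))).
  apply: eq_bigr => m _; rewrite expr2 mulr_suml; apply: eq_bigr => j _.
  rewrite mulr_sumr; apply: eq_bigr => k _; rewrite /frame.
  have w0 : 0 <= gam c * node_weight alpha d m by rewrite mulr_ge0 // node_weight_ge0 // ltW.
  set s := Num.sqrt _; have ss : s * s = gam c * node_weight alpha d m by rewrite -expr2 sqr_sqrtr.
  transitivity ((s * s) * (chi c j * chi c k * (expR (- (j%:R * node d m)) * expR (- (k%:R * node d m)))) * (u j * u k)).
    by ring.
  by rewrite ss; ring.
rewrite exchange_big; apply: eq_bigr => j _; rewrite exchange_big mulr_sumr; apply: eq_bigr => k _.
by rewrite E !(mulr_sumr, mulr_suml); apply: eq_bigr => m _.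
Qed.

Lemma frame_energy_le (chi : C -> nat -> R) gam (M M' N : nat) (u : nat -> R) : (M <= M')%N ->
  frame_energy chi gam M N u <= frame_energy chi gam M' N u.
Proof.
move=> MM; apply: ler_sum => c _; rewrite -(subnKC MM) big_split_ord /= lerDl.
by apply: sumr_ge0 => m _; exact: sqr_ge0.
Qed.

End model_frame.

Section counting.
Context {R : realType}.
Implicit Types (alpha d t gam s x : R).

Lemma count_nat_le x (P : nat) (b : pred nat) : 0 <= x ->
  (forall q, b q -> q%:R < x) -> \sum_(q < P) ((0 < q)%N && b q)%:R <= x :> R.
Proof.
move=> x0 H; elim: P => [|P IH]; first by rewrite big_ord0.
rewrite big_ord_recr /=; case: (boolP ((0 < P)%N && b P)) => [/andP[P0 bP]|_]; last by rewrite addr0.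
have Px := H _ bP; apply: (@le_trans _ _ P%:R); last exact: ltW.
case: P P0 Px {IH bP} => // P _ _.
rewrite big_ord_recl /= add0r -[P.+1]addn1 natrD lerD2r.
apply: (@le_trans _ _ (\sum_(i < P) (1:R))); last by rewrite sumr_const card_ord.
by apply: ler_sum => i _; case: (b _).
Qed.

(** The loss of 3 covers the excluded [q = 0], the shift to [q.+1] and rounding. *)
Lemma count_nat_ge x (P : nat) (b : pred nat) : x <= P%:R ->
  (forall q, q.+1%:R < x -> b q) -> x - 3 <= \sum_(q < P) ((0 < q)%N && b q)%:R.
Proof.
move=> xP H; have [x3|x3] := leP x 3.
  by apply: (@le_trans _ _ 0); [rewrite subr_le0|apply: sumr_ge0 => q _; rewrite ler0n].
pose k := Num.truncn (x - 3).
have x30 : 0 <= x - 3 by rewrite subr_ge0 ltW.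
have /andP[k1 k2] := truncn_itv x30.
have kP : (k.+2 <= P)%N by rewrite -(ler_nat R) -(natr1 k.+1) -(natr1 k); rewrite -/k in k1; lra.
have -> : P = (k.+2 + (P - k.+2))%N by rewrite subnKC.
rewrite big_split_ord /=.
apply: (@le_trans _ _ (\sum_(q < k.+2) ((0 < q)%N && b q)%:R)); last first.
  by rewrite lerDl; apply: sumr_ge0 => q _; rewrite ler0n.
rewrite big_ord_recl /= add0r.
apply: (@le_trans _ _ (\sum_(q < k.+1) (1:R))).
  by rewrite sumr_const card_ord ltW //.
apply: ler_sum => q _; rewrite H //= /bump /= add1n.
have : (q.+2%:R : R) <= k.+2%:R by rewrite ler_nat !ltnS -ltnS.
rewrite -(natr1 k.+1) -(natr1 k); rewrite -/k in k1; lra.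
Qed.

Lemma weight_lt_iff alpha d t gam s (n q : nat) : 0 < alpha -> 0 < d -> 0 < t -> 0 < gam -> 0 < s -> (0 < n)%N ->
  (t * ((q * n)%:R * d) `^ alpha < gam * s) = (q%:R < (gam * s / t) `^ alpha^-1 / (n%:R * d)).
Proof.
move=> al0 d0 t0 g0 s0 n0; have nd0 : 0 < n%:R * d by rewrite mulr_gt0 // ltr0n.
have gs0 : 0 < gam * s / t by rewrite divr_gt0 // mulr_gt0.
have qnd : 0 <= q%:R * (n%:R * d) by rewrite mulr_ge0 // ltW.
rewrite natrM -mulrA [t * _]mulrC -(ltr_pdivlMr _ _ t0) (ltr_pdivlMr _ _ nd0).
have E : gam * s / t = ((gam * s / t) `^ alpha^-1) `^ alpha.
  by rewrite -powRrM mulVf ?lt0r_neq0 // powRr1 // ltW.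
rewrite {1}E; apply/idP/idP => [|H]; last by apply: (gt0_ltr_powR al0); rewrite ?nnegrE ?powR_ge0.
by apply: contraTT; rewrite -!leNgt => H; apply: ler_powRl => //; [exact: ltW|exact: powR_ge0].
Qed.

(** For a mode with symbol value [s > 0] the blocks counted are those with
    [p < (gam s / t)^(1/alpha) / (n d)], and a mode with [s <= 0] counts nothing. Exchanging the
    sums produces a Riemann sum of powers of the symbol. *)
Lemma toeplitz_count_upper alpha d t gam e (a : nat -> R) (n r P : nat) :
  0 < alpha -> 0 < d -> 0 < t -> 0 < gam -> (0 < n)%N ->
  \sum_(q < P) \sum_(l < n) [&& (0 < q)%N, (0 < l)%N &
     t * ((q * n)%:R * d) `^ alpha < gam * (band_symbol a r (pi * l%:R / n%:R) + e)]%:R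
  <= (gam / t) `^ alpha^-1 / pi * \sum_(l < n.-1) pi / (n%:R * d) *
      Num.max 0 (band_symbol a r (pi * l.+1%:R / n%:R) + e) `^ alpha^-1.
Proof.
move=> al0 d0 t0 g0 n0; rewrite exchange_big /=.
have nE : n = n.-1.+1 by rewrite prednK.
rewrite [in leLHS]nE big_ord_recl /= big1 ?add0r; last first.
  by move=> q _; rewrite andbF.
rewrite mulr_sumr; apply: ler_sum => l _; rewrite /bump /= add1n -nE.
set s := band_symbol _ _ _ + e.
have nd0 : 0 < n%:R * d by rewrite mulr_gt0 // ltr0n.
have gt0 : 0 <= gam / t by rewrite divr_ge0 // ltW.
have m0 : 0 <= Num.max 0 s by rewrite le_max lexx.
have -> : (gam / t) `^ alpha^-1 / pi * (pi / (n%:R * d) * Num.max 0 s `^ alpha^-1)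
   = (gam * Num.max 0 s / t) `^ alpha^-1 / (n%:R * d).
  rewrite (_ : gam * Num.max 0 s / t = gam / t * Num.max 0 s); last by ring.
  by rewrite (powRM _ gt0 m0) mulrA mulrA mulfVK ?lt0r_neq0 ?pi_gt0 // mulrAC.
apply: (@count_nat_le _ P (fun q => t * ((q * n)%:R * d) `^ alpha < gam * s)).
  by rewrite divr_ge0 ?powR_ge0 // ltW.
move=> q H; have s0 : 0 < s.
  rewrite -(pmulr_rgt0 _ g0); apply: le_lt_trans H.
  by rewrite mulr_ge0 ?powR_ge0 // ltW.
by move: H; rewrite (max_r (ltW s0)) (weight_lt_iff q al0 d0 t0 g0 s0 n0).
Qed.

Lemma cosine_coef_sum_le d r : 0 < d -> \sum_(k < r) cosine_coef (sech_coef d) k <= 4.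
Proof.
move=> d0; apply: (@le_trans _ _ (2 * \sum_(k < r) sech_coef d k)).
  rewrite mulr_sumr; apply: ler_sum => k _; rewrite /cosine_coef; case: ifP => // /eqP ->.
  by have := sech_coef_ge0 0 (ltW d0); lra.
by have := sech_coef_partial_le r d0; lra.
Qed.

Lemma powR_mono_nat alpha d : 0 < alpha -> 0 < d ->
  forall m m', (m <= m')%N -> (m%:R * d) `^ alpha <= (m'%:R * d) `^ alpha.
Proof.
move=> al0 d0 m m' mm; apply: ler_powRl; [exact: ltW|by rewrite mulr_ge0 // ltW|].
by rewrite ler_pM2r // ler_nat.
Qed.

Lemma toeplitz_energy_upper alpha d t gam e (n r P M : nat) :
  0 < alpha -> 0 < d -> 0 < t -> 0 < gam -> (0 < n)%N -> (0 < r)%N -> e <= 1 ->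
  (forall K, \sum_(k < K | (r < k)%N) 2 * sech_coef d k <= e) ->
  gam * 5 <= t * ((P * n)%:R * d) `^ alpha ->
  codim_le (n%:R + P%:R * (2 * r%:R) + (gam / t) `^ alpha^-1 / pi * \sum_(l < n.-1) pi / (n%:R * d) *
      Num.max 0 (band_symbol (sech_coef d) r (pi * l.+1%:R / n%:R) + e) `^ alpha^-1)
    (fun v : nat -> R => (forall m, (M <= m)%N -> v m = 0) ->
       gam * toeplitz_form (sech_coef d) M (fun m => weight_root alpha d m * v m) <= t * \sum_(m < M) v m ^+ 2).
Proof.
move=> al0 d0 t0 g0 n0 r0 e1 He HP.
(* Here 5 is the bound 4 for the sum of the coefficients plus [e <= 1]. *)
have T := @toeplitz_upper R (sech_coef d) (fun m => (m%:R * d) `^ alpha) n r P M e 5 gam t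
  (fun k => sech_coef_ge0 k (ltW d0)) (powR_mono_nat al0 d0) n0 r0 g0 t0 He _ HP.
have {}T := T (ltac:(have := cosine_coef_sum_le r.+1 d0; lra)).
have lin : linear_map (fun v : nat -> R => fun m => weight_root alpha d m * v m).
  by move=> a u v; apply/funext => m; ring.
apply: codim_leW (codim_le_comp lin T).
  by rewrite lerD2l; exact: toeplitz_count_upper.
move=> v H vM; have [|_ /le_trans] := H.
  by move=> m Mm; rewrite vM // mulr0.
apply; rewrite ler_pM2l //; apply: ler_sum => m _.
rewrite exprMn /weight_root sqr_sqrtr ?powR_ge0 // mulrA.
case: (posnP m) => [->|m0].
  by rewrite mul0r powR0 ?lt0r_neq0 // !mul0r sqr_ge0.
have md : 0 < m%:R * d by rewrite mulr_gt0 // ltr0n.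
by rewrite -powRD_gt0 // subrr powRr0 mul1r.
Qed.

Lemma powRN_eventually_ge alpha T : 0 < alpha -> exists2 t0, 0 < t0 &
  forall t, 0 < t -> t <= t0 -> T <= t `^ (- alpha).
Proof.
move=> al0; pose T1 := Num.max 1 T; have T10 : 0 < T1 by rewrite lt_max ltr01.
exists (T1 `^ (- alpha^-1)); first exact: powR_gt0.
move=> t t0 tt; apply: (@le_trans _ _ T1); first by rewrite le_max lexx orbT.
apply: le_trans (powRN_le al0 t0 tt).
by rewrite -powRrM mulrNN mulVf ?lt0r_neq0 // powRr1 // ltW.
Qed.

End counting.

(** * Upper bound for the model *)

Section model_upper_bound.
Context {R : realType} (C : finType) (alpha : R) (chi : C -> nat -> R) (kap : C -> R) (B : R).
Hypothesis al0 : 0 < alpha.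
Hypothesis B0 : 0 <= B.
Hypothesis chiB : forall c c' n,
  `|\sum_(j < n) (chi c j * chi c' j - (c == c')%:R * kap c)| <= B.
Hypothesis kap01 : forall c, 0 <= kap c <= 1.
Implicit Types (gam : C -> R).

Definition analysis d gam (M N : nat) (u : nat -> R) (cm : C * nat) : R :=
  if (cm.2 < M)%N then \sum_(j < N) frame chi (node d) (node_weight alpha d) gam cm.1 cm.2 j * u j else 0.

Lemma analysis_linear d gam M N : linear_map (analysis d gam M N).
Proof.
move=> a u v; apply/funext => -[c m]; rewrite /analysis /=; case: ifP => _; last by rewrite mulr0 addr0.
by rewrite mulr_sumr -big_split /=; apply: eq_bigr => j _; ring.
Qed.

Lemma analysis_bound d gam (M N : nat) (u : nat -> R) (t : R) : 0 < t ->
  sqnorm N (synthesis chi (node d) (node_weight alpha d) gam M (analysis d gam M N u))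
    <= t * coef_sqnorm M (analysis d gam M N u) ->
  frame_energy alpha d chi gam M N u <= t * sqnorm N u.
Proof.
move=> t0 H.
pose A (j : 'I_N) (k : C * 'I_M) := frame chi (node d) (node_weight alpha d) gam k.1 k.2 j.
have E1 (k : C * 'I_M) : analysis d gam M N u (k.1, nat_of_ord k.2) = \sum_(j < N) A j k * u j.
  by rewrite /analysis /= ltn_ord.
have := @adjoint_bound R (C * 'I_M)%type 'I_N A (fun j => u j) t t0.
have -> : \sum_(j < N) u j ^+ 2 = sqnorm N u by [].
have pairE (F : C -> 'I_M -> R) : \sum_(k : C * 'I_M) F k.1 k.2 = \sum_c \sum_(m < M) F c m.
  by rewrite pair_bigA.
have EF : \sum_(k : C * 'I_M) (\sum_(j < N) A j k * u j) ^+ 2 = frame_energy alpha d chi gam M N u.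
  by rewrite (pairE (fun c m => (\sum_(j < N) frame chi (node d) (node_weight alpha d) gam c m j * u j) ^+ 2)).
rewrite EF; apply; apply: le_trans (le_trans H _).
  apply: ler_sum => j _; rewrite le_eqVlt; apply/orP; left; apply/eqP; congr (_ ^+ 2).
  rewrite /synthesis -(pairE (fun c m => frame chi (node d) (node_weight alpha d) gam c m j * analysis d gam M N u (c, nat_of_ord m))).
  by apply: eq_bigr => k _; rewrite E1.
rewrite ler_pM2l // /coef_sqnorm -(pairE (fun c m => analysis d gam M N u (c, nat_of_ord m) ^+ 2)).
by rewrite -EF; apply: ler_sum => k _; rewrite E1.
Qed.

(** Requiring the first [n] coefficients of each channel to vanish leaves a frame mass that fits
    into the gap [t - t']; the Toeplitz conditions are imposed at level [t']. The adjoint bound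
    carries the estimate from the coefficients back to [u]. *)
Lemma analysis_energy d gam (M N n P r : nat) (t t' Z : R) (e : R) :
  0 < d -> (forall c, 0 <= gam c) -> 0 < t' -> t' < t -> (0 < n)%N -> (0 < r)%N -> e <= 1 ->
  (forall K, \sum_(k < K | (r < k)%N) 2 * sech_coef d k <= e) ->
  (forall c, gam c * 5 <= t' * ((P * n)%:R * d) `^ alpha) ->
  \sum_(l < n.-1) pi / (n%:R * d) *
      Num.max 0 (band_symbol (sech_coef d) r (pi * l.+1%:R / n%:R) + e) `^ alpha^-1 <= Z ->
  (B + 1) * frame_mass (node_weight alpha d) gam M n <= t - t' ->
  codim_le (#|C|%:R * (2 * n%:R + P%:R * (2 * r%:R)) + \sum_c (gam c * kap c / t') `^ alpha^-1 / pi * Z)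
    (fun u => frame_energy alpha d chi gam M N u <= t * sqnorm N u).
Proof.
move=> d0 g0 t'0 tt' n0 r0 e1 He HP HZ Hm.
have t0 : 0 < t := lt_trans t'0 tt'.
have P1 : codim_le (\sum_(c : C) (n%:R : R)) (fun u => forall c (m : 'I_n), analysis d gam M N u (c, nat_of_ord m) = 0).
  apply: codim_le_fin => c; rewrite -[n in n%:R]card_ord -sum1_card natr_sum.
  apply: codim_le_fin => m; apply: codim_le1 => a u v.
  by rewrite (analysis_linear d gam M N).
have Z0 : 0 <= Z.
  apply: le_trans HZ; apply: sumr_ge0 => l _; rewrite mulr_ge0 ?powR_ge0 // divr_ge0 ?pi_ge0 //.
  by rewrite mulr_ge0 // ltW.
have P2 : codim_le (\sum_(c : C) (n%:R + P%:R * (2 * r%:R) + (gam c * kap c / t') `^ alpha^-1 / pi * Z))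
   (fun u => forall c, gam c * kap c * toeplitz_form (sech_coef d) M (fun m => weight_root alpha d m * analysis d gam M N u (c, m))
      <= t' * \sum_(m < M) analysis d gam M N u (c, nat_of_ord m) ^+ 2).
  apply: codim_le_fin => c; have /andP[k0 k1] := kap01 c.
  have lin : linear_map (fun u m => analysis d gam M N u (c, m)).
    by move=> a u v; apply/funext => m; rewrite (analysis_linear d gam M N).
  have p0 : 0 <= (gam c * kap c / t') `^ alpha^-1 / pi * Z.
    by apply: mulr_ge0 => //; rewrite divr_ge0 ?powR_ge0 // pi_ge0.
  have nn : 0 <= n%:R + P%:R * (2 * r%:R) + (gam c * kap c / t') `^ alpha^-1 / pi * Z.
    by rewrite addr_ge0 // addr_ge0 // mulr_ge0 // mulr_ge0.
  have := mulr_ge0 (g0 c) k0; rewrite le_eqVlt => /orP[/eqP E0|gk0].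
    apply: (codim_le_true nn) => u; rewrite -E0 mul0r; apply: mulr_ge0; first exact: ltW.
    by apply: sumr_ge0 => m _; exact: sqr_ge0.
  have HP' : gam c * kap c * 5 <= t' * ((P * n)%:R * d) `^ alpha.
    apply: le_trans (HP c); rewrite ler_pM2r // ler_piMr //.
  have T := toeplitz_energy_upper M al0 d0 t'0 gk0 n0 r0 e1 He HP'.
  apply: codim_leW (codim_le_comp lin T).
    by rewrite lerD2l; apply: ler_wpM2l => //; rewrite divr_ge0 ?powR_ge0 // pi_ge0.
  by move=> u H; apply: H => m Mm; rewrite /analysis /= ltnNge Mm.
apply: codim_leW (codim_leI P1 P2).
  have EC (x : R) : #|C|%:R * x = \sum_(c : C) x by rewrite sumr_const mulr_natl.
  rewrite EC -!big_split /=.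
  by apply: ler_sum => c _; lra.
move=> u [Z1 Z2]; apply: analysis_bound => //.
set v := analysis d gam M N u in Z1 Z2 *.
have v0 c m : (m < n)%N -> v (c, m) = 0 by move=> mn; exact: (Z1 c (Ordinal mn)).
(* The Gram approximation needs a long section. The synthesis may be evaluated on a section longer
   than [N], since this only increases its norm. *)
have [N0 HN0] := synthesis_sqnorm_approx chiB (node_gt0 d) (fun m => node_weight_ge0 alpha m (ltW d0)) kap01 M g0.
have /HN0/(_ v0) := leq_maxr N N0.
under [\sum_c gam c * kap c * _]eq_bigr => c _ do rewrite (gram_toeplitz alpha d0 M (fun m => v (c, m))).
rewrite ler_norml => /andP[_]; rewrite lerBlDr => H.
apply: (@le_trans _ _ (sqnorm (maxn N N0) (synthesis chi (node d) (node_weight alpha d) gam M v))).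
  rewrite /sqnorm -(subnKC (leq_maxl N N0)) big_split_ord /= lerDl.
  by apply: sumr_ge0 => j _; exact: sqr_ge0.
apply: (le_trans H).
have -> : t = (t - t') + t' by rewrite subrK.
rewrite [leRHS]mulrDl; apply: lerD.
  by rewrite mulrA; apply: ler_wpM2r => //; exact: coef_sqnorm_ge0.
by rewrite /coef_sqnorm mulr_sumr; apply: ler_sum => c _.
Qed.

End model_upper_bound.

Section model_upper_asymptotics.
Context {R : realType} (C : finType) (alpha : R) (chi : C -> nat -> R) (kap : C -> R) (B : R).
Hypothesis al0 : 0 < alpha.
Hypothesis B0 : 0 <= B.
Hypothesis chiB : forall c c' n,
  `|\sum_(j < n) (chi c j * chi c' j - (c == c')%:R * kap c)| <= B.
Hypothesis kap01 : forall c, 0 <= kap c <= 1.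
Implicit Types (gam : C -> R).

(** [d], [e] and [r] are fixed before [t]. The block length [n] is about [eta * t^(-1/alpha)]: then
    [n] is a small part of the count, the number [P] of blocks and the margins [2 P r] stay bounded,
    and the node mass beyond [n] is exponentially small. *)
Lemma model_upper gam (eps : R) : (forall c, 0 <= gam c) -> 0 < eps ->
  exists2 d0, 0 < d0 <= 1 & forall d, 0 < d -> d <= d0 -> exists2 t0, 0 < t0 &
    forall t M N, 0 < t -> t <= t0 ->
    codim_le ((sech_pow_integral (alpha^-1 / 2) / pi * (\sum_c (gam c * kap c) `^ alpha^-1) + eps) * t `^ (- alpha^-1))
      (fun u => frame_energy alpha d chi gam M N u <= t * sqnorm N u).
Proof.
move=> g0 eps0; pose p := alpha^-1; have p0 : 0 < p by rewrite invr_gt0.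
have pi0 := pi_gt0 R.
pose I := sech_pow_integral (p / 2); have I0 : 0 <= I := sech_pow_integral_ge0 _.
pose G0 := (\sum_c (gam c * kap c) `^ p) / pi.
have G00 : 0 <= G0 by rewrite divr_ge0 ?(ltW pi0) // sumr_ge0 // => c _; exact: powR_ge0.
have G01 : G0 + 1 != 0 by rewrite gt_eqF //; lra.
pose g := Num.min 1 (eps / (6 * (I + 1) * (G0 + 1))).
have g1 : 0 < g by rewrite lt_min ltr01 divr_gt0 // !mulr_gt0 //; lra.
have gle1 : g <= 1 by rewrite ge_min lexx.
have g2 : 1 + g <= 2 by lra.
have gle : g * ((I + 1) * (G0 + 1)) <= eps / 6.
  have : g <= eps / (6 * (I + 1) * (G0 + 1)) by rewrite ge_min lexx orbT.
  by rewrite ler_pdivlMr ?mulr_gt0 //; lra.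
(* The level [t' = rho * t] leaves room for the Gram error; in the count it costs the factor
   [rho^(-1/alpha) = 1 + g]. *)
pose rho := (1 + g) `^ (- alpha).
have rho0 : 0 < rho by rewrite powR_gt0 //; lra.
have rho1 : rho < 1.
  by rewrite /rho powRN invf_lt1 ?powR_gt0 // -?[ltLHS](one_powR alpha); [apply: (gt0_ltr_powR al0); rewrite ?nnegrE; lra|lra].
have rhoE : rho `^ (- p) = 1 + g by rewrite -powRrM mulrNN /p divff ?lt0r_neq0 // powRr1 //; lra.
pose e1 := eps / (12 * (G0 + 1)).
have e10 : 0 < e1 by rewrite divr_gt0 // mulr_gt0 //; lra.
have [d0 d01 Hd] := symbol_sum_upper p0 e10.
exists d0 => // d dp dd.
have [e0 e00 [r1 Hr1]] := Hd d dp dd.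
pose e := Num.min e0 1.
have e_gt0 : 0 < e by rewrite lt_min e00 ltr01.
have ee0 : e <= e0 by rewrite ge_min lexx.
have ele1 : e <= 1 by rewrite ge_min lexx orbT.
have [r2 Hr2] := sech_coef_tail dp e_gt0.
pose r := (maxn r1 r2).+1.
have rr1 : (r1 <= r)%N by rewrite /r (leq_trans (leq_maxl r1 r2)).
have rr2 : (r2 <= r)%N by rewrite /r (leq_trans (leq_maxr r1 r2)).
have [n1 Hn1] := Hr1 r e rr1 (ltW e_gt0) ee0.
have He K : \sum_(k < K | (r < k)%N) 2 * sech_coef d k <= e := Hr2 r K rr2.
pose c0 : R := #|C|%:R + 1; have c00 : 0 < c0 by rewrite ltr_wpDl.
pose eta := eps / (12 * c0); have eta0 : 0 < eta by rewrite divr_gt0 // mulr_gt0.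
pose Gam := \sum_c gam c; have Gam0 : 0 <= Gam by apply: sumr_ge0.
pose Smax := 5 * (Gam + 1); have Smax0 : 0 < Smax by rewrite mulr_gt0 //; lra.
have gS c : gam c * 5 <= Smax.
  have : gam c <= Gam by rewrite /Gam (bigD1 c) //= lerDl; apply: sumr_ge0.
  rewrite /Smax; lra.
pose X := (eta * d / 2) `^ (- alpha); have X0 : 0 <= X := powR_ge0 _ _.
have q0 : 0 <= node d 1 by exact: ltW (node_gt0 _ _).
have q1 : node d 1 < 1 by rewrite /node mul1r -[ltRHS]expR0 ltr_expR oppr_lt0.
have r10 : 0 < 1 - rho by lra.
have [n2 Hn2] := expr_vanish ((B + 1) * Gam * X) q0 q1 r10.
pose Pmax := Smax `^ p * 4 / (eta * d) + 1.
have ed0 : 0 < eta * d by rewrite mulr_gt0.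
have Pmax0 : 0 <= Pmax.
  by apply: addr_ge0 => //; apply: divr_ge0; [rewrite mulr_ge0 // powR_ge0|exact: ltW].
pose T1 := Num.max ((n1 + n2 + 2)%:R * 2 / eta) (c0 * (Pmax * (2 * r%:R)) * 6 / eps).
have [t0 t00 Ht0] := powRN_eventually_ge T1 p0.
exists t0 => // t M N tp tt.
have := Ht0 t tp tt; rewrite ge_max => /andP[TA TB].
set T := t `^ (- p) in TA TB *.
have T0 : 0 < T by exact: powR_gt0.
pose n := Num.truncn (eta * T).
have eT : (n1 + n2 + 2)%:R * 2 <= eta * T by move: TA; rewrite ler_pdivrMr // [T * _]mulrC.
have eT0 : 0 <= eta * T by rewrite mulr_ge0 // ltW.
have /andP[nle nge] := truncn_itv eT0; rewrite -/n in nle nge.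
have nn : (n1 + n2 + 2 <= n)%N.
  rewrite -ltnS -(ltr_nat R); apply: le_lt_trans nge; apply: le_trans eT.
  by rewrite ler_peMr // ler1n.
have n0 : (0 < n)%N by rewrite (leq_trans _ nn) // addn2.
have nhalf : eta * T / 2 <= n%:R.
  have h1 : (1:R) <= n%:R by rewrite ler1n.
  have h2 : n.+1%:R = n%:R + 1 :> R by rewrite natr1.
  by rewrite h2 in nge; clear - h1 nge; lra.
have nd0 : 0 < n%:R * d by rewrite mulr_gt0 // ltr0n.
pose t' := rho * t; have t'0 : 0 < t' by rewrite mulr_gt0.
have tt' : t' < t by rewrite gtr_pMl.
have TE : T `^ (- alpha) = t by rewrite /T -powRrM mulrNN /p mulVf ?lt0r_neq0 // powRr1 // ltW.
have t'E : t' `^ (- p) = (1 + g) * T by rewrite powRM ?(ltW rho0) ?(ltW tp) // rhoE.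
(* From this many blocks on, [t'] times the weight exceeds the crude bound [Smax] on the matrix. [Q]
   is bounded because [n] and [t'^(-1/alpha)] are comparable. *)
pose Q := (Smax / t') `^ p / (n%:R * d).
have Q0 : 0 <= Q by rewrite divr_ge0 ?powR_ge0 // ltW.
pose P := (Num.truncn Q).+1.
have QP : Q <= P%:R by exact/ltW/truncnS_gt.
have PPmax : P%:R <= Pmax.
  have /andP[h1 _] := truncn_itv Q0; rewrite -natr1 lerD2r; apply: (le_trans h1).
  rewrite /Q powRM ?invr_ge0 ?(ltW t'0) ?(ltW Smax0) // powRV ?(ltW t'0) // t'E.
  rewrite ler_pdivrMr // (_ : Smax `^ p * 4 / (eta * d) * (n%:R * d) = Smax `^ p * (4 * n%:R / eta)); last first.
    by field; rewrite !lt0r_neq0.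
  apply: ler_wpM2l; first exact: powR_ge0.
  rewrite ler_pdivlMr //.
  apply: (@le_trans _ _ (2 * T * eta)); first by rewrite ler_pM2r // ler_pM2r.
  have -> : 2 * T * eta = 4 * (eta * T / 2) by field.
  by rewrite ler_pM2l.
have HP c : gam c * 5 <= t' * ((P * n)%:R * d) `^ alpha.
  apply: (le_trans (gS c)); rewrite mulrC -ler_pdivrMr //.
  have -> : Smax / t' = ((Smax / t') `^ p) `^ alpha.
    by rewrite -powRrM /p mulVf ?lt0r_neq0 // powRr1 // divr_ge0 // ltW.
  apply: ler_powRl; [exact: ltW|exact: powR_ge0|].
  by rewrite natrM -mulrA -ler_pdivrMr.
have Hm : (B + 1) * frame_mass (node_weight alpha d) gam M n <= t - t'.
  apply: (@le_trans _ _ ((B + 1) * (Gam * (node d n * (n%:R * d) `^ (- alpha))))).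
    by apply: ler_wpM2l; [rewrite addr_ge0|exact: frame_mass_tail].
  have Xn : (n%:R * d) `^ (- alpha) <= X * t.
    rewrite -TE -powRM ?(ltW T0) //; last by rewrite divr_ge0 // mulr_ge0 // ltW.
    apply: powRN_le => //; first by rewrite mulr_gt0 // divr_gt0 // mulr_gt0.
    have -> : eta * d / 2 * T = eta * T / 2 * d by ring.
    by rewrite ler_pM2r.
  have qn : node d n = node d 1 ^+ n by rewrite /node mul1r -expRM_natl mulrN.
  apply: (@le_trans _ _ (((B + 1) * Gam * X * node d 1 ^+ n) * t)).
    have -> : (B + 1) * Gam * X * node d 1 ^+ n * t = (B + 1) * (Gam * (node d 1 ^+ n * (X * t))).
      by move: (node d 1 ^+ n) => z; clear; ring.
    rewrite qn.
    apply: ler_wpM2l; first by rewrite addr_ge0.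
    by apply: ler_wpM2l => //; apply: ler_wpM2l => //; exact: exprn_ge0.
  have -> : t - t' = (1 - rho) * t by rewrite mulrBl mul1r.
  rewrite ler_pM2r //; apply: Hn2; apply: leq_trans nn.
  by rewrite -addnA addnCA leq_addr.
have HZ := Hn1 n (leq_trans (leq_trans (leq_addr _ _) (leq_addr _ _)) nn).
have A := @analysis_energy R C alpha chi kap B al0 chiB kap01 d gam M N n P r t t' (I + e1) e dp g0 t'0 tt' n0 (ltn0Sn _) ele1 He HP HZ Hm.
apply: codim_leW A => //.
have -> : \sum_c (gam c * kap c / t') `^ p / pi * (I + e1) = (I + e1) * (1 + g) * G0 * T.
  rewrite -mulr_suml -mulr_suml.
  have -> : \sum_c (gam c * kap c / t') `^ p = (\sum_c (gam c * kap c) `^ p) * ((1 + g) * T).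
    rewrite mulr_suml; apply: eq_bigr => c _; have /andP[k0 _] := kap01 c.
    by rewrite powRM ?invr_ge0 ?(ltW t'0) ?mulr_ge0 // powRV ?(ltW t'0) // t'E.
  by rewrite /G0; ring.
have B1 : #|C|%:R * (2 * n%:R + P%:R * (2 * r%:R)) <= eps / 3 * T.
  apply: (@le_trans _ _ (c0 * (2 * n%:R + P%:R * (2 * r%:R)))).
    by apply: ler_wpM2r; [rewrite addr_ge0 ?mulr_ge0|rewrite lerDl].
  have h1 : c0 * (2 * n%:R) <= eps / 6 * T.
    have -> : eps / 6 * T = c0 * (2 * (eta * T)) by rewrite /eta; field; rewrite lt0r_neq0.
    by rewrite ler_pM2l // ler_pM2l.
  have h2 : c0 * (P%:R * (2 * r%:R)) <= eps / 6 * T.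
    apply: (@le_trans _ _ (c0 * (Pmax * (2 * r%:R)))).
      by rewrite ler_pM2l //; apply: ler_wpM2r => //; rewrite mulr_ge0.
    by move: TB; rewrite ler_pdivrMr //; clear; lra.
  by rewrite mulrDr; clear - h1 h2; lra.
have B2 : (I + e1) * (1 + g) * G0 <= I * G0 + eps / 3.
  have h1 : I * g * G0 <= eps / 6.
    apply: le_trans gle; rewrite mulrC mulrA mulrC; apply: ler_wpM2l; [exact: ltW|].
    by apply: le_trans (_ : G0 * (I + 1) <= _); [apply: ler_wpM2l => //; rewrite lerDl|rewrite mulrC; apply: ler_wpM2l; [rewrite addr_ge0|rewrite lerDl]].
  have h2 : e1 * (1 + g) * G0 <= eps / 6.
    have -> : eps / 6 = e1 * 2 * (G0 + 1).
      by rewrite /e1; field; exact: G01.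
    have g10 : 0 <= 1 + g by rewrite addr_ge0 // ltW.
    by apply: ler_pM; rewrite ?(mulr_ge0 (ltW e10) g10) // ?lerDl // ler_pM2l.
  by clear - h1 h2; lra.
have -> : I / pi * (\sum_c (gam c * kap c) `^ p) = I * G0 by rewrite /G0; ring.
have B3 := ler_wpM2r (ltW T0) B2; have B4 := mulr_gt0 eps0 T0.
by clear - B1 B3 B4; lra.
Qed.

End model_upper_asymptotics.

(** * Lower bound for the model *)

Section model_lower_bound.
Context {R : realType} (C : finType) (alpha : R) (chi : C -> nat -> R) (kap : C -> R) (B : R).
Hypothesis al0 : 0 < alpha.
Hypothesis B0 : 0 <= B.
Hypothesis chiB : forall c c' n,
  `|\sum_(j < n) (chi c j * chi c' j - (c == c')%:R * kap c)| <= B.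
Hypothesis kap01 : forall c, 0 <= kap c <= 1.
Implicit Types (gam : C -> R).


Definition dual_root d (m : nat) : R := Num.sqrt ((m%:R * d) `^ alpha).

Lemma weight_dual_root d m : 0 < d -> (0 < m)%N -> weight_root alpha d m * dual_root d m = 1.
Proof.
move=> d0 m0; have md : 0 < m%:R * d by rewrite mulr_gt0 // ltr0n.
by rewrite /weight_root /dual_root -sqrtrM ?powR_ge0 // -powRD_gt0 // addNr powRr0 sqrtr1.
Qed.

(** The hypothesis bounds a form on sequences [u], while the Toeplitz count needs one on
    coefficients. Let [u] be synthesized from [v]. If its squared norm exceeded [t2] times that of
    [v], the cross bound would make the positive energy of [u] at most [t2] times its squared norm,
    and the adjoint bound would give a contradiction. The gaps in [t1 < t2 < t3] pay for the cross
    term and for the Gram error. *)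
Lemma synthesis_energy d gam gam' (M N n P : nat) (t1 t2 t3 x : R) :
  0 < d -> (forall c, 0 <= gam c) -> (forall c, 0 <= gam' c) -> (forall c, gam c * gam' c = 0) ->
  0 < t1 -> t1 < t2 -> t2 < t3 -> (0 < n)%N -> (P * n <= M)%N ->
  (forall v, (forall c m, (m < n)%N -> v (c, m) = 0) ->
    `|sqnorm N (synthesis chi (node d) (node_weight alpha d) gam (P * n) v) - \sum_c gam c * kap c *
       \sum_(m < P * n) \sum_(m' < P * n)
         Num.sqrt (node_weight alpha d m) * Num.sqrt (node_weight alpha d m') / (node d m + node d m')
            * (v (c, nat_of_ord m) * v (c, nat_of_ord m'))|
    <= (B + 1) * (frame_mass (node_weight alpha d) gam (P * n) n * coef_sqnorm (P * n) v)) ->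
  B ^+ 2 * (frame_mass (node_weight alpha d) gam' M 0 * frame_mass (node_weight alpha d) gam (P * n) n)
    <= (t2 - t1) * t2 ->
  (B + 1) * frame_mass (node_weight alpha d) gam (P * n) n <= t3 - t2 ->
  codim_le x (fun u => frame_energy alpha d chi gam M N u - frame_energy alpha d chi gam' M N u
     <= t1 * sqnorm N u) ->
  codim_le x (fun y : C * nat -> R =>
    (forall c m, (m < n)%N || (P * n <= m)%N -> y (c, m) = 0) ->
    \sum_c (gam c * kap c) * toeplitz_form (sech_coef d) (P * n) (fun m => y (c, m))
      <= t3 * \sum_c \sum_(m < P * n) (m%:R * d) `^ alpha * y (c, nat_of_ord m) ^+ 2).
Proof.
move=> d0 g0 g'0 gg t10 t12 t23 n0 PM Happ HR Hm Hx.
pose om := node_weight alpha d.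
have om0 m : 0 <= om m := node_weight_ge0 alpha m (ltW d0).
pose V (y : C * nat -> R) (k : C * nat) := dual_root d k.2 * y k.
pose F (y : C * nat -> R) := synthesis chi (node d) om gam (P * n) (V y).
have lin : linear_map F.
  move=> a u v; apply/funext => j; rewrite /F /synthesis mulr_sumr -big_split /=; apply: eq_bigr => c _.
  by rewrite mulr_sumr -big_split /=; apply: eq_bigr => m _; rewrite /V; ring.
apply: codim_leW (codim_le_comp lin Hx) => // y Hy y0.
set v := V y; set u := F y in Hy; set S := coef_sqnorm (P * n) v.
have v0 c m : (m < n)%N -> v (c, m) = 0 by move=> mn; rewrite /v /V y0 ?mn // mulr0.
have SE : S = \sum_c \sum_(m < P * n) (m%:R * d) `^ alpha * y (c, nat_of_ord m) ^+ 2.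
  apply: eq_bigr => c _; apply: eq_bigr => m _.
  by rewrite /v /V exprMn /dual_root sqr_sqrtr // powR_ge0.
have S0 : 0 <= S := coef_sqnorm_ge0 _ _.
have t20 : 0 < t2 := lt_trans t10 t12.
have cross := synthesis_cross_bound chiB (node_gt0 d) om0 (P * n) M N g0 g'0 gg v0.
have cross' : frame_energy alpha d chi gam' M N u <= (t2 - t1) * t2 * S.
  apply: (le_trans cross); rewrite -/om -/S [frame_mass _ _ _ _ * (_ * _)]mulrA mulrA.
  by apply: ler_wpM2r.
have uS : sqnorm N u <= t2 * S.
  rewrite leNgt; apply/negP => lt.
  have fe : frame_energy alpha d chi gam (P * n) N u <= t2 * sqnorm N u.
    have h1 := le_trans (frame_energy_le alpha d chi gam N u PM) (_ : _ <= t1 * sqnorm N u + frame_energy alpha d chi gam' M N u).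
    apply: le_trans (h1 _) _; first by rewrite -lerBlDr.
    have h2 : (t2 - t1) * t2 * S <= (t2 - t1) * sqnorm N u.
      by rewrite -mulrA; apply: ler_wpM2l; [rewrite subr_ge0 ltW|exact: ltW].
    by have := le_trans cross' h2; rewrite mulrBl; lra.
  pose A (k : C * 'I_(P * n)) (j : 'I_N) := frame chi (node d) om gam k.1 k.2 j.
  have pairE (G : C -> 'I_(P * n) -> R) : \sum_(k : C * 'I_(P * n)) G k.1 k.2 = \sum_c \sum_(m < P * n) G c m.
    by rewrite pair_bigA.
  have uE (j : 'I_N) : u j = \sum_(k : C * 'I_(P * n)) A k j * v (k.1, nat_of_ord k.2).
    by rewrite (pairE (fun c m => frame chi (node d) om gam c m j * v (c, nat_of_ord m))).
  have := @adjoint_bound R 'I_N (C * 'I_(P * n))%type A (fun k => v (k.1, nat_of_ord k.2)) t2 t20.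
  have -> : \sum_(j < N) (\sum_(k : C * 'I_(P * n)) A k j * v (k.1, nat_of_ord k.2)) ^+ 2 = sqnorm N u.
    by apply: eq_bigr => j _; rewrite -uE.
  have -> : \sum_(k : C * 'I_(P * n)) v (k.1, nat_of_ord k.2) ^+ 2 = S.
    by rewrite (pairE (fun c m => v (c, nat_of_ord m) ^+ 2)).
  have -> : \sum_(k : C * 'I_(P * n)) (\sum_(j < N) A k j * \sum_(k' : C * 'I_(P * n)) A k' j * v (k'.1, nat_of_ord k'.2)) ^+ 2
     = frame_energy alpha d chi gam (P * n) N u.
    rewrite /frame_energy -(pairE (fun c m => (\sum_(j < N) frame chi (node d) om gam c m j * u j) ^+ 2)).
    by apply: eq_bigr => k _; congr (_ ^+ 2); apply: eq_bigr => j _; rewrite -uE.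
  by move=> /(_ fe); rewrite leNgt lt.
have := Happ v v0; rewrite -/om -/u -/S.
under [\sum_c gam c * kap c * _]eq_bigr => c _ do rewrite (gram_toeplitz alpha d0 (P * n) (fun m => v (c, m))).
have TE c : toeplitz_form (sech_coef d) (P * n) (fun m => weight_root alpha d m * v (c, m))
   = toeplitz_form (sech_coef d) (P * n) (fun m => y (c, m)).
  have yE m : weight_root alpha d m * v (c, m) = y (c, m).
    case: (posnP m) => [->|m0]; last by rewrite /v /V mulrA weight_dual_root // mul1r.
    by rewrite v0 // y0 ?n0 // mulr0.
  by congr toeplitz_form; apply/funext.
have -> : \sum_c gam c * kap c * toeplitz_form (sech_coef d) (P * n) (fun m => weight_root alpha d m * v (c, m))
   = \sum_c gam c * kap c * toeplitz_form (sech_coef d) (P * n) (fun m => y (c, m)).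
  by apply: eq_bigr => c _; rewrite TE.
rewrite ler_norml => /andP[+ _]; rewrite lerNl opprB lerBlDr => H.
rewrite -SE; apply: (le_trans H).
have -> : t3 = (t3 - t2) + t2 by rewrite subrK.
rewrite [leRHS]mulrDl; apply: lerD => //.
by rewrite mulrA; apply: ler_wpM2r.
Qed.

Lemma band_symbol_sech_le d r (th : R) : 0 < d -> band_symbol (sech_coef d) r th <= 4.
Proof.
move=> d0; apply: (le_trans (ler_norm _)).
apply: (@le_trans _ _ (2 * \sum_(k < r.+1) sech_coef d k)).
  by apply: band_symbol_norm_le => k; rewrite ger0_norm // sech_coef_ge0 // ltW.
by have := sech_coef_partial_le r.+1 d0; lra.
Qed.

Lemma ler_sum_ord (F : nat -> R) m n : (m <= n)%N -> (forall l, 0 <= F l) ->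
  \sum_(l < m) F l <= \sum_(l < n) F l.
Proof.
move=> mn F0; rewrite -(subnKC mn) big_split_ord /= lerDl.
by apply: sumr_ge0 => l _.
Qed.

Lemma toeplitz_count_lower d t g e (n r P m : nat) :
  0 < d -> 0 < t -> 0 <= g -> 0 <= e -> (0 < n)%N -> (m < n)%N ->
  (forall l, (l < m)%N -> 0 < band_symbol (sech_coef d) r (pi * l.+1%:R / n%:R) - e) ->
  (g * 4 / t) `^ alpha^-1 / (n%:R * d) <= P%:R ->
  (g / t) `^ alpha^-1 / pi * \sum_(l < m) pi / (n%:R * d) *
      (band_symbol (sech_coef d) r (pi * l.+1%:R / n%:R) - e) `^ alpha^-1 - 3 * m%:R
  <= \sum_(q < P) \sum_(l < n) [&& (0 < q)%N, (0 < l)%N &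
     t * ((q.+1 * n)%:R * d) `^ alpha < g * (band_symbol (sech_coef d) r (pi * l%:R / n%:R) - e)]%:R.
Proof.
move=> d0 t0 g0 e0 n0 mn Hs HP; rewrite exchange_big /=.
have nd0 : 0 < n%:R * d by rewrite mulr_gt0 // ltr0n.
have pi0 := pi_gt0 R.
have m1 : (m.+1 <= n)%N by [].
apply: (@le_trans _ _ (\sum_(l < m.+1) \sum_(q < P) [&& (0 < q)%N, (0 < l)%N &
     t * ((q.+1 * n)%:R * d) `^ alpha < g * (band_symbol (sech_coef d) r (pi * l%:R / n%:R) - e)]%:R)); last first.
  apply: (ler_sum_ord (F := fun l => \sum_(q < P) [&& (0 < q)%N, (0 < l)%N &
     t * ((q.+1 * n)%:R * d) `^ alpha < g * (band_symbol (sech_coef d) r (pi * l%:R / n%:R) - e)]%:R)) => // l.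
  by apply: sumr_ge0 => q _; rewrite ler0n.
rewrite big_ord_recl /= [X in _ <= X + _]big1 ?add0r; last by move=> q _; rewrite andbF.
have -> : 3 * m%:R = \sum_(l < m) (3 : R) by rewrite sumr_const card_ord mulr_natr.
rewrite mulr_sumr -sumrB; apply: ler_sum => l _; rewrite /bump /= add1n.
have s0 := Hs l (ltn_ord l); set s := band_symbol _ _ _ - e in s0 *.
have gt0 : 0 <= g / t by rewrite divr_ge0 // ltW.
have -> : (g / t) `^ alpha^-1 / pi * (pi / (n%:R * d) * s `^ alpha^-1) = (g * s / t) `^ alpha^-1 / (n%:R * d).
  rewrite (_ : g * s / t = g / t * s); last by ring.
  by rewrite (powRM _ gt0 (ltW s0)) mulrA mulrA mulfVK ?lt0r_neq0 // mulrAC.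
apply: (@count_nat_ge _ _ P (fun q => t * ((q.+1 * n)%:R * d) `^ alpha < g * s)).
  apply: le_trans HP; rewrite ler_pM2r ?invr_gt0 //; apply: ler_powRl.
  - by rewrite invr_ge0 ltW.
  - by rewrite divr_ge0 ?(ltW t0) // mulr_ge0 // ltW.
  - rewrite ler_pM2r ?invr_gt0 //; apply: ler_wpM2l => //.
    by have := @band_symbol_sech_le d r (pi * l.+1%:R / n%:R) d0; rewrite /s; lra.
move=> q; move: g0; rewrite le_eqVlt => /orP[/eqP <-|g0].
  rewrite !mul0r powR0 ?invr_eq0 ?lt0r_neq0 // mul0r => h.
  by have := lt_trans (ltr0Sn _ q) h; rewrite ltxx.
by rewrite (weight_lt_iff q.+1 al0 d0 t0 g0 s0 n0).
Qed.

Lemma node_powR_vanish d (Cst e : R) : 0 < d -> 0 <= Cst -> 0 < e ->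
  exists n0, forall n, (n0 <= n)%N -> Cst * (node d n * n%:R `^ alpha) <= e.
Proof.
move=> d0 C0 e0; pose k := (Num.truncn alpha).+1.
have ak : alpha <= k%:R by exact/ltW/truncnS_gt.
pose u := expR (- (d / 2)).
have u1 : u < 1 by rewrite -[ltRHS]expR0 ltr_expR oppr_lt0 divr_gt0.
have [n0 H] := expr_vanish (Cst * ((2 / d) ^+ k * k`!%:R)) (ltW (expR_gt0 _)) u1 e0.
exists n0.+1 => n nn; apply: le_trans (H n (ltnW nn)).
rewrite -mulrA; apply: ler_wpM2l => //.
have n1 : 1 <= n%:R :> R by rewrite ler1n (leq_trans _ nn).
have nE : node d n = u ^+ n * expR (- (n%:R * d / 2)).
  by rewrite -expRM_natl -expRD /node; congr expR; field.
rewrite nE -mulrA [leRHS]mulrC; apply: ler_wpM2l; first by rewrite exprn_ge0 // ltW // expR_gt0.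
have nd2 : 0 <= n%:R * d / 2 by rewrite divr_ge0 // mulr_ge0 // ltW.
apply: (@le_trans _ _ (expR (- (n%:R * d / 2)) * n%:R ^+ k)).
  apply: ler_wpM2l; first by rewrite ltW // expR_gt0.
  by rewrite -powR_mulrn //; apply: ler_powR.
have := ler_wpM2l (_ : 0 <= (2 / d) ^+ k) (expr_mul_expRN_le k nd2).
have d20 : 0 <= (2 / d) ^+ k by rewrite exprn_ge0 // divr_ge0 // ltW.
move=> /(_ d20); apply: le_trans.
have E : 2 / d * (n%:R * d / 2) = n%:R by field; exact: lt0r_neq0.
by rewrite mulrA -exprMn E mulrC.
Qed.

(** Test vectors live on the nodes [n <= m < P * n], with [n] again proportional to [t^(-1/alpha)].
    [M] and [N] are taken large only after [t]; this suffices, as the operator controls all its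
    sections at once. *)
Lemma model_lower gam gam' (eps : R) : (forall c, 0 <= gam c) -> (forall c, 0 <= gam' c) ->
  (forall c, gam c * gam' c = 0) -> 0 < eps ->
  exists2 d0, 0 < d0 <= 1 & forall d, 0 < d -> d <= d0 -> exists2 t0, 0 < t0 &
    forall t, 0 < t -> t <= t0 -> exists M0 N0, forall M N x, (M0 <= M)%N -> (N0 <= N)%N ->
    codim_le x (fun u => frame_energy alpha d chi gam M N u - frame_energy alpha d chi gam' M N u
       <= t * sqnorm N u) ->
    (sech_pow_integral (alpha^-1 / 2) / pi * (\sum_c (gam c * kap c) `^ alpha^-1) - eps) * t `^ (- alpha^-1) <= x.
Proof.
move=> g0 g'0 gg eps0; pose p := alpha^-1; have p0 : 0 < p by rewrite invr_gt0.
have pi0 := pi_gt0 R.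
pose I := sech_pow_integral (p / 2); have I0 : 0 <= I := sech_pow_integral_ge0 _.
pose G0 := (\sum_c (gam c * kap c) `^ p) / pi.
have G00 : 0 <= G0 by rewrite divr_ge0 ?(ltW pi0) // sumr_ge0 // => c _; exact: powR_ge0.
have G01 : 0 < G0 + 1 by lra.
pose g := Num.min 1 (eps / (6 * (I + 1) * (G0 + 1))).
have g1 : 0 < g by rewrite lt_min ltr01 divr_gt0 // !mulr_gt0 //; lra.
have gle1 : g <= 1 by rewrite ge_min lexx.
have gle : g * ((I + 1) * (G0 + 1)) <= eps / 6.
  have : g <= eps / (6 * (I + 1) * (G0 + 1)) by rewrite ge_min lexx orbT.
  by rewrite ler_pdivlMr ?mulr_gt0 //; lra.
have g10 : 0 < 1 + g by lra.
pose rho := (1 + g) `^ alpha.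
have rho1 : 1 < rho.
  by rewrite /rho -[ltLHS](one_powR alpha); apply: (gt0_ltr_powR al0); rewrite ?nnegrE; lra.
have rho0 : 0 < rho by lra.
have rhoE : rho `^ (- p) = (1 + g)^-1.
  by rewrite -powRrM mulrN /p divff ?lt0r_neq0 // powR_inv1 // ltW.
pose e1 := Num.min (1 / 2) (eps / (6 * (G0 + 1))).
have e10 : 0 < e1 by rewrite lt_min !divr_gt0 // mulr_gt0.
have e11 : e1 < 1 by rewrite gt_min; apply/orP; left; lra.
have e1le : e1 * (G0 + 1) <= eps / 6.
  have : e1 <= eps / (6 * (G0 + 1)) by rewrite ge_min lexx orbT.
  by rewrite ler_pdivlMr ?mulr_gt0 //; lra.
have key : I * G0 - eps / 3 <= (I - e1) * (1 + g)^-1 * G0.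
  have h1 : 1 - g <= (1 + g)^-1 by rewrite -[leRHS]mul1r ler_pdivlMr //; have := sqr_ge0 g; lra.
  have h2 : (1 + g)^-1 <= 1 by rewrite invf_le1 //; lra.
  have h3 : I * G0 * (1 - g) <= I * G0 * (1 + g)^-1 by apply: ler_wpM2l => //; rewrite mulr_ge0.
  have h4 : e1 * G0 * (1 + g)^-1 <= e1 * G0.
    by rewrite -[leRHS]mulr1; apply: ler_wpM2l => //; rewrite mulr_ge0 // ltW.
  have h5 : I * G0 * g <= g * ((I + 1) * (G0 + 1)).
    rewrite mulrC; apply: ler_wpM2l; first exact: ltW.
    by apply: ler_pM => //; rewrite lerDl.
  have h6 : e1 * G0 <= e1 * (G0 + 1) by rewrite ler_pM2l // lerDl.
  have -> : (I - e1) * (1 + g)^-1 * G0 = I * G0 * (1 + g)^-1 - e1 * G0 * (1 + g)^-1 by ring.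
  by clear - h3 h4 h5 h6 gle e1le; lra.
have [K [d0 d01 Hd]] := symbol_sum_lower p0 e10 e11.
exists d0 => // d dp dd.
have dle1 : d <= 1 by apply: (le_trans dd); case/andP: d01.
have [e0 e00 [r1 Hr1]] := Hd d dp dd.
pose e := Num.min e0 1.
have e_gt0 : 0 < e by rewrite lt_min e00 ltr01.
have ee0 : e <= e0 by rewrite ge_min lexx.
have [r2 Hr2] := sech_coef_tail dp e_gt0.
pose r := maxn r1 r2.
have [n1 Hn1] := Hr1 r e (leq_maxl _ _) (ltW e_gt0) ee0.
have He k : \sum_(i < k | (r < i)%N) 2 * sech_coef d i <= e := Hr2 r k (leq_maxr _ _).
pose c0 : R := #|C|%:R + 1; have c00 : 0 < c0 by rewrite ltr_wpDl.
pose K1 := `|K| + 1; have K10 : 0 < K1 by rewrite ltr_wpDl.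
pose eta := eps / (9 * (K1 * c0)); have eta0 : 0 < eta by rewrite divr_gt0 // !mulr_gt0.
pose Gam := \sum_c gam c; have Gam0 : 0 <= Gam by apply: sumr_ge0.
pose Gam' := \sum_c gam' c; have Gam'0 : 0 <= Gam' by apply: sumr_ge0.
have gGam c : gam c <= Gam by rewrite /Gam (bigD1 c) //= lerDl; apply: sumr_ge0.
pose Smax := 4 * (Gam + 1); have Smax0 : 0 < Smax by rewrite mulr_gt0 // ltr_wpDl.
pose X := (eta * d / 2) `^ (- alpha); have X0 : 0 <= X := powR_ge0 _ _.
have ed0 : 0 < eta * d by rewrite mulr_gt0.
(* Half of the room between [t] and [rho * t] for each of the two errors. *)
pose h := (rho - 1) / 2; have h0 : 0 < h by rewrite divr_gt0 // subr_gt0.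
pose Y := (2 / eta) `^ alpha; have Y0 : 0 <= Y := powR_ge0 _ _.
have D0 : 0 <= (B ^+ 2 * (Gam' * d `^ (- alpha)) + (B + 1)) * Gam * X * (Y + 1).
  have da := powR_ge0 d (- alpha).
  have b0 : 0 <= B ^+ 2 * (Gam' * d `^ (- alpha)) + (B + 1).
    by rewrite addr_ge0 ?(addr_ge0 B0) // mulr_ge0 ?sqr_ge0 // mulr_ge0.
  by rewrite mulr_ge0 ?addr_ge0 // mulr_ge0 // mulr_ge0.
(* The cross term must be of order [t^2], but the bound on the total mass of the negative channels
   does not shrink with [t]. The exponentially small [node d n] therefore has to beat an extra
   [1 / t], which is of order [n ^ alpha]. *)
have [n2 Hn2] := node_powR_vanish dp D0 h0.
pose Pmax := Smax `^ p * 2 / (eta * d) + 1.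
have Pmax0 : 0 <= Pmax.
  by apply: addr_ge0 => //; apply: divr_ge0; [rewrite mulr_ge0 // powR_ge0|exact: ltW].
pose T1 := Num.max 1 (Num.max ((n1 + n2 + 2)%:R * 2 / eta) (c0 * (Pmax * (2 * r%:R)) * 3 / eps)).
have [t0 t00 Ht0] := powRN_eventually_ge T1 p0.
exists t0 => // t tp tt.
have := Ht0 t tp tt; rewrite ge_max => /andP[Tone]; rewrite ge_max => /andP[TA TB].
set T := t `^ (- p) in Tone TA TB *.
have T0 : 0 < T by exact: powR_gt0.
pose n := Num.truncn (eta * T).
have eT : (n1 + n2 + 2)%:R * 2 <= eta * T by move: TA; rewrite ler_pdivrMr // [T * _]mulrC.
have eT0 : 0 <= eta * T by rewrite mulr_ge0 // ltW.
have /andP[nle nge] := truncn_itv eT0; rewrite -/n in nle nge.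
have nn : (n1 + n2 + 2 <= n)%N.
  rewrite -ltnS -(ltr_nat R); apply: le_lt_trans nge; apply: le_trans eT.
  by rewrite ler_peMr // ler1n.
have n0 : (0 < n)%N by rewrite (leq_trans _ nn) // addn2.
have n10 : (1:R) <= n%:R by rewrite ler1n.
have nhalf : eta * T / 2 <= n%:R.
  have h2 : n.+1%:R = n%:R + 1 :> R by rewrite natr1.
  by rewrite h2 in nge; clear - n10 nge; lra.
have nd0 : 0 < n%:R * d by rewrite mulr_gt0 // ltr0n.
pose t2 := (1 + h) * t; pose t3 := rho * t.
have t20 : 0 < t2 by rewrite mulr_gt0 // addr_gt0.
have t30 : 0 < t3 by rewrite mulr_gt0.
have tt2 : t < t2 by rewrite ltr_pMl // ltrDl.
have rhoh : rho = 1 + 2 * h by rewrite /h; field.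
have t23 : t2 < t3 by rewrite ltr_pM2r // rhoh ltrD2l mulr_natl mulr2n ltrDl.
have TE : T `^ (- alpha) = t by rewrite /T -powRrM mulrNN /p mulVf ?lt0r_neq0 // powRr1 // ltW.
have TaE : T `^ alpha * t = 1 by rewrite -TE -powRD_gt0 // subrr powRr0.
have t3E : t3 `^ (- p) = (1 + g)^-1 * T by rewrite powRM ?(ltW rho0) ?(ltW tp) // rhoE.
pose Q := (Smax / t3) `^ p / (n%:R * d).
have Q0 : 0 <= Q by rewrite divr_ge0 ?powR_ge0 // ltW.
pose P := (Num.truncn Q).+1.
have QP : Q <= P%:R by exact/ltW/truncnS_gt.
have PPmax : P%:R <= Pmax.
  have /andP[h1 _] := truncn_itv Q0; rewrite -natr1 lerD2r; apply: (le_trans h1).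
  rewrite /Q powRM ?invr_ge0 ?(ltW t30) ?(ltW Smax0) // powRV ?(ltW t30) // t3E.
  rewrite ler_pdivrMr // (_ : Smax `^ p * 2 / (eta * d) * (n%:R * d) = Smax `^ p * (2 * n%:R / eta)); last first.
    by field; rewrite !lt0r_neq0.
  apply: ler_wpM2l; first exact: powR_ge0.
  rewrite ler_pdivlMr //.
  apply: (@le_trans _ _ (T * eta)).
    by rewrite ler_pM2r // ler_piMl ?(ltW T0) // invf_le1 // lerDl ltW.
  have -> : T * eta = 2 * (eta * T / 2) by field.
  by rewrite ler_pM2l.
have Xn : (n%:R * d) `^ (- alpha) <= X * t.
  rewrite -TE -powRM ?(ltW T0) //; last by rewrite divr_ge0 // ltW.
  apply: powRN_le => //; first by rewrite mulr_gt0 // divr_gt0.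
  have -> : eta * d / 2 * T = eta * T / 2 * d by ring.
  by rewrite ler_pM2r.
have nTa : T `^ alpha <= Y * n%:R `^ alpha.
  have ye0 : 0 <= 2 / eta by rewrite divr_ge0 // ltW.
  rewrite /Y -(powRM alpha ye0 (ler0n R n)); apply: ler_powRl; [exact: ltW|exact: ltW|].
  have -> : T = 2 / eta * (eta * T / 2) by field; exact: lt0r_neq0.
  by rewrite ler_pM2l // divr_gt0.
have q0 : 0 <= node d n by exact: ltW (node_gt0 _ _).
have na1 : 1 <= n%:R `^ alpha by rewrite -[leLHS](powRr0 (n%:R)); apply: ler_powR => //; exact: ltW.
have massn M : frame_mass (node_weight alpha d) gam M n <= Gam * (node d n * (X * t)).
  apply: le_trans (frame_mass_tail dp M al0 g0 n0) _.
  by apply: ler_wpM2l => //; apply: ler_wpM2l.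
have Hn := Hn2 n (leq_trans (leq_trans (leq_addl n1 n2) (leq_addr 2 _)) nn).
have da := powR_ge0 d (- alpha).
pose B1 := B ^+ 2 * (Gam' * d `^ (- alpha)).
have B10 : 0 <= B1 by rewrite mulr_ge0 ?sqr_ge0 // mulr_ge0.
have qX0 : 0 <= Gam * X * node d n by rewrite mulr_ge0 // mulr_ge0.
have Hn' : (B1 + (B + 1)) * (Gam * X * node d n) * ((Y + 1) * n%:R `^ alpha) <= h.
  by apply: le_trans Hn; rewrite -/B1 le_eqVlt; apply/orP; left; apply/eqP; clear; ring.
have BB0 : 0 <= B + 1 by rewrite addr_ge0.
have Y1 : 1 <= (Y + 1) * n%:R `^ alpha.
  by rewrite -[leLHS]mulr1; apply: ler_pM => //; rewrite lerDr.
have Hm1 : (B + 1) * (Gam * X * node d n) <= h.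
  apply: le_trans Hn'.
  have z0 : 0 <= (B1 + (B + 1)) * (Gam * X * node d n) by apply: mulr_ge0 => //; exact: addr_ge0.
  apply: (@le_trans _ _ ((B1 + (B + 1)) * (Gam * X * node d n))).
    by apply: ler_wpM2r => //; rewrite lerDr.
  by rewrite -[leLHS]mulr1; apply: ler_wpM2l.
have Hm2 : B1 * (Gam * X * node d n) <= h * t.
  have z1 : B1 * (Gam * X * node d n) * T `^ alpha <= h.
    apply: le_trans Hn'; apply: ler_pM.
    - exact: mulr_ge0.
    - exact: powR_ge0.
    - by apply: ler_wpM2r => //; rewrite lerDl.
    - by apply: (le_trans nTa); apply: ler_wpM2r; [exact: powR_ge0|rewrite lerDl].
  rewrite -[leLHS]mulr1 -TaE mulrA; apply: ler_wpM2r => //; exact: ltW.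
have om0 m : 0 <= node_weight alpha d m := node_weight_ge0 alpha m (ltW dp).
have [N0 HN0] := synthesis_sqnorm_approx chiB (node_gt0 d) om0 kap01 (P * n) g0.
exists (P * n)%N, N0 => M N x PM NN Hx.
have Happ v : (forall c m, (m < n)%N -> v (c, m) = 0) -> _ := HN0 N n v NN.
have HR : B ^+ 2 * (frame_mass (node_weight alpha d) gam' M 0 * frame_mass (node_weight alpha d) gam (P * n) n)
    <= (t2 - t) * t2.
  apply: (@le_trans _ _ (B1 * (Gam * X * node d n) * t)).
    rewrite (_ : B1 * (Gam * X * node d n) * t = B ^+ 2 * ((Gam' * d `^ (- alpha)) * (Gam * (node d n * (X * t))))); last first.
      by rewrite /B1; clear; ring.
    apply: ler_wpM2l; first exact: sqr_ge0.
    apply: ler_pM; [exact: frame_mass_ge0|exact: frame_mass_ge0|exact: frame_mass_total|exact: massn].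
  apply: (@le_trans _ _ (h * t * t)); first by rewrite ler_pM2r.
  have -> : t2 - t = h * t by rewrite /t2; ring.
  by apply: ler_wpM2l; [exact: ltW (mulr_gt0 h0 tp)|exact: ltW].
have Hm : (B + 1) * frame_mass (node_weight alpha d) gam (P * n) n <= t3 - t2.
  apply: (@le_trans _ _ ((B + 1) * (Gam * X * node d n) * t)).
    rewrite -[leRHS]mulrA; apply: ler_wpM2l => //; apply: (le_trans (massn _)).
    by rewrite le_eqVlt; apply/orP; left; apply/eqP; clear; ring.
  have -> : t3 - t2 = h * t by rewrite /t3 rhoh /t2; ring.
  by rewrite ler_pM2r.
have S := synthesis_energy dp g0 g'0 gg tp tt2 t23 n0 PM Happ HR Hm Hx.
have gk c : 0 <= gam c * kap c by have /andP[k0 _] := kap01 c; rewrite mulr_ge0.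
have TL := toeplitz_lower (fun k => sech_coef_ge0 k (ltW dp)) (powR_mono_nat al0 dp) n0 t30 gk He S.
have [m [mn mK ms Hs]] := Hn1 n (leq_trans (leq_trans (leq_addr _ _) (leq_addr _ _)) nn).
have cnt c : (gam c * kap c) `^ p * ((1 + g)^-1 * T) / pi * (I - e1) - 3 * m%:R <=
   \sum_(q < P) \sum_(l < n) [&& (0 < q)%N, (0 < l)%N &
     t3 * ((q.+1 * n)%:R * d) `^ alpha < gam c * kap c * (band_symbol (sech_coef d) r (pi * l%:R / n%:R) - e)]%:R.
  have HP : (gam c * kap c * 4 / t3) `^ p / (n%:R * d) <= P%:R.
    apply: le_trans QP; rewrite ler_pM2r ?invr_gt0 //; apply: ler_powRl; first exact: ltW.
      by rewrite divr_ge0 ?(ltW t30) // mulr_ge0.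
    rewrite ler_pM2r ?invr_gt0 // /Smax mulrC ler_pM2l //.
    have /andP[k0 k1] := kap01 c.
    apply: (@le_trans _ _ (gam c)); first by rewrite -[leRHS]mulr1; apply: ler_wpM2l.
    by apply: (le_trans (gGam c)); rewrite lerDl.
  apply: le_trans (toeplitz_count_lower dp t30 (gk c) (ltW e_gt0) n0 mn ms HP).
  rewrite lerD2r -t3E -powRV ?(ltW t30) // -powRM ?invr_ge0 ?(ltW t30) //.
  by apply: ler_wpM2l => //; rewrite divr_ge0 ?powR_ge0 // ltW.
have mle : 3 * m%:R * #|C|%:R <= eps / 3 * T.
  have m1 : m%:R <= K1 * eta * T.
    have : m%:R * (pi / (n%:R * d)) <= K1.
      by apply: (le_trans mK); rewrite (le_trans (ler_norm K)) // lerDl.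
    rewrite mulrA ler_pdivrMr // => h1.
    have pi1 : 1 <= pi :> R by have := pihalf_ge1 R; rewrite ler_pdivlMr // mul1r; apply: le_trans; rewrite ler1n.
    apply: (@le_trans _ _ (m%:R * pi)); first by rewrite -[leLHS]mulr1; apply: ler_wpM2l.
    apply: (le_trans h1); rewrite -[leRHS]mulrA; apply: ler_wpM2l; first exact: ltW.
    by rewrite -[leRHS]mulr1; apply: ler_pM => //; exact: ltW.
  have -> : eps / 3 * T = 3 * (K1 * eta * T) * c0.
    by rewrite /eta; field; rewrite (lt0r_neq0 K10) (lt0r_neq0 c00).
  have m0 : 0 <= 3 * m%:R :> R by rewrite -natrM.
  have c1 : #|C|%:R <= c0 by rewrite lerDl.
  by apply: (ler_pM m0 (ler0n _ _) _ c1); rewrite ler_pM2l.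
have Pr : #|C|%:R * (P%:R * (2 * r%:R)) <= eps / 3 * T.
  apply: (@le_trans _ _ (c0 * (Pmax * (2 * r%:R)))).
    have c1 : #|C|%:R <= c0 by rewrite lerDl.
    have p0' : 0 <= P%:R * (2 * r%:R) :> R by rewrite -!natrM.
    apply: (ler_pM (ler0n _ _) p0' c1).
    by apply: ler_wpM2r => //; rewrite -natrM.
  by move: TB; rewrite ler_pdivrMr //; clear; lra.
have LB : (I - e1) * (1 + g)^-1 * G0 * T - 3 * m%:R * #|C|%:R <= x + #|C|%:R * (P%:R * (2 * r%:R)).
  apply: le_trans TL.
  apply: (@le_trans _ _ (\sum_c ((gam c * kap c) `^ p * ((1 + g)^-1 * T) / pi * (I - e1) - 3 * m%:R))).
    rewrite sumrB sumr_const mulr_natr lerD2r -!mulr_suml /G0.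
    by rewrite le_eqVlt; apply/orP; left; apply/eqP; ring.
  by apply: ler_sum => c _; exact: cnt.
have kT := ler_wpM2r (ltW T0) key.
have -> : I / pi * (\sum_c (gam c * kap c) `^ p) = I * G0 by rewrite /G0; ring.
clear - kT LB Pr mle; lra.
Qed.

End model_lower_bound.

(** * Oscillating kernels *)

Section error_terms.
Context {R : realType}.
Implicit Types (alpha eta t : R).

Lemma fin_lower_bound (C : finType) (f : C -> R) : (forall c, 0 < f c) ->
  exists2 m, 0 < m & forall c, m <= f c.
Proof.
move=> f0; have S0 : 0 <= \sum_c (f c)^-1 by apply: sumr_ge0 => c _; rewrite invr_ge0 ltW.
exists (1 + \sum_c (f c)^-1)^-1; first by rewrite invr_gt0 ltr_wpDr.
move=> c; rewrite -[leRHS]invrK lef_pV2 ?posrE ?invr_gt0 ?ltr_wpDr //.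
rewrite (bigD1 c) //= addrCA lerDl addr_ge0 //.
by apply: sumr_ge0 => c' _; rewrite invr_ge0 ltW.
Qed.

Lemma hform_small alpha (C eta : R) : 0 < alpha -> 0 < C -> 0 < eta ->
  exists2 eps, 0 < eps & forall (t : R) (N j0 : nat) g, 0 < t <= eps -> (2 <= j0)%N ->
    (forall j, (j0 <= j < N + N)%N -> `|g j| <= eps * (j%:R^-1 * logpow alpha j)) ->
    (forall j, (j0 <= j < N + N)%N ->
       `|iter (Mdiff alpha) telescope g j| <= C * (j%:R ^- (Mdiff alpha).+1 * logpow alpha j)) ->
    codim_le (eta * t `^ (- alpha^-1))
      (fun u => (forall j, (j < j0)%N -> u j = 0) -> `|hform g N u| <= t * sqnorm N u).
Proof.
move=> al0 C0 eta0; rewrite /Mdiff; case: ifP => [al2|_].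
  have al : 0 < alpha < 1 / 2 by rewrite al0.
  by have [eps eps0 H] := hform_small_rough al eta0; exists eps => // t N j0 g tt j2 h1 _; exact: H.
have al : 0 < alpha < (Num.truncn alpha).+1%:R by rewrite al0 truncnS_gt.
by have [eps eps0 H] := hform_small_smooth al C0 eta0; exists eps.
Qed.

Lemma iter_telescope_linear (a : R) (f g : nat -> R) (k j : nat) :
  iter k telescope (fun i => a * f i + g i) j = a * iter k telescope f j + iter k telescope g j.
Proof. by elim: k j => [//|k IH] j; rewrite !iterS !telescopeE !IH; ring. Qed.

Lemma sqnorm_mul_le (chi u : nat -> R) N : (forall j, `|chi j| <= 1) ->
  sqnorm N (fun j => chi j * u j) <= sqnorm N u.
Proof.
move=> H; apply: ler_sum => j _; rewrite exprMn ler_piMl ?sqr_ge0 //.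
by rewrite -real_normK ?num_real // exprn_ile1.
Qed.

(** All kernel errors of one channel together. A section of size [N] involves indices below [2 N],
    where the exponential model is accurate once [M] exceeds a multiple of [ln (2 N)]. The
    oscillating factor is harmless, since multiplication by it does not increase the norm. *)
Lemma model_error_form alpha (b : R) (g chi : nat -> R) (dl eta : R) : 0 < alpha -> 0 < dl -> 0 < eta ->
  (forall j, `|chi j| <= 1) ->
  (forall eps, 0 < eps -> exists J, forall j, (J <= j)%N -> `|g j| <= eps * (j%:R^-1 * logpow alpha j)) ->
  (exists J, forall j, (J <= j)%N ->
     `|iter (Mdiff alpha) telescope g j| <= j%:R ^- (Mdiff alpha).+1 * logpow alpha j) ->
  exists2 d0, 0 < d0 & forall d, 0 < d -> d <= d0 -> exists2 t0, 0 < t0 & exists (j0 : nat) (c : R),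
    forall t N M, 0 < t -> t <= t0 -> c * ln (N + N)%:R + 1 <= M%:R ->
    codim_le (eta * t `^ (- alpha^-1)) (fun u => (forall j, (j < j0)%N -> u j = 0) ->
      `|hform (fun i => b * (model_kernel alpha i - expo_model alpha d M i%:R) + g i) N (fun j => chi j * u j)|
         <= dl * t * sqnorm N u).
Proof.
move=> al0 dl0 eta0 chi1 Hg [J1 HJ1].
have [C1 C10 HC] := model_error (Mdiff alpha) al0.
pose C := `|b| * C1 + 1; have C0 : 0 < C by rewrite ltr_wpDl // mulr_ge0 // ltW.
(* The estimate is applied at level [dl * t]; the power of [dl] compensates the factor
   [dl^(-1/alpha)] in the count. *)
have eta'0 : 0 < eta * dl `^ alpha^-1 by rewrite mulr_gt0 // powR_gt0.
have [eps eps0 Heps] := hform_small al0 C0 eta'0.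
have b1 : 0 < `|b| + 1 by rewrite ltr_wpDl.
pose e1 := Num.min (1 / 2) (eps / (2 * (`|b| + 1))).
have e10 : 0 < e1 by rewrite lt_min !divr_gt0 // mulr_gt0.
have e11 : e1 < 1 by rewrite gt_min; apply/orP; left; lra.
have be : `|b| * e1 <= eps / 2.
  apply: (@le_trans _ _ ((`|b| + 1) * e1)); first by rewrite ler_pM2r // lerDl.
  have : e1 <= eps / (2 * (`|b| + 1)) by rewrite ge_min lexx orbT.
  by rewrite ler_pdivlMr ?mulr_gt0 //; lra.
have [d0 d00 Hd] := HC e1 (ltac:(by rewrite e10)).
exists d0 => // d dp dd.
have [j1 [c [j12 Hj]]] := Hd d (ltac:(by rewrite dp)).
have e2 : 0 < eps / 2 by rewrite divr_gt0.
have [J0 HJ0] := Hg _ e2.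
exists (eps / dl); first by rewrite divr_gt0.
exists (maxn j1 (maxn J0 J1)), `|c| => t N M tp tt HM.
set e := fun i => b * _ + g i.
have dt : 0 < dl * t <= eps by rewrite mulr_gt0 //= mulrC -ler_pdivlMr.
have j02 : (2 <= maxn j1 (maxn J0 J1))%N by rewrite (leq_trans j12) // leq_maxl.
have cond j : (maxn j1 (maxn J0 J1) <= j < N + N)%N -> [/\ (j1 <= j)%N, (J0 <= j)%N, (J1 <= j)%N & c * ln j%:R + 1 <= M%:R].
  rewrite !geq_max => /andP[/andP[h1 /andP[h2 h3]] jN]; split => //.
  have j0 : 0 < j%:R :> R by rewrite ltr0n (leq_trans _ h1) // (leq_trans _ j12).
  have j1' : 1 <= j%:R :> R by rewrite ler1n -(ltr0n R).
  apply: le_trans HM; rewrite lerD2r.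
  apply: (@le_trans _ _ (`|c| * ln j%:R)); first by rewrite ler_wpM2r ?ler_norm // ln_ge0.
  apply: ler_wpM2l => //; rewrite ler_ln ?posrE // ?ler_nat ?(ltnW jN) //.
  by rewrite (lt_le_trans j0) // ler_nat ltnW.
have X0 k j : 0 <= j%:R ^- k * logpow alpha j :> R.
  by rewrite mulr_ge0 ?powR_ge0 // invr_ge0 exprn_ge0.
have E0 j : (maxn j1 (maxn J0 J1) <= j < N + N)%N -> `|e j| <= eps * (j%:R^-1 * logpow alpha j).
  move=> /cond [h1 h2 h3 h4]; have [m1 _] := Hj M j h1 h4; have m2 := HJ0 j h2.
  have x0 : 0 <= j%:R^-1 * logpow alpha j := X0 1%N j.
  apply: (le_trans (ler_normD _ _)); rewrite normrM.
  have m3 := ler_wpM2l (normr_ge0 b) m1.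
  have m4 := ler_wpM2r x0 be.
  move: m2 m3 m4; set x := _^-1 * _; clear; lra.
have E1 j : (maxn j1 (maxn J0 J1) <= j < N + N)%N ->
  `|iter (Mdiff alpha) telescope e j| <= C * (j%:R ^- (Mdiff alpha).+1 * logpow alpha j).
  move=> /cond [h1 h2 h3 h4]; have [_ m1] := Hj M j h1 h4; have m2 := HJ1 j h3.
  rewrite iter_telescope_linear.
  apply: (le_trans (ler_normD _ _)); rewrite normrM /C mulrDl mul1r; apply: lerD => //.
  by rewrite -mulrA; apply: ler_wpM2l.
have K := Heps (dl * t) N _ e dt j02 E0 E1.
have lin : linear_map (fun (u : nat -> R) j => chi j * u j) by move=> a u v; apply/funext => j; ring.
apply: codim_leW (codim_le_comp lin K).
  rewrite powRM ?(ltW dl0) ?(ltW tp) // mulrA -[X in X * t `^ _ <= _]mulrA -powRD_gt0 //.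
  by rewrite subrr powRr0 mulr1.
move=> u H u0; apply: le_trans (H _) _.
  by move=> j jj; rewrite u0 // mulr0.
by apply: ler_wpM2l; [case/andP: dt => /ltW|exact: sqnorm_mul_le].
Qed.

Lemma codim_le_initial (n : nat) (T : R) : n%:R <= T ->
  codim_le T (fun u : nat -> R => forall j, (j < n)%N -> u j = 0).
Proof. by move=> nT; exists n, (fun k u => u k); split. Qed.

(** A slight change of the level [t] multiplies counts by [q] or [1 / q]; [q] is so close to 1 that
    the coefficient moves by at most [eps / 4]. *)
Lemma rescaling_factor (A eps : R) : 0 <= A -> 0 < eps -> exists q, [/\ 1 < q,
  (A + eps / 4) * q <= A + eps / 2 & A - eps / 2 <= (A - eps / 4) / q].
Proof.
move=> A_ge0 e0; have Ae : 0 < A + eps by rewrite ltr_wpDl.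
pose d := eps / (4 * (A + eps)); have d0 : 0 < d by rewrite divr_gt0 // mulr_gt0.
have dE : d * (A + eps) = eps / 4 by rewrite /d; field; rewrite gt_eqF.
have dA : 0 <= d * A by rewrite mulr_ge0 // ltW.
have de : 0 <= d * eps by rewrite mulr_ge0 // ltW.
exists (1 + d); split; first by rewrite ltrDl.
  by clear -dE dA de; nra.
rewrite ler_pdivlMr; last by rewrite ltr_wpDr // ltW.
by clear -dE dA de; nra.
Qed.

Lemma scaled_sub (X Y Z r t S : R) :
  - ((r - 1) * t * S) <= X - (Y - Z) -> X <= t * S -> Y - Z <= r * t * S.
Proof. by rewrite !mulrBl mul1r; lra. Qed.

Lemma scaled_add (X Y Z r t S : R) :
  X - (Y - Z) <= (1 - r) * t * S -> Y <= r * t * S -> 0 <= Z -> X <= t * S.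
Proof. by rewrite !mulrBl mul1r; lra. Qed.

Lemma rescaled_upper (A eps q T : R) : 0 <= T -> (A + eps / 4) * q <= A + eps / 2 ->
  (A + eps / 4) * q * T + (eps / 4 * T + eps / 4 * T) <= (A + eps) * T.
Proof. by move=> T0 /(ler_wpM2r T0); lra. Qed.

Lemma rescaled_lower (A eps q T x : R) : 0 <= T -> A - eps / 2 <= (A - eps / 4) / q ->
  (A - eps / 4) / q * T <= x + (eps / 4 * T + eps / 4 * T) -> (A - eps) * T <= x.
Proof. by move=> T0 /(ler_wpM2r T0); lra. Qed.

End error_terms.

(** * From the model to oscillating Hankel forms *)

Section oscillating_hankel.
Context {R : realType} (C : finType) (alpha : R) (chi : C -> nat -> R) (kap : C -> R) (B : R).
Hypothesis al0 : 0 < alpha.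
Hypothesis B0 : 0 <= B.
Hypothesis chiB : forall c c' n,
  `|\sum_(j < n) (chi c j * chi c' j - (c == c')%:R * kap c)| <= B.
Hypothesis kap01 : forall c, 0 <= kap c <= 1.
Hypothesis chi1 : forall c j, `|chi c j| <= 1.
Variables (beta : C -> R) (g : C -> nat -> R) (h : nat -> R) (j1 : nat).
Hypothesis g_small : forall c eps, 0 < eps -> exists J, forall j, (J <= j)%N ->
  `|g c j| <= eps * (j%:R^-1 * logpow alpha j).
Hypothesis g_smooth : forall c, exists J, forall j, (J <= j)%N ->
  `|iter (Mdiff alpha) telescope (g c) j| <= j%:R ^- (Mdiff alpha).+1 * logpow alpha j.
Hypothesis hE : forall j k, (j1 <= j)%N -> (j1 <= k)%N ->
  h (j + k)%N = \sum_c chi c j * chi c k * (beta c * model_kernel alpha (j + k) + g c (j + k)%N).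

(** Positive and negative parts of the coefficients: [gam] drives the positive eigenvalues, [gam']
    the negative ones, and no channel carries both. *)
Let gam c := Num.max (beta c) 0.
Let gam' c := Num.max (- beta c) 0.

Let gamE c : beta c = gam c - gam' c.
Proof.
rewrite /gam /gam'; have [b0|b0] := leP 0 (beta c); first by rewrite (max_r (_ : _ <= 0)) ?subr0 // oppr_le0.
by rewrite (max_l (_ : 0 <= - _)) ?oppr_ge0 ?(ltW b0) // sub0r opprK.
Qed.

Let gam_ge0 c : 0 <= gam c. Proof. by rewrite le_max lexx orbT. Qed.
Let gam'_ge0 c : 0 <= gam' c. Proof. by rewrite le_max lexx orbT. Qed.

Let gamM c : gam c * gam' c = 0.
Proof.
rewrite /gam /gam'; have [b0|b0] := leP 0 (beta c).
  by rewrite (max_r (_ : - beta c <= 0)) ?mulr0 // oppr_le0.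
by rewrite mul0r.
Qed.

Lemma hform_split d M N (u : nat -> R) : 0 < d -> (forall j, (j < j1)%N -> u j = 0) ->
  hform h N u = frame_energy alpha d chi gam M N u - frame_energy alpha d chi gam' M N u
    + \sum_c hform (fun i => beta c * (model_kernel alpha i - expo_model alpha d M i%:R) + g c i) N
               (fun j => chi c j * u j).
Proof.
move=> d0 u0; rewrite !frame_energy_expo // -sumrB -big_split /= /hform /qform.
transitivity (\sum_(j < N) \sum_(k < N) \sum_c chi c j * chi c k *
   (beta c * model_kernel alpha (j + k) + g c (j + k)%N) * (u j * u k)).
  apply: eq_bigr => j _; apply: eq_bigr => k _; rewrite -mulr_suml.
  have [jj|jj] := leqP j1 j; last by rewrite (u0 j jj) mul0r !mulr0.
  have [kk|kk] := leqP j1 k; last by rewrite (u0 k kk) !mulr0.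
  by rewrite hE.
transitivity (\sum_c \sum_(j < N) \sum_(k < N) chi c j * chi c k *
   (beta c * model_kernel alpha (j + k) + g c (j + k)%N) * (u j * u k)).
  by rewrite [RHS]exchange_big; apply: eq_bigr => j _; rewrite [RHS]exchange_big.
apply: eq_bigr => c _.
rewrite -mulrBl -gamE mulr_sumr -big_split /=; apply: eq_bigr => j _.
rewrite mulr_sumr -big_split /=; apply: eq_bigr => k _; ring.
Qed.

(** Each channel has its own thresholds; the finitely many are merged, with level and count divided
    by the number of channels plus 1. [M0] depends on [N], but [t0] and [j0] do not. *)
Lemma hform_errors (dl eta : R) : 0 < dl -> 0 < eta ->
  exists2 d0, 0 < d0 & forall d, 0 < d -> d <= d0 -> exists2 t0, 0 < t0 & exists j0, forall N, exists M0,
    forall t M, 0 < t -> t <= t0 -> (M0 <= M)%N ->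
    codim_le (eta * t `^ (- alpha^-1)) (fun u => (forall j, (j < j0)%N -> u j = 0) ->
      `|hform h N u - (frame_energy alpha d chi gam M N u - frame_energy alpha d chi gam' M N u)|
         <= dl * t * sqnorm N u).
Proof.
move=> dl0 eta0; pose n : R := #|C|%:R + 1; have n0 : 0 < n by rewrite ltr_wpDl.
have dln : 0 < dl / n by rewrite divr_gt0.
have etan : 0 < eta / n by rewrite divr_gt0.
have H1 c := model_error_form (beta c) al0 dln etan (chi1 c) (g_small c) (g_smooth c).
have {H1} [D HD] : exists D : C -> R, forall c, 0 < D c /\ forall d, 0 < d -> d <= D c ->
  exists2 t0, 0 < t0 & exists (j0 : nat) (cst : R), forall t N M, 0 < t -> t <= t0 -> cst * ln (N + N)%:R + 1 <= M%:R ->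
    codim_le (eta / n * t `^ (- alpha^-1)) (fun u => (forall j, (j < j0)%N -> u j = 0) ->
      `|hform (fun i => beta c * (model_kernel alpha i - expo_model alpha d M i%:R) + g c i) N (fun j => chi c j * u j)|
         <= dl / n * t * sqnorm N u).
  have : forall c, exists d0, 0 < d0 /\ forall d, 0 < d -> d <= d0 ->
  exists2 t0, 0 < t0 & exists (j0 : nat) (cst : R), forall t N M, 0 < t -> t <= t0 -> cst * ln (N + N)%:R + 1 <= M%:R ->
    codim_le (eta / n * t `^ (- alpha^-1)) (fun u => (forall j, (j < j0)%N -> u j = 0) ->
      `|hform (fun i => beta c * (model_kernel alpha i - expo_model alpha d M i%:R) + g c i) N (fun j => chi c j * u j)|
         <= dl / n * t * sqnorm N u).
    by move=> c; have [d0 d00 Hc] := H1 c; exists d0.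
  by case/choice => D HD; exists D.
have [d0 d00 Hd0] := fin_lower_bound (fun c => (HD c).1).
exists d0 => // d dp dd.
have {HD} [E HE] : exists E : C -> R * nat * R, forall c, 0 < (E c).1.1 /\
  forall t N M, 0 < t -> t <= (E c).1.1 -> (E c).2 * ln (N + N)%:R + 1 <= M%:R ->
    codim_le (eta / n * t `^ (- alpha^-1)) (fun u => (forall j, (j < (E c).1.2)%N -> u j = 0) ->
      `|hform (fun i => beta c * (model_kernel alpha i - expo_model alpha d M i%:R) + g c i) N (fun j => chi c j * u j)|
         <= dl / n * t * sqnorm N u).
  have : forall c, exists e : R * nat * R, 0 < e.1.1 /\
  forall t N M, 0 < t -> t <= e.1.1 -> e.2 * ln (N + N)%:R + 1 <= M%:R ->
    codim_le (eta / n * t `^ (- alpha^-1)) (fun u => (forall j, (j < e.1.2)%N -> u j = 0) ->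
      `|hform (fun i => beta c * (model_kernel alpha i - expo_model alpha d M i%:R) + g c i) N (fun j => chi c j * u j)|
         <= dl / n * t * sqnorm N u).
    by move=> c; have [t0 t00 [j0 [cst Hc]]] := (HD c).2 d dp (le_trans dd (Hd0 c)); exists (t0, j0, cst).
  by case/choice => E HE; exists E.
have [t0 t00 Ht0] := fin_lower_bound (fun c => (HE c).1).
exists t0 => //; pose F (c : C) := (E c).1.2; pose j0 := maxn j1 (\max_(c : C) F c)%N; exists j0 => N.
pose G (c : C) := (Num.truncn (`|(E c).2 * ln (N + N)%:R| + 1)).+1.
exists (\max_(c : C) G c)%N => t M tp tt MM.
have H c : codim_le (eta / n * t `^ (- alpha^-1)) (fun u => (forall j, (j < F c)%N -> u j = 0) ->
      `|hform (fun i => beta c * (model_kernel alpha i - expo_model alpha d M i%:R) + g c i) N (fun j => chi c j * u j)|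
         <= dl / n * t * sqnorm N u).
  apply: (HE c).2 => //; first exact: le_trans tt (Ht0 c).
  apply: (@le_trans _ _ (`|(E c).2 * ln (N + N)%:R| + 1)); first by rewrite lerD2r ler_norm.
  apply: le_trans (ltW (truncnS_gt _)) _; rewrite ler_nat (leq_trans _ MM) //.
  exact: (leq_bigmax (F := G)).
have Cn : #|C|%:R <= n by rewrite lerDl.
apply: codim_leW (codim_le_fin H).
  rewrite sumr_const -mulr_natr mulrAC; apply: ler_wpM2r; first exact: powR_ge0.
  by rewrite mulrAC ler_pdivrMr // ler_wpM2l // ltW.
move=> u Hu u0; have u0' : forall j, (j < j1)%N -> u j = 0.
  by move=> j jj; apply: u0; rewrite (leq_trans jj) // leq_maxl.
rewrite (hform_split M N dp u0') addrAC subrr add0r.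
apply: (le_trans (ler_norm_sum _ _ _)).
apply: (@le_trans _ _ (\sum_(c : C) dl / n * t * sqnorm N u)).
  apply: ler_sum => c _; apply: Hu => j jj; apply: u0; rewrite (leq_trans jj) //.
  by rewrite leq_max (leq_bigmax (F := F)) orbT.
have S0 : 0 <= sqnorm N u by apply: sumr_ge0 => j _; rewrite sqr_ge0.
rewrite sumr_const -mulr_natr mulrAC; apply: ler_wpM2r => //.
rewrite mulrAC; apply: ler_wpM2r; first exact: ltW.
by rewrite mulrAC ler_pdivrMr // ler_wpM2l // ltW.
Qed.

Let p := alpha^-1.
Let A : R := sech_pow_integral (p / 2) / pi * (\sum_c (gam c * kap c) `^ p).

Let A_ge0 : 0 <= A.
Proof.
rewrite mulr_ge0 ?divr_ge0 ?sech_pow_integral_ge0 ?pi_ge0 //.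
by apply: sumr_ge0 => c _; exact: powR_ge0.
Qed.

Let p_gt0 : 0 < p. Proof. by rewrite invr_gt0. Qed.

(** The negative channels enter with a minus sign and are dropped. *)
Theorem hform_upper (eps : R) : 0 < eps -> exists2 t0, 0 < t0 & forall t N, 0 < t -> t <= t0 ->
  codim_le ((A + eps) * t `^ (- p)) (fun u => hform h N u <= t * sqnorm N u).
Proof.
move=> e0; have e4 : 0 < eps / 4 by rewrite divr_gt0.
have [q [q1 Hq _]] := rescaling_factor A_ge0 e0; have q0 : 0 < q := lt_trans ltr01 q1.
pose r := q `^ (- alpha); have r0 : 0 < r by rewrite powR_gt0.
have r1 : r < 1 by rewrite /r powRN invf_lt1 ?powR_gt0 // -(one_powR alpha) gt0_ltr_powR // nnegrE ltW.
have rE : r `^ (- p) = q by rewrite /r -powRrM mulrNN mulfV ?gt_eqF // powRr1 // ltW.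
have dl0 : 0 < 1 - r by rewrite subr_gt0.
have [d1 /andP[d10 _] H1] := model_upper al0 B0 chiB kap01 gam_ge0 e4.
have [d2 d20 H2] := hform_errors dl0 e4.
pose d := Num.min d1 d2; have d0 : 0 < d by rewrite lt_min d10.
have [t1 t10 {}H1] := H1 d d0 (ltac:(by rewrite ge_min lexx)).
have [t2 t20 [j0 {}H2]] := H2 d d0 (ltac:(by rewrite ge_min lexx orbT)).
have [t3 t30 H3] := powRN_eventually_ge (j0%:R / (eps / 4)) p_gt0.
exists (Num.min t1 (Num.min t2 t3)); first by rewrite !lt_min t10 t20.
move=> t N tp; rewrite !le_min => /andP[tt1 /andP[tt2 tt3]].
have [M {}H2] := H2 N.
have rt0 : 0 < r * t by rewrite mulr_gt0.
have rt1 : r * t <= t1 by apply: le_trans tt1; rewrite ger_pMl // ltW.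
have K1 := H1 (r * t) M N rt0 rt1.
have K2 := H2 t M tp tt2 (leqnn _).
have K3 : codim_le (eps / 4 * t `^ (- p)) (fun u : nat -> R => forall j, (j < j0)%N -> u j = 0).
  by apply: codim_le_initial; rewrite mulrC -ler_pdivrMr //; exact: H3.
apply: codim_leW (codim_leI K1 (codim_leI K2 K3)).
  rewrite powRM ?(ltW r0) ?(ltW tp) // rE mulrA.
  exact: rescaled_upper (powR_ge0 _ _) Hq.
move=> u [h1 [h2 h3]]; have := h2 h3; rewrite ler_norml => /andP[_ h4].
apply: scaled_add h4 h1 _.
by apply: sumr_ge0 => c _; apply: sumr_ge0 => m _; exact: sqr_ge0.
Qed.

(** Here the negative channels stay; [model_lower] shows that they do not reduce the count. The
    section [N] comes from the model, and [M] is then chosen large for that [N]. *)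
Theorem hform_lower (eps : R) : 0 < eps -> exists2 t0, 0 < t0 & forall t x, 0 < t -> t <= t0 ->
  (forall N, codim_le x (fun u => hform h N u <= t * sqnorm N u)) -> (A - eps) * t `^ (- p) <= x.
Proof.
move=> e0; have e4 : 0 < eps / 4 by rewrite divr_gt0.
have [q [q1 _ Hq]] := rescaling_factor A_ge0 e0; have q0 : 0 < q := lt_trans ltr01 q1.
pose r := q `^ alpha; have r0 : 0 < r by rewrite powR_gt0.
have r1 : 1 < r by rewrite /r -(one_powR alpha) gt0_ltr_powR // nnegrE ltW.
have rE : r `^ (- p) = q^-1 by rewrite /r -powRrM mulrN mulfV ?gt_eqF // powR_inv1 // ltW.
have dl0 : 0 < r - 1 by rewrite subr_gt0.
have [d1 /andP[d10 _] H1] := model_lower al0 B0 chiB kap01 gam_ge0 gam'_ge0 gamM e4.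
have [d2 d20 H2] := hform_errors dl0 e4.
pose d := Num.min d1 d2; have d0 : 0 < d by rewrite lt_min d10.
have [t1 t10 {}H1] := H1 d d0 (ltac:(by rewrite ge_min lexx)).
have [t2 t20 [j0 {}H2]] := H2 d d0 (ltac:(by rewrite ge_min lexx orbT)).
have [t3 t30 H3] := powRN_eventually_ge (j0%:R / (eps / 4)) p_gt0.
exists (Num.min (t1 / r) (Num.min t2 t3)); first by rewrite !lt_min t20 t30 divr_gt0.
move=> t x tp; rewrite !le_min => /andP[tt1 /andP[tt2 tt3]] Hx.
have rt0 : 0 < r * t by rewrite mulr_gt0.
have rt1 : r * t <= t1 by rewrite mulrC -ler_pdivlMr.
have [M1 [N {}H1]] := H1 (r * t) rt0 rt1.
have [M2 {}H2] := H2 N; pose M := maxn M1 M2.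
have K2 := H2 t M tp tt2 (leq_maxr _ _).
have K3 : codim_le (eps / 4 * t `^ (- p)) (fun u : nat -> R => forall j, (j < j0)%N -> u j = 0).
  by apply: codim_le_initial; rewrite mulrC -ler_pdivrMr //; exact: H3.
have K := codim_leI (Hx N) (codim_leI K2 K3).
have {K} : codim_le (x + (eps / 4 * t `^ (- p) + eps / 4 * t `^ (- p)))
    (fun u => frame_energy alpha d chi gam M N u - frame_energy alpha d chi gam' M N u
       <= r * t * sqnorm N u).
  apply: codim_leW K => // u [h1 [h2 h3]]; have := h2 h3; rewrite ler_norml => /andP[h4 _].
  exact: scaled_sub h4 h1.
move/(H1 M N _ (leq_maxl _ _) (leqnn _)).
rewrite powRM ?(ltW r0) ?(ltW tp) // rE mulrA.
exact: rescaled_lower (powR_ge0 _ _) Hq.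
Qed.

End oscillating_hankel.

Section error_sequences.
Context {R : realType}.
Implicit Types (alpha a : R) (g : nat -> R).

Lemma error_seq_eventually alpha g m (eps : R) : error_seq alpha g -> (m <= Mdiff alpha)%N -> 0 < eps ->
  exists J, forall j, (J <= j)%N -> `|iter m telescope g j| <= eps * (j%:R ^- m.+1 * logpow alpha j).
Proof.
move=> H mM e0; have /eqoP/(_ _ e0)[J _ HJ] := H m mM.
exists J => j Jj; have := HJ j Jj; rewrite [X in _ <= _ * X -> _]ger0_norm //.
by rewrite mulr_ge0 ?powR_ge0 // invr_ge0 exprn_ge0.
Qed.

Lemma error_seq_scale alpha a g m (eps : R) : error_seq alpha g -> (m <= Mdiff alpha)%N -> 0 < eps ->
  exists J, forall j, (J <= j)%N ->
    `|iter m telescope (fun i => a * g i) j| <= eps * (j%:R ^- m.+1 * logpow alpha j).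
Proof.
move=> H mM e0; have a0 : 0 < `|a| + 1 by rewrite ltr_wpDl.
have e'0 : 0 < eps / (`|a| + 1) by rewrite divr_gt0.
have [J HJ] := error_seq_eventually H mM e'0; exists J => j Jj.
have -> : iter m telescope (fun i => a * g i) j = a * iter m telescope g j.
  by elim: m j {H mM HJ Jj} => [//|m IH] j; rewrite !iterS !telescopeE !IH mulrBr.
have := HJ j Jj; set X := j%:R ^- _ * _ => HX.
rewrite normrM; apply: (@le_trans _ _ ((`|a| + 1) * (eps / (`|a| + 1) * X))).
  by apply: ler_pM => //; rewrite lerDl.
by rewrite mulrA [_ * (eps / _)]mulrC divfK // gt_eqF.
Qed.

End error_sequences.

(** * Orthogonality in the mean of the oscillating factors *)

Section trigonometric_frame.
Context {R : realType} (L : nat) (phi psi : 'I_L -> R).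
Hypothesis hphi : forall l, 0 < phi l < pi.
Hypothesis phi_inj : injective phi.

(* [oscillation] enumerates 1, (-1)^j, cos(phi_l j - psi_l / 2) and sin(phi_l j - psi_l / 2):
   by the addition formula 2 cos(phi (j + k) - psi) splits over the last two with opposite signs,
   whence |b_l| in both [a^+] and [a^-]. *)
Definition frame_index : finType := (bool + 'I_L * bool)%type.

Definition frequency (c : frame_index) : R :=
  match c with inl s => if s then 0 else pi | inr (l, _) => phi l end.

Definition phase (c : frame_index) : R :=
  match c with inl _ => 0 | inr (l, s) => - (psi l / 2) - (if s then pi / 2 else 0) end.

Definition oscillation (c : frame_index) (j : nat) : R := cos (frequency c * j%:R + phase c).

Definition mean_square (c : frame_index) : R := if c is inl _ then 1 else 1 / 2.

Lemma big_frame_index (F : frame_index -> R) :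
  \sum_c F c = F (inl true) + F (inl false) + \sum_l (F (inr (l, true)) + F (inr (l, false))).
Proof.
transitivity (\sum_(s : bool) F (inl s) + \sum_(ls : 'I_L * bool) F (inr ls)); first exact: big_sumType.
rewrite big_bool; congr (_ + _).
transitivity (\sum_l \sum_s F (inr (l, s))); last by apply: eq_bigr => l _; rewrite big_bool.
by rewrite pair_bigA; apply: eq_bigr => -[].
Qed.

Lemma oscillation_le1 c j : `|oscillation c j| <= 1.
Proof. exact: cos_max. Qed.

Lemma mean_square_bounds c : 0 <= mean_square c <= 1.
Proof. by case: c => [s|ls] /=; lra. Qed.

Lemma cosM (x y : R) : cos x * cos y = (cos (x - y) + cos (x + y)) / 2.
Proof. by rewrite cosB cosD; field. Qed.

Lemma cos_pi_nat j : cos (pi * j%:R) = (-1) ^+ j :> R.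
Proof.
elim: j => [|j IH]; first by rewrite mulr0 cos0 expr0.
by rewrite -natr1 mulrDr mulr1 cosDpi IH exprS mulN1r.
Qed.

Lemma sum_cos_bounded (th : R) : 0 < `|th| < 2 * pi -> exists2 B, 0 <= B &
  forall a n, `|\sum_(j < n) cos (th * j%:R + a)| <= B.
Proof.
move=> /andP[th0 th2].
have s0 : 0 < `|sin (th / 2)|.
  wlog tp : th th0 th2 / 0 < th => [H|].
    have [tp|tn|t0] := ltrgtP 0 th; first exact: H.
      have := H (- th); rewrite normrN => /(_ th0 th2); rewrite oppr_gt0 => /(_ tn).
      by rewrite mulNr sinN normrN.
    by move: th0; rewrite -t0 normr0 ltxx.
  by rewrite gtr0_norm; apply: sin_gt0_pi; move: th2; rewrite gtr0_norm // => th2; lra.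
exists (1 / `|sin (th / 2)|) => [|a n]; first by rewrite divr_ge0.
have := sum_cos_telescope n th a; set S := \sum_(_ < _) _ => E.
rewrite ler_pdivlMr // mulrC -normrM.
have : `|2 * (sin (th / 2) * S)| <= 2.
  rewrite mulrA E (le_trans (ler_normB _ _)) //.
  by have := sin_max (th * n%:R - th / 2 + a); have := sin_max (a - th / 2); lra.
by rewrite (normrM 2) (_ : `|2| = 2 :> R); [lra|exact: ger0_norm].
Qed.

Lemma frequency_sum_diff c c' : 0 < `|frequency c - frequency c'| < 2 * pi ->
  0 < `|frequency c + frequency c'| < 2 * pi -> c != c' ->
  exists2 B, 0 <= B & forall n, `|\sum_(j < n) (oscillation c j * oscillation c' j
      - (c == c')%:R * mean_square c)| <= B.
Proof.
move=> h1 h2 cc; have [B1 B10 H1] := sum_cos_bounded h1; have [B2 B20 H2] := sum_cos_bounded h2.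
exists ((B1 + B2) / 2) => [|n]; first by rewrite divr_ge0 ?addr_ge0.
rewrite (negbTE cc).
have -> : \sum_(j < n) (oscillation c j * oscillation c' j - false%:R * mean_square c) =
  (\sum_(j < n) cos ((frequency c - frequency c') * j%:R + (phase c - phase c')) +
   \sum_(j < n) cos ((frequency c + frequency c') * j%:R + (phase c + phase c'))) / 2.
  rewrite -big_split /= mulr_suml; apply: eq_bigr => j _; rewrite mul0r subr0 cosM.
  by congr ((cos _ + cos _) / 2); ring.
rewrite normrM [ `|2^-1| ]ger0_norm ?invr_ge0 // ler_pM2r ?invr_gt0 //.
by apply: le_trans (ler_normD _ _) _; rewrite lerD.
Qed.

(** Frequencies lie in [[0, pi]], so for distinct ones sum and difference are strictly between 0 and
    [2 pi] in absolute value, and both cosine sums are bounded. For the two factors of one frequency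
    in [(0, pi)] the difference is zero: the phase shift [pi / 2] makes the constant term vanish off
    the diagonal, and on the diagonal it is the mean square. *)
Lemma oscillation_orthogonal_pair c c' :
  exists2 B, 0 <= B & forall n, `|\sum_(j < n) (oscillation c j * oscillation c' j
      - (c == c')%:R * mean_square c)| <= B.
Proof.
have pi0 := pi_gt0 R.
case: c c' => [s|[l s]] [s'|[l' s']].
- have [<-|ss] := eqVneq s s'.
    exists 0 => // n; rewrite big1 ?normr0 // => j _; rewrite eqxx /oscillation /= addr0 mul1r.
    case: s; first by rewrite mul0r cos0 mulr1 subrr.
    by rewrite cos_pi_nat -expr2 sqrr_sign subrr.
  apply: frequency_sum_diff => /=; last by apply: contra_neq ss => -[].
    by case: s s' ss => -[] //= _; rewrite ?sub0r ?subr0 ?normrN gtr0_norm //; lra.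
  by case: s s' ss => -[] //= _; rewrite ?add0r ?addr0 gtr0_norm //; lra.
- have /andP[p1 p2] := hphi l'; apply: frequency_sum_diff => //=.
    by case: s; [rewrite sub0r normrN gtr0_norm //|rewrite gtr0_norm]; lra.
  by case: s; rewrite gtr0_norm; lra.
- have /andP[p1 p2] := hphi l; apply: frequency_sum_diff => //=.
    by case: s'; [rewrite subr0 gtr0_norm //|rewrite ltr0_norm]; lra.
  by case: s'; rewrite gtr0_norm; lra.
have /andP[p1 p2] := hphi l; have /andP[p3 p4] := hphi l'.
have [ll|ll] := eqVneq l l'; last first.
  apply: frequency_sum_diff => /=; last by apply: contra_neq ll => -[].
    rewrite normr_gt0 subr_eq0 (inj_eq phi_inj) ll /=.
    by rewrite ltr_norml; apply/andP; split; lra.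
  by rewrite gtr0_norm; lra.
rewrite -{}ll {l' p3 p4}.
have [B B0 HB] : exists2 B, 0 <= B & forall a n, `|\sum_(j < n) cos (phi l * 2 * j%:R + a)| <= B.
  by apply: sum_cos_bounded; rewrite gtr0_norm; lra.
exists (B / 2) => [|n]; first by rewrite divr_ge0.
have -> : \sum_(j < n) (oscillation (inr (l, s)) j * oscillation (inr (l, s')) j
      - (@inr bool _ (l, s) == inr (l, s'))%:R * mean_square (inr (l, s))) =
  (\sum_(j < n) cos (phi l * 2 * j%:R + (phase (inr (l, s)) + phase (inr (l, s'))))) / 2.
  rewrite mulr_suml; apply: eq_bigr => j _; rewrite cosM /=.
  have -> : (@inr bool _ (l, s) == inr (l, s')) = (s == s').
    by apply/eqP/eqP => [[]|->].
  have -> : cos (phi l * j%:R + (- (psi l / 2) - (if s then pi / 2 else 0)) -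
      (phi l * j%:R + (- (psi l / 2) - (if s' then pi / 2 else 0)))) = (s == s')%:R.
    case: s; case: s' => /=.
    - by rewrite subrr cos0.
    - by transitivity (cos (- (pi / 2)) : R); [congr cos; ring|rewrite cosN cos_pihalf].
    - by transitivity (cos (pi / 2) : R); [congr cos; ring|rewrite cos_pihalf].
    - by rewrite subrr cos0.
  rewrite mulrDl addrAC mul1r subrr add0r; congr (cos _ / 2); ring.
by rewrite normrM [ `|2^-1| ]ger0_norm ?invr_ge0 // ler_pM2r ?invr_gt0.
Qed.

Lemma oscillation_orthogonal : exists2 B, 0 <= B & forall c c' n,
  `|\sum_(j < n) (oscillation c j * oscillation c' j - (c == c')%:R * mean_square c)| <= B.
Proof.
have : forall cc : frame_index * frame_index, exists B, 0 <= B /\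
  forall n, `|\sum_(j < n) (oscillation cc.1 j * oscillation cc.2 j - (cc.1 == cc.2)%:R * mean_square cc.1)| <= B.
  by move=> [c c']; have [B B0 HB] := oscillation_orthogonal_pair c c'; exists B.
case/choice => B HB; exists (\sum_cc B cc); first by apply: sumr_ge0 => cc _; exact: (HB cc).1.
move=> c c' n; apply: le_trans ((HB (c, c')).2 n) _.
by rewrite (bigD1 (c, c')) //= lerDl; apply: sumr_ge0 => cc _; exact: (HB cc).1.
Qed.

End trigonometric_frame.

Section oscillating_counting.
Context {R : realType} (alpha : R) (L : nat) (phi psi : 'I_L -> R).
Hypothesis halpha : 0 < alpha.
Hypothesis hphi : forall l, 0 < phi l < pi.
Hypothesis phi_inj : injective phi.
Variables (b1 bm1 : R) (b : 'I_L -> R) (h g1 gm1 : nat -> R) (g : 'I_L -> nat -> R).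
Hypothesis hh : forall j : nat, (2 <= j)%N ->
    h j = b1 * j%:R^-1 * ln j%:R `^ (- alpha) + g1 j
        + (-1) ^+ j * (bm1 * j%:R^-1 * ln j%:R `^ (- alpha) + gm1 j)
        + 2 * \sum_(l < L) (b l * j%:R^-1 * ln j%:R `^ (- alpha) + g l j)
                           * cos (phi l * j%:R - psi l).
Hypothesis hg1 : error_seq alpha g1.
Hypothesis hgm1 : error_seq alpha gm1.
Hypothesis hg : forall l, error_seq alpha (g l).
Variable sg : R.
Hypothesis sgE : sg ^+ 2 = 1.

(** By [2 cos (x + y) = 2 cos x cos y - 2 sin x sin y], each [phi l] has two channels with opposite
    coefficients; their factor 2 is compensated by the mean square [1/2]. The sign [sg] lets one
    result serve both [h] and [-h]. *)
Let beta (c : frame_index L) : R :=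
  match c with inl s => sg * (if s then b1 else bm1) | inr (l, s) => sg * (-1) ^+ s * 2 * b l end.

Let err (c : frame_index L) : nat -> R :=
  match c with inl s => fun j => sg * (if s then g1 else gm1) j
             | inr (l, s) => fun j => sg * (-1) ^+ s * 2 * g l j end.

Let err_small c m (eps : R) : (m <= Mdiff alpha)%N -> 0 < eps ->
  exists J, forall j, (J <= j)%N -> `|iter m telescope (err c) j| <= eps * (j%:R ^- m.+1 * logpow alpha j).
Proof.
by move=> mM e0; case: c => [[]|[l s]]; apply: error_seq_scale.
Qed.

Let hE j k : (1 <= j)%N -> (1 <= k)%N ->
  sg * h (j + k)%N = \sum_c oscillation phi psi c j * oscillation phi psi c k *
     (beta c * model_kernel alpha (j + k) + err c (j + k)%N).
Proof.
move=> j1 k1; rewrite hh ?(@leq_add 1 1) //.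
rewrite big_frame_index /=.
have E1 x : oscillation phi psi (inl true) x = 1 by rewrite /oscillation /= mul0r addr0 cos0.
have E x : oscillation phi psi (inl false) x = (-1) ^+ x by rewrite /oscillation /= addr0 cos_pi_nat.
rewrite !E1 !E -exprD mul1r.
rewrite mulrDr; congr (_ + _).
  by rewrite /model_kernel /logpow; ring.
rewrite mulrA mulr_sumr; apply: eq_bigr => l _.
have E2 x : oscillation phi psi (inr (l, true)) x = sin (phi l * x%:R - psi l / 2).
  by rewrite /oscillation /= addrA cosBpihalf.
rewrite !E2.
rewrite /oscillation /= subr0.
have -> : phi l * (j + k)%:R - psi l = (phi l * j%:R - psi l / 2) + (phi l * k%:R - psi l / 2).
  by rewrite natrD; field.
rewrite cosD /model_kernel /logpow.
set cj := cos _; set ck := cos _; set sj := sin _; set sk := sin _.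
ring.
Qed.

Lemma oscillating_hankel_decay : exists (K : R) (J : nat), forall n, (J <= n)%N ->
  `|sg * h n| <= K * model_kernel alpha n.
Proof.
have [J HJ] : exists J : frame_index L -> nat, forall c j, (J c <= j)%N ->
    `|err c j| <= 1 * (j%:R ^- 1 * logpow alpha j).
  suff : forall c, exists J, forall j, (J <= j)%N -> `|err c j| <= 1 * (j%:R ^- 1 * logpow alpha j).
    by case/choice => J HJ; exists J.
  by move=> c; exact: (@err_small c 0%N).
exists (\sum_c (`|beta c| + 1)), (maxn 2 (\max_(c : frame_index L) J c)%N) => n.
rewrite geq_max => /andP[n2 nJ].
have -> : n = (1 + n.-1)%N by lia.
rewrite hE //; last by lia.
rewrite mulr_suml; apply: (le_trans (ler_norm_sum _ _ _)); apply: ler_sum => c _.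
rewrite !normrM; apply: (@le_trans _ _ `|beta c * model_kernel alpha (1 + n.-1) + err c (1 + n.-1)|).
  rewrite ler_piMl // -[leRHS]mulr1; apply: ler_pM => //; exact: oscillation_le1.
apply: (le_trans (ler_normD _ _)); rewrite normrM mulrDl; apply: lerD.
  rewrite [X in _ * X]ger0_norm // mulr_ge0 ?powR_ge0 // invr_ge0 //.
apply: HJ; have -> : (1 + n.-1)%N = n by lia.
by apply: leq_trans nJ; exact: (leq_bigmax (F := J)).
Qed.

Theorem oscillating_hankel_counting (eps : R) : 0 < eps ->
  let A := sech_pow_integral (alpha^-1 / 2) / pi * (pospart (sg * bm1) `^ alpha^-1
    + pospart (sg * b1) `^ alpha^-1 + \sum_(l < L) `|b l| `^ alpha^-1) in
  exists2 t0, 0 < t0 & forall t, 0 < t -> t <= t0 ->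
    (forall N, codim_le ((A + eps) * t `^ (- alpha^-1))
       (fun u => hform (fun j => sg * h j) N u <= t * sqnorm N u)) /\
    (forall x, (forall N, codim_le x (fun u => hform (fun j => sg * h j) N u <= t * sqnorm N u)) ->
       (A - eps) * t `^ (- alpha^-1) <= x).
Proof.
move=> e0 A; have [B B0 HB] := oscillation_orthogonal psi hphi phi_inj.
have small c e : 0 < e -> exists J, forall j, (J <= j)%N -> `|err c j| <= e * (j%:R^-1 * logpow alpha j).
  by move=> e0'; exact: (@err_small c 0%N).
have smooth c : exists J, forall j, (J <= j)%N ->
  `|iter (Mdiff alpha) telescope (err c) j| <= j%:R ^- (Mdiff alpha).+1 * logpow alpha j.
  by have [J HJ] := err_small c (leqnn _) (@ltr01 R); exists J => j /HJ; rewrite mul1r.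
have [t1 t10 H1] := hform_upper (h := fun j => sg * h j) halpha B0 HB (mean_square_bounds (L := L)) (oscillation_le1 phi psi)
  small smooth hE e0.
have [t2 t20 H2] := hform_lower (h := fun j => sg * h j) halpha B0 HB (mean_square_bounds (L := L)) (oscillation_le1 phi psi)
  small smooth hE e0.
have EA : sech_pow_integral (alpha^-1 / 2) / pi *
  (\sum_c (Num.max (beta c) 0 * mean_square c) `^ alpha^-1) = A.
  have mp (x : R) : Num.max x 0 = pospart x.
    rewrite /pospart; have [x0|x0] := leP 0 x; first by rewrite ger0_norm //; field.
    by rewrite ltr0_norm // addNr mul0r.
  have p0 : alpha^-1 != 0 by rewrite invr_eq0 gt_eqF.
  rewrite big_frame_index /= !mulr1 !mp; congr (_ * _); rewrite [X in X + _ = _]addrC; congr (_ + _).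
  apply: eq_bigr => l _; rewrite expr1 mulrN1 !mp.
  have dbl (x : R) : pospart (x * 2 * b l) * (1 / 2) = pospart (x * b l).
    by rewrite /pospart (mulrAC x) (normrM _ 2) (_ : `|2| = 2 :> R); [field|exact: ger0_norm].
  rewrite !dbl mulNr.
  have sl : `|sg * b l| = `|b l|.
    have : `|sg| = 1 by apply/eqP; rewrite -sqrp_eq1 // real_normK ?num_real // sgE.
    by rewrite normrM => ->; rewrite mul1r.
  rewrite -sl /pospart normrN; move: (sg * b l) => x.
  (* Of the two channels at most one has a positive coefficient, and after weighting it is the
     absolute value of [b l]. *)
  have [x0|x0] := leP 0 x.
    rewrite ger0_norm // subrr mul0r powR0 // add0r; congr (_ `^ _); by field.
  rewrite ltr0_norm // addNr mul0r powR0 // addr0; congr (_ `^ _); by field.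
exists (Num.min t1 t2); first by rewrite lt_min t10.
move=> t t0; rewrite le_min => /andP[tt1 tt2]; split=> [N|x Hx].
  by have := H1 t N t0 tt1; rewrite EA.
by have := H2 t x t0 tt2 Hx; rewrite EA.
Qed.

End oscillating_counting.

(** * Hankel operators in real l^2 *)

Section real_l2.
Context {R : realType}.
Implicit Types (x y z : nat -> R) (a b : R).

Definition sqsummable x : Prop := exists C, forall N, sqnorm N x <= C.

Definition rdotN x y (N : nat) : R := \sum_(k < N) x k * y k.

Definition rdot x y : R := limn (rdotN x y).

Lemma rdotNxx x N : rdotN x x N = sqnorm N x.
Proof. by apply: eq_bigr => k _; rewrite expr2. Qed.

Lemma sqnorm_nondecreasing x : nondecreasing_seq (sqnorm^~ x).
Proof.
move=> m n mn; rewrite /sqnorm -(subnKC mn) big_split_ord /= lerDl.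
by apply: sumr_ge0 => k _; exact: sqr_ge0.
Qed.

Lemma sqsummableD x y : sqsummable x -> sqsummable y -> sqsummable (fun k => x k + y k).
Proof.
move=> [C HC] [D HD]; exists (2 * C + 2 * D) => N.
apply: (@le_trans _ _ (2 * sqnorm N x + 2 * sqnorm N y)).
  rewrite /sqnorm !mulr_sumr -big_split; apply: ler_sum => k _.
  by have := sqr_ge0 (x k - y k); rewrite /=; nra.
by have := HC N; have := HD N; lra.
Qed.

Lemma sqsummableZ a x : sqsummable x -> sqsummable (fun k => a * x k).
Proof.
move=> [C HC]; exists (a ^+ 2 * C) => N.
rewrite /sqnorm (eq_bigr (fun k : 'I_N => a ^+ 2 * x k ^+ 2)); last by move=> k _; rewrite exprMn.
by rewrite -mulr_sumr; apply: ler_wpM2l; [exact: sqr_ge0|exact: HC].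
Qed.

Lemma sqsummable_lin a x y : sqsummable x -> sqsummable y -> sqsummable (fun k => a * x k + y k).
Proof. by move=> hx hy; exact: sqsummableD (sqsummableZ a hx) hy. Qed.

Lemma sqsummable_finite x N : (forall k, (N <= k)%N -> x k = 0) -> sqsummable x.
Proof.
move=> H; exists (sqnorm N x) => M; have [MN|NM] := leqP M N; first exact: sqnorm_nondecreasing.
rewrite /sqnorm -(subnKC (ltnW NM)) big_split_ord /= gerDl big1 // => k _.
by rewrite H ?expr0n //= leq_addr.
Qed.

Lemma sqsummable0 : sqsummable (fun=> 0).
Proof. exact: (@sqsummable_finite _ 0%N). Qed.

Lemma sqsummable_sum (d : nat) (c : 'I_d -> R) (e : 'I_d -> nat -> R) :
  (forall i, sqsummable (e i)) -> sqsummable (fun k => \sum_(i < d) c i * e i k).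
Proof.
elim: d c e => [|d IH] c e H.
  by apply: (@sqsummable_finite _ 0%N) => k _; rewrite big_ord0.
have -> : (fun k => \sum_(i < d.+1) c i * e i k) =
   (fun k => c ord_max * e ord_max k + \sum_(i < d) c (widen_ord (leqnSn d) i) * e (widen_ord (leqnSn d) i) k).
  by apply/funext => k; rewrite big_ord_recr addrC.
by apply: sqsummable_lin => //; exact: IH.
Qed.

Lemma is_cvg_sqnorm x : sqsummable x -> cvgn (sqnorm^~ x).
Proof.
move=> [C HC]; apply: nondecreasing_is_cvgn; first exact: sqnorm_nondecreasing.
by exists C => _ [N _ <-].
Qed.

Lemma is_cvg_rdot x y : sqsummable x -> sqsummable y -> cvgn (rdotN x y).
Proof.
move=> hx hy.
have -> : rdotN x y = (fun N => (sqnorm N (fun k => x k + y k) - sqnorm N x - sqnorm N y) * 2^-1).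
  apply/funext => N; rewrite /sqnorm -!sumrB mulr_suml; apply: eq_bigr => k _; by field.
apply: is_cvgM; last exact: is_cvg_cst.
by do 2?apply: is_cvgB; apply: is_cvg_sqnorm => //; exact: sqsummableD.
Qed.

Lemma rdot_cvg x y : sqsummable x -> sqsummable y -> rdotN x y @ \oo --> rdot x y.
Proof. exact: is_cvg_rdot. Qed.

Lemma rdotC x y : rdot x y = rdot y x.
Proof. by congr (limn _); apply/funext => N; apply: eq_bigr => k _; rewrite mulrC. Qed.

Lemma rdot_linl a x y z : sqsummable x -> sqsummable y -> sqsummable z ->
  rdot (fun k => a * x k + y k) z = a * rdot x z + rdot y z.
Proof.
move=> hx hy hz; apply: cvg_lim => //.
have -> : rdotN (fun k => a * x k + y k) z = (fun N => a * rdotN x z N + rdotN y z N).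
  by apply/funext => N; rewrite mulr_sumr -big_split; apply: eq_bigr => k _; rewrite /= mulrDl mulrA.
by apply: cvgD; [apply: cvgMr; exact: rdot_cvg|exact: rdot_cvg].
Qed.

Lemma rdot_linr a x y z : sqsummable x -> sqsummable y -> sqsummable z ->
  rdot z (fun k => a * x k + y k) = a * rdot z x + rdot z y.
Proof. by move=> hx hy hz; rewrite ![rdot z _]rdotC rdot_linl. Qed.

Lemma rdotZl a x z : sqsummable x -> sqsummable z -> rdot (fun k => a * x k) z = a * rdot x z.
Proof.
move=> hx hz; apply: cvg_lim => //.
have -> : rdotN (fun k => a * x k) z = (fun N => a * rdotN x z N).
  by apply/funext => N; rewrite mulr_sumr; apply: eq_bigr => k _; rewrite mulrA.
by apply: cvgMr; exact: rdot_cvg.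
Qed.

Lemma rdot0l x : rdot (fun=> 0) x = 0.
Proof.
rewrite /rdot (_ : rdotN _ _ = fun=> 0) ?lim_cst //.
by apply/funext => N; rewrite /rdotN big1 // => k _; rewrite mul0r.
Qed.

Lemma rdot_suml (d : nat) (c : 'I_d -> R) (e : 'I_d -> nat -> R) y :
  (forall i, sqsummable (e i)) -> sqsummable y ->
  rdot (fun k => \sum_(i < d) c i * e i k) y = \sum_(i < d) c i * rdot (e i) y.
Proof.
move=> He hy; elim: d c e He => [|d IH] c e He.
  rewrite big_ord0 -[RHS](rdot0l y); congr (rdot _ _); apply/funext => k; exact: big_ord0.
rewrite big_ord_recr /= addrC -IH // -rdot_linl //; last exact: sqsummable_sum.
by congr (rdot _ _); apply/funext => k; rewrite big_ord_recr addrC.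
Qed.

Lemma rdotB x y z : sqsummable x -> sqsummable y -> sqsummable z ->
  rdot (fun k => x k - y k) z = rdot x z - rdot y z.
Proof.
move=> hx hy hz; have -> : (fun k => x k - y k) = (fun k => -1 * y k + x k).
  by apply/funext => k; rewrite mulN1r addrC.
by rewrite rdot_linl // mulN1r addrC.
Qed.

Lemma sqsummableB x y : sqsummable x -> sqsummable y -> sqsummable (fun k => x k - y k).
Proof.
move=> hx hy; have -> : (fun k => x k - y k) = (fun k => -1 * y k + x k).
  by apply/funext => k; rewrite mulN1r addrC.
exact: sqsummable_lin.
Qed.

Lemma sqnorm_le_rdot x N : sqsummable x -> sqnorm N x <= rdot x x.
Proof.
move=> hx; have -> : rdot x x = limn (sqnorm^~ x) by congr (limn _); apply/funext => n; exact: rdotNxx.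
by apply: nondecreasing_cvgn_le; [exact: sqnorm_nondecreasing|exact: is_cvg_sqnorm].
Qed.

Lemma rdot_ge0 x : sqsummable x -> 0 <= rdot x x.
Proof. by move=> hx; apply: le_trans (sqnorm_le_rdot 0 hx); rewrite sqnorm_ge0. Qed.

Lemma sqnorm_bound x C : (forall N, sqnorm N x <= C) -> sqsummable x /\ rdot x x <= C.
Proof.
move=> H; have hx : sqsummable x by exists C.
split=> //; apply: limr_le; first exact: is_cvg_rdot.
by apply: nearW => N; rewrite rdotNxx.
Qed.

Lemma sqr_le_rdot x k : sqsummable x -> x k ^+ 2 <= rdot x x.
Proof.
move=> hx; apply: le_trans (sqnorm_le_rdot k.+1 hx).
by rewrite /sqnorm big_ord_recr /= lerDr sqnorm_ge0.
Qed.

Lemma rdot_eq0 x : sqsummable x -> rdot x x = 0 -> x = (fun=> 0).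
Proof.
move=> hx x0; apply/funext => k; have := sqr_le_rdot k hx; rewrite x0 => H.
by apply/eqP; rewrite -sqrf_eq0 eq_le H sqr_ge0.
Qed.

Lemma rdot_cauchy x y : sqsummable x -> sqsummable y ->
  rdot x y ^+ 2 <= rdot x x * rdot y y.
Proof.
move=> hx hy; have Y0 := rdot_ge0 hy.
have [y0|yn0] := eqVneq (rdot y y) 0.
  by rewrite (rdot_eq0 hy y0) rdotC !rdot0l mulr0 expr0n.
have Yp : 0 < rdot y y by rewrite lt_neqAle eq_sym yn0.
have hx' := sqsummableZ (rdot y y) hx.
have hw : sqsummable (fun k => - rdot x y * y k + (fun i => rdot y y * x i) k) by exact: sqsummable_lin.
have := rdot_ge0 hw.
have e1 : rdot (fun i => rdot y y * x i) y = rdot y y * rdot x y by exact: rdotZl.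
have e2 : rdot y (fun i => rdot y y * x i) = rdot y y * rdot x y by rewrite rdotC.
have e3 : rdot (fun i => rdot y y * x i) (fun i => rdot y y * x i) = rdot y y * (rdot y y * rdot x x).
  by rewrite rdotZl // rdotC rdotZl.
rewrite rdot_linl // !rdot_linr // e1 e2 e3.
set X := rdot x x; set Y := rdot y y; set Z := rdot x y => H.
have : 0 <= Y * (X * Y - Z ^+ 2) by move: H; rewrite expr2; lra.
by rewrite pmulr_rge0 // subr_ge0.
Qed.

Lemma rdot_finite x y N : (forall k, (N <= k)%N -> x k = 0) -> rdot x y = rdotN x y N.
Proof.
move=> H; apply: cvg_lim => //; apply: cvg_near_cst; exists N => // M /= NM.
rewrite /rdotN -(subnKC NM) big_split_ord /= [X in _ + X]big1 ?addr0 // => k _.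
by rewrite H ?mul0r // leq_addr.
Qed.

Lemma rdot_sqD x y : sqsummable x -> sqsummable y ->
  rdot (fun k => x k + y k) (fun k => x k + y k) <= 2 * rdot x x + 2 * rdot y y.
Proof.
move=> hx hy; apply: (sqnorm_bound _).2 => N.
apply: (@le_trans _ _ (2 * sqnorm N x + 2 * sqnorm N y)).
  rewrite /sqnorm !mulr_sumr -big_split; apply: ler_sum => k _.
  by have := sqr_ge0 (x k - y k); rewrite /=; nra.
by rewrite lerD // ler_wpM2l // sqnorm_le_rdot.
Qed.

Definition truncate (N : nat) x : nat -> R := fun k => if (k < N)%N then x k else 0.

Lemma truncate_sqsummable N x : sqsummable (truncate N x).
Proof. by apply: (@sqsummable_finite _ N) => k; rewrite /truncate leqNgt => /negbTE ->. Qed.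

Lemma rdot_truncate N x y : rdot (truncate N x) y = rdotN x y N.
Proof.
rewrite (@rdot_finite _ _ N); last by move=> k; rewrite /truncate leqNgt => /negbTE ->.
by apply: eq_bigr => k _; rewrite /truncate ltn_ord.
Qed.

Lemma truncate_error x : sqsummable x ->
  (fun N => rdot (fun k => x k - truncate N x k) (fun k => x k - truncate N x k)) @ \oo --> (0 : R).
Proof.
move=> hx; have hT N := truncate_sqsummable N x.
have -> : (fun N => rdot (fun k => x k - truncate N x k) (fun k => x k - truncate N x k)) =
    (fun N => rdot x x - rdotN x x N).
  apply/funext => N; have hB := sqsummableB hx (hT N).
  rewrite rdotB // (rdotC x) (rdotC (truncate N x)) !rdotB // (rdotC x) !rdot_truncate.
  have -> : rdotN x (truncate N x) N = rdotN x x N.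
    by apply: eq_bigr => k _; rewrite /truncate ltn_ord.
  by rewrite subrr subr0.
by rewrite -[X in _ --> X](subrr (rdot x x)); apply: cvgB; [exact: cvg_cst|exact: rdot_cvg].
Qed.

End real_l2.

(** * Pointwise convergent subsequences *)

Section pointwise_compactness.
Context {R : realType}.

Lemma cvg_ordsum (M : nat) (f : 'I_M -> nat -> R) (l : 'I_M -> R) :
  (forall i, f i @ \oo --> l i) -> (fun n => \sum_(i < M) f i n) @ \oo --> \sum_(i < M) l i.
Proof.
elim: M f l => [|M IH] f l H.
  rewrite big_ord0 (_ : (fun n => _) = fun=> 0); first exact: cvg_cst.
  by apply/funext => n; rewrite big_ord0.
rewrite big_ord_recr /= (_ : (fun n => _) =
  (fun n => \sum_(i < M) f (widen_ord (leqnSn M) i) n + f ord_max n)).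
  by apply: cvgD => //; apply: IH.
by apply/funext => n; rewrite big_ord_recr.
Qed.

(** Tychonoff's theorem gives a cluster point in a product of segments; a neighbourhood of it is
    needed only on finitely many coordinates. *)
Lemma pointwise_cluster (x : nat -> nat -> R) (C : R) : (forall n k, `|x n k| <= C) ->
  exists y : nat -> R, forall m n, exists2 p, (n <= p)%N &
    forall k, (k < m)%N -> `|y k - x p k| < m.+1%:R^-1.
Proof.
move=> H.
have K : @compact (prod_topology (fun _ : nat => R)) [set f | forall i, `[-C, C]%classic (f i)].
  exact: (@tychonoff nat (fun=> R) (fun=> `[-C, C]%classic) (fun=> @segment_compact R (- C) C)).
have [|y [_ clu]] := K ((x : nat -> prod_topology (fun _ : nat => R)) @ \oo) _.
  by exists 0%N => // n _ i /=; rewrite in_itv /= -ler_norml.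
exists y => m n.
have nb : nbhs (y : prod_topology (fun _ : nat => R))
   [set f | forall k, (k < m)%N -> `|y k - f k| < m.+1%:R^-1].
  have e0 : 0 < m.+1%:R^-1 :> R by rewrite invr_gt0.
  elim: m (m.+1%:R^-1 : R) e0 {K clu} => [|m IH] e e0.
    exact: (@filterS _ _ (nbhs_filter (y : prod_topology (fun _ : nat => R))) setT _ _ filterT).
  have h1 := IH _ e0.
  have := @proj_continuous _ (fun _ : nat => R) m (y : prod_topology (fun _ : nat => R)) (ball (y m) e).
  move=> /(_ (nbhsx_ballx _ _ e0)) h2.
  have FF := nbhs_filter (y : prod_topology (fun _ : nat => R)).
  apply: (@filterS _ _ FF _ _ _ (@filterI _ _ FF _ _ h1 h2)) => f /= [f1 f2] k; rewrite ltnS leq_eqVlt => /orP[/eqP ->|]; last exact: f1.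
  by move: f2; rewrite /nbhs /= /ball /=.
have inn : (x @ \oo) [set f | exists2 p, (n <= p)%N & f = x p].
  by exists n => // p /= np; exists p.
have [f [[p np ->] Hp]] := clu _ _ inn nb.
by exists p.
Qed.

(** With countably many coordinates a cluster point is the limit of a subsequence: each index is
    taken past the previous one and close to [y] on an increasing number of coordinates. *)
Lemma pointwise_subsequence (x : nat -> nat -> R) (C : R) : (forall n k, `|x n k| <= C) ->
  exists (s : nat -> nat) (y : nat -> R), {homo s : m n / (m < n)%N} /\
    forall k, (fun n => x (s n) k) @ \oo --> y k.
Proof.
move=> /pointwise_cluster [y Hy].
have [P HP] : exists P : nat * nat -> nat, forall mn, (mn.2 <= P mn)%N /\
    forall k, (k < mn.1)%N -> `|y k - x (P mn) k| < mn.1.+1%:R^-1.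
  have : forall mn : nat * nat, exists p, (mn.2 <= p)%N /\
    forall k, (k < mn.1)%N -> `|y k - x p k| < mn.1.+1%:R^-1.
    by move=> [m n]; have [p np Hp] := Hy m n; exists p.
  by case/choice => P HP; exists P.
pose s := fix s n := if n is n'.+1 then P (n, (s n').+1) else P (0, 0)%N.
have sS n : (s n < s n.+1)%N by exact: (HP (n.+1, (s n).+1)).1.
exists s, y; split; first by apply: homo_ltn => //; exact: ltn_trans.
move=> k; apply/cvgrPdist_lt => e e0.
have [N _ HN] := near_infty_natSinv_lt (PosNum e0).
exists (maxn N k.+1) => // n /=; rewrite geq_max => /andP[Nn kn].
apply: lt_trans (HN n Nn).
by case: n kn {Nn HN} => [//|n] kn; exact: (HP (n.+1, (s n).+1)).2.
Qed.

End pointwise_compactness.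

Section strong_limits.
Context {R : realType}.
Implicit Types (x y : nat -> nat -> R) (a b : nat -> R).

Lemma cvg_sqr0 (s : nat -> R) : (fun n => s n ^+ 2) @ \oo --> (0 : R) -> s @ \oo --> (0 : R).
Proof.
move=> /cvgr0Pnorm_lt H; apply/cvgr0Pnorm_lt => e e0.
have := H (e ^+ 2) (exprn_gt0 2 e0); apply: filterS => n /=.
by rewrite normrX ltr_pXn2r // nnegrE ?ltW.
Qed.

Lemma rdot_cvg0 x y C : (forall n, sqsummable (x n)) -> (forall n, sqsummable (y n)) ->
  (forall n, rdot (x n) (x n) <= C) -> (fun n => rdot (y n) (y n)) @ \oo --> (0 : R) ->
  (fun n => rdot (x n) (y n)) @ \oo --> (0 : R).
Proof.
move=> hx hy HC y0; apply: cvg_sqr0.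
have y1 : (fun n => C * rdot (y n) (y n)) @ \oo --> (0 : R).
  by rewrite -[X in _ --> X](mulr0 C); apply: cvgMr.
apply: (squeeze_cvgr _ (cvg_cst 0) y1); apply: nearW => n; rewrite sqr_ge0 /=.
apply: le_trans (rdot_cauchy (hx n) (hy n)) _.
by apply: ler_wpM2r; [exact: rdot_ge0|exact: HC].
Qed.

End strong_limits.

(** * Boundedness and compactness of Hankel operators *)

Section hankel_operator.
Context {R : realType}.
Implicit Types (h x y : nat -> R).

Definition hankel_bound h (c : R) : Prop := forall j, `|h j| <= c / j.+1%:R.

(** [h j = o(1 / j)], a sufficient condition for compactness. *)
Definition hankel_vanishing h : Prop :=
  forall e, 0 < e -> exists J, forall j, (J <= j)%N -> `|h j| <= e / j.+1%:R.

Definition rhankel h x : nat -> R := fun j => rdot (fun k => h (j + k)%N) x.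

Lemma sum_invsqr_le2 N : \sum_(k < N) (k.+1%:R ^- 2 : R) <= 2.
Proof.
case: N => [|N]; first by rewrite big_ord0.
suff : \sum_(k < N.+1) (k.+1%:R ^- 2 : R) <= 2 - N.+1%:R^-1.
  by move=> /le_trans; apply; rewrite gerBl.
elim: N => [|N IH]; first by rewrite big_ord1 expr1n invr1; lra.
rewrite big_ord_recr /=; apply: le_trans (lerD IH (lexx _)) _.
have x0 : 0 < N.+1%:R :> R by rewrite ltr0n.
rewrite -(natr1 N.+1); move: (N.+1%:R : R) x0 => x x0; have x10 : 0 < x + 1 by lra.
have E : x^-1 - (x + 1)^-1 = (x + 1)^-1 * x^-1 by field; rewrite !gt_eqF.
have uv : (x + 1)^-1 <= x^-1 by rewrite lef_pV2 ?posrE // lerDl.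
have u0 : 0 < (x + 1)^-1 by rewrite invr_gt0.
rewrite -exprVn expr2; have := ler_wpM2l (ltW u0) uv; lra.
Qed.

Lemma hankel_row_sqsummable h c j : hankel_bound h c -> sqsummable (fun k => h (j + k)%N).
Proof.
move=> H; exists (c ^+ 2 * 2) => N.
apply: (@le_trans _ _ (c ^+ 2 * \sum_(k < N) (k.+1%:R ^- 2 : R))); last first.
  by apply: ler_wpM2l; [exact: sqr_ge0|exact: sum_invsqr_le2].
rewrite mulr_sumr; apply: ler_sum => k _; rewrite -exprVn -exprMn.
rewrite -[leLHS]real_normK ?num_real //; apply: lerXn2r; rewrite ?nnegrE //.
  have := H 0%N; rewrite divr1 => h0; rewrite divr_ge0 //; exact: le_trans h0.
apply: le_trans (H _) _; apply: ler_wpM2l.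
  by have := H 0%N; rewrite divr1; exact: le_trans.
by rewrite lef_pV2 ?posrE // ler_nat ltnS leq_addl.
Qed.

Lemma bilinear_hilbert h c N x y : hankel_bound h c ->
  \sum_(j < N) \sum_(k < N) h (j + k)%N * (x j * y k) <= c * (2 * (sqnorm N x + sqnorm N y)).
Proof.
move=> H; have c0 : 0 <= c by have := H 0%N; rewrite divr1; exact: le_trans.
apply: (@le_trans _ _ (c * \sum_(j < N) \sum_(k < N) `|x j| * `|y k| / (j + k).+1%:R)); last first.
  by apply: ler_wpM2l => //; exact: hilbert_inequality.
rewrite mulr_sumr; apply: ler_sum => j _; rewrite mulr_sumr; apply: ler_sum => k _.
apply: le_trans (ler_norm _) _; rewrite normrM (normrM (x j)).
have -> : c * (`|x j| * `|y k| / (j + k).+1%:R) = c / (j + k).+1%:R * (`|x j| * `|y k|) by ring.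
by apply: ler_wpM2r; [exact: mulr_ge0|exact: H].
Qed.

Lemma rdotN_truncate x y M N : (M <= N)%N -> rdotN x (truncate M y) N = rdotN x y M.
Proof.
move=> MN; rewrite /rdotN -(subnKC MN) big_split_ord /= [X in _ + X]big1 ?addr0.
  by apply: eq_bigr => k _; rewrite /truncate ltn_ord.
by move=> k _; rewrite /truncate ltnNge leq_addr mulr0.
Qed.

(** The bilinear form is tested on [s * w] and [x], where [w] is a section of the image; the
    constant 16 is the square of the operator bound [4 c], up to [c ^ 2]. *)
Lemma hankel_section_bound h c M N x : 0 < c -> hankel_bound h c ->
  sqnorm M (fun j => rdotN (fun k => h (j + k)%N) x N) <= 16 * c ^+ 2 * sqnorm N x.
Proof.
move=> c0 H; set w := fun j => _; set S := sqnorm M w; set X := sqnorm N x.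
(* With [s = 1 / (4 c)] the square of [w] produced by Hilbert's inequality is half of the left
   side. *)
pose P := maxn M N; pose s := (4 * c)^-1; have s0 : 0 < s by rewrite invr_gt0 mulr_gt0.
have := bilinear_hilbert P (fun j => s * truncate M w j) (truncate N x) H.
have -> : sqnorm P (truncate N x) = X.
  rewrite -rdotNxx rdotN_truncate ?leq_maxr // /X -rdotNxx; apply: eq_bigr => k _.
  by rewrite /truncate ltn_ord.
have -> : sqnorm P (fun j => s * truncate M w j) = s ^+ 2 * S.
  rewrite /sqnorm (eq_bigr (fun j : 'I_P => s ^+ 2 * truncate M w j ^+ 2)); last by move=> j _; rewrite exprMn.
  rewrite -mulr_sumr; congr (_ * _); rewrite -/(sqnorm P _) -rdotNxx rdotN_truncate ?leq_maxl // /S -rdotNxx.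
  by apply: eq_bigr => k _; rewrite /truncate ltn_ord.
have -> : \sum_(j < P) \sum_(k < P) h (j + k)%N * (s * truncate M w j * truncate N x k) = s * S.
  transitivity (s * \sum_(j < P) w j * truncate M w j).
    rewrite mulr_sumr; apply: eq_bigr => j _.
    rewrite /w -(rdotN_truncate _ x (leq_maxr M N)) mulr_suml mulr_sumr; apply: eq_bigr => k _.
    by rewrite /=; ring.
  congr (_ * _); rewrite -/(rdotN w (truncate M w) P) rdotN_truncate ?leq_maxl //.
move=> K; have sc : s * c = 1 / 4 by rewrite /s; field; rewrite gt_eqF.
have : c * (s * S) <= c * (c * (2 * (s ^+ 2 * S + X))) by rewrite ler_pM2l.
have -> : c * (s * S) = 1 / 4 * S by rewrite mulrA (mulrC c) sc.
have -> : c * (c * (2 * (s ^+ 2 * S + X))) = 2 * ((s * c) ^+ 2 * S) + 2 * (c ^+ 2 * X) by ring.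
by rewrite sc -(mulrA 16); move: (c ^+ 2 * X) => V; clear; lra.
Qed.

Lemma rhankel_bounded h c x : 0 < c -> hankel_bound h c -> sqsummable x ->
  sqsummable (rhankel h x) /\ rdot (rhankel h x) (rhankel h x) <= 16 * c ^+ 2 * rdot x x.
Proof.
move=> c0 H hx; apply: sqnorm_bound => M.
have C : (fun N => sqnorm M (fun j => rdotN (fun k => h (j + k)%N) x N)) @ \oo -->
    sqnorm M (rhankel h x).
  apply: cvg_ordsum => j; rewrite expr2.
  rewrite (_ : (fun n => _) = (fun n => rdotN (fun k => h (j + k)%N) x n * rdotN (fun k => h (j + k)%N) x n)); last first.
    by apply/funext => n; rewrite expr2.
  by apply: cvgM; apply: rdot_cvg => //; exact: hankel_row_sqsummable H.
rewrite -(cvg_lim _ C) //; apply: limr_le; first exact: cvgP C.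
apply: nearW => N; apply: le_trans (hankel_section_bound _ _ _ c0 H) _.
by rewrite ler_pM2l ?sqnorm_le_rdot // mulr_gt0 // exprn_gt0.
Qed.

Lemma rhankel_lin h c a x y : hankel_bound h c -> sqsummable x -> sqsummable y ->
  rhankel h (fun k => a * x k + y k) = (fun j => a * rhankel h x j + rhankel h y j).
Proof.
move=> H hx hy; apply/funext => j; rewrite /rhankel rdot_linr //.
exact: hankel_row_sqsummable H.
Qed.

Lemma rhankel_truncate h N x y : rdot (rhankel h (truncate N x)) (truncate N y) =
  \sum_(j < N) \sum_(k < N) h (j + k)%N * (y j * x k).
Proof.
rewrite rdotC rdot_truncate; apply: eq_bigr => j _; rewrite /rhankel rdotC rdot_truncate mulr_sumr.
by apply: eq_bigr => k _; ring.
Qed.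

Lemma rhankel_truncate_cvg h c x y : 0 < c -> hankel_bound h c -> sqsummable x -> sqsummable y ->
  (fun N => rdot (rhankel h (truncate N x)) (truncate N y)) @ \oo --> rdot (rhankel h x) y.
Proof.
move=> c0 H hx hy.
have hT N (z : nat -> R) : sqsummable (truncate N z) := truncate_sqsummable N z.
have hA z : sqsummable z -> sqsummable (rhankel h z) by move=> hz; exact: (rhankel_bounded c0 H hz).1.
pose p N k := x k - truncate N x k; pose q N k := y k - truncate N y k.
have hp N : sqsummable (p N) by exact: sqsummableB.
have hq N : sqsummable (q N) by exact: sqsummableB.
have p0 : (fun N => rdot (rhankel h (p N)) (rhankel h (p N))) @ \oo --> (0 : R).
  have e1 : (fun N => 16 * c ^+ 2 * rdot (p N) (p N)) @ \oo --> (0 : R).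
    by rewrite -[X in _ --> X](mulr0 (16 * c ^+ 2)); apply: cvgMr; exact: truncate_error.
  apply: (squeeze_cvgr _ (cvg_cst 0) e1); apply: nearW => N.
  by rewrite rdot_ge0 ?(rhankel_bounded c0 H (hp N)).2 //; exact: hA.
have q0 := truncate_error hy.
have ET N : rdot (rhankel h (truncate N x)) (truncate N y) =
    rdot (rhankel h x) y - rdot (rhankel h x) (q N) - rdot (truncate N y) (rhankel h (p N)).
  have -> : rhankel h (truncate N x) = (fun j => -1 * rhankel h (p N) j + rhankel h x j).
    rewrite -(rhankel_lin _ H (hp N) hx); congr rhankel; apply/funext => k; rewrite /p.
    by ring.
  rewrite (rdot_linl _ (hA _ (hp N)) (hA _ hx) (hT N y)) (rdotC (truncate N y)).
  have -> : rdot (rhankel h x) (truncate N y) = rdot (rhankel h x) y - rdot (rhankel h x) (q N).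
    rewrite ![rdot (rhankel h x) _]rdotC -(rdotB hy (hq N) (hA _ hx)); congr rdot; apply/funext => k.
    by rewrite /q; ring.
  by ring.
rewrite (funext ET) -[X in _ --> X]subr0 -[X in _ --> X - 0]subr0.
apply: cvgB; first (apply: cvgB; first exact: cvg_cst).
  apply: (rdot_cvg0 (x := fun=> rhankel h x) (C := rdot (rhankel h x) (rhankel h x))) => // N; exact: hA.
apply: (rdot_cvg0 (C := rdot y y)) => // N; first exact: hA.
apply: (sqnorm_bound _).2 => M; apply: le_trans (sqnorm_le_rdot M hy).
apply: ler_sum => k _; rewrite /truncate; case: ifP => // _.
by rewrite expr0n /= sqr_ge0.
Qed.

Lemma rhankel_symmetric h c x y : 0 < c -> hankel_bound h c -> sqsummable x -> sqsummable y ->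
  rdot (rhankel h x) y = rdot x (rhankel h y).
Proof.
move=> c0 H hx hy; rewrite -(cvg_lim _ (rhankel_truncate_cvg c0 H hx hy)) //.
rewrite rdotC -(cvg_lim _ (rhankel_truncate_cvg c0 H hy hx)) //.
congr (limn _); apply/funext => N; rewrite !rhankel_truncate exchange_big.
by apply: eq_bigr => j _; apply: eq_bigr => k _; rewrite /= addnC (mulrC (y k)).
Qed.

(** The kernel is cut at [J]. The head sees finitely many coordinates and has finite rank; the tail
    has norm at most [4 f] by Hilbert's inequality. This is the form in which compactness is used
    below. *)
Lemma rhankel_strong h c (d : nat -> nat -> R) C : 0 < c -> hankel_bound h c -> hankel_vanishing h ->
  (forall n, sqsummable (d n)) -> (forall n, rdot (d n) (d n) <= C) ->
  (forall k, (fun n => d n k) @ \oo --> (0 : R)) ->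
  (fun n => rdot (rhankel h (d n)) (rhankel h (d n))) @ \oo --> (0 : R).
Proof.
move=> c0 H V hd HC d0; have C0 : 0 <= C by apply: le_trans (rdot_ge0 (hd 0%N)) (HC 0%N).
apply/cvgr0Pnorm_lt => e e0.
pose f := Num.min 1 (e / (64 * (C + 1))).
have C64 : 0 < 64 * (C + 1) by rewrite mulr_gt0 // ltr_wpDl.
have f0 : 0 < f by rewrite lt_min ltr01 divr_gt0.
have f1 : f ^+ 2 <= f by rewrite expr2 ger_pMr // ge_min lexx.
have fe : 64 * (f * (C + 1)) <= e.
  have : f <= e / (64 * (C + 1)) by rewrite ge_min lexx orbT.
  by rewrite ler_pdivlMr // mulrCA.
have [J HJ] := V f f0.
pose h1 j := if (j < J)%N then h j else 0.
pose h2 j := if (j < J)%N then 0 else h j.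
have H1 : hankel_bound h1 c.
  by move=> j; rewrite /h1; case: ifP => // _; rewrite normr0 divr_ge0 // ltW.
have H2 : hankel_bound h2 f.
  move=> j; rewrite /h2; case: ltnP => [_|/HJ //]; by rewrite normr0 divr_ge0 // ltW.
have Eh x : sqsummable x -> rhankel h x = (fun j => rhankel h1 x j + rhankel h2 x j).
  move=> hx; apply/funext => j; rewrite /rhankel.
  transitivity (rdot (fun k => 1 * h1 (j + k)%N + h2 (j + k)%N) x).
    by congr rdot; apply/funext => k; rewrite /h1 /h2 mul1r; case: ifP; rewrite ?addr0 ?add0r.
  by rewrite rdot_linl ?mul1r //; [exact: hankel_row_sqsummable H1|exact: hankel_row_sqsummable H2].
have L1 : (fun n => rdot (rhankel h1 (d n)) (rhankel h1 (d n))) @ \oo --> (0 : R).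
  have E n : rdot (rhankel h1 (d n)) (rhankel h1 (d n)) =
      \sum_(j < J) (\sum_(k < J) h1 (j + k)%N * d n k) ^+ 2.
    rewrite (@rdot_finite _ _ _ J) => [|j jJ]; last first.
      rewrite /rhankel -[RHS](rdot0l (d n)); congr rdot; apply/funext => k.
      by rewrite /h1 ltnNge (leq_trans jJ) // leq_addr.
    apply: eq_bigr => j _; rewrite -expr2; congr (_ ^+ 2).
    rewrite /rhankel (@rdot_finite _ _ _ J) // => k kJ.
    by rewrite /h1 ltnNge (leq_trans kJ) // leq_addl.
  rewrite (funext E) -[X in _ --> X](_ : \sum_(j < J) 0 = 0 :> R); last by rewrite big1.
  apply: cvg_ordsum => j.
  rewrite (_ : (fun n => _) = (fun n => (\sum_(k < J) h1 (j + k)%N * d n k) * (\sum_(k < J) h1 (j + k)%N * d n k))); last first.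
    by apply/funext => n; rewrite expr2.
  have Z : (fun n => \sum_(k < J) h1 (j + k)%N * d n k) @ \oo --> (0 : R).
    rewrite -[X in _ --> X](_ : \sum_(k < J) h1 (j + k)%N * 0 = 0 :> R); last first.
      by rewrite big1 // => k _; rewrite mulr0.
    by apply: cvg_ordsum => k; apply: cvgMr.
  by rewrite -[X in _ --> X](mulr0 (0 : R)); apply: cvgM.
have e4 : 0 < e / 4 by rewrite divr_gt0.
move/cvgr0Pnorm_lt: L1 => /(_ _ e4); apply: filterS => n.
have hA1 := (rhankel_bounded c0 H1 (hd n)).1.
have [hA2 B2] := rhankel_bounded f0 H2 (hd n).
rewrite (Eh _ (hd n)) !ger0_norm ?rdot_ge0 //; last exact: sqsummableD.
move=> r1; have r2 := rdot_sqD hA1 hA2.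
apply: le_lt_trans r2 _.
have : 16 * f ^+ 2 * rdot (d n) (d n) <= 16 * f * C.
  by apply: ler_pM; [rewrite mulr_ge0 ?sqr_ge0|exact: rdot_ge0|rewrite ler_pM2l|exact: HC].
move: r1 B2 fe; set X := rdot _ _; set Y := rdot _ _; set Z := _ * rdot _ _.
have := mulr_ge0 (ltW f0) C0; move: (f0) (e0); clear.
rewrite mulrDr mulr1 -mulrA; set W := f * C; lra.
Qed.

End hankel_operator.

Lemma ge_homo (s : nat -> nat) : {homo s : m n / (m < n)%N} -> forall n, (n <= s n)%N.
Proof. by move=> H; elim=> [//|n IH]; apply: leq_ltn_trans IH (H _ _ _). Qed.

Lemma le_sqrD1 (R : realType) (a : R) : a <= a ^+ 2 + 1.
Proof. by have := sqr_ge0 (a - 1); nra. Qed.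

(** * Eigenvalues *)

Section greedy_eigenvectors.
Context {R : realType} (h : nat -> R) (c : R).
Hypothesis c0 : 0 < c.
Hypothesis hb : hankel_bound h c.
Hypothesis hv : hankel_vanishing h.
Implicit Types (x y : nat -> R).

Let A := rhankel h.

Let A_sq x : sqsummable x -> sqsummable (A x).
Proof. by move=> hx; exact: (rhankel_bounded c0 hb hx).1. Qed.

Let A_sym x y : sqsummable x -> sqsummable y -> rdot (A x) y = rdot x (A y).
Proof. exact: rhankel_symmetric c0 hb. Qed.

Lemma rhankelZ a x : sqsummable x -> rhankel h (fun k => a * x k) = (fun j => a * rhankel h x j).
Proof.
move=> hx; apply/funext => j; rewrite /rhankel rdotC rdotZl 1?rdotC //.
exact: hankel_row_sqsummable hb.
Qed.

Lemma rhankel0 : rhankel h (fun=> 0) = (fun=> 0).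
Proof. by apply/funext => j; rewrite /rhankel rdotC rdot0l. Qed.

Lemma rhankelB x y : sqsummable x -> sqsummable y ->
  rhankel h (fun k => x k - y k) = (fun j => rhankel h x j - rhankel h y j).
Proof.
move=> hx hy; have -> : (fun k => x k - y k) = (fun k => -1 * y k + x k).
  by apply/funext => k; rewrite mulN1r addrC.
by rewrite (rhankel_lin _ hb) //; apply/funext => j; rewrite mulN1r addrC.
Qed.

Lemma rhankel_compact (y : nat -> nat -> R) C : (forall n, sqsummable (y n)) ->
  (forall n, rdot (y n) (y n) <= C) ->
  exists (s : nat -> nat) z, [/\ {homo s : m n / (m < n)%N}, sqsummable z, rdot z z <= C &
    (fun n => rdot (A (fun k => y (s n) k - z k)) (A (fun k => y (s n) k - z k))) @ \oo --> (0 : R)].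
Proof.
move=> hy HC; have C0 : 0 <= C := le_trans (rdot_ge0 (hy 0%N)) (HC 0%N).
have bnd n k : `|y n k| <= C + 1.
  have := le_trans (sqr_le_rdot k (hy n)) (HC n).
  rewrite -real_normK ?num_real //; have := normr_ge0 (y n k); move: `|_| => u u0 u2.
  by rewrite leNgt; apply/negP => Cu; nra.
have [s [z [hs sz]]] := pointwise_subsequence bnd.
have zC N : sqnorm N z <= C.
  have S : (fun n => sqnorm N (y (s n))) @ \oo --> sqnorm N z.
    apply: cvg_ordsum => k; rewrite expr2.
    rewrite (_ : (fun n => _) = (fun n => y (s n) k * y (s n) k)); first exact: cvgM.
    by apply/funext => n; rewrite expr2.
  rewrite -(cvg_lim _ S) //; apply: limr_le; first exact: cvgP S.
  by apply: nearW => n; apply: le_trans (sqnorm_le_rdot N (hy (s n))) (HC _).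
have [hz zz] := sqnorm_bound zC.
exists s, z; split=> //.
apply: (rhankel_strong (C := 4 * C) c0 hb hv) => [n|n|k]; first exact: sqsummableB.
  have hz' := sqsummableZ (-1) hz.
  have -> : (fun k => y (s n) k - z k) = (fun k => y (s n) k + -1 * z k).
    by apply/funext => k; rewrite mulN1r.
  apply: le_trans (rdot_sqD (hy (s n)) hz') _.
  have -> : rdot (fun k => -1 * z k) (fun k => -1 * z k) = rdot z z.
    by rewrite rdotZl // rdotC rdotZl // !mulN1r opprK.
  by have := HC (s n); lra.
by rewrite -[X in _ --> X](subrr (z k)); apply: cvgB => //; exact: cvg_cst.
Qed.

(** [mu] is the maximum of the form on the unit ball orthogonal to the first [m] vectors, and [x] a
    maximizer. Once the maximum is 0, [x] is the zero vector, so that the sequence can go on for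
    ever even if there are only finitely many positive eigenvalues. *)
Definition greedy_step (e : nat -> nat -> R) (m : nat) (x : nat -> R) (mu : R) : Prop :=
  [/\ 0 <= mu, sqsummable x, rhankel h x = (fun k => mu * x k),
      forall i, (i < m)%N -> rdot x (e i) = 0 &
      [/\ mu = 0 -> x = (fun=> 0), 0 < mu -> rdot x x = 1 &
       forall y, sqsummable y -> (forall i, (i < m)%N -> rdot y (e i) = 0) ->
         rdot (rhankel h y) y <= mu * rdot y y]].

(** The first-order condition at a maximum: for [s = g / (|K| + 1)] the linear term would win. *)
Lemma quadratic_vanish (g K : R) : 0 <= g -> (forall s, 2 * s * g <= s ^+ 2 * K) -> g = 0.
Proof.
move=> g0 H; have [->//|gn] := eqVneq g 0.
have gp : 0 < g by rewrite lt_neqAle eq_sym gn.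
pose D := `|K| + 1; have D0 : 0 < D by rewrite ltr_wpDl.
have KD : K <= D by apply: le_trans (ler_norm K) _; rewrite lerDl.
have := H (g / D).
have -> : 2 * (g / D) * g = g ^+ 2 / D ^+ 2 * (2 * D) by field; rewrite gt_eqF.
have -> : (g / D) ^+ 2 * K = g ^+ 2 / D ^+ 2 * K by field; rewrite gt_eqF.
rewrite ler_pM2l; last by rewrite divr_gt0 ?exprn_gt0.
move=> D2K; exfalso; have := le_trans D2K KD; move: D0; move: (D) => u u0; lra.
Qed.

(** A maximizing sequence has a pointwise convergent subsequence; compactness makes the images
    converge in norm, so the form passes to the limit. Varying the maximizer [z] in the direction of
    its residual [A z - mu z] shows that the residual vanishes. *)
Lemma greedy_step_exists (e : nat -> nat -> R) (l : nat -> R) (m : nat) :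
  (forall i, (i < m)%N -> greedy_step e i (e i) (l i)) ->
  exists x mu, greedy_step e m x mu.
Proof.
move=> He.
have hsq i : (i < m)%N -> sqsummable (e i) by move=> /He[].
have heig i : (i < m)%N -> A (e i) = (fun k => l i * e i k) by move=> /He[].
pose V y := sqsummable y /\ forall i, (i < m)%N -> rdot y (e i) = 0.
pose S := [set rdot (A y) y | y in [set y | V y /\ rdot y y <= 1]].
have V0 : V (fun=> 0) by split=> [|i _]; [exact: sqsummable0|rewrite rdot0l].
have S0 : S 0.
  by exists (fun=> 0); [split=> //; rewrite rdot0l|rewrite rdotC rdot0l].
have bS : has_ubound S.
  exists (16 * c ^+ 2 + 1) => _ [y [[hy _] y1] <-].
  have cs := rdot_cauchy (A_sq hy) hy.
  have [_ b1] := rhankel_bounded c0 hb hy.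
  have {cs} : rdot (A y) y ^+ 2 <= 16 * c ^+ 2.
    apply: le_trans cs _; apply: le_trans (ler_piMr (rdot_ge0 (A_sq hy)) y1) _.
    by apply: le_trans b1 _; rewrite ler_piMr // mulr_ge0 // sqr_ge0.
  by move=> b2; apply: le_trans (le_sqrD1 _) _; rewrite lerD2r.
have hS : has_sup S by split; [exists 0|].
pose mu := sup S; have mu0 : 0 <= mu by apply: ub_le_sup.
have Vform y : V y -> rdot (A y) y <= mu * rdot y y.
  move=> [hy Vy]; have := rdot_ge0 hy; rewrite le_eqVlt => /orP[/eqP/esym y0|y0].
    by rewrite (rdot_eq0 hy y0) [rdot (A _) _]rdotC !rdot0l mulr0.
  pose a := (Num.sqrt (rdot y y))^-1.
  have a2 : a * (a * rdot y y) = 1.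
    by rewrite mulrA -expr2 exprVn sqr_sqrtr ?(ltW y0) // mulVf ?gt_eqF.
  have hz := sqsummableZ a hy.
  have zz : rdot (fun k => a * y k) (fun k => a * y k) = 1 by rewrite rdotZl // rdotC rdotZl.
  have Sz : S (rdot (A (fun k => a * y k)) (fun k => a * y k)).
    exists (fun k => a * y k) => //; split; last by rewrite zz.
    by split=> // i im; rewrite (rdotZl _ hy (hsq i im)) Vy ?mulr0.
  have := ub_le_sup bS Sz; rewrite /A rhankelZ // rdotZl //; last exact: A_sq.
  rewrite rdotC rdotZl //; last exact: A_sq.
  rewrite (rdotC y) -/A -/mu => Hmu.
  have aa : a * a = (rdot y y)^-1 by apply: (mulIf (lt0r_neq0 y0)); rewrite -mulrA a2 mulVf ?gt_eqF.
  by move: Hmu; rewrite mulrA aa mulrC ler_pdivrMr.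
have [mu00|mun] := eqVneq mu 0.
  exists (fun=> 0), mu; split=> //; first exact: sqsummable0.
  - by rewrite rhankel0; apply/funext => k; rewrite mulr0.
  - by move=> i _; rewrite rdot0l.
  split=> //; first by rewrite mu00 ltxx.
  by move=> y hy Vy; apply: Vform.
have mup : 0 < mu by rewrite lt_neqAle eq_sym mun.
have [y Hy] : exists y : nat -> nat -> R, forall n,
    [/\ V (y n), rdot (y n) (y n) <= 1 & mu - n.+1%:R^-1 < rdot (A (y n)) (y n)].
  suff : forall n, exists y, [/\ V y, rdot y y <= 1 & mu - n.+1%:R^-1 < rdot (A y) y].
    by case/choice => y Hy; exists y.
  move=> n.
  have n0 : 0 < n.+1%:R^-1 :> R by rewrite invr_gt0.
  by have [_ [y [Vy y1] <-] yn] := sup_adherent n0 hS; exists y.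
have hy n : sqsummable (y n) by have [[]] := Hy n.
have y1 n : rdot (y n) (y n) <= 1 by have [] := Hy n.
have [s [z [hs hz z1 zc]]] := rhankel_compact hy y1.
have hd n : sqsummable (fun k => y (s n) k - z k) by exact: sqsummableB.
(* The vectors themselves converge only pointwise. Orthogonality survives because [e i] is an
   eigenvector: [l i] times the product of [z] and [e i] is, up to sign, a limit of products with
   images. If [l i = 0] then [e i = 0]. *)
have Vz : V z.
  split=> // i im; have [l0|ln] := eqVneq (l i) 0.
    by have [_ _ _ _ [/(_ l0) -> _ _]] := He i im; rewrite rdotC rdot0l.
  have Z : (fun n => rdot (e i) (A (fun k => y (s n) k - z k))) @ \oo --> (0 : R).
    apply: (rdot_cvg0 (x := fun=> e i) (C := rdot (e i) (e i))) => // n; first exact: hsq.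
    exact: A_sq.
  have E n : rdot (e i) (A (fun k => y (s n) k - z k)) = - (l i * rdot z (e i)).
    have hi := hsq i im; rewrite -(A_sym hi (hd n)) heig // (rdotZl _ hi (hd n)) rdotC (rdotB (hy (s n)) hz hi).
    by have [[_ -> //]] := Hy (s n); rewrite sub0r mulrN.
  move: Z; rewrite (funext E) => Z.
  have /eqP : - (l i * rdot z (e i)) = 0 by exact: (cvg_unique _ (cvg_cst _) Z).
  by rewrite oppr_eq0 mulf_eq0 (negbTE ln) /= => /eqP.
have fz : mu <= rdot (A z) z.
  have E n : rdot (A (y (s n))) (y (s n)) = rdot (A z) z
      + rdot (y (s n)) (A (fun k => y (s n) k - z k)) + rdot z (A (fun k => y (s n) k - z k)).
    rewrite -(A_sym hz (hd n)) (rdotC (y (s n)) (A _)) /A rhankelB // -/A.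
    have hyn := hy (s n); have hAy := A_sq hyn; have hAz := A_sq hz.
    rewrite (rdotB hAy hAz hyn) (rdotC (A z) (fun k => _ - _)) (rdotB hyn hz hAz).
    by rewrite (rdotC (y (s n)) (A z)) (rdotC z (A z)); ring.
  have L : (fun n => rdot (A (y (s n))) (y (s n))) @ \oo --> rdot (A z) z.
    rewrite (funext E) -[X in _ --> X]addr0 -[X in _ --> X + 0]addr0.
    apply: cvgD; first (apply: cvgD; first exact: cvg_cst).
      by apply: (rdot_cvg0 (C := 1)) => // n; exact: A_sq.
    by apply: (rdot_cvg0 (x := fun=> z) (C := 1)) => // n; exact: A_sq.
  have L2 : (fun n => mu - n.+1%:R^-1) @ \oo --> mu.
    by rewrite -[X in _ --> X]subr0; apply: cvgB; [exact: cvg_cst|exact: cvg_harmonic].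
  apply: (ler_cvg_to L2 L); apply: nearW => n.
  have [_ _ /ltW] := Hy (s n); apply: le_trans; rewrite lerD2l lerN2 lef_pV2 ?posrE //.
  by rewrite ler_nat ltnS ge_homo.
(* As [mu > 0], a maximizer cannot lie inside the unit ball. *)
have zz : rdot z z = 1.
  apply/eqP; rewrite eq_le z1 /= -(ler_pM2l mup) mulr1.
  exact: le_trans fz (Vform _ Vz).
have fzE : rdot (A z) z = mu by apply/eqP; rewrite eq_le fz andbT -[leRHS]mulr1 -zz Vform.
exists z, mu; split=> //; last 1 first.
- by split=> //; [move/eqP; rewrite gt_eqF|move=> x hx Vx; exact: Vform].
- pose w k := A z k - mu * z k.
  have hmz := sqsummableZ mu hz.
  have hw : sqsummable w by exact: sqsummableB (A_sq hz) hmz.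
  have Vw : V w.
    split=> // i im; have hi := hsq i im; rewrite (rdotB (A_sq hz) hmz hi) (rdotZl _ hz hi) (A_sym hz hi) heig //.
    by rewrite rdotC (rdotZl _ hi hz) (rdotC (e i)) Vz.2 // !mulr0 subrr.
  have g0 : rdot w w = 0.
    apply: (@quadratic_vanish _ (mu * rdot w w - rdot (A w) w)); first exact: rdot_ge0.
    move=> t; have Vt : V (fun k => t * w k + z k).
      split; first exact: sqsummable_lin.
      by move=> i im; rewrite (rdot_linl _ hw hz (hsq i im)) Vw.2 // Vz.2 // mulr0 addr0.
    have := Vform _ Vt.
    have hAw := A_sq hw; have hAz := A_sq hz; have ht : sqsummable (fun k => t * w k + z k) by case: Vt.
    rewrite /A (rhankel_lin _ hb hw hz) -/A (rdot_linl _ hAw hAz ht) (rdot_linr _ hw hz hAw) (rdot_linr _ hw hz hAz).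
    rewrite (rdot_linl _ hw hz ht) (rdot_linr _ hw hz hw) (rdot_linr _ hw hz hz) fzE zz (rdotC z w) (A_sym hw hz) (rdotC w (A z)).
    have : rdot w w = rdot (A z) w - mu * rdot w z.
      by rewrite {1}/w (rdotB (A_sq hz) hmz hw) (rdotZl _ hz hw) (rdotC z).
    move=> ->; rewrite expr2; move: (rdot (A w) w) (rdot (A z) w) (rdot w w) (rdot w z).
    by move=> a b d f; lra.
  apply/funext => k; have := congr1 (@^~ k) (rdot_eq0 hw g0); rewrite /w => /eqP.
  by rewrite subr_eq0 => /eqP.
- exact: Vz.2.
Qed.

Lemma greedy_step_congr e e' m x mu : (forall i, (i < m)%N -> e i = e' i) ->
  greedy_step e m x mu -> greedy_step e' m x mu.
Proof.
move=> E [h1 h2 h3 h4 [h5 h6 h7]]; split=> //; first by move=> i im; rewrite -E // h4.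
by split=> // y hy Hy; apply: h7 => // i im; rewrite E // Hy.
Qed.

(** Each vector depends on all earlier ones, so the recursion runs on the list of previous
    choices. *)
Theorem greedy_sequence : exists (e : nat -> nat -> R) (l : nat -> R),
  forall m, greedy_step e m (e m) (l m).
Proof.
pose P := ((nat -> R) * R)%type; pose d : P := (fun=> 0, 0).
have [F HF] : exists F : nat * seq P -> P, forall ms,
    (forall i, (i < ms.1)%N ->
      greedy_step (fun i => (nth d ms.2 i).1) i (nth d ms.2 i).1 (nth d ms.2 i).2) ->
    greedy_step (fun i => (nth d ms.2 i).1) ms.1 (F ms).1 (F ms).2.
  suff : forall ms : nat * seq P, exists p : P, (forall i, (i < ms.1)%N ->
      greedy_step (fun i => (nth d ms.2 i).1) i (nth d ms.2 i).1 (nth d ms.2 i).2) ->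
    greedy_step (fun i => (nth d ms.2 i).1) ms.1 p.1 p.2.
    by case/choice => F HF; exists F.
  move=> [m s] /=.
  case: (pselect (forall i, (i < m)%N ->
      greedy_step (fun i => (nth d s i).1) i (nth d s i).1 (nth d s i).2)) => [H|H].
    by have [x [mu Hx]] := @greedy_step_exists (fun i => (nth d s i).1) (fun i => (nth d s i).2) m H; exists (x, mu).
  by exists d.
pose st := fix st n := if n is n'.+1 then rcons (st n') (F (n', st n')) else [::] : seq P.
pose p n := F (n, st n).
have sz n : size (st n) = n by elim: n => [//|n IH] /=; rewrite size_rcons IH.
have stE n i : (i < n)%N -> nth d (st n) i = p i.
  elim: n => [//|n IH] /=; rewrite ltnS leq_eqVlt nth_rcons sz => /orP[/eqP ->|ii].
    by rewrite ltnn eqxx.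
  by rewrite ii IH.
exists (fun n => (p n).1), (fun n => (p n).2) => m.
have [n] := ubnP m; elim: n m => [//|n IH] m; rewrite ltnS => mn.
have := HF (m, st m) => /=; rewrite -/(p m) => Hm.
apply: (@greedy_step_congr (fun i => (nth d (st m) i).1)); first by move=> i im; rewrite stE.
apply: Hm => i im; rewrite stE //; apply: (@greedy_step_congr (fun n => (p n).1)).
  by move=> k ki; rewrite stE // (ltn_trans ki).
by apply: IH; exact: leq_trans im mn.
Qed.

End greedy_eigenvectors.

(** * Eigenspaces and min-max for the greedy sequence *)

Section greedy_spectrum.
Context {R : realType} (h : nat -> R) (c : R).
Hypothesis c0 : 0 < c.
Hypothesis hb : hankel_bound h c.
Hypothesis hv : hankel_vanishing h.
Variables (e : nat -> nat -> R) (l : nat -> R).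
Hypothesis G : forall m, greedy_step h e m (e m) (l m).
Implicit Types (x y : nat -> R).

Lemma greedy_ge0 m : 0 <= l m. Proof. by have [] := G m. Qed.

Lemma greedy_sqsummable m : sqsummable (e m). Proof. by have [] := G m. Qed.

Let esq := greedy_sqsummable.

Lemma greedy_eigenvector m : rhankel h (e m) = (fun k => l m * e m k). Proof. by have [] := G m. Qed.

Lemma greedy_unit m : 0 < l m -> rdot (e m) (e m) = 1. Proof. by have [_ _ _ _ []] := G m. Qed.

Lemma greedy_orthonormal i k : 0 < l i -> rdot (e i) (e k) = (i == k)%:R.
Proof.
move=> li; have [ik|ki|ik] := ltngtP i k; last by rewrite -ik greedy_unit.
  by have [_ _ _ H _] := G k; rewrite rdotC H.
by have [_ _ _ H _] := G i; rewrite H.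
Qed.

Lemma greedy_maximal m y : sqsummable y -> (forall i, (i < m)%N -> rdot y (e i) = 0) ->
  rdot (rhankel h y) y <= l m * rdot y y.
Proof. by have [_ _ _ _ [_ _]] := G m; exact. Qed.

Lemma greedy_nonincreasing i k : (i <= k)%N -> l k <= l i.
Proof.
move=> /subnKC <-; elim: (k - i)%N => [|n IH]; first by rewrite addn0.
rewrite addnS; apply: le_trans _ IH; set m := (i + n)%N.
have := greedy_ge0 m.+1; rewrite le_eqVlt => /orP[/eqP <-|lm]; first exact: greedy_ge0.
have := @greedy_maximal m (e m.+1) (esq _).
rewrite greedy_eigenvector rdotZl // greedy_unit // !mulr1; apply=> j jm.
by have [_ _ _ H _] := G m.+1; apply: H; exact: ltnW.
Qed.

(** Orthonormal eigenvectors with values at least [t] have images at squared distance at least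
    [2 t ^ 2], so no subsequence of the images converges. *)
Lemma greedy_to0 t : 0 < t -> exists m, l m < t.
Proof.
move=> t0; apply: contrapT => /forallNP Hn.
have lt m : t <= l m by rewrite leNgt; apply/negP; exact: Hn.
have l0 m : 0 < l m := lt_le_trans t0 (lt m).
have [|s [z [hs hz _ Z]]] := @rhankel_compact _ h c c0 hb hv e 1 esq.
  by move=> n; rewrite greedy_unit.
have t2 : 0 < t ^+ 2 / 2 by rewrite divr_gt0 // exprn_gt0.
move/cvgr0Pnorm_lt: Z => /(_ _ t2) [N _ HN].
have H1 := HN N (leqnn _); have H2 := HN N.+1 (leqnSn _).
pose a n k := rhankel h (fun k => e (s n) k - z k) k.
have ha n : sqsummable (a n) by exact: (rhankel_bounded c0 hb (sqsummableB (esq _) hz)).1.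
have ha' n : sqsummable (fun k => -1 * a n k) by exact: sqsummableZ.
have := rdot_sqD (ha N) (ha' N.+1).
have -> : (fun k => a N k + -1 * a N.+1 k) = (fun k => l (s N) * e (s N) k - l (s N.+1) * e (s N.+1) k).
  apply/funext => k; rewrite /a !(rhankelB hb) // !greedy_eigenvector; ring.
have -> : rdot (fun k => -1 * a N.+1 k) (fun k => -1 * a N.+1 k) = rdot (a N.+1) (a N.+1).
  by rewrite rdotZl // rdotC rdotZl // !mulN1r opprK.
have hl n : sqsummable (fun k => l (s n) * e (s n) k) by exact: sqsummableZ.
have hB := sqsummableB (hl N) (hl N.+1).
have Nlt := hs N N.+1 (ltnSn N).
have -> : rdot (fun k => l (s N) * e (s N) k - l (s N.+1) * e (s N.+1) k)
   (fun k => l (s N) * e (s N) k - l (s N.+1) * e (s N.+1) k) = l (s N) ^+ 2 + l (s N.+1) ^+ 2.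
  have E i j : rdot (fun k => l i * e i k) (fun k => l j * e j k) = l i * l j * (i == j)%:R.
    rewrite (rdotZl _ (esq i)) ?(rdotC (e i)) ?(rdotZl _ (esq j)) ?(rdotC (e j)) ?greedy_orthonormal //.
      by rewrite mulrA.
    exact: sqsummableZ.
  rewrite (rdotB (hl N) (hl N.+1) hB) (rdotC (fun k => l (s N) * _)) (rdotC (fun k => l (s N.+1) * _)).
  rewrite (rdotB (hl N) (hl N.+1) (hl N)) (rdotB (hl N) (hl N.+1) (hl N.+1)) !E !eqxx.
  by rewrite (ltn_eqF Nlt) (gtn_eqF Nlt) !mulr0 !mulr1 subr0 sub0r opprK !expr2.
move: H1 H2; rewrite /= !ger0_norm ?rdot_ge0 //; try exact: (ha _).
rewrite -/(a N) -/(a N.+1); set X := rdot (a N) _; set Y := rdot (a N.+1) _ => H1 H2 H3.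
have K n : t ^+ 2 <= l (s n) ^+ 2 by apply: lerXn2r; rewrite ?nnegrE ?(ltW t0) ?(ltW (l0 _)).
have := K N; have := K N.+1; move: (l (s N) ^+ 2) (l (s N.+1) ^+ 2) H1 H2 H3 => u v.
by move: X Y (t ^+ 2) {t2} => X Y T; lra.
Qed.

(** The indices [i0 <= i < i1] are those with [l i = t]. The difference [w] of [x] and its expansion
    is orthogonal to every [e k] with [k < i1], since eigenvectors of different eigenvalues are
    orthogonal. By maximality [t] times the squared norm of [w] is at most [l i1] times it, and
    [l i1 < t]. *)
Lemma greedy_expansion t i0 i1 x : 0 < t -> (i0 <= i1)%N ->
  (forall i, (i < i1)%N = (t <= l i)) -> (forall i, (i0 <= i)%N = (l i <= t)) ->
  sqsummable x -> rhankel h x = (fun k => t * x k) ->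
  x = (fun k => \sum_(i < (i1 - i0)%N) rdot x (e (i0 + i)%N) * e (i0 + i)%N k).
Proof.
move=> t0 i01 H1 H0 hx Ex; set y := fun k => _.
pose f (i : 'I_(i1 - i0)) := e (i0 + i)%N; pose a (i : 'I_(i1 - i0)) := rdot x (f i).
have yE : y = (fun k => \sum_(i < (i1 - i0)%N) a i * f i k) by [].
have hy : sqsummable y by apply: sqsummable_sum => i.
have lpos i : (i < i1)%N -> 0 < l i by rewrite H1; exact: lt_le_trans.
have lt i : (i < (i1 - i0))%N -> l (i0 + i)%N = t.
  move=> ii; apply/eqP; rewrite eq_le -H0 leq_addr /= -H1; lia.
have hw := sqsummableB hx hy.
have ye k : (k < i1)%N -> rdot y (e k) = if (i0 <= k)%N then rdot x (e k) else 0.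
  move=> k1; rewrite yE rdot_suml; [|by move=> i; exact: esq|exact: esq].
  have E (i : 'I_(i1 - i0)) : rdot (f i) (e k) = ((i0 + i)%N == k)%:R.
    by rewrite greedy_orthonormal // lpos //; have := ltn_ord i; lia.
  case: ifP => [k0|kn].
    have kk : (k - i0 < i1 - i0)%N by lia.
    rewrite (bigD1 (Ordinal kk)) //= E /a /f /= subnKC // eqxx mulr1 big1 ?addr0 // => i /eqP ik.
    rewrite E; case: eqP => [ki|]; last by rewrite mulr0.
    by case: ik; apply: val_inj => /=; lia.
  by rewrite big1 // => i _; rewrite E; case: eqP => [ki|]; rewrite ?mulr0 //; lia.
have we k : (k < i1)%N -> rdot (fun k => x k - y k) (e k) = 0.
  move=> k1; rewrite (rdotB hx hy (esq k)) ye //; case: ifP => [k0|kn]; first exact: subrr.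
  rewrite subr0.
  have : t * rdot x (e k) = l k * rdot x (e k).
    transitivity (rdot (rhankel h x) (e k)); first by rewrite Ex (rdotZl _ hx (esq k)).
    rewrite (rhankel_symmetric c0 hb hx (esq k)) greedy_eigenvector.
    by rewrite rdotC (rdotZl _ (esq k) hx) rdotC.
  move/eqP; rewrite -subr_eq0 -mulrBl mulf_eq0 subr_eq0 => /orP[/eqP tl|/eqP //].
  by move: (H0 k); rewrite -tl lexx kn.
have Ay : rhankel h y = (fun k => t * y k).
  apply/funext => j; rewrite /rhankel rdotC yE rdot_suml; [|by move=> i; exact: esq|exact: hankel_row_sqsummable hb].
  rewrite mulr_sumr; apply: eq_bigr => i _; rewrite rdotC -/(rhankel h _ j) /f greedy_eigenvector lt //.
  by rewrite mulrCA.
have := greedy_maximal hw we.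
rewrite (rhankelB hb) // Ex Ay.
have -> : (fun j => t * x j - t * y j) = (fun j => t * (x j - y j)) by apply/funext => j; rewrite mulrBr.
rewrite (rdotZl _ hw hw) => Hle.
have lt1 : l i1 < t by rewrite ltNge -H1 ltnn.
have w0 : rdot (fun k => x k - y k) (fun k => x k - y k) = 0.
  apply/eqP; rewrite eq_le rdot_ge0 // andbT leNgt; apply/negP => wp.
  by move: Hle; rewrite ler_pM2r // leNgt lt1.
by apply/funext => k; have := congr1 (@^~ k) (rdot_eq0 hw w0) => /eqP; rewrite subr_eq0 => /eqP.
Qed.

Lemma hform_truncate N x : rdot (rhankel h (truncate N x)) (truncate N x) = hform h N x.
Proof. exact: rhankel_truncate. Qed.

(** Truncating [u] to [N] entries turns orthogonality to the first [n] eigenvectors into [n]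
    conditions on the section. *)
Lemma codim_le_of_eigenvalue n t N : l n <= t ->
  codim_le n%:R (fun u => hform h N u <= t * sqnorm N u).
Proof.
move=> lt; exists n, (fun k u => \sum_(j < N) e k j * u j); split=> //.
  by move=> k; exact: linear_dot.
move=> u Hu; rewrite -hform_truncate; have hT := truncate_sqsummable N u.
have E : rdot (truncate N u) (truncate N u) = sqnorm N u.
  rewrite rdot_truncate -rdotNxx; apply: eq_bigr => k _; by rewrite /truncate ltn_ord.
rewrite -E; apply: le_trans (greedy_maximal hT _) _; last by apply: ler_wpM2r lt; exact: rdot_ge0.
by move=> i im; rewrite rdotC rdotC rdot_truncate -(Hu i im); apply: eq_bigr => k _; rewrite mulrC.
Qed.

Lemma quadratic_expansion (q : nat -> nat -> R) N d (a : 'I_d -> R) (f : 'I_d -> nat -> R) :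
  qform q N (fun k => \sum_(i < d) a i * f i k) =
  \sum_(i < d) \sum_(i' < d) a i * a i' * \sum_(j < N) \sum_(k < N) q j k * (f i j * f i' k).
Proof.
transitivity (\sum_(j < N) \sum_(k < N) \sum_(i < d) \sum_(i' < d) a i * a i' * (q j k * (f i j * f i' k))).
  apply: eq_bigr => j _; apply: eq_bigr => k _; rewrite big_distrlr /= mulr_sumr.
  by apply: eq_bigr => i _; rewrite mulr_sumr; apply: eq_bigr => i' _; ring.
rewrite (eq_bigr (fun j : 'I_N => \sum_(i < d) \sum_(i' < d) \sum_(k < N) a i * a i' * (q j k * (f i j * f i' k)))); last first.
  by move=> j _; rewrite exchange_big; apply: eq_bigr => i _; rewrite exchange_big.
rewrite exchange_big; apply: eq_bigr => i _; rewrite exchange_big; apply: eq_bigr => i' _.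
by rewrite mulr_sumr; apply: eq_bigr => j _; rewrite mulr_sumr.
Qed.

Lemma bilinear_shift (q : nat -> nat -> R) t N x y :
  \sum_(j < N) \sum_(k < N) (q j k - t * (j == k :> nat)%:R) * (x j * y k) =
  \sum_(j < N) \sum_(k < N) q j k * (x j * y k) - t * rdotN x y N.
Proof.
rewrite mulr_sumr -sumrB; apply: eq_bigr => j _.
transitivity (\sum_(k < N) q j k * (x j * y k) - \sum_(k < N) t * (j == k :> nat)%:R * (x j * y k)).
  by rewrite -sumrB; apply: eq_bigr => k _; rewrite mulrBl.
congr (_ - _); rewrite (bigD1 j) //= eqxx mulr1 big1 ?addr0 // => k /negbTE kj.
by rewrite -val_eqE /= in kj; rewrite eq_sym kj mulr0 mul0r.
Qed.

(** If [l n > t], the form shifted by [t] is positive definite on the span of the first [n + 1]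
    eigenvectors. Its matrix on sections converges to a diagonal one, with an error uniform in the
    coefficients; so one large [N] works for whatever combination [codim_le_nontrivial] provides. *)
Lemma eigenvalue_of_codim_le n (t x : R) : 0 < t -> x < n.+1%:R ->
  (forall N, codim_le x (fun u => hform h N u <= t * sqnorm N u)) -> l n <= t.
Proof.
move=> t0 xn Hx; rewrite leNgt; apply/negP => tl.
have lpos i : (i <= n)%N -> t < l i by move=> ii; apply: lt_le_trans tl (greedy_nonincreasing ii).
pose D i i' : R := (l i - t) * (i == i')%:R.
pose T N (i i' : nat) := \sum_(j < N) \sum_(k < N) (h (j + k)%N - t * (j == k :> nat)%:R) * (e i j * e i' k).
have TE N i i' : T N i i' = rdot (rhankel h (truncate N (e i'))) (truncate N (e i)) - t * rdotN (e i) (e i') N.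
  by rewrite rhankel_truncate /T (bilinear_shift (fun j k => h (j + k)%N)).
have TD i i' : (i <= n)%N -> (i' <= n)%N -> (fun N => T N i i') @ \oo --> D i i'.
  move=> ii ii'; have -> : D i i' = rdot (rhankel h (e i')) (e i) - t * rdot (e i) (e i').
    rewrite greedy_eigenvector (rdotZl _ (esq _) (esq _)) (rdotC (e i')).
    rewrite greedy_orthonormal ?(lt_trans t0) ?lpos //.
    by rewrite /D; case: eqP => [->|]; rewrite ?mulr1 // !mulr0 subr0.
  rewrite (funext (fun N => TE N i i')).
  apply: cvgB; first exact: (rhankel_truncate_cvg c0 hb).
  by apply: cvgMr; exact: rdot_cvg.
pose Err N := \sum_(i < n.+1) \sum_(i' < n.+1) `|T N i i' - D i i'|.
have Err0 : Err @ \oo --> (0 : R).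
  rewrite -[X in _ --> X](_ : \sum_(i < n.+1) \sum_(i' < n.+1) (0 : R) = 0); last first.
    by rewrite big1 // => i _; rewrite big1.
  apply: cvg_ordsum => i; apply: cvg_ordsum => i'.
  rewrite -[X in _ --> X](@normr0 _ R^o); apply: cvg_norm.
  rewrite -[X in _ --> X](subrr (D i i')); apply: cvgB; last exact: cvg_cst.
  by apply: TD; rewrite -ltnS.
have dl : 0 < l n - t by rewrite subr_gt0.
move/cvgr0Pnorm_lt: Err0 => /(_ _ dl) [N _ /(_ N (leqnn _))] /= HN.
have [a [[i0 ai0] Ha]] := codim_le_nontrivial (fun i : 'I_n.+1 => e i) (Hx N) xn.
pose S := \sum_(i < n.+1) a i ^+ 2.
have S0 : 0 < S.
  rewrite /S (bigD1 i0) //= ltr_pwDl ?exprn_even_gt0 //.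
  by apply: sumr_ge0 => i _; exact: sqr_ge0.
have aS i i' : `|a i * a i'| <= S.
  have b j : a j ^+ 2 <= S.
    by rewrite /S (bigD1 j) //= lerDl; apply: sumr_ge0 => k _; exact: sqr_ge0.
  have := b i; have := b i'; have := sqr_ge0 (a i - a i'); have := sqr_ge0 (a i + a i').
  by rewrite ler_norml => h1 h2 h3 h4; apply/andP; split; move: h1 h2 h3 h4; rewrite sqrrD sqrrB; lra.
have : \sum_(i < n.+1) \sum_(i' < n.+1) a i * a i' * T N i i' <= 0.
  rewrite -(quadratic_expansion (fun j k => h (j + k)%N - t * (j == k)%:R) N a (fun i => e i)).
  set u := (X in qform _ _ X); rewrite /qform (bilinear_shift (fun j k => h (j + k)%N) t N u u) rdotNxx subr_le0.
  exact: Ha.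
apply/negP; rewrite -ltNge.
have -> : \sum_(i < n.+1) \sum_(i' < n.+1) a i * a i' * T N i i' =
   \sum_(i < n.+1) (l i - t) * a i ^+ 2 + \sum_(i < n.+1) \sum_(i' < n.+1) a i * a i' * (T N i i' - D i i').
  rewrite -big_split; apply: eq_bigr => i _ /=.
  have -> : (l i - t) * a i ^+ 2 = \sum_(i' < n.+1) a i * a i' * D i i'.
    rewrite (bigD1 i) //= /D eqxx mulr1 big1 ?addr0; first by rewrite mulrC expr2.
    by move=> k /negbTE ki; rewrite -val_eqE eq_sym /= in ki; rewrite ki !mulr0.
  by rewrite -big_split; apply: eq_bigr => i' _ /=; ring.
have b1 : (l n - t) * S <= \sum_(i < n.+1) (l i - t) * a i ^+ 2.
  rewrite mulr_sumr; apply: ler_sum => i _; apply: ler_wpM2r; first exact: sqr_ge0.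
  by rewrite lerD2r greedy_nonincreasing // -ltnS.
have b2 : `|\sum_(i < n.+1) \sum_(i' < n.+1) a i * a i' * (T N i i' - D i i')| <= S * Err N.
  rewrite /Err mulr_sumr; apply: (le_trans (ler_norm_sum _ _ _)); apply: ler_sum => i _.
  rewrite mulr_sumr; apply: (le_trans (ler_norm_sum _ _ _)); apply: ler_sum => i' _.
  by rewrite normrM ler_wpM2r.
have b3 : S * Err N < (l n - t) * S.
  by rewrite mulrC ltr_pM2r //; apply: le_lt_trans HN; exact: ler_norm.
move: b2; rewrite ler_norml => /andP[b2 _]; move: b1 b2 b3.
move: (\sum_(i < n.+1) _) (\sum_(i < n.+1) \sum_(i' < n.+1) _) (S * Err N) ((l n - t) * S) => X Y Z W.
by lra.
Qed.

End greedy_spectrum.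

(** * Passage to complex sequences *)

Section complex_components.
Context {R : realType}.
Local Open Scope complex_scope.
Implicit Types (u v : nat -> R[i]) (x y : nat -> R).

Definition re u : nat -> R := fun k => complex.Re (u k).
Definition im u : nat -> R := fun k => complex.Im (u k).

Lemma complexD (a b c d : R) : (a +i* b) + (c +i* d) = (a + c) +i* (b + d).
Proof. by []. Qed.

Lemma complexM (a b c d : R) : (a +i* b) * (c +i* d) = (a * c - b * d) +i* (a * d + b * c).
Proof. by []. Qed.

Lemma sqrt_sum_sqr_le (a b : R) : Num.sqrt (a ^+ 2 + b ^+ 2) <= `|a| + `|b|.
Proof.
rewrite -[leRHS]ger0_norm ?addr_ge0 // -sqrtr_sqr ler_sqrt ?sqr_ge0 //.
rewrite sqrrD !real_normK ?num_real // -addrA lerD2l lerDr.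
by rewrite mulrn_wge0 // mulr_ge0.
Qed.

Lemma complex_cvg (z : nat -> R[i]) a b : re z @ \oo --> a -> im z @ \oo --> b ->
  (z : nat -> R[i]^o) @ \oo --> (a +i* b : R[i]^o).
Proof.
move=> za zb; apply/cvgrPdist_lt => -[er ei]; rewrite ltcE /= => /andP[/eqP -> e0].
have e2 : 0 < er / 2 by rewrite divr_gt0.
move/cvgrPdist_lt: za => /(_ _ e2) Ha; move/cvgrPdist_lt: zb => /(_ _ e2) Hb.
apply: filterS (filterI Ha Hb) => n [] /=; rewrite /re /im normc_def ltcE /= eqxx /=.
case: (z n) => p q /= h1 h2; apply: le_lt_trans (sqrt_sum_sqr_le _ _) _; lra.
Qed.

Lemma series_complex (z : nat -> R[i]) n : series (z : nat -> R[i]^o) n =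
  (\sum_(k < n) re z k) +i* (\sum_(k < n) im z k).
Proof.
rewrite seriesEord /=; elim: n => [|n IH]; first by rewrite !big_ord0.
by rewrite !big_ord_recr /= IH /re /im; case: (z n).
Qed.

Lemma limn_series_complex (z : nat -> R[i]) a b :
  (fun n => \sum_(k < n) re z k) @ \oo --> a -> (fun n => \sum_(k < n) im z k) @ \oo --> b ->
  limn (series (z : nat -> R[i]^o)) = a +i* b.
Proof.
move=> ha hb; apply: cvg_lim; first exact: norm_hausdorff.
apply: complex_cvg.
  by rewrite (_ : re _ = (fun n => \sum_(k < n) re z k)) //; apply/funext => n; rewrite /re series_complex.
by rewrite (_ : im _ = (fun n => \sum_(k < n) im z k)) //; apply/funext => n; rewrite /im series_complex.
Qed.

Lemma series_normc u N : series (fun k => Normc.normc (u k) ^+ 2 : R) N =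
  sqnorm N (re u) + sqnorm N (im u).
Proof.
rewrite seriesEord /sqnorm -big_split; apply: eq_bigr => k _ /=; rewrite /re /im.
by case: (u k) => a b /=; rewrite sqr_sqrtr // addr_ge0 ?sqr_ge0.
Qed.

Lemma l2P u : l2 u <-> sqsummable (re u) /\ sqsummable (im u).
Proof.
rewrite /l2 (_ : series _ = (fun N => sqnorm N (re u) + sqnorm N (im u))); last first.
  by apply/funext => N; exact: series_normc.
split=> [C|[h1 h2]]; last first.
  by apply: is_cvgD; exact: is_cvg_sqnorm.
have H N := nondecreasing_cvgn_le _ C N.
have mono : nondecreasing_seq (fun N => sqnorm N (re u) + sqnorm N (im u)).
  by move=> m n mn; apply: lerD; exact: sqnorm_nondecreasing.
split; exists (limn (fun N => sqnorm N (re u) + sqnorm N (im u))) => N;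
  apply: le_trans (H mono N); rewrite ?lerDl ?lerDr; exact: sqnorm_ge0.
Qed.

Lemma l2normE u : l2 u -> l2norm u = Num.sqrt (rdot (re u) (re u) + rdot (im u) (im u)).
Proof.
move=> /l2P [h1 h2]; congr Num.sqrt; apply: cvg_lim => //.
rewrite (_ : series _ = (fun N => rdotN (re u) (re u) N + rdotN (im u) (im u) N)).
  by apply: cvgD; exact: rdot_cvg.
by apply/funext => N; rewrite !rdotNxx series_normc.
Qed.

Lemma l2dotE u v : l2 u -> l2 v -> l2dot u v =
  (rdot (re u) (re v) + rdot (im u) (im v)) +i* (rdot (im u) (re v) - rdot (re u) (im v)).
Proof.
move=> /l2P [h1 h2] /l2P [h3 h4]; apply: limn_series_complex.
  rewrite (_ : (fun n => _) = (fun N => rdotN (re u) (re v) N + rdotN (im u) (im v) N)).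
    by apply: cvgD; exact: rdot_cvg.
  apply/funext => N; rewrite -big_split; apply: eq_bigr => k _; rewrite /re /im /=.
  by case: (u k) (v k) => a b [c d] /=; ring.
rewrite (_ : (fun n => _) = (fun N => rdotN (im u) (re v) N - rdotN (re u) (im v) N)).
  by apply: cvgB; exact: rdot_cvg.
apply/funext => N; rewrite -sumrB; apply: eq_bigr => k _; rewrite /re /im /=.
by case: (u k) (v k) => a b [c d] /=; ring.
Qed.

Lemma complex_seqP u v : re u = re v -> im u = im v -> u = v.
Proof.
move=> E1 E2; apply/funext => k; move: (congr1 (@^~ k) E1) (congr1 (@^~ k) E2).
by rewrite /re /im; case: (u k) (v k) => a b [c d] /= -> ->.
Qed.

(** A real kernel acts on real and imaginary parts separately; the complex statements reduce to the
    real ones through this. *)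
Lemma hankelE h c u : hankel_bound h c -> l2 u ->
  hankel h u = (fun j => rhankel h (re u) j +i* rhankel h (im u) j).
Proof.
move=> H /l2P [h1 h2]; apply/funext => j; have hr := hankel_row_sqsummable j H.
apply: limn_series_complex.
  rewrite (_ : (fun n => _) = (rdotN (fun k => h (j + k)%N) (re u))); first exact: rdot_cvg.
  apply/funext => N; apply: eq_bigr => k _; rewrite /re /=.
  by case: (u k) => a b /=; rewrite mul0r subr0.
rewrite (_ : (fun n => _) = (rdotN (fun k => h (j + k)%N) (im u))); first exact: rdot_cvg.
apply/funext => N; apply: eq_bigr => k _; rewrite /im /=.
by case: (u k) => a b /=; rewrite mul0r addr0.
Qed.

Lemma hankel_compact_selfadjoint h c : 0 < c -> hankel_bound h c -> hankel_vanishing h ->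
  @compact_selfadjoint R (hankel h).
Proof.
move=> c0 hb hv.
have A_sq x : sqsummable x -> sqsummable (rhankel h x).
  by move=> hx; exact: (rhankel_bounded c0 hb hx).1.
have Al2 u : l2 u -> l2 (hankel h u).
  by move=> hu; rewrite (hankelE hb hu); have /l2P [h1 h2] := hu; apply/l2P; split; exact: A_sq.
split=> //.
- move=> [a b] u v hu hv'; have /l2P [h1 h2] := hu; have /l2P [h3 h4] := hv'.
  have Er : re (fun k => (a +i* b) * u k + v k) = (fun k => a * re u k + (- b * im u k + re v k)).
    by apply/funext => k; rewrite /re /im; case: (u k) (v k) => p q [r s] /=; ring.
  have Ei : im (fun k => (a +i* b) * u k + v k) = (fun k => a * im u k + (b * re u k + im v k)).
    by apply/funext => k; rewrite /re /im; case: (u k) (v k) => p q [r s] /=; ring.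
  have s1 : sqsummable (fun k => - b * im u k + re v k) by exact: sqsummable_lin.
  have s2 : sqsummable (fun k => b * re u k + im v k) by exact: sqsummable_lin.
  rewrite !(hankelE hb) //; last by apply/l2P; rewrite Er Ei; split; exact: sqsummable_lin.
  rewrite Er Ei; apply/funext => j.
  rewrite (rhankel_lin _ hb h1 s1) (rhankel_lin _ hb h2 h3) (rhankel_lin _ hb h2 s2) (rhankel_lin _ hb h1 h4).
  by rewrite complexM complexD; congr (_ +i* _); ring.
- move=> u v hu hv'; have /l2P [h1 h2] := hu; have /l2P [h3 h4] := hv'.
  rewrite (l2dotE (Al2 u hu) hv') (l2dotE hu (Al2 v hv')) (hankelE hb hu) (hankelE hb hv').
  have Er w : re (fun j => rhankel h (re w) j +i* rhankel h (im w) j) = rhankel h (re w) by [].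
  have Ei w : im (fun j => rhankel h (re w) j +i* rhankel h (im w) j) = rhankel h (im w) by [].
  by rewrite !Er !Ei !(rhankel_symmetric c0 hb).
- move=> u C HC; have hu n : l2 (u n) := (HC n).1.
  have hn n : rdot (re (u n)) (re (u n)) + rdot (im (u n)) (im (u n)) <= C ^+ 2.
    have /l2P [h1 h2] := hu n.
    have p0 : 0 <= rdot (re (u n)) (re (u n)) + rdot (im (u n)) (im (u n)) by rewrite addr_ge0 ?rdot_ge0.
    have := (HC n).2; rewrite l2normE // -[X in X <= _ ^+ 2]sqr_sqrtr // => Hle.
    by apply: lerXn2r => //; rewrite nnegrE ?sqrtr_ge0 //; apply: le_trans Hle; rewrite sqrtr_ge0.
  have hr n : sqsummable (re (u n)) by have /l2P [] := hu n.
  have hi n : sqsummable (im (u n)) by have /l2P [] := hu n.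
  have [|s1 [x [hs1 hx _ cx]]] := @rhankel_compact _ h c c0 hb hv (fun n => re (u n)) (C ^+ 2) hr.
    by move=> n; apply: le_trans (hn n); rewrite lerDl rdot_ge0.
  (* A subsequence of the first subsequence, so that real and imaginary parts converge together. *)
  have [|s2 [y [hs2 hy _ cy]]] := @rhankel_compact _ h c c0 hb hv (fun n => im (u (s1 n))) (C ^+ 2) (fun n => hi _).
    by move=> n; apply: le_trans (hn (s1 n)); rewrite lerDr rdot_ge0.
  pose w k : R[i] := x k +i* y k.
  have hw : l2 w by apply/l2P; split.
  exists (s1 \o s2), (hankel h w); split; first by move=> m n mn /=; exact/hs1/hs2.
    exact: Al2.
  have s2oo : s2 @ \oo --> \oo.
    move=> P [N _ HN]; exists N => // n /= Nn; apply: HN => /=.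
    exact: leq_trans Nn (ge_homo hs2 n).
  have cx' := cvg_comp _ _ s2oo cx.
  have Z : (fun n => rdot (rhankel h (fun k => re (u (s1 (s2 n))) k - x k)) (rhankel h (fun k => re (u (s1 (s2 n))) k - x k))
    + rdot (rhankel h (fun k => im (u (s1 (s2 n))) k - y k)) (rhankel h (fun k => im (u (s1 (s2 n))) k - y k))) @ \oo --> (0 : R).
    by rewrite -[X in _ --> X]addr0; apply: cvgD.
  have := cvg_comp _ _ Z (@sqrt_continuous R 0); rewrite sqrtr0.
  rewrite (_ : _ \o _ = (fun n => l2norm (fun k => hankel h (u (s1 (s2 n))) k - hankel h w k))) //.
  apply/funext => n /=; set d := (X in l2norm X).
  have Er : re d = rhankel h (fun k => re (u (s1 (s2 n))) k - x k).
    by rewrite (rhankelB hb) // /d /re !(hankelE hb) //; apply/funext.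
  have Ei : im d = rhankel h (fun k => im (u (s1 (s2 n))) k - y k).
    by rewrite (rhankelB hb) // /d /im !(hankelE hb) //; apply/funext.
  rewrite l2normE ?Er ?Ei //.
  by apply/l2P; rewrite Er Ei; split; apply: A_sq; exact: sqsummableB.
Qed.

End complex_components.

(** * Dimension and uniqueness of the eigenvalue sequence *)

Section dimension.
Context {R : realType}.

(** Writing each basis in terms of the other gives matrices with [M N = 1], by uniqueness of
    coefficients, and a right inverse forces [d <= d']. *)
Lemma has_dim_le (S : set (nat -> R[i])) d d' : has_dim S d -> has_dim S d' -> (d <= d')%N.
Proof.
move=> [e [Se He]] [f [Sf Hf]].
have [M HM] : exists M : 'I_d -> {ffun 'I_d' -> R[i]}, forall i, e i = (fun k => \sum_(j < d') M i j * f j k).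
  suff : forall i, exists c : {ffun 'I_d' -> R[i]}, e i = (fun k => \sum_(j < d') c j * f j k).
    by case/choice => M HM; exists M.
  by move=> i; have [c [Hc _]] := Hf _ (Se i); exists c.
have [N HN] : exists N : 'I_d' -> {ffun 'I_d -> R[i]}, forall j, f j = (fun k => \sum_(i < d) N j i * e i k).
  suff : forall j, exists c : {ffun 'I_d -> R[i]}, f j = (fun k => \sum_(i < d) c i * e i k).
    by case/choice => N HN; exists N.
  by move=> j; have [c [Hc _]] := He _ (Sf j); exists c.
apply: (@mulmx1_min _ d d' (\matrix_(i, j) M i j) (\matrix_(j, i) N j i)).
apply/matrixP => i i'; rewrite !mxE.
have [c [_ Uc]] := He _ (Se i).
have E1 : c = [ffun k => (i == k)%:R].
  apply: Uc; apply/funext => k; rewrite (bigD1 i) //= ffunE eqxx mul1r big1 ?addr0 // => j /negbTE ji.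
  by rewrite ffunE eq_sym ji mul0r.
have E2 : c = [ffun k => \sum_j M i j * N j k].
  apply: Uc; apply/funext => k; rewrite [LHS](congr1 (@^~ k) (HM i)).
  transitivity (\sum_(j < d') \sum_(k' < d) M i j * N j k' * e k' k).
    apply: eq_bigr => j _; rewrite [f j k](congr1 (@^~ k) (HN j)) mulr_sumr.
    by apply: eq_bigr => k' _; rewrite mulrA.
  by rewrite exchange_big; apply: eq_bigr => k' _; rewrite ffunE mulr_suml.
have := congr1 (fun g : {ffun _} => g i') E2; rewrite E1 !ffunE => ->.
by apply: eq_bigr => j _; rewrite !mxE.
Qed.

Lemma has_dim_unique (S : set (nat -> R[i])) d d' : has_dim S d -> has_dim S d' -> d = d'.
Proof. by move=> H H'; apply/eqP; rewrite eqn_leq !(has_dim_le (S := S)). Qed.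

(** At the first index [n] where the sequences differ, say [g n < f n], monotonicity confines the
    indices with [g k = f n] to [k < n], where both agree. This level set is thus contained in that
    of [f], which also contains [n]; but both have the dimension of the same eigenspace as
    cardinality. *)
Lemma pos_eigenvalue_seq_unique (A : (nat -> R[i]) -> nat -> R[i]) (l l' : nat -> R) :
  pos_eigenvalue_seq A l -> pos_eigenvalue_seq A l' -> forall n, (0 < n)%N -> l n = l' n.
Proof.
move=> H H' n; have [m] := ubnP n; elim: m l l' H H' n => [//|m IH] l l' H H' n nm n0.
suff K f g : pos_eigenvalue_seq A f -> pos_eigenvalue_seq A g ->
    (forall k, (0 < k < n)%N -> f k = g k) -> f n <= g n.
  have E k : (0 < k < n)%N -> l k = l' k.
    by move=> /andP[k0 kn]; apply: IH => //; exact: leq_trans kn nm.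
  by apply/eqP; rewrite eq_le !K // => k /E.
move=> Hf Hg E; rewrite leNgt; apply/negP => lt.
have t0 : 0 < f n by apply: le_lt_trans lt; exact: pes_ge0 Hg n n0.
have [d Hd Cd] := pes_mult Hf t0; have [d' Hd' Cd'] := pes_mult Hg t0.
have dd := has_dim_unique Hd Hd'; subst d'.
set S := [set k | _] in Cd; set S' := [set k | _] in Cd'.
have fS : finite_set S by apply/finite_setP; exists d.
have fS' : finite_set S' by apply/finite_setP; exists d.
have sub : (fset_set S' `<=` fset_set S)%fset.
  apply/fsubsetP => k; rewrite !in_fset_set // => /set_mem [k0 kt]; apply/mem_set; split=> //.
  have [kn|nk] := ltnP k n; first by rewrite E // k0.
  by have := pes_noninc Hg n0 nk; rewrite kt leNgt lt.
have /eqP ES : fset_set S' == fset_set S.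
  by rewrite eqEfcard sub (card_fset_set Cd) (card_fset_set Cd') leqnn.
have : n \in fset_set S by rewrite in_fset_set //; apply/mem_set.
by rewrite -ES in_fset_set // => /set_mem [_ gn]; move: lt; rewrite gn ltxx.
Qed.

End dimension.

Section eigenvalue_sequence.
Context {R : realType} (h : nat -> R) (c : R).
Hypothesis c0 : 0 < c.
Hypothesis hb : hankel_bound h c.
Hypothesis hv : hankel_vanishing h.
Variables (e : nat -> nat -> R) (l : nat -> R).
Hypothesis G : forall m, greedy_step h e m (e m) (l m).
Local Open Scope complex_scope.

Let esq := greedy_sqsummable G.

(** The real eigenvectors form a complex basis: real and imaginary parts are expanded separately,
    and orthonormality gives uniqueness. *)
Lemma eigenspace_dim t i0 i1 : 0 < t -> (i0 <= i1)%N ->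
  (forall i, (i < i1)%N = (t <= l i)) -> (forall i, (i0 <= i)%N = (l i <= t)) ->
  has_dim (l2_eigenspace (hankel h) t) (i1 - i0)%N.
Proof.
move=> t0 i01 H1 H0; pose f (i : 'I_(i1 - i0)) : nat -> R := e (i0 + i)%N.
have ft (i : 'I_(i1 - i0)) : l (i0 + i)%N = t.
  by apply/eqP; rewrite eq_le -H0 leq_addr /= -H1; have := ltn_ord i; lia.
have fsq i : sqsummable (f i) by exact: esq.
have orth (i k : 'I_(i1 - i0)) : rdot (f i) (f k) = (i == k)%:R.
  by rewrite /f (greedy_orthonormal G) ?ft // eqn_add2l.
exists (fun i k => (f i k)%:C); split.
  move=> i; have hl : l2 (fun k => (f i k)%:C).
    by apply/l2P; split; [exact: fsq|exact: sqsummable0].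
  split=> //; rewrite (hankelE hb hl); apply/funext => j.
  have -> : re (fun k => (f i k)%:C) = f i by [].
  have -> : im (fun k => (f i k)%:C) = (fun=> 0) by [].
  by rewrite rhankel0 /f (greedy_eigenvector G) ft complexM !(mulr0, mul0r, subr0, addr0).
move=> u [hu Eu]; have /l2P [h1 h2] := hu.
have Er : rhankel h (re u) = (fun k => t * re u k).
  apply/funext => j; have := congr1 (@^~ j) Eu; rewrite (hankelE hb hu) /re /im.
  by case: (u j) => a b /= [-> _]; rewrite mul0r subr0.
have Ei : rhankel h (im u) = (fun k => t * im u k).
  apply/funext => j; have := congr1 (@^~ j) Eu; rewrite (hankelE hb hu) /re /im.
  by case: (u j) => a b /= [_ ->]; rewrite mul0r addr0.
have X1 := greedy_expansion c0 hb G t0 i01 H1 H0 h1 Er.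
have X2 := greedy_expansion c0 hb G t0 i01 H1 H0 h2 Ei.
have comb (b : 'I_(i1 - i0) -> R[i]) : (fun k => \sum_i b i * (f i k)%:C) =
   (fun k => (\sum_i complex.Re (b i) * f i k) +i* (\sum_i complex.Im (b i) * f i k)).
  apply/funext => k.
  apply: (big_ind3 (fun (z : R[i]) x y => z = x +i* y)) => //.
    by move=> z x y z' x' y' -> ->.
  by move=> i _; case: (b i) => p q; rewrite complexM mulr0 subr0 mulr0 add0r.
exists [ffun i => rdot (re u) (f i) +i* rdot (im u) (f i)]; split.
  rewrite comb; apply: complex_seqP.
    rewrite [LHS]X1; apply/funext => k; rewrite /re /=; apply: eq_bigr => i _; by rewrite ffunE.
  rewrite [LHS]X2; apply/funext => k; rewrite /im /=; apply: eq_bigr => i _; by rewrite ffunE.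
move=> b; rewrite comb => ub; apply/ffunP => i; rewrite ffunE.
have D (a : 'I_(i1 - i0) -> R) : rdot (fun k => \sum_i a i * f i k) (f i) = a i.
  rewrite rdot_suml // (bigD1 i) //= orth eqxx mulr1 big1 ?addr0 // => k /negbTE ki.
  by rewrite orth ki mulr0.
have -> : re u = (fun k => \sum_i complex.Re (b i) * f i k) by rewrite ub.
have -> : im u = (fun k => \sum_i complex.Im (b i) * f i k) by rewrite ub.
by rewrite !D; case: (b i).
Qed.

Lemma greedy_pos_eigenvalue_seq : pos_eigenvalue_seq (hankel h) (fun n => l n.-1).
Proof.
split=> [n _|m n m0 mn|t t0]; first exact: greedy_ge0 G _.
  by apply: (greedy_nonincreasing G); lia.
have E1 : exists i, l i < t := greedy_to0 c0 hb hv G t0.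
have E0 : exists i, l i <= t by have [i /ltW it] := E1; exists i.
have mono := greedy_nonincreasing G.
(* [i1] and [i0] are the first indices with [l i < t] and [l i <= t]; the multiplicity of [t] is
   their difference. *)
case: (ex_minnP E1) => i1 l1 m1; case: (ex_minnP E0) => i0 l0 m0.
have H1 i : (i < i1)%N = (t <= l i).
  apply/idP/idP => [ii|]; first by rewrite leNgt; apply/negP => /m1; lia.
  by move=> tl; rewrite ltnNge; apply/negP => /mono; move: tl l1; lra.
have H0 i : (i0 <= i)%N = (l i <= t).
  apply/idP/idP => [/mono|/m0 //]; first by move=> li; exact: le_trans li l0.
have i01 : (i0 <= i1)%N by rewrite m0 // ltW.
exists (i1 - i0)%N; first exact: eigenspace_dim.
have -> : [set n | (0 < n)%N /\ l n.-1 = t] = (fun i => (i0 + i).+1) @` `I_(i1 - i0).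
  apply/seteqP; split=> [n [n0 nt]|_ [i /= ii <-]].
    exists (n.-1 - i0)%N => /=.
      by have := H1 n.-1; have := H0 n.-1; rewrite nt lexx; lia.
    by have := H0 n.-1; rewrite nt lexx; lia.
  split=> //=; apply/eqP; rewrite eq_le -H0 leq_addr /= -H1; lia.
by apply: inj_card_eq => i k _ _ []; lia.
Qed.

Lemma lambda_plus_greedy n : lambda_plus (hankel h) n.+1 = l n.
Proof.
have P : pos_eigenvalue_seq (hankel h) (lambda_plus (hankel h)).
  by apply: (@xgetPex _ _ [set lam | pos_eigenvalue_seq (hankel h) lam]); exists (fun n => l n.-1); exact: greedy_pos_eigenvalue_seq.
exact: (pos_eigenvalue_seq_unique P greedy_pos_eigenvalue_seq).
Qed.

End eigenvalue_sequence.

Lemma lambda_plus_hankel (R : realType) (h : nat -> R) (c : R) : 0 < c -> hankel_bound h c ->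
  hankel_vanishing h -> exists l : nat -> R,
  [/\ forall n, lambda_plus (hankel h) n.+1 = l n, forall n, 0 <= l n,
      forall n t N, l n <= t -> codim_le n%:R (fun u => hform h N u <= t * sqnorm N u) &
      forall n (t x : R), 0 < t -> x < n.+1%:R ->
        (forall N, codim_le x (fun u => hform h N u <= t * sqnorm N u)) -> l n <= t].
Proof.
move=> c0 hb hv; have [e [l G]] := greedy_sequence c0 hb hv; exists l; split.
- exact: lambda_plus_greedy c0 hb hv e l G.
- exact: greedy_ge0 G.
- by move=> n t N lt; exact: (codim_le_of_eigenvalue G N lt).
- by move=> n t x; exact: (eigenvalue_of_codim_le c0 hb G).
Qed.

(** * Asymptotics *)

Section asymptotics.
Context {R : realType} (alpha A : R) (l : nat -> R).
Hypothesis al0 : 0 < alpha.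
Hypothesis A0 : 0 <= A.
Hypothesis l0 : forall n, 0 <= l n.
Hypothesis count : forall eps, 0 < eps -> exists2 t0, 0 < t0 & forall t, 0 < t -> t <= t0 ->
  (forall n : nat, (A + eps) * t `^ (- alpha^-1) <= n%:R -> l n <= t) /\
  (forall n : nat, l n <= t -> (A - eps) * t `^ (- alpha^-1) <= n%:R).

Let p0 : 0 < alpha^-1. Proof. by rewrite invr_gt0. Qed.

Lemma natr_powRN_small (B t0 : R) : 0 < B -> 0 < t0 -> exists n0 : nat, (0 < n0)%N /\
  forall n, (n0 <= n)%N -> B * n%:R `^ (- alpha) <= t0.
Proof.
move=> B0 t00; have Bt : 0 < B / t0 by rewrite divr_gt0.
exists (Num.truncn ((B / t0) `^ alpha^-1)).+1; split=> // n nn.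
have lt : (B / t0) `^ alpha^-1 <= n%:R.
  by apply: le_trans (ltW (truncnS_gt _)) _; rewrite ler_nat.
have n0 : 0 < n%:R :> R by apply: lt_le_trans lt; rewrite powR_gt0.
have : B / t0 <= n%:R `^ alpha.
  have -> : B / t0 = ((B / t0) `^ alpha^-1) `^ alpha.
    by rewrite -powRrM mulVf ?gt_eqF // powRr1 // ltW.
  by apply: (ge0_ler_powR (ltW al0)) => //; rewrite nnegrE ?powR_ge0 // ltW.
by rewrite powRN ler_pdivrMr // ler_pdivrMr ?powR_gt0 // mulrC.
Qed.

Let scaled_powR (b : R) (n : nat) : 0 < b -> (0 < n)%N ->
  (b * n%:R `^ (- alpha)) `^ (- alpha^-1) = (b `^ alpha^-1)^-1 * n%:R.
Proof.
move=> b0 n0; have n0' : 0 < n%:R :> R by rewrite ltr0n.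
rewrite powRM ?powR_ge0 ?ltW // -powRrM mulrNN mulfV ?gt_eqF // powRr1 ?ltW //.
by rewrite powRN.
Qed.

Let alphaK (b : R) : 0 <= b -> (b `^ alpha) `^ alpha^-1 = b.
Proof. by move=> b0; rewrite -powRrM mulfV ?gt_eqF // powRr1. Qed.

(** The counting function is inverted at [t = b n^(-alpha)], with [b] slightly above or below
    [A^alpha]; the margin absorbs [eps]. As [l] starts at index 0, the eigenvalue number [n] is
    [l n.-1]. *)
Theorem eigenvalue_asymptotics (eta : R) : 0 < eta -> exists n0 : nat, forall n, (n0 <= n)%N ->
  `|l n.-1 - A `^ alpha * n%:R `^ (- alpha)| <= eta * n%:R `^ (- alpha).
Proof.
move=> eta0; pose a := A `^ alpha; have a0 : 0 <= a := powR_ge0 _ _.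
suff [[n1 H1] [n2 H2]] : (exists n0 : nat, forall n, (n0 <= n)%N -> l n.-1 <= (a + eta) * n%:R `^ (- alpha)) /\
    (exists n0 : nat, forall n, (n0 <= n)%N -> (a - eta) * n%:R `^ (- alpha) <= l n.-1).
  exists (maxn n1 n2) => n; rewrite geq_max => /andP[/H1 h1 /H2 h2].
  by rewrite ler_norml; apply/andP; split; move: h1 h2; rewrite -/a mulrDl mulrBl; lra.
split.
  pose B := a + eta; have B0 : 0 < B by rewrite ltr_wpDl.
  have AB : A < B `^ alpha^-1.
    by rewrite -[ltLHS](alphaK A0); apply: gt0_ltr_powR; rewrite ?nnegrE ?(ltW B0) // ltrDl.
  set Bp := B `^ alpha^-1 in AB *; have Bp0 : 0 < Bp by rewrite powR_gt0.
  pose eps := (Bp - A) / 2; have eps0 : 0 < eps by rewrite divr_gt0 // subr_gt0.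
  have [t0 t00 H] := count eps0; have [n0 [n00 Hn0]] := natr_powRN_small B0 t00.
  (* The count is at most [rho * n] with [rho < 1], which for large [n] also covers the shift from
     [n] to [n - 1]. *)
  pose rho := (A + eps) / Bp; have rho1 : rho < 1.
    by rewrite ltr_pdivrMr // mul1r /eps; move: AB; lra.
  exists (maxn n0 (Num.truncn (1 - rho)^-1).+1) => n; rewrite geq_max => /andP[nn nr].
  have np : (0 < n)%N := leq_trans n00 nn.
  have t1 : 0 < B * n%:R `^ (- alpha) by rewrite mulr_gt0 ?powR_gt0 ?ltr0n.
  apply: (H _ t1 (Hn0 n nn)).1; rewrite scaled_powR // -/Bp mulrA -/rho.
  have : (1 - rho)^-1 <= n%:R by apply: le_trans (ltW (truncnS_gt _)) _; rewrite ler_nat.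
  rewrite -[X in X <= _ -> _]mul1r ler_pdivrMr ?subr_gt0 // => K.
  have nE : n%:R = n.-1%:R + 1 :> R by rewrite natr1 prednK.
  by move: K; rewrite nE; lra.
(* If [a <= eta], the lower bound to be shown is not positive. *)
have [ae|ea] := leP a eta.
  exists 0%N => n _; apply: le_trans (l0 _); rewrite mulr_le0_ge0 ?powR_ge0 // subr_le0 //.
pose b := a - eta; have b0 : 0 < b by rewrite subr_gt0.
have bA : b `^ alpha^-1 < A.
  rewrite -[ltRHS](alphaK A0); apply: gt0_ltr_powR; rewrite ?nnegrE ?(ltW b0) //.
  by rewrite ltrBlDr ltrDl.
set bp := b `^ alpha^-1 in bA *; have bp0 : 0 < bp by rewrite powR_gt0.
have eps0 : 0 < A - bp by rewrite subr_gt0.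
have [t0 t00 H] := count eps0; have [n0 [n00 Hn0]] := natr_powRN_small b0 t00.
exists n0 => n nn; have np : (0 < n)%N := leq_trans n00 nn.
have t1 : 0 < b * n%:R `^ (- alpha) by rewrite mulr_gt0 ?powR_gt0 ?ltr0n.
rewrite leNgt; apply/negP => /ltW Hl.
have := (H _ t1 (Hn0 n nn)).2 _ Hl; rewrite scaled_powR // -/bp opprB addrC subrK mulrA.
by rewrite mulfV ?gt_eqF // mul1r ler_nat leqNgt ltn_predL np.
Qed.

End asymptotics.

Section decay.
Context {R : realType}.
Implicit Types (h : nat -> R).

Lemma logpow_small (alpha e : R) : 0 < alpha -> 0 < e -> exists J : nat, forall j, (J <= j)%N ->
  logpow alpha j <= e.
Proof.
move=> al0 e0; have ei : 0 < e^-1 by rewrite invr_gt0.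
pose T := expR (e^-1 `^ alpha^-1); exists (Num.truncn T).+1 => j jj.
have jT : T <= j%:R by apply: le_trans (ltW (truncnS_gt _)) _; rewrite ler_nat.
have lnj : e^-1 `^ alpha^-1 <= ln j%:R.
  by rewrite -[leLHS]expRK ler_ln ?posrE ?expR_gt0 // (lt_le_trans _ jT) ?expR_gt0.
have lnj0 : 0 < ln j%:R :> R by apply: lt_le_trans lnj; rewrite powR_gt0.
rewrite /logpow powRN -[leRHS]invrK lef_pV2 ?posrE ?powR_gt0 //.
have -> : e^-1 = (e^-1 `^ alpha^-1) `^ alpha by rewrite -powRrM mulVf ?gt_eqF // powRr1 // ltW.
by apply: (ge0_ler_powR (ltW al0)) => //; rewrite nnegrE ?powR_ge0 // ltW.
Qed.

Lemma model_decay_vanishing (alpha : R) h : 0 < alpha ->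
  (exists (K : R) (J : nat), forall n, (J <= n)%N -> `|h n| <= K * model_kernel alpha n) ->
  hankel_vanishing h.
Proof.
move=> al0 [K [J HJ]] e e0; have K0 : 0 < `|K| + 1 by rewrite ltr_wpDl.
have e'0 : 0 < e / (2 * (`|K| + 1)) by rewrite divr_gt0 // mulr_gt0.
have [J' HJ'] := logpow_small al0 e'0; exists (maxn 1 (maxn J J')) => j.
rewrite !geq_max => /andP[j1 /andP[jJ jJ']].
apply: le_trans (HJ j jJ) _; rewrite /model_kernel.
have j0 : 0 < j%:R :> R by rewrite ltr0n.
have L0 : 0 <= logpow alpha j by exact: powR_ge0.
apply: (@le_trans _ _ ((`|K| + 1) * (j%:R^-1 * (e / (2 * (`|K| + 1)))))).
  apply: (@le_trans _ _ ((`|K| + 1) * (j%:R^-1 * logpow alpha j))).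
    apply: ler_wpM2r; first by rewrite mulr_ge0 // invr_ge0.
    by apply: le_trans (ler_norm K) _; rewrite lerDl.
  apply: ler_wpM2l; first exact: ltW.
  by apply: ler_wpM2l; [rewrite invr_ge0|exact: HJ'].
have -> : (`|K| + 1) * (j%:R^-1 * (e / (2 * (`|K| + 1)))) = e / (2 * j%:R).
  by field; rewrite !gt_eqF.
apply: ler_wpM2l; first exact: ltW.
rewrite lef_pV2 ?posrE ?mulr_gt0 // -natrM ler_nat; lia.
Qed.

Lemma vanishing_hankel_bound h : hankel_vanishing h -> exists2 c, 0 < c & hankel_bound h c.
Proof.
move=> V; have [J HJ] := V 1 ltr01.
have S0 : 0 <= \sum_(j < J) `|h j| * j.+1%:R by apply: sumr_ge0 => j _; rewrite mulr_ge0.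
exists (1 + \sum_(j < J) `|h j| * j.+1%:R); first by rewrite ltr_wpDr.
move=> j; have j0 : 0 < j.+1%:R :> R by rewrite ltr0n.
have [jJ|/HJ H] := ltnP j J; last first.
  by apply: le_trans H _; rewrite ler_pM2r ?invr_gt0 // lerDl.
rewrite ler_pdivlMr // (bigD1 (Ordinal jJ)) //= addrCA lerDl addr_ge0 //.
by apply: sumr_ge0 => i _; rewrite mulr_ge0.
Qed.

End decay.

(** Eigenvectors lie in [l2], so only values there matter. The operator with kernel [-h] is compared
    with the negative of [hankel h] on [l2] only, where the series converge. *)
Lemma lambda_plus_eq_l2 (R : realType) (A A' : (nat -> R[i]) -> nat -> R[i]) :
  (forall u, l2 u -> A u = A' u) -> lambda_plus A = lambda_plus A'.
Proof.
move=> E; have S t : l2_eigenspace A t = l2_eigenspace A' t.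
  by apply/seteqP; split=> u [hu Eu]; split=> //; rewrite -?E // E.
congr (xget _ _); apply/seteqP; split=> l [h1 h2 h3]; split=> // t t0.
  by have := h3 t t0; rewrite S.
by have := h3 t t0; rewrite -S.
Qed.

(** * The constant and the conclusion *)

Section coefficient.
Context {R : realType}.

(** The powers of [pi] combine: [pi^(1/alpha - 1) / pi] raised to [alpha] is [pi^(1 - 2 alpha)], and
    the factor [1/2] becomes [2^(-alpha)]. *)
Lemma varkappaE (alpha S : R) : 0 < alpha -> 0 <= S ->
  (sech_pow_integral (alpha^-1 / 2) / pi * S) `^ alpha = varkappa alpha * S `^ alpha.
Proof.
move=> al0 S0; have pi0 := pi_gt0 R.
have I0 := sech_pow_integral_ge0 (alpha^-1 / 2).
have B0 : 0 <= Beta (alpha^-1 / 2) (1 / 2).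
  by move: I0; rewrite /sech_pow_integral pmulr_rge0 // divr_gt0 ?powR_gt0.
rewrite powRM ?divr_ge0 ?(ltW pi0) //; congr (_ * _).
rewrite /sech_pow_integral /varkappa.
have -> : 1 / (2 * alpha) = alpha^-1 / 2 by field; rewrite gt_eqF.
have -> : 2 * (alpha^-1 / 2) - 1 = alpha^-1 - 1 by field; rewrite gt_eqF.
set B := Beta _ _.
have -> : pi `^ (alpha^-1 - 1) / 2 * B / pi = (2^-1 * (pi `^ (alpha^-1 - 1) * pi^-1)) * B by ring.
rewrite powRM ?mulr_ge0 ?invr_ge0 ?powR_ge0 ?(ltW pi0) //; congr (_ * _).
rewrite powRM ?mulr_ge0 ?invr_ge0 ?powR_ge0 ?(ltW pi0) //.
rewrite -(powR_inv1 (ltW pi0)) -powRD_gt0 // -powRrM powRV //; congr (_ * _ `^ _).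
by field; rewrite gt_eqF.
Qed.

End coefficient.

Lemma hankelN (R : realType) (h : nat -> R) c u : hankel_bound h c -> l2 u ->
  hankel (fun j => - h j) u = (fun k => - hankel h u k).
Proof.
move=> H hu; have H' : hankel_bound (fun j => - h j) c by move=> j; rewrite normrN; exact: H.
rewrite (hankelE H hu) (hankelE H' hu); have /l2P [h1 h2] := hu.
have E x : sqsummable x -> rhankel (fun j => - h j) x = (fun k => - rhankel h x k).
  move=> hx; apply/funext => k; rewrite /rhankel -[RHS]mulN1r -rdotZl //; last exact: hankel_row_sqsummable H.
  by congr rdot; apply/funext => i; rewrite mulN1r.
by rewrite !E.
Qed.

Section signed_asymptotics.
Context {R : realType} (alpha : R) (L : nat) (phi psi : 'I_L -> R).
Hypothesis halpha : 0 < alpha.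
Hypothesis hphi : forall l, 0 < phi l < pi.
Hypothesis phi_inj : injective phi.
Variables (b1 bm1 : R) (b : 'I_L -> R) (h g1 gm1 : nat -> R) (g : 'I_L -> nat -> R).
Hypothesis hh : forall j : nat, (2 <= j)%N ->
    h j = b1 * j%:R^-1 * ln j%:R `^ (- alpha) + g1 j
        + (-1) ^+ j * (bm1 * j%:R^-1 * ln j%:R `^ (- alpha) + gm1 j)
        + 2 * \sum_(l < L) (b l * j%:R^-1 * ln j%:R `^ (- alpha) + g l j)
                           * cos (phi l * j%:R - psi l).
Hypothesis hg1 : error_seq alpha g1.
Hypothesis hgm1 : error_seq alpha gm1.
Hypothesis hg : forall l, error_seq alpha (g l).

Lemma signed_hankel_vanishing sg : hankel_vanishing (fun j => sg * h j).
Proof.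
apply: (model_decay_vanishing halpha).
exact: (oscillating_hankel_decay halpha hh hg1 hgm1 hg sg).
Qed.

Lemma signed_lambda_asymptotics sg : sg ^+ 2 = 1 ->
  lambda_plus (hankel (fun j => sg * h j)) =
    (fun n => varkappa alpha * (pospart (sg * bm1) `^ alpha^-1 + pospart (sg * b1) `^ alpha^-1 +
       \sum_(l < L) `|b l| `^ alpha^-1) `^ alpha * n%:R `^ (- alpha) : R^o) +o_\oo
    (fun n => n%:R `^ (- alpha) : R^o).
Proof.
move=> sgE; have hv := signed_hankel_vanishing sg; have [c c0 hb] := vanishing_hankel_bound hv.
have [l [lE l0 H1 H2]] := lambda_plus_hankel c0 hb hv.
pose S := pospart (sg * bm1) `^ alpha^-1 + pospart (sg * b1) `^ alpha^-1 + \sum_(l < L) `|b l| `^ alpha^-1.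
have S0 : 0 <= S by rewrite !addr_ge0 ?powR_ge0 // sumr_ge0 // => i _; exact: powR_ge0.
pose A := sech_pow_integral (alpha^-1 / 2) / pi * S.
have A0 : 0 <= A by rewrite mulr_ge0 // divr_ge0 ?sech_pow_integral_ge0 ?pi_ge0.
have count eps : 0 < eps -> exists2 t0, 0 < t0 & forall t, 0 < t -> t <= t0 ->
  (forall n : nat, (A + eps) * t `^ (- alpha^-1) <= n%:R -> l n <= t) /\
  (forall n : nat, l n <= t -> (A - eps) * t `^ (- alpha^-1) <= n%:R).
  move=> e0; have [t0 t00 H] := oscillating_hankel_counting halpha hphi phi_inj hh hg1 hgm1 hg sgE e0.
  exists t0 => // t tp tt; have [U V] := H t tp tt; split=> n Hn.
    apply: (H2 n t ((A + eps) * t `^ (- alpha^-1)) tp) => [|N]; last exact: U.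
    by apply: le_lt_trans Hn _; rewrite ltr_nat.
  by apply: V => N; exact: H1.
apply/eqaddoP => eps e0.
have [n0 Hn0] := eigenvalue_asymptotics halpha A0 l0 count e0.
exists (maxn 1 n0) => // n /=; rewrite geq_max => /andP[n1 /Hn0 K].
rewrite [X in _ <= _ * X]ger0_norm ?powR_ge0 //; apply: le_trans K.
rewrite -(varkappaE halpha S0) -/A le_eqVlt; apply/orP; left; apply/eqP; congr `|_|.
by rewrite -lE prednK.
Qed.

End signed_asymptotics.

Theorem theorem5p7 (R : realType) (alpha : R) (halpha : 0 < alpha)
  (L : nat) (phi psi : 'I_L -> R)
  (hphi : forall l, 0 < phi l < pi) (hphi_inj : injective phi)
  (b1 bm1 : R) (b : 'I_L -> R)
  (h g1 gm1 : nat -> R) (g : 'I_L -> nat -> R)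
  (hh : forall j : nat, (2 <= j)%N ->
    h j = b1 * j%:R^-1 * ln j%:R `^ (- alpha) + g1 j
        + (-1) ^+ j * (bm1 * j%:R^-1 * ln j%:R `^ (- alpha) + gm1 j)
        + 2 * \sum_(l < L) (b l * j%:R^-1 * ln j%:R `^ (- alpha) + g l j)
                           * cos (phi l * j%:R - psi l))
  (hg1 : error_seq alpha g1) (hgm1 : error_seq alpha gm1)
  (hg : forall l, error_seq alpha (g l)) :
  let aplus := varkappa alpha *
    (pospart bm1 `^ (1 / alpha) + pospart b1 `^ (1 / alpha)
     + \sum_(l < L) `|b l| `^ (1 / alpha)) `^ alpha in
  let aminus := varkappa alpha *
    (negpart bm1 `^ (1 / alpha) + negpart b1 `^ (1 / alpha)
     + \sum_(l < L) `|b l| `^ (1 / alpha)) `^ alpha in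
  [/\ compact_selfadjoint (hankel h),
      lambda_plus (hankel h) =
        (fun n => aplus * n%:R `^ (- alpha) : R^o) +o_\oo
        (fun n => n%:R `^ (- alpha) : R^o) &
      lambda_minus (hankel h) =
        (fun n => aminus * n%:R `^ (- alpha) : R^o) +o_\oo
        (fun n => n%:R `^ (- alpha) : R^o)].
Proof.
move=> aplus aminus.
have one2 : (1 : R) ^+ 2 = 1 by rewrite expr1n.
have mone2 : (-1 : R) ^+ 2 = 1 by rewrite sqrrN expr1n.
have h1 : (fun j => 1 * h j) = h by apply/funext => j; rewrite mul1r.
have hm1 : (fun j => -1 * h j) = (fun j => - h j) by apply/funext => j; rewrite mulN1r.
have := signed_hankel_vanishing halpha hh hg1 hgm1 hg 1; rewrite h1 => hv.
have [c c0 hb] := vanishing_hankel_bound hv.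
have np (x : R) : negpart x = pospart (- x) by rewrite /negpart /pospart normrN.
split; first exact: hankel_compact_selfadjoint c0 hb hv.
  have := signed_lambda_asymptotics halpha hphi hphi_inj hh hg1 hgm1 hg one2.
  by rewrite h1 !mul1r /aplus div1r.
(* The negative eigenvalues are the positive ones for [-h]; the positive parts of [- b1] and [- bm1]
   are the negative parts of [b1] and [bm1]. *)
have := signed_lambda_asymptotics halpha hphi hphi_inj hh hg1 hgm1 hg mone2.
rewrite hm1 !mulN1r /aminus div1r -!np.
by rewrite (lambda_plus_eq_l2 (A' := fun u k => - hankel h u k)) // => u hu; exact: hankelN hb hu.
Qed.
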